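(* Let $G$ be a cubic 3-connected graph and $k$ a natural number. If the diameter of $G$ is at least $10^9k^{13}2^{9k^2}$, then $G$ is $k$-good.
   Context: All graphs are finite and simple. A subcubic graph has maximum degree at most 3. An $A-B$ path is a path with one end in $A$, one end in $B$, and no internal vertex in $A\cup B$. A $\theta$-graph consists of two vertices $u,v$ and three pairwise internally disjoint $u-v$ paths (its legs). A $\theta(k,i)$-necklace is a connected subcubic graph consisting of $k$ disjoint $\theta$-graphs $\Theta_1,\dots,\Theta_k$ and $k$ disjoint paths $Q_1,\dots,Q_k$ such that $\Theta_j$ has legs $L_{j,1},L_{j,2},L_{j,3}$ with $L_{j,3}$ of length $i$, $Q_j$ is an $L_{j,2}-L_{j+1,1}$ path for $j<k$, $Q_k$ is an $L_{k,2}-L_{1,1}$ path, and no interior vertex of any $Q_j$ lies in any $\Theta_{j'}$. Two subgraphs are $k$-close if they are disjoint and joined by $k$ pairwise disjoint paths of length at most 2 (each having one end in each subgraph and no internal vertex in either). For pairwise disjoint 2-connected subgraphs $B_1,\dots,B_\ell$ of $G$, a necklace on them consists of the $B_i$ together with pairwise disjoint paths $Q_1,\dots,Q_\ell$, $Q_i$ a $B_i-B_{i+1}$ path ($Q_\ell$ a $B_\ell-B_1$ path), with no interior vertex of any $Q_i$ in any $B_j$; letting $x_i,y_i$ be the two vertices of $B_i$ lying on some $Q_j$, it is $k$-wiggly if for at least $k$ indices $i$, $B_i$ contains two $x_i-y_i$ paths whose lengths differ by 1 or 2. A graph is $k$-good if it contains a $\theta(k,i)$-necklace with $i\in\{1,2\}$,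 a $k$-wiggly necklace, or a path and a cycle which are $k$-close. *)

(* Defs.v *)
From mathcomp Require Import all_boot.

Set Implicit Arguments.
Unset Strict Implicit.
Unset Printing Implicit Defensive.

(* Finite simple graphs with vertices in an ambient finite type; the same type
   serves for a graph and for its (not necessarily induced) subgraphs. *)
Record graph (T : finType) := Graph {
  vset : {set T};
  adj : rel T;
  adj_sym : symmetric adj;
  adj_irr : irreflexive adj;
  adj_vset : forall x y, adj x y -> x \in vset
}.

(* A sequence of vertices src :: steps, to be used as a path; its length is the
   number of edges, and a single vertex is a path of length 0. *)
Record vpath (T : Type) := VPath { src : T; steps : seq T }.

Section Graphs.
Variable T : finType.
Implicit Types (G H : graph T) (P : vpath T) (A B S : {set T}) (x y z : T).

Definition subgraph H G : Prop :=
  vset H \subset vset G /\ subrel (adj H) (adj G).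

Definition degree G x : nat := #|[set y | adj G x y]|.
Definition cubic G : Prop := forall x, x \in vset G -> degree G x = 3.
Definition subcubic G : Prop := forall x, x \in vset G -> degree G x <= 3.

Definition connected G : Prop :=
  vset G != set0 /\ {in vset G &, forall x y, connect (adj G) x y}.

Section Deletion.
Variables (G : graph T) (S : {set T}).

Definition del_adj : rel T :=
  [rel x y | [&& adj G x y, x \notin S & y \notin S]].

Lemma del_adj_sym : symmetric del_adj.
Proof. by move=> x y; rewrite /del_adj /= adj_sym; congr andb; rewrite andbC. Qed.

Lemma del_adj_irr : irreflexive del_adj.
Proof. by move=> x; rewrite /del_adj /= adj_irr. Qed.

Lemma del_adj_vset x y : del_adj x y -> x \in vset G :\: S.
Proof. by case/and3P=> /adj_vset xG xS _; rewrite inE xS. Qed.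

Definition del_vertices : graph T := Graph del_adj_sym del_adj_irr del_adj_vset.
End Deletion.

Definition n_connected n G : Prop :=
  n < #|vset G| /\
  forall S, S \subset vset G -> #|S| < n -> connected (del_vertices G S).

Definition tgt P : T := last (src P) (steps P).
Definition pverts P : seq T := src P :: steps P.
Definition plen P : nat := size (steps P).
Definition interior P : seq T := behead (belast (src P) (steps P)).
Definition pedge P : rel T :=
  [rel x y | ((x, y) \in zip (pverts P) (steps P)) ||
             ((y, x) \in zip (pverts P) (steps P))].

Definition is_path G P : bool :=
  [&& src P \in vset G, path (adj G) (src P) (steps P) & uniq (pverts P)].

Definition is_xy_path G x y P : bool :=
  [&& is_path G P, src P == x & tgt P == y].

(* Paths are oriented here, so an A-B path is taken to start in A. *)
Definition is_AB_path G A B P : bool :=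
  [&& is_path G P, src P \in A, tgt P \in B
    & all (fun z => z \notin A :|: B) (interior P)].

Definition is_cycle G (c : seq T) : bool :=
  [&& 2 < size c, cycle (adj G) c & uniq c].

(* The search is among lengths below #|vset G|, the possible lengths of paths;
   the value is #|vset G| when there is no x-y path. *)
Definition dist G x y : nat :=
  find (fun n => [exists t : n.-tuple T, is_xy_path G x y (VPath x t)])
       (iota 0 #|vset G|).

Definition diameter G : nat :=
  \max_(x in vset G) \max_(y in vset G) dist G x y.

Definition disjoint_paths n (P : 'I_n -> vpath T) : Prop :=
  forall i j, i != j -> [disjoint pverts (P i) & pverts (P j)].

(* Legs must be distinct: otherwise the edge uv could be used for two of them. *)
Definition is_theta G x y (L : 'I_3 -> vpath T) : Prop :=
  [/\ x != y,
      forall m, is_xy_path G x y (L m),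
      injective L
    & forall m n, m != n -> [disjoint interior (L m) & interior (L n)]].

Definition theta_verts (L : 'I_3 -> vpath T) : {set T} :=
  [set z | [exists m, z \in pverts (L m)]].

Definition leg1 : 'I_3 := @Ordinal 3 0 isT.
Definition leg2 : 'I_3 := @Ordinal 3 1 isT.
Definition leg3 : 'I_3 := @Ordinal 3 2 isT.

(* ordS is the cyclic successor on 'I_k. *)
Definition is_theta_necklace k i H : Prop :=
  [/\ connected H, subcubic H
    & exists (u v : 'I_k -> T) (L : 'I_k -> 'I_3 -> vpath T)
             (Q : 'I_k -> vpath T),
      [/\ forall j, is_theta H (u j) (v j) (L j) /\ plen (L j leg3) = i,
          forall j j', j != j' ->
            [disjoint theta_verts (L j) & theta_verts (L j')],
          disjoint_paths Q,
          forall j, is_AB_path H [set z in pverts (L j leg2)]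
                                 [set z in pverts (L (ordS j) leg1)] (Q j)
            /\ (forall j', [disjoint interior (Q j) & theta_verts (L j')])
        & vset H = [set z | [exists j,
                      (z \in theta_verts (L j)) || (z \in pverts (Q j))]]
          /\ forall x y, adj H x y = [exists j,
                      [exists m, pedge (L j m) x y] || pedge (Q j) x y]]].

(* A and B are the vertex sets of the two subgraphs of G. *)
Definition close G k A B : Prop :=
  [disjoint A & B] /\
  exists P : 'I_k -> vpath T,
    disjoint_paths P /\ forall i, is_AB_path G A B (P i) /\ plen (P i) <= 2.

Section Necklaces.
Variables (l : nat) (B : 'I_l -> graph T) (Q : 'I_l -> vpath T).

Definition attachments i : {set T} :=
  [set z in vset (B i) | [exists j, z \in pverts (Q j)]].

(* The condition on attachments follows from the others if l >= 2; for l = 1 it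
   says that the unique path has two distinct ends. *)
Definition is_necklace G : Prop :=
  [/\ 0 < l,
      forall i, subgraph (B i) G /\ n_connected 2 (B i),
      forall i j, i != j -> [disjoint vset (B i) & vset (B j)],
      disjoint_paths Q
    & forall i, [/\ is_AB_path G (vset (B i)) (vset (B (ordS i))) (Q i),
                    forall j, [disjoint interior (Q i) & vset (B j)]
                  & #|attachments i| = 2]].

Definition wiggly_bead i : Prop :=
  exists x y P P',
    [/\ attachments i = [set x; y],
        is_xy_path (B i) x y P, is_xy_path (B i) x y P'
      & plen P' = plen P + 1 \/ plen P' = plen P + 2].

Definition wiggly k : Prop :=
  exists I : {set 'I_l}, k <= #|I| /\ forall i, i \in I -> wiggly_bead i.
End Necklaces.

Definition good k G : Prop :=
  [\/ exists i H, [/\ i = 1 \/ i = 2, subgraph H G & is_theta_necklace k i H],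
      exists l (B : 'I_l -> graph T) (Q : 'I_l -> vpath T),
        is_necklace B Q G /\ wiggly B Q k
    | exists P c, [/\ is_path G P, is_cycle G c
        & close G k [set z in pverts P] [set z in c]]].

End Graphs.

(* Main.v *)
(* If dist(s, t) is large, Menger's theorem gives three disjoint s-t paths; one of them
   can be chosen so that the other two stay connected in the rest, and it closes up to
   a cycle c with a connected set K off c, all of whose outside neighbours lie on c, and
   with many "feet", i.e. edges from K to c.  A depth-first search in K yields one of:

   - a comb: a path Q in K with many disjoint sets of feet hanging on it, each either a
     foot of a vertex of Q or a connected set with one or two feet attached to Q;
   - a large family of disjoint pieces, each a connected set with exactly two feet and a
     third foot next to it, whose complement in K is connected.

   Each item carries a gadget: a vertex q with a foot on c and two disjoint arms, to c
   (locally) and to a common connected set, or to two such sets.  Intervals of a path are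
   either pairwise disjoint for many indices or share a point for many (Helly); in the
   latter case one cuts the cycle there and uses the two sides as the connected sets,
   closing up a new cycle through some of the items.  A packing argument groups the
   gadgets by three and joins the three inside disjoint pieces of the two connected
   sets: each group becomes a theta-graph with a leg of length 1, and consecutive
   groups are linked along the cycle.  This gives a theta-necklace.

   The exceptional items are sets ("blobs") with exactly three exit edges.  Single
   vertices give a path k-close to a cycle, and in general a blob contains, between two
   of its exits, a theta-graph with a leg of length 1 or a 2-connected subgraph with two
   paths of lengths differing by 1 or 2, whence a theta-necklace or a wiggly necklace. *)

(* The obstacle is that the cycle orders the items, while the connected sets that must join them are
   arbitrary. [packing] overcomes it: a connected set of maximum degree 3 splits into two connected
   parts, each with about a third of the terminals, and splitting both sets at once isolates three
   items for one theta-graph. Each theta-graph costs a factor 12, whence [12 ^ k]. Cubicity enters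
   again because a vertex of a cycle has only one neighbour off it, so disjoint items never share a
   foot. Cutting the cycle at a point common to many intervals serves items with two feet on it: one
   foot stays on the new cycle, the other becomes the end of an arm to a second connected set. With
   t = 12^k, a comb needs O(t^2) items and a family O(t^3) pieces; the search spends at most 4 + 2n
   feet per piece, n being the size of the comb, so O(t^5) feet suffice. The non-separating path
   turns a distance D into about D/2 feet, and 12^5 < 2^18 gives t^5 <= 2^(9k^2) for k >= 2; the
   cases k = 0 and k = 1 are settled directly. *)
Require Import Defs.
From mathcomp Require Import all_boot zify.

Set Implicit Arguments.
Unset Strict Implicit.
Unset Printing Implicit Defensive.

(** * Connected sets of vertices *)

Section ConnectedSets.
Variables (T : finType) (e : rel T).
Implicit Types (X Y A B S U : {set T}) (x y z : T).

(** Connectivity inside a vertex set is expressed by restricting the relation, so the proof handles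
    vertex sets only and builds subgraphs just for the final necklace. *)
Definition restr X : rel T := [rel x y | [&& e x y, x \in X & y \in X]].

Lemma restrE X x y : restr X x y = [&& e x y, x \in X & y \in X].
Proof. by []. Qed.

(* [X] induces a connected subgraph, or is empty. *)
Definition cset X := [forall x in X, forall y in X, connect (restr X) x y].

Lemma csetP X : reflect {in X &, forall x y, connect (restr X) x y} (cset X).
Proof.
apply: (iffP idP) => [/forallP cX x y xX yX | cX].
  by move/(_ x): cX; rewrite xX /= => /forallP/(_ y); rewrite yX.
by apply/forallP=> x; apply/implyP=> xX; apply/forallP=> y; apply/implyP; apply: cX.
Qed.

Lemma restrS X Y : X \subset Y -> subrel (restr X) (restr Y).
Proof. by move=> sXY x y; rewrite !restrE => /and3P[-> /(subsetP sXY)-> /(subsetP sXY)->]. Qed.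

Lemma connect_restrS X Y x y :
  X \subset Y -> connect (restr X) x y -> connect (restr Y) x y.
Proof. move=> sXY; apply: connect_sub => u v uv; apply: connect1; exact: restrS uv. Qed.

Lemma path_restr X x p :
  path (restr X) x p -> path e x p && all [in X] p.
Proof.
elim: p x => //= y p IHp x /andP[/and3P[-> _ ->] /IHp /andP[-> ->]]; by [].
Qed.

Lemma restr_path X x p :
  x \in X -> all [in X] p -> path e x p -> path (restr X) x p.
Proof.
elim: p x => //= y p IHp x xX /andP[yX pX] /andP[exy yp].
by rewrite restrE exy xX yX IHp.
Qed.

Lemma conn_path X x y : x \in X -> connect (restr X) x y ->
  exists p, [/\ path e x p, last x p = y, uniq (x :: p) & {subset x :: p <= X}].
Proof.
move=> xX /connectP[p0 p0P ->]; case/shortenP: p0P => p p_path p_uniq _.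
exists p; split=> //; first by case/andP: (path_restr p_path).
by case/andP: (path_restr p_path) => _ /allP pX z; rewrite inE => /predU1P[-> | /pX].
Qed.

Lemma cset_path X x y : cset X -> x \in X -> y \in X ->
  exists p, [/\ path e x p, last x p = y, uniq (x :: p) & {subset x :: p <= X}].
Proof. by move=> /csetP cX xX yX; apply: conn_path => //; apply: cX. Qed.

Lemma path_conn X x p : path e x p -> {subset x :: p <= X} ->
  connect (restr X) x (last x p).
Proof.
move=> xp sX; apply/connectP; exists p => //; apply: restr_path => //.
  by rewrite sX ?mem_head.
by apply/allP=> z zp; rewrite sX // inE zp orbT.
Qed.

Lemma connect_stable (X : {set T}) (P : pred T) x y :
  (forall u v, u \in X -> v \in X -> e u v -> P u -> P v) ->
  connect (restr X) x y -> P x -> P y.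
Proof.
move=> clP /connectP[p xp ->]; elim: p x xp => //= z p IHp x /andP[/and3P[xz xX zX] zp] Px.
by apply: IHp zp _; apply: clP xz Px.
Qed.

Lemma cset1 x : cset [set x].
Proof. by apply/csetP=> u v /set1P-> /set1P->; exact: connect0. Qed.

Lemma cset0 : cset set0.
Proof. by apply/csetP=> u v; rewrite inE. Qed.

Hypothesis esym : symmetric e.

Lemma restr_sym X : symmetric (restr X).
Proof. by move=> x y; rewrite !restrE esym; congr andb; rewrite andbC. Qed.

Lemma crestr_sym X : connect_sym (restr X).
Proof. by apply: sym_connect_sym; apply: restr_sym. Qed.

Lemma cset_center X x : (forall y, y \in X -> connect (restr X) x y) -> cset X.
Proof.
move=> cX; apply/csetP=> u v uX vX; apply: connect_trans (cX v vX).
by rewrite crestr_sym; apply: cX.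
Qed.

Lemma path_cset x p : path e x p -> cset [set z in x :: p].
Proof.
move=> xp; apply: (@cset_center _ x) => y; rewrite inE => yp.
case/splitPl: yp xp => p1 p2 <-; rewrite cat_path => /andP[xp1 _].
by apply: path_conn => // z; rewrite !inE mem_cat => /predU1P[->|->]; rewrite ?eqxx ?orbT.
Qed.

Lemma csetU A B a b : cset A -> cset B -> a \in A -> b \in B ->
  (a == b) || e a b -> cset (A :|: B).
Proof.
move=> /csetP cA /csetP cB aA bB ab; apply: (@cset_center _ a) => y /setUP[yA|yB].
  by apply: connect_restrS (cA _ _ aA yA); apply: subsetUl.
apply: (@connect_trans _ _ b).
  case/orP: ab => [/eqP-> | ab]; first exact: connect0.
  by apply: connect1; rewrite restrE ab !inE aA bB orbT.
by apply: connect_restrS (cB _ _ bB yB); apply: subsetUr.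
Qed.

Lemma csetU1 A a b : cset A -> b \in A -> e a b -> cset (a |: A).
Proof. move=> cA bA ab; apply: csetU (cset1 a) cA (set11 a) bA _; by rewrite ab orbT. Qed.

Definition ccomp X x := [set y in X | connect (restr X) x y].

Lemma ccomp_sub X x : ccomp X x \subset X.
Proof. by apply/subsetP=> y; rewrite inE => /andP[]. Qed.

Lemma mem_ccomp X x : x \in X -> x \in ccomp X x.
Proof. by move=> xX; rewrite inE xX connect0. Qed.

Lemma ccomp_closed X x y z : y \in ccomp X x -> z \in X -> e y z -> z \in ccomp X x.
Proof.
rewrite !inE => /andP[yX xy] zX yz; rewrite zX; apply: connect_trans xy _.
by apply: connect1; rewrite restrE yz yX zX.
Qed.

Lemma ccomp_cset X x : x \in X -> cset (ccomp X x).
Proof.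
move=> xX; apply: (@cset_center _ x) => y; rewrite inE => /andP[yX /(conn_path xX)].
case=> p [xp <- _ pX]; apply: path_conn => // z zp.
rewrite inE pX //=; case/splitPl: zp xp pX => p1 p2 <-.
rewrite cat_path => /andP[xp1 _] pX; apply: path_conn => // w wp; apply: pX.
by move: wp; rewrite !inE mem_cat => /predU1P[->|->]; rewrite ?eqxx ?orbT.
Qed.

Lemma ccomp_sym X x y : y \in ccomp X x -> ccomp X y = ccomp X x.
Proof.
rewrite inE => /andP[yX xy]; apply/setP=> z; rewrite !inE; congr andb.
by rewrite (same_connect (@crestr_sym X) xy).
Qed.

Lemma ccomp_disj X x y : y \notin ccomp X x -> y \in X -> [disjoint ccomp X x & ccomp X y].
Proof.
move=> yx yX; apply/pred0P=> z /=; apply/negP=> /andP[zx zy].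
by case/negP: yx; rewrite -(ccomp_sym zx) (ccomp_sym zy) mem_ccomp.
Qed.

Lemma cset_stable X (P : pred T) x y : cset X -> x \in X -> y \in X ->
  (forall u v, u \in X -> v \in X -> e u v -> P u -> P v) -> P x -> P y.
Proof. by move=> /csetP cX xX yX clP; apply: connect_stable (clP) (cX _ _ xX yX). Qed.

Lemma cset_exit X (P : pred T) x y : cset X -> x \in X -> y \in X -> P x -> ~~ P y ->
  exists u v, [/\ u \in X, v \in X, e u v, P u & ~~ P v].
Proof.
move=> cX xX yX Px nPy.
case: (boolP [exists u in X, exists v in X, [&& e u v, P u & ~~ P v]]).
  by case/existsP=> u /andP[uX /existsP[v /andP[vX /and3P[uv Pu Pv]]]]; exists u, v.
move/existsPn=> none; case/negP: nPy; apply: cset_stable xX yX _ Px => // u v uX vX uv Pu.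
apply/negPn/negP=> nPv; move/(_ u): none; rewrite uX /= => /existsPn/(_ v).
by rewrite vX uv Pu nPv.
Qed.

(** Connectedness of [X] forces an edge out of the component, and its far end cannot avoid [A]
    because the component is closed in the rest. *)
Lemma ccomp_nbr X A x : cset X -> x \in X :\: A -> A :&: X != set0 ->
  exists u v, [/\ u \in ccomp (X :\: A) x, v \in A :&: X & e u v].
Proof.
move=> cX xXA /set0Pn[a aAX]; have [xX xA] := setDP xXA.
have aX: a \in X by case/setIP: aAX.
have := @cset_exit X [in ccomp (X :\: A) x] x a cX xX aX (mem_ccomp xXA).
case; first by apply/negP=> /(subsetP (ccomp_sub _ _)); rewrite !inE; case/setIP: aAX => ->.
move=> u [v [uX vX uv uc vc]]; exists u, v; split=> //.
rewrite inE vX andbT; apply/negPn/negP=> vA; case/negP: vc.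
by apply: ccomp_closed uc _ uv; rewrite !inE vA vX.
Qed.

End ConnectedSets.

Lemma pairwise_in (T : eqType) (r : rel T) s x y : symmetric r -> pairwise r s ->
  x \in s -> y \in s -> x != y -> r x y.
Proof.
move=> rs; elim: s => // z s IHs /= /andP[/allP rz pw].
rewrite !inE => /predU1P[->|xs] /predU1P[->|ys]; rewrite ?eqxx // => ne.
- exact: rz.
- by rewrite rs rz.
- exact: IHs.
Qed.

Lemma uniq_pairwise_in (T : eqType) (r : rel T) s : uniq s ->
  {in s &, forall x y, x != y -> r x y} -> pairwise r s.
Proof.
elim: s => //= x s IHs /andP[xs us] H; apply/andP; split; last first.
  by apply: IHs us _ => y z ys zs; apply: H; rewrite inE ?ys ?zs orbT.
apply/allP=> y ys; apply: H; rewrite ?inE ?eqxx ?ys ?orbT //.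
by apply: contraNneq xs => ->.
Qed.

Lemma first_has (T : Type) (a : pred T) s : has a s ->
  exists s1 b s2, [/\ a b, ~~ has a s1 & s = rcons s1 b ++ s2].
Proof. by case/split_find=> b s1 s2 ab n1; exists s1, b, s2. Qed.

Lemma last_has (T : Type) (a : pred T) s : has a s ->
  exists s1 b s2, [/\ a b, ~~ has a s2 & s = s1 ++ b :: s2].
Proof.
rewrite -has_rev => /first_has[s1 [b [s2 [ab n1 es]]]].
exists (rev s2), b, (rev s1); split; rewrite ?has_rev //.
by rewrite -[s]revK es rev_cat rev_rcons.
Qed.

(** * Menger's theorem *)

Section Menger.
Variable T : finType.
Implicit Types (e : rel T) (A B S : {set T}).

(** Repetitions are allowed, since only disjointness between different lists matters for Menger's
    theorem; the paths are shortened when they are used. *)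
Definition pth e A B (s : seq T) :=
  if s is x :: p then [&& path e x p, x \in A & last x p \in B] else false.

Definition dsj (s t : seq T) := [disjoint s & t].

Lemma dsjS (s t s' t' : seq T) :
  {subset s' <= s} -> {subset t' <= t} -> dsj s t -> dsj s' t'.
Proof.
move=> ss tt /pred0P d; apply/pred0P=> x /=; apply/negP=> /andP[/ss xs /tt xt].
by have /= := d x; rewrite xs xt.
Qed.

Definition linked e k A B := exists ps : seq (seq T),
  [/\ size ps = k, all (pth e A B) ps & pairwise dsj ps].

Definition separates e A B S := forall s, pth e A B s -> has [in S] s.

Lemma pth_sub e e' A B s : subrel e e' -> pth e A B s -> pth e' A B s.
Proof. by case: s => //= x p ee /and3P[/(sub_path ee)-> -> ->]. Qed.

Lemma linked_sub e e' k A B : subrel e e' -> linked e k A B -> linked e' k A B.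
Proof.
move=> ee [ps [sz al pw]]; exists ps; split=> //.
by apply: sub_all al => s; apply: pth_sub.
Qed.

Lemma pth_trimr e A B s : pth e A B s ->
  exists s0 b, [/\ pth e A B (rcons s0 b), {subset rcons s0 b <= s}, b \in B &
    ~~ has [in B] s0].
Proof.
case: s => // x p /and3P[xp xA lB].
have /first_has[s1 [b [s2 [bB n1 es]]]]: has [in B] (x :: p).
  by apply/hasP; exists (last x p); rewrite ?mem_last.
exists s1, b; split=> //; last by rewrite es => z zs; rewrite mem_cat zs.
case: s1 n1 es bB => [|y s1] /= n1 [<- ep] bB; first by rewrite xA.
by move: xp; rewrite ep cat_path => /andP[-> _]; rewrite xA last_rcons.
Qed.

Lemma pth_last e A B s b : pth e A B (rcons s b) -> b \in B.
Proof. by case: s => [|x s] /=; rewrite ?last_rcons; [case/andP | case/and3P]. Qed.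

Lemma pth_cat1 e A B B' C s t a :
  pth e A B (rcons s a) -> pth e B' C (a :: t) -> pth e A C (rcons s a ++ t).
Proof.
case: s => [|x s] /=; first by move=> /andP[-> _] /and3P[-> _ ->].
by move=> /and3P[h1 -> _] /and3P[h2 _ h3]; rewrite cat_path h1 last_cat !last_rcons h2 h3.
Qed.

Lemma pth_cat2 e A B B' C s t a b : pth e A B (rcons s a) ->
  pth e B' C (b :: t) -> e a b -> pth e A C (rcons s a ++ b :: t).
Proof.
case: s => [|x s] /=; first by move=> /andP[-> _] /and3P[-> _ ->] ->.
by move=> /and3P[h1 -> _] /and3P[h2 _ h3] ab; rewrite cat_path h1 last_cat !last_rcons /= ab h2 h3.
Qed.

Lemma pth_rev e A B s : pth e A B s -> pth (fun u v => e v u) B A (rev s).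
Proof.
case/lastP: s => // s b; rewrite rev_rcons.
case: s => [|x s] /=; first by case/andP=> -> ->.
rewrite last_rcons => /and3P[xs xA bB]; rewrite bB {2}rev_cons last_rcons xA !andbT.
have := rev_path (fun u v => e v u) x (rcons s b).
by rewrite last_rcons belast_rcons => ->.
Qed.

(** As many disjoint paths as [B] has vertices, each cut at its first vertex in [B], end in every
    vertex of [B] exactly once; so the family can be indexed by [B]. This is the form in which two
    families are glued. *)
Lemma linked_ends e A B : linked e #|B| A B ->
  exists f : T -> seq T, (forall z, z \in B ->
      pth e A B (rcons (f z) z) /\ ~~ has [in B] (f z)) /\
    {in B &, forall z z', z != z' -> dsj (rcons (f z) z) (rcons (f z') z')}.
Proof.
case=> ps [sz al pw].
have [qs [szq alq pwq _]] : exists qs : seq (seq T * T), [/\ size qs = #|B|,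
    all (fun q => pth e A B (rcons q.1 q.2) && ~~ has [in B] q.1) qs,
    pairwise (fun q q' => dsj (rcons q.1 q.2) (rcons q'.1 q'.2)) qs &
    forall q, q \in qs -> exists2 p, p \in ps & {subset rcons q.1 q.2 <= p}].
  rewrite -sz; elim: ps al pw {sz} => [|p ps IHp] /=; first by exists [::].
  case/andP=> /pth_trimr[s [b [h1 h2 h3 h4]]] al /andP[/allP dp pw].
  case: (IHp al pw) => qs [h5 h6 h7 h8]; exists ((s, b) :: qs); split=> /=.
  - by rewrite h5.
  - by rewrite h1 h4.
  - rewrite h7 andbT; apply/allP=> q /h8[p' p'ps qp'] /=.
    exact: dsjS h2 qp' (dp _ p'ps).
  - move=> q; rewrite inE => /predU1P[-> | /h8[p' p'ps qp']]; first by exists p; rewrite ?mem_head.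
    by exists p'; rewrite // inE p'ps orbT.
have uql : uniq (map snd qs).
  move: pwq; rewrite uniq_pairwise pairwise_map; apply: sub_pairwise => q q' /= d.
  apply/eqP=> eq2; have /pred0P/(_ q.2) := d.
  by rewrite /= mem_rcons mem_head eq2 mem_rcons mem_head.
have subl : {subset map snd qs <= enum B}.
  move=> z /mapP[q /(allP alq)/andP[qq _] ->]; rewrite mem_enum.
  exact: pth_last qq.
have szle : size (enum B) <= size (map snd qs) by rewrite size_map szq cardE.
have [_ inB] := uniq_min_size uql subl szle.
pose x0 (z : T) := ([::], z) : seq T * T.
pose g z := nth (x0 z) qs (index z (map snd qs)).
have gP z : z \in B -> g z \in qs /\ (g z).2 = z.
  rewrite -mem_enum -inB => zq; split; first by rewrite mem_nth // -(size_map snd) index_mem.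
  by rewrite -(nth_map _ z) ?nth_index // -(size_map snd) index_mem.
exists (fun z => (g z).1); split=> [z /gP[gz ez] | z z' zB z'B ne].
  by case/andP: (allP alq _ gz); rewrite ez.
have [gz ez] := gP z zB; have [gz' ez'] := gP z' z'B.
have: g z != g z' by apply: contra ne => /eqP eg; rewrite -ez eg ez'.
move/(pairwise_in _ pwq gz gz'); rewrite ez ez'; apply=> q q'.
exact: disjoint_sym.
Qed.

(* Two families that end in, resp. start from, the same separating set are glued
   along it; this is the combination step of Göring's proof. *)
Lemma menger e A B k :
  (forall S, separates e A B S -> k <= #|S|) -> linked e k A B.
Proof.
move: {2}#|_| (leqnn #|[set u : T * T | e u.1 u.2]|) => n.
elim: n e A B k => [|n IHn] e A B k.
  rewrite leqn0 cards_eq0 => /eqP e0 sepk.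
  have ne x y : e x y = false.
    by move/setP/(_ (x, y)): e0; rewrite !inE.
  have kAB: k <= #|A :&: B|.
    apply: sepk => -[//|x [|y p]] /=; last by rewrite ne.
    by case/andP=> xA xB; rewrite inE xA xB.
  exists [seq [:: x] | x <- take k (enum (A :&: B))]; split.
  - by rewrite size_map size_take -cardE; case: ltngtP kAB.
  - apply/allP=> s /mapP[x /mem_take]; rewrite mem_enum => /setIP[xA xB] ->.
    by rewrite /= xA xB.
  - rewrite pairwise_map; have := take_uniq k (enum_uniq (A :&: B)).
    rewrite uniq_pairwise; apply: sub_pairwise => x y /= xy.
    by rewrite /dsj disjoint_has /= orbF inE.
move=> le_n sepk.
case: (set_0Vmem [set u : T * T | e u.1 u.2]) => [e0 | [[x y]]].
  by apply: IHn sepk; rewrite e0 cards0.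
rewrite inE /= => exy.
pose e' := [rel u v | e u v && ((u, v) != (x, y))].
have ee' : subrel e' e by move=> u v /andP[].
have le' : #|[set u : T * T | e' u.1 u.2]| <= n.
  rewrite -ltnS; apply: leq_trans le_n; apply: proper_card; apply/properP; split.
    by apply/subsetP=> -[u v]; rewrite !inE /= => /andP[].
  by exists (x, y); rewrite !inE ?exy // eqxx andbF.
(* If no set of fewer than [k] vertices separates after deletion of the edge [xy], induction on the
   number of edges applies. Otherwise some [S] with [k - 1] vertices separates in [e'], and both
   [x |: S] and [y |: S] separate in [e]. *)
have [//|sep'] := boolP [forall S : {set T}, (#|S| < k) ==>
   [exists u : T, exists v, [&& u \in A :\: S, v \in B :\: S &
       connect (restr e' (~: S)) u v]]].
  move=> /forallP H; apply: (linked_sub ee'); apply: IHn le' _ => S sS.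
  rewrite leqNgt; apply/negP=> ltS; move/implyP/(_ ltS): (H S).
  case/existsP=> u /existsP[v /and3P[/setDP[uA uS] /setDP[vB vS]]].
  move/conn_path; rewrite inE => /(_ uS) [p [up lp _ pS]].
  have /sS/hasP[z zp zS] : pth e' A B (u :: p) by rewrite /= up uA lp vB.
  by move/(_ z zp): pS; rewrite inE zS.
case/forallPn: sep' => S; rewrite negb_imply => /andP[ltS nS].
have sepS : separates e' A B S.
  move=> [//|u p] /and3P[up uA lB]; apply/negPn/negP=> nh; case/negP: nS.
  have sub: {subset u :: p <= ~: S}.
    by move=> z zp; rewrite inE; apply/negP=> zS; case/negP: nh; apply/hasP; exists z.
  apply/existsP; exists u; apply/existsP; exists (last u p).
  rewrite !inE uA lB -!in_setC !sub ?mem_head ?mem_last //=.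
  exact: path_conn.
have seps z : z \in [:: x; y] -> separates e A B (z |: S).
  move=> zxy [//|u p] /and3P[up uA lB]; apply/negPn/negP=> nh.
  have sub: {subset u :: p <= ~: (z |: S)}.
    by move=> w wp; rewrite inE; apply/negP=> wS; case/negP: nh; apply/hasP; exists w.
  have: pth e' A B (u :: p).
    rewrite /= uA lB !andbT.
    clear uA lB nh; elim: p u up sub => //= w p IHp u /andP[uw wp] sub.
    rewrite IHp // ?andbT; last by move=> v vp; apply: sub; rewrite inE vp orbT.
    rewrite uw /=; apply/eqP=> -[ux wy].
    have := sub u (mem_head _ _); have := sub w; rewrite !inE eqxx orbT => /(_ isT).
    by move: zxy; rewrite !inE ux wy => /orP[]/eqP->; rewrite eqxx.
  move/sepS/hasP=> [w /sub]; rewrite !inE negb_or => /andP[_ /negP] //.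
have kx : k <= #|x |: S| by apply/sepk/seps; rewrite inE eqxx.
have ky : k <= #|y |: S| by apply/sepk/seps; rewrite !inE eqxx orbT.
have [xS yS] : x \notin S /\ y \notin S.
  by split; apply/negP=> zS; [move: kx | move: ky];
    rewrite cardsU1 zS /= add0n leqNgt ltS.
have cS : k = #|S|.+1.
  by apply/eqP; rewrite eqn_leq ltS andbT; move: kx; rewrite cardsU1 xS.
have cx : #|x |: S| = k by rewrite cardsU1 xS.
have cy : #|y |: S| = k by rewrite cardsU1 yS.
have L1 : linked e' k A (x |: S).
  apply: IHn le' _ => S' sS'; apply: sepk => s sp.
  have /first_has[s1 [b [s2 [bS n1 es]]]] := seps x (mem_head _ _) _ sp.
  have: pth e' A (x |: S) (rcons s1 b).
    case: s1 n1 es => [|u s1] n1 es; rewrite es /= in sp *.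
      by case/and3P: sp => _ -> _; rewrite bS.
    case/and3P: sp => up uA _; rewrite uA last_rcons bS !andbT.
    move: up; rewrite cat_path => /andP[up _].
    move: {uA es} n1 up; elim: s1 u => [|w s1 IHs] u /= /norP[uS n1]; rewrite ?andbT.
      move=> ->; apply: contra uS => /eqP[-> _]; exact: setU11.
    case/andP=> -> /IHs -> //; rewrite !andbT; apply: contra uS => /eqP[-> _]; exact: setU11.
  by move/sS'/hasP=> [w ws wS]; apply/hasP; exists w; rewrite // es mem_cat ws.
have L2 : linked e' k (y |: S) B.
  apply: IHn le' _ => S' sS'; apply: sepk => s sp.
  have /last_has[s1 [b [s2 [bS n1 es]]]] := seps y (mem_last x [:: y]) _ sp.
  have: pth e' (y |: S) B (b :: s2).
    have : pth e setT B (b :: s2).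
      move: sp; rewrite es; case: s1 {es} => [|u s1] /=; first by rewrite inE => /and3P[-> _ ->].
      by rewrite cat_path last_cat inE /= => /and3P[/and3P[_ _ ->] _ ->].
    rewrite /= inE bS /= => /andP[bp ->]; rewrite andbT.
    clear bS es; elim: s2 b n1 bp => //= w s2 IHs b /norP[wS n1] /andP[-> wp].
    rewrite IHs // andbT; apply: contra wS => /eqP[_ ->]; exact: setU11.
  by move/sS'/hasP=> [w ws wS]; apply/hasP; exists w; rewrite // es mem_cat ws orbT.
rewrite -{}cx in L1; case/linked_ends: L1 => f [fP fd].
have [g [gP gd]] : exists g : T -> seq T, (forall z, z \in y |: S ->
      pth e' (y |: S) B (z :: g z) /\ ~~ has [in y |: S] (g z)) /\
    {in y |: S &, forall z z', z != z' -> dsj (z :: g z) (z' :: g z')}.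
  have: linked (fun u v => e' v u) #|y |: S| B (y |: S).
    rewrite cy; case: L2 => ps [sz /allP al pw]; exists (map rev ps); split.
    - by rewrite size_map.
    - by apply/allP=> s /mapP[s' /al s'P ->]; apply: pth_rev.
    - rewrite pairwise_map; apply: sub_pairwise pw => s t; apply: dsjS => z;
        by rewrite mem_rev.
  case/linked_ends=> g [gP gd]; exists (fun z => rev (g z)); split=> [z zS | z z' zS z'S ne].
    have [/pth_rev h1 h2] := gP z zS; rewrite has_rev h2; split=> //.
    by move: h1; rewrite rev_rcons.
  by apply: dsjS (gd z z' zS z'S ne) => w; rewrite inE mem_rev mem_rcons inE.
(* Switching from the first family to the second at a common vertex [w] yields an [A]-[B] path of
   [e'], which must hit [S]. Each path meets its separating set only at its end, so the vertex hit
   is [w] itself. *)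
have meet z z' w : z \in x |: S -> z' \in y |: S -> w \in rcons (f z) z ->
    w \in z' :: g z' -> [/\ w = z, w = z' & w \in S].
  move=> zS z'S; have [fz nfz] := fP z zS; have [gz ngz] := gP z' z'S.
  move=> wf wg.
  have [l1 [l2 el]] : exists l1 l2, rcons (f z) z = rcons l1 w ++ l2.
    by case/splitPr: wf => l1 l2; exists l1, l2; rewrite cat_rcons.
  have [r1 [r2 er]] : exists r1 r2, z' :: g z' = r1 ++ w :: r2.
    by case/splitPr: wg => r1 r2; exists r1, r2.
  have l1f : {subset l1 <= f z}.
    case/lastP: l2 el => [|l2 u].
      by rewrite cats0 => /eqP; rewrite eqseq_rcons => /andP[/eqP-> _].
    rewrite -rcons_cat => /eqP; rewrite eqseq_rcons => /andP[/eqP-> _] v vl.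
    by rewrite mem_cat mem_rcons inE vl orbT.
  have r2g : {subset r2 <= g z'}.
    case: r1 er => [[_ ->] | v r1 [_ ->]] // v' vr.
    by rewrite mem_cat inE vr !orbT.
  have p1 : pth e' A setT (rcons l1 w).
    move: fz; rewrite el; case: (l1) => [|a t] /=; rewrite in_setT andbT; first by case/and3P.
    by rewrite cat_path => /and3P[/andP[-> _] -> _].
  have p2 : pth e' setT B (w :: r2).
    move: gz; rewrite er; case: (r1) => [|a t] /=; rewrite in_setT; first by case/and3P=> -> _ ->.
    by rewrite cat_path last_cat /= => /and3P[/and3P[_ _ ->] _ ->].
  have /hasP[v] := sepS _ (pth_cat1 p1 p2).
  rewrite mem_cat mem_rcons inE => /orP[/predU1P[->|/l1f vf]|/r2g vg] vS.
  - split=> //.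
      move: wf; rewrite mem_rcons inE => /predU1P[//|wf]; case/hasP: nfz.
      by exists w; rewrite // !inE vS orbT.
    move: wg; rewrite inE => /predU1P[//|wg]; case/hasP: ngz.
    by exists w; rewrite // !inE vS orbT.
  - by case/hasP: nfz; exists v; rewrite // !inE vS orbT.
  - by case/hasP: ngz; exists v; rewrite // !inE vS orbT.
exists ((rcons (f x) x ++ y :: g y) :: [seq rcons (f z) z ++ g z | z <- enum S]); split.
- by rewrite /= size_map -cardE cS.
- apply/andP; split.
    apply: pth_cat2 exy; first by apply: pth_sub ee' _; exact: (fP x (setU11 _ _)).1.
    by apply: pth_sub ee' _; exact: (gP y (setU11 _ _)).1.
  apply/allP=> s /mapP[z]; rewrite mem_enum => zS ->.
  apply: pth_sub ee' _; apply: pth_cat1.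
    by have [|h _] := fP z; [rewrite inE zS orbT | exact: h].
  by have [|h _] := gP z; [rewrite inE zS orbT | exact: h].
- have key z z' : z \in x |: S -> z' \in x |: S -> z != z' ->
    forall t t', t \in y |: S -> t' \in y |: S -> t != t' ->
    (z == t') = false -> (z' == t) = false ->
    dsj (rcons (f z) z ++ t :: g t) (rcons (f z') z' ++ t' :: g t').
    move=> zS z'S ne t t' tS t'S ne' zt z't; apply/pred0P=> w /=; apply/negP.
    rewrite !mem_cat => /andP[/orP[wz|wt] /orP[wz'|wt']].
    + by have /pred0P/(_ w) := fd z z' zS z'S ne; rewrite /= wz wz'.
    + by have [e1 e2 _] := meet z t' w zS t'S wz wt'; rewrite -e1 -e2 eqxx in zt.
    + by have [e1 e2 _] := meet z' t w z'S tS wz' wt; rewrite -e1 -e2 eqxx in z't.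
    + by have /pred0P/(_ w) := gd t t' tS t'S ne'; rewrite /= wt wt'.
  have dg z : {subset rcons (f z) z ++ g z <= rcons (f z) z ++ z :: g z}.
    by move=> w; rewrite !mem_cat inE => /orP[->|->]; rewrite ?orbT.
  rewrite /= pairwise_map; apply/andP; split.
    apply/allP=> s /mapP[z]; rewrite mem_enum => zS ->; apply: dsjS (fun _ h => h) (dg z) _.
    have zx : z != x by apply: contraNneq xS => <-.
    have zy : z != y by apply: contraNneq yS => <-.
    apply: key; rewrite ?setU11 ?inE ?zS ?orbT //; rewrite 1?eq_sym //.
      by apply: contra_neqF zx => /eqP->.
    by apply: contra_neqF zy => /eqP->.
  apply: uniq_pairwise_in (enum_uniq S) _ => z z'; rewrite !mem_enum => zS z'S ne.
  apply: dsjS (dg z) (dg z') _.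
  by apply: key; rewrite ?inE ?zS ?z'S ?orbT //; apply: negbTE; rewrite // eq_sym.
Qed.

End Menger.

Section SeqAux.
Variables (T : eqType) (e : rel T).

Lemma sorted_glue (a b : seq T) x y : sorted e (rcons a x) -> e x y ->
  sorted e (y :: b) -> sorted e (rcons a x ++ y :: b).
Proof.
case: a => [|z a] /=; first by move=> _ -> ->.
by rewrite cat_path last_rcons /= => -> -> ->.
Qed.

Lemma index_drop (l : seq T) i y : uniq l -> y \in drop i l -> i <= index y l.
Proof.
move=> ul yd; have yl: y \in l by exact: mem_drop yd.
rewrite leqNgt; apply/negP; rewrite -in_take // => yt.
by move: ul; rewrite -(cat_take_drop i l) cat_uniq => /and3P[_ /hasPn/(_ _ yd)]; rewrite yt.
Qed.

Lemma drop_index (l : seq T) i y : y \in l -> i <= index y l -> y \in drop i l.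
Proof.
move=> yl; rewrite leqNgt -in_take //; move: yl.
by rewrite -{1}(cat_take_drop i l) mem_cat => /orP[->|].
Qed.

Lemma sorted_nth x0 (l : seq T) i : sorted e l -> i.+1 < size l ->
  e (nth x0 l i) (nth x0 l i.+1).
Proof. by case: l => // x p xp; rewrite /= ltnS => ip; move/(pathP x0): xp => /(_ i ip). Qed.

End SeqAux.

(** * Non-separating paths *)

Section NonSeparating.
Variables (T : finType) (e : rel T).
Hypothesis esym : symmetric e.
Variables (U A0 : {set T}) (s t : T).
Implicit Types (l : seq T).

Definition stpath l := [&& l != [::], head t l == s, last s l == t, sorted e l,
  uniq l & all [in U :\: A0] l].

Definition offp l := [set y in U | y \notin l].

(* The part of [U] off [l] that can be reached from the anchors [A0]; rerouting [l]
   through a component that is not anchored frees vertices of [l]. *)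
Definition anchored l :=
  [set y in offp l | [exists a in A0, connect (restr e (offp l)) a y]].

Definition nbrs (X : {set T}) := [set y in U | (y \notin X) && [exists x in X, e x y]].

Hypothesis A0U : A0 \subset U.
Hypothesis C3 : forall X : {set T}, X != set0 -> X \subset U ->
  [disjoint X & s |: (t |: A0)] -> cset e X -> 2 < #|nbrs X|.

Lemma anchored_closed l y z : y \in anchored l -> z \in offp l -> e y z -> z \in anchored l.
Proof.
rewrite !inE -!andbA => /and3P[yU yl /existsP[a /andP[aA ay]]] /andP[zU zl] yz.
rewrite zU zl; apply/existsP; exists a; rewrite aA; apply: connect_trans ay _.
by apply: connect1; rewrite restrE yz !inE yU yl zU zl.
Qed.

Lemma anchor_anchored l a : stpath l -> a \in A0 -> a \in anchored l.
Proof.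
case/and5P=> _ _ _ _ /andP[_ /allP lU] aA.
have ao : a \in offp l.
  by rewrite !inE (subsetP A0U) //=; apply/negP=> /lU; rewrite !inE aA.
by rewrite inE ao; apply/existsP; exists a; rewrite aA connect0.
Qed.

(** The neighbours of a component [X] of bad vertices all lie on [l], and [C3] provides three of
    them. Rerouting [l] through [X] between the first and the last frees the one in the middle,
    which has an anchored neighbour; so the anchored part grows strictly. *)
Lemma nonsep_step l : stpath l ->
  (forall y, y \in offp l -> y \in anchored l) /\
    (forall y, y \in l -> y != s -> y != t -> exists2 z, z \in offp l & e y z) \/
  exists2 l', stpath l' & #|anchored l| < #|anchored l'|.
Proof.
move=> lP; case/and5P: (lP) => l0 /eqP hl /eqP ll sl /andP[ul /allP lU].
have sl0 : s \in l by case: (l) l0 hl => //= x p _ ->; rewrite mem_head.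
have tl0 : t \in l by case: (l) l0 ll => //= x p _ <-; rewrite mem_last.
have lUU y : y \in l -> y \in U by move/lU; rewrite inE => /andP[].
have [K eK] : exists K : {set T}, K = anchored l by exists (anchored l).
have Kl y : y \in K -> y \in U /\ y \notin l.
  by rewrite eK !inE -!andbA => /and3P[].
have Kl0 y : y \in K -> y \in offp l by move/Kl=> [yU yl]; rewrite inE yU.
have KA a : a \in A0 -> a \in K by rewrite eK; apply: anchor_anchored.
have Kcl y z : y \in K -> z \in U -> z \notin l -> e y z -> z \in K.
  by rewrite eK => yK zU zl; apply: anchored_closed => //; rewrite inE zU.
have Kc y : y \in K -> exists2 a, a \in A0 & connect (restr e (offp l)) a y.
  by rewrite eK inE => /andP[_ /existsP[a /andP[]]]; exists a.
rewrite -eK.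
(* The inner vertices that are neither anchored nor on [l] with an anchored neighbour. If there are
   none, [l] is as wanted. Otherwise the component [X] may itself contain vertices of [l]. *)
pose bad := [set y in U | [&& y != s, y != t, y \notin K &
   ~~ ((y \in l) && [exists z in K, e y z])]].
case: (set_0Vmem bad) => [b0 | [x0 x0b]].
  left; split=> [y yo | y yl ys yt].
    have: y \notin bad by rewrite b0 inE.
    move: yo; rewrite inE => /andP[yU yl]; rewrite inE yU (negbTE yl).
    have -> : y != s by apply: contraNneq yl => ->.
    have -> : y != t by apply: contraNneq yl => ->.
    by rewrite /= andbT negbK.
  have: y \notin bad by rewrite b0 inE.
  rewrite inE lUU // ys yt /= negb_and !negbK => /orP[/Kl[_]|]; first by rewrite yl.
  case/andP=> _ /existsP[z /andP[zK yz]]; exists z => //.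
  by have [zU zl] := Kl z zK; rewrite !inE zU.
right; set X := ccomp e bad x0.
have XB : X \subset bad by exact: ccomp_sub.
have X0 : X != set0 by apply/set0Pn; exists x0; apply: mem_ccomp.
have cX : cset e X by apply: ccomp_cset.
have Xcl x y : x \in X -> y \in bad -> e x y -> y \in X by apply: ccomp_closed.
clearbody X; have [N eN] : exists N : {set T}, N = nbrs X by exists (nbrs X).
have NI y x : y \in U -> y \notin X -> x \in X -> e x y -> y \in N.
  by move=> yU yX xX xy; rewrite eN inE yU yX; apply/existsP; exists x; rewrite xX.
have NE y : y \in N -> [/\ y \in U, y \notin X & exists2 x, x \in X & e x y].
  by rewrite eN inE => /and3P[-> -> /existsP[x /andP[xX xy]]]; split=> //; exists x.
have XU : X \subset U by apply: subset_trans XB _; apply/subsetP=> y; rewrite inE => /andP[].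
have Nl y : y \in N -> y \in l /\ (y != s -> y != t -> exists2 z, z \in K & e y z).
  case/NE=> yU yX [x xX xy].
  have yb : y \notin bad.
    by apply: contra yX => yb; apply: Xcl xX yb xy.
  have := subsetP XB _ xX; rewrite inE => /and5P[_ _ _ xK xn].
  have yK : y \notin K.
    apply/negP=> yK; case: (boolP (x \in l)) xn => [xl | xl _] /=.
      by case/negP; apply/existsP; exists y; rewrite yK.
    case/negP: xK; apply: Kcl yK _ xl _; [exact: (subsetP XU) | by rewrite esym].
  move: yb; rewrite inE yU yK /=.
  case: (altP (y =P s)) => [-> _ | ys] /=; first by [].
  case: (altP (y =P t)) => [-> _ | yt] /=; first by [].
  by rewrite negbK => /andP[-> /existsP[z /andP[zK yz]]]; split=> //; exists z.
have N3 : 2 < #|N|.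
  rewrite eN; apply: C3 => //.
  - apply/pred0P=> y /=; apply/negP=> /andP[/(subsetP XB)].
    rewrite !inE => /and5P[_ ys yt yK _] /or3P[] //; first by rewrite (negbTE ys).
      by rewrite (negbTE yt).
    by move/KA; rewrite (negbTE yK).
have [y0 y0N] : exists y, y \in N by apply/set0Pn; rewrite -card_gt0; apply: leq_trans N3.
pose idx y := index y l.
case: (@arg_minnP _ y0 [in N] idx y0N) => f1 f1N min1.
case: (@arg_maxnP _ y0 [in N] idx y0N) => f3 f3N max3.
have {}max3 y : y \in N -> idx y <= idx f3 by exact: max3.
have [f2 f2N [f21 f23]] : exists2 f2, f2 \in N & f2 != f1 /\ f2 != f3.
  have : 0 < #|N :\: [set f1; f3]|.
    have le2 : #|N :&: [set f1; f3]| <= 2.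
      by apply: leq_trans (subset_leq_card (subsetIr _ _)) _; rewrite cards2; case: eqP.
    by move: le2 (cardsID [set f1; f3] N) N3; clear; lia.
  by rewrite card_gt0 => /set0Pn[f2]; rewrite !inE negb_or => /andP[/andP[? ?] ?]; exists f2.
have [[f1l _] [f2l K2] [f3l _]] := And3 (Nl f1 f1N) (Nl f2 f2N) (Nl f3 f3N).
have idxI y z : y \in l -> z \in l -> idx y = idx z -> y = z.
  by move=> yl zl /(congr1 (nth s l)); rewrite !nth_index.
have lt12 : idx f1 < idx f2.
  rewrite ltn_neqAle min1 // andbT; apply: contra f21 => /eqP/idxI -> //.
have lt23 : idx f2 < idx f3.
  by rewrite ltn_neqAle max3 // andbT; apply: contra f23 => /eqP/idxI -> //.
have Xst x : x \in X -> [/\ x \in U, x != s & x != t].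
  by move/(subsetP XB); rewrite inE => /and5P[-> -> ->].
have nthl i : i < size l -> nth s l i \in l by exact: mem_nth.
have sidx : idx s = 0 by rewrite /idx; case: (l) l0 hl => //= x p _ ->; rewrite eqxx.
have tidx : idx t = (size l).-1.
  by rewrite /idx -{1}ll; case: (l) l0 ul => // x p _ ul; rewrite -[last s _]/(last x p) index_last.
(* Walking back along [l] from a vertex of [X], one leaves [X] before reaching [s], and the vertex
   where this happens belongs to [N]; hence [f1] comes earlier. [XR] is the mirror image. *)
have XL x : x \in X -> x \in l -> idx f1 < idx x.
  move: {2}(idx x) (erefl (idx x)) => n; elim: n x => [|n IHn] x ex xX xl.
    have [_ /eqP[]] := Xst x xX; apply: idxI => //; by rewrite ex sidx.
  have lt_n: n.+1 < size l by rewrite -ex index_mem.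
  set y := nth s l n; have yl : y \in l by apply: nthl; apply: ltn_trans lt_n.
  have ey : idx y = n by rewrite /idx index_uniq //; apply: ltn_trans lt_n.
  have yx : e y x.
    by rewrite -[x](nth_index s xl) -/(idx x) ex; apply: sorted_nth.
  case: (boolP (y \in X)) => yX; first by have := IHn y ey yX yl; rewrite ey ex; apply: ltnW.
  have yN : y \in N.
    by apply: NI (lUU y yl) yX xX _; rewrite esym.
  by have := min1 y yN; rewrite ey ex.
have XR x : x \in X -> x \in l -> idx x < idx f3.
  move: {2}(size l - idx x) (erefl (size l - idx x)) => n; elim: n x => [|n IHn] x ex xX xl.
    by have : idx x < size l; [rewrite index_mem | rewrite -subn_gt0 ex].
  have lt_n: idx x < size l by rewrite index_mem.
  have lt_n1 : (idx x).+1 < size l.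
    rewrite ltn_neqAle lt_n andbT; apply/eqP=> en; have [_ _ /eqP[]] := Xst x xX.
    by apply: idxI => //; rewrite tidx -en.
  set y := nth s l (idx x).+1; have yl : y \in l by apply: nthl.
  have ey : idx y = (idx x).+1 by rewrite /idx index_uniq.
  have yx : e x y by rewrite -{1}[x](nth_index s xl); apply: sorted_nth.
  case: (boolP (y \in X)) => yX; first by apply: ltn_trans (IHn y _ yX yl); rewrite ey // subnS ex.
  have yN : y \in N.
    exact: NI (lUU y yl) yX xX yx.
  by have := max3 y yN; rewrite ey.
have [x1 [x1X x1f]] : exists x, x \in X /\ e x f1.
  by have [_ _ [x xX xf]] := NE _ f1N; exists x.
have [x3 [x3X x3f]] : exists x, x \in X /\ e x f3.
  by have [_ _ [x xX xf]] := NE _ f3N; exists x.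
have [q [qp ql qu qX]] := cset_path cX x1X x3X.
have i1s : idx f1 < size l by rewrite index_mem.
have i3s : idx f3 < size l by rewrite index_mem.
have n1 : nth s l (idx f1) = f1 by rewrite nth_index.
have n3 : nth s l (idx f3) = f3 by rewrite nth_index.
have tk : take (idx f1).+1 l = rcons (take (idx f1) l) f1 by rewrite (take_nth s) ?n1.
have dk : drop (idx f3) l = f3 :: drop (idx f3).+1 l by rewrite (drop_nth s) ?n3.
pose l' := take (idx f1).+1 l ++ ((x1 :: q) ++ drop (idx f3) l).
have inl' y : y \in l' -> y \in X \/ (y \in l /\ (idx y <= idx f1 \/ idx f3 <= idx y)).
  rewrite !mem_cat => /or3P[yt | yq | yd]; last 1 first.
  - by right; split; [apply: mem_drop yd | right; apply: index_drop].
  - by right; split; [apply: mem_take yt | left; rewrite -ltnS -in_take // (mem_take yt)].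
  - by left; apply: qX.
have Xu y : y \in X -> y \in U :\: A0.
  move=> yX; have [yU _ _] := Xst y yX; rewrite inE yU andbT; apply/negP.
  move/KA => yK; move/(subsetP XB): yX.
  by rewrite inE => /and5P[_ _ _]; rewrite yK.
have l'P : stpath l'.
  apply/and5P; split.
  - by rewrite /l' tk; case: (take _ _).
  - rewrite /l'; case: (l) l0 hl => //= x p _ ->; exact: eqxx.
  - rewrite /l' catA last_cat dk /= -[last f3 _]/(last s (f3 :: drop (idx f3).+1 l)) -dk.
    have -> : last s (drop (idx f3) l) = last s l.
      by rewrite -{2}(cat_take_drop (idx f3) l) last_cat dk.
    by rewrite ll.
  - rewrite /l' tk cat_cons; apply: sorted_glue; first by rewrite -tk; apply: take_sorted.
      by rewrite esym.
    rewrite /= cat_path qp ql dk /= x3f.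
    by have := drop_sorted (idx f3) sl; rewrite dk.
  - apply/andP; split; last first.
      by apply/allP=> y /inl'[/Xu | [/lU]].
    rewrite /l' cat_uniq take_uniq // andTb; apply/andP; split.
      apply/hasPn=> y; rewrite mem_cat => /orP[/qX yX | yd]; apply/negP=> yt.
        have yl := mem_take yt; have := XL y yX yl.
        by move: yt; rewrite in_take // ltnS leqNgt => /negP h1 /h1.
      have yl := mem_take yt; have h1 := index_drop ul yd.
      move: yt; rewrite in_take // ltnS => h2.
      by move: (leq_trans h1 h2); rewrite leqNgt (ltn_trans lt12 lt23).
    rewrite cat_uniq qu drop_uniq // andbT; apply/hasPn=> y yd.
    apply/negP=> /qX yX; have yl := mem_drop yd.
    by have := XR y yX yl; rewrite ltnNge (index_drop ul yd).
have Ko y : y \in K -> y \in offp l'.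
  move=> yK; have [yU yl] := Kl y yK; rewrite inE yU; apply/negP=> /inl'[yX | [yl2]].
    by move/(subsetP XB): yX; rewrite inE yK => /and5P[].
  by rewrite yl2 in yl.
have KK' y : y \in K -> y \in anchored l'.
  move=> yK; rewrite inE Ko //; have [a aA ay] := Kc y yK.
  apply/existsP; exists a; rewrite aA /=.
  have [p [ap lp _ pU]] := conn_path (Kl0 _ (KA _ aA)) ay.
  have pK w : w \in a :: p -> w \in K.
    move=> wp; case/splitPl: wp ap pU => p1 p2 <-; rewrite cat_path => /andP[ap1 _] pU.
    have {}pU : {subset a :: p1 <= offp l}.
      by move=> v vp; apply: pU; move: vp; rewrite !inE mem_cat orbA => ->.
    apply: (@connect_stable _ _ _ [in K] _ _ _ (path_conn ap1 pU) (KA _ aA)) => u v _.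
    by rewrite inE => /andP[vU vl] uv uK; apply: Kcl uK vU vl uv.
  by rewrite -lp; apply: path_conn => // w wp; apply/Ko/pK.
exists l' => //; apply: proper_card; apply/properP; split; last first.
  exists f2; last by apply/negP=> /Kl[_]; rewrite f2l.
  have f2s : f2 != s by apply/eqP=> E; move: lt12; rewrite E sidx.
  have f2t : f2 != t.
    by apply/eqP=> E; move: lt23 i3s; rewrite E tidx -/(idx f3); clear; lia.
  have [z zK fz] := K2 f2s f2t.
  have f2o : f2 \in offp l'.
    rewrite inE lUU //=; apply/negP=> /inl'[f2X | [_ []]]; last 2 first.
    - by rewrite leqNgt lt12.
    - by rewrite leqNgt lt23.
    by have [_] := NE _ f2N; rewrite f2X.
  by apply: (anchored_closed (KK' z zK) f2o); rewrite esym.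
by apply/subsetP.
Qed.

Lemma nonsep l : stpath l -> exists l', [/\ stpath l',
  forall y, y \in offp l' -> y \in anchored l' &
  forall y, y \in l' -> y != s -> y != t -> exists2 z, z \in offp l' & e y z].
Proof.
have [n] := ubnP (#|U| - #|anchored l|); elim: n l => // n IHn l len lP.
case: (nonsep_step lP) => [[h1 h2] | [l' l'P ll']]; first by exists l.
apply: IHn l'P; suff: #|anchored l'| <= #|U| by move: len ll'; clear; lia.
by apply/subset_leq_card/subsetP=> y; rewrite !inE -!andbA => /and3P[].
Qed.

End NonSeparating.

(** * Splitting a connected set by weight *)

Section Weights.
Variables (T : finType) (e : rel T).
Hypothesis esym : symmetric e.
Hypothesis deg3 : forall x, #|[set y | e x y]| <= 3.
Implicit Types (R C S X Y : {set T}) (w : T -> nat).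

(** A path in [R] that enters [C] can leave it only at [s], so after the removal of [C] every
    remaining vertex is still joined to [s]. *)
Lemma cset_diff R C s : cset e R -> s \in R -> s \notin C ->
  (forall u v, u \in C -> v \in R -> v \notin C -> e u v -> v = s) -> cset e (R :\: C).
Proof.
move=> cR sR sC hC; apply: (@cset_center _ e esym _ s) => y /setDP[yR yC].
pose P v := (v \in C) || connect (restr e (R :\: C)) s v.
suff: P y by rewrite /P (negbTE yC).
apply: (@cset_stable _ e R P s y cR sR yR); last by rewrite /P connect0 orbT.
move=> u v uR vR uv; rewrite /P; case: (boolP (v \in C)) => //= vC.
case: (boolP (u \in C)) => [uC _ | uC /= su]; first by rewrite (hC _ _ uC vR vC uv) connect0.
by apply: connect_trans su (connect1 _); rewrite restrE uv !inE uR vR uC vC.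
Qed.

Lemma cset_diff_comp R x y : cset e R -> x \in R -> cset e (R :\: ccomp e (R :\ x) y).
Proof.
move=> cR xR; apply: (cset_diff cR xR).
  by apply/negP=> /(subsetP (ccomp_sub _ _ _)); rewrite !inE eqxx.
move=> u v uC vR vC uv; apply/eqP/negPn/negP=> vx; case/negP: vC.
by apply: ccomp_closed uC _ uv; rewrite !inE vx.
Qed.

Definition wt w X := \sum_(v in X) w v.

Lemma wtU w X Y : [disjoint X & Y] -> wt w (X :|: Y) = wt w X + wt w Y.
Proof. by move=> d; rewrite /wt -bigU //; apply: eq_bigl => v; rewrite !inE. Qed.

Lemma wt0 w : wt w set0 = 0.
Proof. exact: big_set0. Qed.

Lemma wtD w X Y : Y \subset X -> wt w X = wt w Y + wt w (X :\: Y).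
Proof. by move=> sYX; rewrite /wt (big_setID Y) /= (setIidPr sYX). Qed.

Lemma wtD1 w X x : x \in X -> wt w X = w x + wt w (X :\ x).
Proof. by move=> xX; rewrite /wt (big_setD1 x). Qed.

Lemma wt_cover (I : finType) (J : {set I}) (F : I -> {set T}) w X :
  (forall v, v \in X -> exists2 j, j \in J & v \in F j) ->
  wt w X <= \sum_(j in J) wt w (F j).
Proof.
move=> cov; rewrite /wt (exchange_big_dep xpredT) //= big_mkcond /=.
apply: leq_sum => v _; case: ifP => // /cov[j jJ vj].
by rewrite (bigD1 j) /= ?jJ // leq_addr.
Qed.

Definition nb X x := [set y in X | e x y].

Lemma nb_card X x (A : {set T}) : [disjoint A & X] -> (forall y, y \in A -> e x y) ->
  #|nb X x| + #|A| <= 3.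
Proof.
move=> d hA; apply: leq_trans (deg3 x); rewrite -cardsUI.
have -> : nb X x :&: A = set0.
  apply/setP=> y; rewrite !inE; apply/negP=> /andP[/andP[yX _] yA].
  by have /pred0P/(_ y) := d; rewrite /= yA yX.
rewrite cards0 addn0; apply/subset_leq_card/subsetP=> y; rewrite !inE.
by case/orP=> [/andP[]//|/hA].
Qed.

Lemma nb_card0 X x : #|nb X x| <= 3.
Proof.
by apply: leq_trans (deg3 x); apply/subset_leq_card/subsetP=> y; rewrite !inE => /andP[].
Qed.

Lemma nb_card1 X x z : z \notin X -> e x z -> #|nb X x| <= 2.
Proof.
move=> zX xz; have := @nb_card X x [set z]; rewrite disjoints1 zX cards1 addn1 ltnS.
by apply=> // y /set1P->.
Qed.

Lemma wt_comps w R x : cset e R -> x \in R ->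
  wt w (R :\ x) <= \sum_(y in nb (R :\ x) x) wt w (ccomp e (R :\ x) y).
Proof.
move=> cR xR; apply: wt_cover => v vR.
have [|u [z [uc zx uz]]] := ccomp_nbr cR vR; first by apply/set0Pn; exists x; rewrite inE set11.
move: zx; rewrite inE => /andP[/set1P ez _]; subst z.
exists u; last by rewrite (ccomp_sym esym uc) mem_ccomp.
by rewrite inE (subsetP (ccomp_sub _ _ _) _ uc) esym.
Qed.

(** Each component of [R :\ x] contains a neighbour of [x], so at most [d] components share the
    weight. *)
Lemma big_comp w R x d th : cset e R -> x \in R -> #|nb (R :\ x) x| <= d ->
  d * th < wt w (R :\ x) -> exists2 y, y \in nb (R :\ x) x & th < wt w (ccomp e (R :\ x) y).
Proof.
move=> cR xR led lt; case: (boolP [exists y in nb (R :\ x) x, th < wt w (ccomp e (R :\ x) y)]).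
  by case/existsP=> y /andP[]; exists y.
move/existsPn=> none; move: lt; rewrite ltnNge => /negP[].
apply: leq_trans (wt_comps w cR xR) _; apply: leq_trans (leq_mul led (leqnn th)).
rewrite -sum_nat_const; apply: leq_sum => y yn.
by move/(_ y): none; rewrite yn /= -leqNgt.
Qed.

(** Take [S1] minimal with weight at least [th] such that [S1] and its complement are connected. If
    the complement were too light, choose [x] in [S1] with a neighbour in the complement: at most
    two neighbours of [x] remain in [S1], so a component of [S1 :\ x] is still heavy enough and
    contradicts minimality. *)
Lemma split_cset w S th : cset e S -> (forall v, w v <= 3) -> 0 < th ->
  3 * th < wt w S -> exists S1, [/\ S1 \subset S, cset e S1, cset e (S :\: S1),
    th <= wt w S1 & th <= wt w (S :\: S1)].
Proof.
move=> cS w3 th0 big.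
pose P S1 := [&& S1 \subset S, cset e S1, cset e (S :\: S1) & th <= wt w S1].
have PS : P S.
  rewrite /P subxx cS setDv cset0 /=; apply: leq_trans (ltnW big); lia.
case: (arg_minnP (fun S1 => #|S1|) PS) => S1 /and4P[sS1 cS1 cD ge1] min1.
exists S1; split=> //; rewrite leqNgt; apply/negP=> lt2.
have wS : wt w S = wt w S1 + wt w (S :\: S1) := wtD w sS1.
have [x [xS1 hx]] : exists x, x \in S1 /\
   ((S :\: S1 = set0) \/ exists2 y, y \in S :\: S1 & e x y).
  have [x xS1] : exists x, x \in S1.
    apply/set0Pn/eqP=> E; move: ge1; rewrite E wt0; move: th0; clear; lia.
  case: (set_0Vmem (S :\: S1)) => [-> | [y yD]]; first by exists x; split=> //; left.
  case/setDP: (yD) => yS yS1.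
  have [u [v [uS vS uv uS1 vS1]]] := @cset_exit _ e S [in S1] x y cS (subsetP sS1 _ xS1) yS xS1 yS1.
  by exists u; split=> //; right; exists v; rewrite // inE vS vS1.
have [y yn yw] : exists2 y, y \in nb (S1 :\ x) x & th <= wt w (ccomp e (S1 :\ x) y).
  (* [big_comp] gives a strict inequality and is used with the predecessor of the threshold; this
     gains just enough to pay for the weight of [x], which is at most 3. *)
  case: th th0 big lt2 {ge1 min1 PS P} => // th _ big lt2.
  have wx := wtD1 w xS1; have w3x := w3 x.
  case: hx => [D0 | [z zD xz]].
    apply: (big_comp cS1 xS1 (d := 3)). exact: nb_card0.
    move: wS big wx w3x; rewrite D0 wt0; clear; lia.
  apply: (big_comp cS1 xS1 (d := 2)).
    apply: nb_card1 xz; case/setDP: zD => _ zS1; by rewrite !inE (negbTE zS1) andbF.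
  move: wS big wx w3x lt2; clear; lia.
have yx : y \in S1 :\ x by move: yn; rewrite inE => /andP[].
have sC := ccomp_sub e (S1 :\ x) y; have sC1 := subset_trans sC (subsetDl _ _).
have: P (ccomp e (S1 :\ x) y).
  rewrite /P (subset_trans sC1 sS1) ccomp_cset // yw andbT /=.
  have -> : S :\: ccomp e (S1 :\ x) y = (S1 :\: ccomp e (S1 :\ x) y) :|: (S :\: S1).
    apply/setP=> z; rewrite [LHS]in_setD in_setU !in_setD.
    case: (boolP (z \in ccomp _ _ _)) => [/(subsetP sC1) -> //| _] /=.
    by case: (boolP (z \in S1)) => [/(subsetP sS1)-> | _].
  have cD1 := cset_diff_comp y cS1 xS1.
  case: hx => [-> | [z zD xz]]; first by rewrite setU0.
  apply: (csetU esym cD1 cD _ zD (a := x)); last by rewrite xz orbT.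
  rewrite in_setD xS1 andbT; apply/negP=> /(subsetP sC); by rewrite !inE eqxx.
move/min1; rewrite leqNgt => /negP; apply; apply: proper_card; apply/properP; split=> //.
by exists x => //; apply/negP=> /(subsetP sC); rewrite !inE eqxx.
Qed.

End Weights.

Lemma ex_min (I : finType) (J : {set I}) (f : I -> nat) : 0 < #|J| ->
  exists2 j, j \in J & forall i, i \in J -> f j <= f i.
Proof.
rewrite card_gt0 => /set0Pn[j0 j0J].
by case: (@arg_minnP _ j0 [in J] f j0J) => j jJ jm; exists j.
Qed.

(** * Families of intervals *)

Section Chains.
Variables (I : finType) (pos : I -> nat).
Implicit Types (J : {set I}).

Lemma ex_chain n J : {in J &, injective pos} -> n <= #|J| ->
  exists s, [/\ size s = n, {subset s <= J} & sorted (fun i j => pos i < pos j) s].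
Proof.
elim: n J => [|n IHn] J inj le; first by exists [::].
have [j jJ jmin] := ex_min pos (leq_trans (ltn0Sn n) le).
have [||s [sz sJ so]] := IHn (J :\ j).
- by move=> x y /setD1P[_ xJ] /setD1P[_ yJ]; apply: inj.
- by move: le; rewrite (cardsD1 j J) jJ add1n ltnS.
exists (j :: s); split=> /=; rewrite ?sz //.
  by move=> i; rewrite inE => /predU1P[-> // | /sJ /setD1P[]].
case: s sJ so {sz} => //= i s sJ ->; rewrite andbT.
have /setD1P[ij iJ] := sJ i (mem_head _ _).
by rewrite ltn_neqAle jmin // andbT; apply: contra ij => /eqP/inj-> //.
Qed.

(** The intervals are half-open. Let [j] have the smallest right end. An interval that does not lie
    entirely to the right of [j] contains the last point [(r j).-1] of [j]. Either [b] intervals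
    contain this point, or they are discarded, [j] is kept, and the argument is repeated. *)
Lemma helly J (l r : I -> nat) a b : {in J, forall j, l j < r j} -> a * b <= #|J| ->
  (exists J', [/\ J' \subset J, a <= #|J'| &
     {in J' &, forall i j, i != j -> r i <= l j \/ r j <= l i}]) \/
  (exists t, b <= #|[set j in J | l j <= t < r j]|).
Proof.
elim: a J => [|a IHa] J lr le.
  by left; exists set0; split; rewrite ?sub0set ?cards0 // => i; rewrite inE.
case: (posnP b) => [-> | b0]; first by right; exists 0.
have [|j jJ jmin] := @ex_min _ J r.
  by apply: leq_trans le; rewrite mulSn addn_gt0 b0.
pose B := [set i in J | l i <= (r j).-1 < r i].
case: (leqP b #|B|) => [bB | ltB]; first by right; exists (r j).-1.
have rj : 0 < r j by apply: leq_trans (lr j jJ).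
have sB : B \subset J by apply/subsetP=> i; rewrite inE => /andP[].
case: (IHa (J :\: B)) => [i /setDP[iJ _] | | [J' [sJ' aJ' dJ']] | [t bt]].
- exact: lr.
- by move: le ltB; rewrite -(cardsID B J) (setIidPr sB) mulSn; clear; lia.
- left; exists (j |: J'); split.
  + apply/subsetP=> i /setU1P[-> // | /(subsetP sJ')/setDP[]]; by [].
  + rewrite cardsU1; case: (boolP (j \in J')) => //=.
      move/(subsetP sJ'); rewrite !inE jJ /= andbT.
      by move: (lr j jJ) rj; clear; case: (r j) => //= n; rewrite !ltnS leqnn => ->.
  + have key i : i \in J' -> r j <= l i.
      move/(subsetP sJ')/setDP=> [iJ]; rewrite inE iJ /=.
      have := jmin i iJ; move: rj; clear; lia.
    move=> i i' /setU1P[-> | iJ'] /setU1P[-> | i'J'] ne.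
    * by rewrite eqxx in ne.
    * by left; apply: key.
    * by right; apply: key.
    * exact: dJ'.
- right; exists t; apply: leq_trans bt _; apply/subset_leq_card/subsetP=> i.
  by rewrite !inE -!andbA => /and4P[_ -> -> ->].
Qed.

End Chains.

(** * Packing terminals in two connected sets *)

Section Packing.
Variables (T : finType) (e : rel T).
Hypothesis esym : symmetric e.
Hypothesis deg3 : forall x, #|[set y | e x y]| <= 3.
Variables (I : finType) (pos : I -> nat) (t2 t3 : I -> T).
Implicit Types (J : {set I}) (A S : {set T}).

(** The material for one bead: three items in the order of their positions, a connected part of the
    second rail and one of the third, each containing the three terminals. *)
Definition block := (I * I * I * {set T} * {set T})%type.
Implicit Types (B : block) (bs : seq block).

Definition fst3 B := B.1.1.1.1.
Definition snd3 B := B.1.1.1.2.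
Definition trd3 B := B.1.1.2.
Definition set2 B := B.1.2.
Definition set3 B := B.2.

Definition joined (t : I -> T) A S B :=
  [&& cset e A, A \subset S, t (fst3 B) \in A, t (snd3 B) \in A & t (trd3 B) \in A].

Definition block_ok J S2 S3 B := [&& fst3 B \in J, snd3 B \in J, trd3 B \in J,
  pos (fst3 B) < pos (snd3 B), pos (snd3 B) < pos (trd3 B),
  joined t2 (set2 B) S2 B & joined t3 (set3 B) S3 B].

Definition block_lt B B' := [&& pos (trd3 B) < pos (fst3 B'),
  [disjoint set2 B & set2 B'] & [disjoint set3 B & set3 B']].

Definition fibers3 (t : I -> T) J := forall v, #|[set j in J | t j == v]| <= 3.

Lemma fibers3S t J J' : J' \subset J -> fibers3 t J -> fibers3 t J'.
Proof.
move=> sJ f v; apply: leq_trans (f v); apply/subset_leq_card/subsetP=> j.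
by rewrite !inE => /andP[/(subsetP sJ)-> ->].
Qed.

Lemma wt_fibers t J S : wt (fun v => #|[set j in J | t j == v]|) S = #|[set j in J | t j \in S]|.
Proof.
rewrite /wt -sum1_card (partition_big t [in S]) /=; last by move=> j; rewrite inE => /andP[].
apply: eq_bigr => v vS; rewrite -sum1_card; apply: eq_bigl => j; rewrite !inE.
by case: eqP => [->|_]; rewrite ?vS ?andbT ?andbF.
Qed.

Lemma split_terminals t J S th : cset e S -> (forall j, j \in J -> t j \in S) ->
  fibers3 t J -> 0 < th -> 3 * th < #|J| ->
  exists S', [/\ S' \subset S, cset e S', cset e (S :\: S'),
    th <= #|[set j in J | t j \in S']| & th <= #|[set j in J | t j \notin S']|].
Proof.
move=> cS tS f3 th0 big.
have [|S' [sS' cS' cD h1 h2]] := split_cset esym deg3 cS f3 th0.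
  rewrite wt_fibers; apply: leq_trans big _; apply/subset_leq_card/subsetP=> j jJ.
  by rewrite inE jJ tS.
exists S'; rewrite -!wt_fibers; split=> //; apply: leq_trans h2 _; rewrite wt_fibers.
by apply/subset_leq_card/subsetP=> j; rewrite !inE => /and3P[-> -> ].
Qed.

Lemma joinedS t A S S' B : S \subset S' -> joined t A S B -> joined t A S' B.
Proof. by move=> sS /and5P[h1 h2 h3 h4 h5]; apply/and5P; split; rewrite ?(subset_trans h2). Qed.

Lemma block_okS J J' S2 S3 S2' S3' B : J \subset J' -> S2 \subset S2' -> S3 \subset S3' ->
  block_ok J S2 S3 B -> block_ok J' S2' S3' B.
Proof.
move=> sJ s2 s3 /and5P[/(subsetP sJ) h1 /(subsetP sJ) h2 /(subsetP sJ) h3 h4].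
case/and3P=> h5 h6 h7; apply/and5P; split=> //; apply/and3P; split=> //.
  exact: joinedS h6.
exact: joinedS h7.
Qed.

Lemma joined_disj t t' A A' S S' B B' : joined t A S B -> joined t' A' S' B' ->
  [disjoint S & S'] -> [disjoint A & A'].
Proof.
by move=> /and5P[_ s1 _ _ _] /and5P[_ s2 _ _ _] d; apply: disjointWl s1 (disjointWr s2 d).
Qed.

Lemma disjoint_setD S S' : [disjoint S' & S :\: S'].
Proof. by rewrite disjoint_subset; apply/subsetP=> x xS; rewrite !inE xS. Qed.

(** Both rails are split in two, which sorts the items into four classes. Two opposite classes are
    large, and their terminals lie in disjoint parts of both rails: one class supplies a block, the
    other is left to the induction. *)
Lemma packing k J S2 S3 : cset e S2 -> cset e S3 -> {in J &, injective pos} ->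
  (forall j, j \in J -> t2 j \in S2) -> (forall j, j \in J -> t3 j \in S3) ->
  fibers3 t2 J -> fibers3 t3 J -> 4 * 12 ^ k <= #|J|.+1 ->
  exists bs, [/\ size bs = k, all (block_ok J S2 S3) bs & pairwise block_lt bs].
Proof.
elim: k J S2 S3 => [|k IHk] J S2 S3 c2 c3 inj h2 h3 f2 f3 le; first by exists [::].
set m := 12 ^ k in IHk; have m0 : 0 < m by rewrite expn_gt0.
have {}le : 48 * m <= #|J|.+1 by move: le; rewrite expnS mulnA -/m.
clearbody m.
(* From at least [48 * m - 1] items, each part of a split keeps [16 * m - 4], each of two opposite
   classes [8 * m - 2], and one side of the new block [4 * m - 1], which is the hypothesis of the
   induction. *)
pose th := 16 * m - 4; have th0 : 0 < th by rewrite /th; move: m0; clear; lia.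
have big : 3 * th < #|J| by move: le m0; rewrite /th; clear; lia.
have [S2' [s2 c2' c2'' n2 n2']] := split_terminals c2 h2 f2 th0 big.
have [S3' [s3 c3' c3'' n3 n3']] := split_terminals c3 h3 f3 th0 big.
pose J2 (b : bool) := [set j in J | (t2 j \in S2') == b].
pose J3 (b : bool) := [set j in J | (t3 j \in S3') == b].
pose U2 (b : bool) := if b then S2' else S2 :\: S2'.
pose U3 (b : bool) := if b then S3' else S3 :\: S3'.
have cU2 b : cset e (U2 b) by case: b.
have cU3 b : cset e (U3 b) by case: b.
have sU2 b : U2 b \subset S2 by case: b => //; apply: subsetDl.
have sU3 b : U3 b \subset S3 by case: b => //; apply: subsetDl.
have dU2 b : [disjoint U2 b & U2 (~~ b)].
  by case: b; [apply: disjoint_setD | rewrite disjoint_sym; apply: disjoint_setD].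
have dU3 b : [disjoint U3 b & U3 (~~ b)].
  by case: b; [apply: disjoint_setD | rewrite disjoint_sym; apply: disjoint_setD].
have nJ2 b : th <= #|J2 b|.
  case: b; [apply: (leq_trans n2) | apply: (leq_trans n2')]; apply/subset_leq_card/subsetP=> j;
    by rewrite !inE => /andP[-> /=]; rewrite ?eqb_id // => /negbTE->.
have nJ3 b : th <= #|J3 b|.
  case: b; [apply: (leq_trans n3) | apply: (leq_trans n3')]; apply/subset_leq_card/subsetP=> j;
    by rewrite !inE => /andP[-> /=]; rewrite ?eqb_id // => /negbTE->.
pose C b b' := J2 b :&: J3 b'.
have sC b b' : C b b' \subset J by apply/subsetP=> j; rewrite !inE -andbA => /andP[].
have CU2 b b' j : j \in C b b' -> t2 j \in U2 b.
  rewrite !inE => /andP[/andP[jJ /eqP E] _]; case: b E => E; rewrite /U2 ?E //.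
  by rewrite inE E h2.
have CU3 b b' j : j \in C b b' -> t3 j \in U3 b'.
  rewrite !inE => /andP[_ /andP[jJ /eqP E]]; case: b' E => E; rewrite /U3 ?E //.
  by rewrite inE E h3.
have C2 b : #|C b true| + #|C b false| = #|J2 b|.
  rewrite -cardsUI; have -> : (C b true) :&: (C b false) = set0.
    by apply/setP=> j; rewrite !inE; case: (t3 j \in S3'); rewrite ?andbF.
  rewrite cards0 addn0; apply: eq_card => j; rewrite !inE.
  by case: (t3 j \in S3'); case: (j \in J); rewrite ?andbF ?andbT ?orbF.
have C3 b : #|C true b| + #|C false b| = #|J3 b|.
  rewrite -cardsUI; have -> : (C true b) :&: (C false b) = set0.
    by apply/setP=> j; rewrite !inE; case: (t2 j \in S2'); rewrite ?andbF.
  rewrite cards0 addn0; apply: eq_card => j; rewrite !inE.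
  by case: (t2 j \in S2'); case: (j \in J); rewrite ?andbF ?andbT ?orbF.
pose h := 8 * m - 2.
(* If a class has fewer than [h] items, the two classes adjacent to it have at least [th - h = h]
   each, and these two are opposite to each other. *)
have [b [b' [hb hb']]] : exists b b', h <= #|C b b'| /\ h <= #|C (~~ b) (~~ b')|.
  have := (nJ2 true, nJ2 false, nJ3 true, nJ3 false); rewrite -!C2 -!C3.
  case=> [[[l1 l2] l3] l4].
  case: (leqP h #|C true true|) => q1; last first.
    by exists true, false; move: q1 l1 l2 l3 l4 m0; rewrite /h /th /=; clear; lia.
  case: (leqP h #|C false false|) => q2; first by exists true, true.
  by exists true, false; move: q1 q2 l1 l2 l3 l4 m0; rewrite /h /th /=; clear; lia.
(* Six items make two candidate blocks. At least half of the items of [D] lie after the first three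
   or before the last three, and the corresponding triple is placed at that end of the list, so that
   the blocks stay ordered. *)
have [||s [szs sJ so]] := @ex_chain _ pos 6 (C b b').
- by move=> x y /(subsetP (sC _ _)) xJ /(subsetP (sC _ _)) yJ; apply: inj.
- by apply: leq_trans hb; rewrite /h; move: m0; clear; lia.
case: s szs sJ so => [|a1 [|a2 [|a3 [|b1 [|b2 [|b3 [|]]]]]]] //= _ sJ.
case/and5P=> lt1 lt2 lt3 lt4 /andP[lt5 _].
have blk i1 i2 i3 : pos i1 < pos i2 -> pos i2 < pos i3 ->
    i1 \in C b b' -> i2 \in C b b' -> i3 \in C b b' ->
    block_ok (C b b') (U2 b) (U3 b') (i1, i2, i3, U2 b, U3 b').
  by move=> l1 l2 i1C i2C i3C; rewrite /block_ok /joined /= i1C i2C i3C l1 l2 cU2 cU3 !subxx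
    !(CU2 b b') // !(CU3 b b').
set D := C (~~ b) (~~ b') in hb'.
have sub J' : J' \subset D -> 4 * m <= #|J'|.+1 -> exists bs,
    [/\ size bs = k, all (block_ok J' (U2 (~~ b)) (U3 (~~ b'))) bs & pairwise block_lt bs].
  move=> sD; have sDJ := subset_trans sD (sC _ _).
  apply: IHk => //.
  - by move=> x y /(subsetP sDJ) xJ /(subsetP sDJ) yJ; apply: inj.
  - by move=> j /(subsetP sD); apply: CU2.
  - by move=> j /(subsetP sD); apply: CU3.
  - exact: fibers3S f2.
  - exact: fibers3S f3.
have up J' B : J' \subset J -> block_ok J' (U2 (~~ b)) (U3 (~~ b')) B -> block_ok J S2 S3 B.
  by move=> s; apply: block_okS.
have upb B : block_ok (C b b') (U2 b) (U3 b') B -> block_ok J S2 S3 B by apply: block_okS.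
have lo : {subset [:: a1; a2; a3; b1; b2; b3] <= C b b'} := sJ.
have sh J' : J' \subset D -> J' \subset J by move=> s; apply: subset_trans s (sC _ _).
case: (leqP (4 * m) #|[set j in D | pos a3 < pos j]|.+1) => [ge | lt].
  have sD : [set j in D | pos a3 < pos j] \subset D by apply/subsetP=> j; rewrite inE => /andP[].
  have [bs [szb okb pwb]] := sub _ sD ge.
  have ok := blk a1 a2 a3 lt1 lt2 (lo _ _) (lo _ _) (lo _ _).
  exists ((a1, a2, a3, U2 b, U3 b') :: bs); split=> /=.
  - by rewrite szb.
  - rewrite upb ?ok ?inE ?eqxx ?orbT //=; apply: sub_all okb => B; apply: up (sh _ sD).
  - rewrite pwb andbT; apply/allP=> B /(allP okb)/and5P[]; rewrite inE => /andP[_ lB] _ _ _.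
    case/and3P=> _ j2 j3; rewrite /block_lt lB /=.
    have {}ok := ok _ _ _; rewrite !inE !eqxx !orbT in ok.
    case/and5P: (ok isT isT isT) => _ _ _ _ /and3P[_ j2' j3'].
    by rewrite (joined_disj j2' j2) // (joined_disj j3' j3).
have sD : [set j in D | pos j < pos b1] \subset D by apply/subsetP=> j; rewrite inE => /andP[].
have ge : 4 * m <= #|[set j in D | pos j < pos b1]|.+1.
  have := cardsID [set j | pos a3 < pos j] D.
  have -> : D :&: [set j | pos a3 < pos j] = [set j in D | pos a3 < pos j].
    by apply/setP=> j; rewrite !inE.
  have : #|D :\: [set j | pos a3 < pos j]| <= #|[set j in D | pos j < pos b1]|.
    apply/subset_leq_card/subsetP=> j; rewrite !inE -leqNgt => /andP[le3 ->] /=.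
    exact: leq_ltn_trans le3 lt3.
  by move: lt hb' m0; rewrite /h; clear; lia.
have [bs [szb okb pwb]] := sub _ sD ge.
have ok := blk b1 b2 b3 lt4 lt5 (lo _ _) (lo _ _) (lo _ _).
exists (rcons bs (b1, b2, b3, U2 b, U3 b')); split=> /=.
- by rewrite size_rcons szb.
- rewrite all_rcons upb ?ok ?inE ?eqxx ?orbT //=; apply: sub_all okb => B; apply: up (sh _ sD).
- rewrite pairwise_rcons pwb andbT; apply/allP=> B /(allP okb)/and5P[_ _].
  rewrite inE => /andP[_ lB] _ /and3P[_ j2 j3]; rewrite /block_lt lB /=.
  have {}ok := ok _ _ _; rewrite !inE !eqxx !orbT in ok.
  case/and5P: (ok isT isT isT) => _ _ _ _ /and3P[_ j2' j3'].
  apply/andP; split; [apply: joined_disj j2 j2' _ | apply: joined_disj j3 j3' _];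
    by rewrite disjoint_sym.
Qed.

End Packing.

(** * Necklaces from beads *)

Section Zip.
Variable T : eqType.
Implicit Types (r : rel T) (x y : T) (p : seq T).

Lemma path_zip r x p : path r x p = all (fun ab => r ab.1 ab.2) (zip (x :: p) p).
Proof. by elim: p x => //= y p IHp x; rewrite IHp. Qed.

Lemma zip_mem x y z p : (y, z) \in zip (x :: p) p -> y \in x :: p /\ z \in x :: p.
Proof.
elim: p x => //= w p IHp x; rewrite inE => /predU1P[[-> ->] | /IHp[h1 h2]].
  by rewrite !inE !eqxx orbT.
by split; apply/orP; right.
Qed.

End Zip.

Section Paths.
Variables (T : finType) (G : graph T).
Implicit Types (P : vpath T) (H : graph T) (x y z : T).

Lemma interior_ends P z : uniq (pverts P) -> z \in interior P ->
  [/\ z \in pverts P, z != src P & z != tgt P].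
Proof.
case: P => x [|y p] //= /andP[xp up] zp.
have: uniq (rcons (belast y p) (last y p)) by rewrite -lastI.
rewrite rcons_uniq => /andP[lp _]; have zyp := mem_belast zp.
by split; [rewrite in_cons; apply/orP; right | apply: contraNneq xp => <- |
  by apply: contraNneq lp => E; have <- : z = last y p by exact: E].
Qed.

Lemma pedge_verts P x y : pedge P x y -> x \in pverts P /\ y \in pverts P.
Proof. by case/orP=> /zip_mem[]. Qed.

Lemma pedge_sym P : symmetric (pedge P).
Proof. by move=> x y; rewrite /pedge /= orbC. Qed.

Lemma pedge_adj P x y : is_path G P -> pedge P x y -> adj G x y.
Proof.
case/and3P=> _; rewrite path_zip => /allP h _ /orP[/h // | /h /=].
by rewrite adj_sym.
Qed.

Lemma path_verts P : is_path G P -> {subset pverts P <= vset G}.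
Proof.
case/and3P=> xV xp _ z; rewrite inE => /predU1P[-> //|].
elim: (steps P) (src P) xp {xV} => //= y p IHp x /andP[xy yp].
rewrite inE => /predU1P[-> | ]; last exact: IHp yp.
by move: xy; rewrite adj_sym => /adj_vset.
Qed.

Lemma path_in H P : is_path G P -> src P \in vset H ->
  (forall x y, pedge P x y -> adj H x y) -> is_path H P.
Proof.
case/and3P=> _ _ uP sH h; apply/and3P; split=> //; rewrite path_zip; apply/allP=> -[x y] xy.
by apply: h; rewrite /pedge /= xy.
Qed.

Lemma path_connect_src H P z : is_path H P -> z \in pverts P -> connect (adj H) (src P) z.
Proof. by case/and3P=> _ /path_connect h _; apply: h. Qed.

Lemma cset_vpath A x y : cset (adj G) A -> x \in A -> y \in A -> x != y ->
  exists P, [/\ is_path G P, src P = x, tgt P = y & {subset pverts P <= A}].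
Proof.
move=> cA xA yA xy; have [p [xp lp up sp]] := cset_path cA xA yA.
exists (VPath x p); split=> //; rewrite /is_path /= in up *; rewrite xp up !andbT.
case: p xp lp {up sp} => [_ /= E | z p /= /andP[/adj_vset]]; last by [].
by rewrite E eqxx in xy.
Qed.

Definition theta_core (C : {set T}) x y := exists u v (L : 'I_3 -> vpath T),
  [/\ is_theta G u v L, plen (L leg3) = 1, C = theta_verts L, x \in pverts (L leg1)
    & y \in pverts (L leg2)].

Definition wiggly_core (C : {set T}) x y := exists B : graph T,
  [/\ subgraph B G, n_connected 2 B, vset B = C & exists P P',
    [/\ is_xy_path B x y P, is_xy_path B x y P'
      & plen P' = plen P + 1 \/ plen P' = plen P + 2]].

Definition core (b : bool) (C : {set T}) x y := [/\ x != y, x \in C, y \in C &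
  if b then theta_core C x y else wiggly_core C x y].

(* A bead of the necklace with a tail on each side; [b] tells the two kinds of
   necklaces apart. *)
Definition bead b (X : {set T}) x y := exists C TL TR x' y', [/\ core b C x' y',
  [/\ cset (adj G) TL, x \in TL & TL :&: C = [set x']],
  [/\ cset (adj G) TR, y \in TR & TR :&: C = [set y']],
  [disjoint TL & TR] & [/\ C \subset X, TL \subset X & TR \subset X]].

(** The right tail of a bead and the left tail of the next one form a connected set, and a path in
    it from core to core is the [Q] of the necklace: a tail meets its core in a single vertex, so
    the interior of the path avoids all cores. *)
Lemma chain b k (X : 'I_k -> {set T}) (x y : 'I_k -> T) : subcubic G -> 0 < k ->
  (forall i, bead b (X i) (x i) (y i)) ->
  (forall i j, i != j -> [disjoint X i & X j]) ->
  (forall i, adj G (y i) (x (ordS i))) -> good k G.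
Proof.
move=> subG k0 beads dX yx.
have [C {}beads] := fin_all_exists beads; have [TL {}beads] := fin_all_exists beads.
have [TR {}beads] := fin_all_exists beads; have [x' {}beads] := fin_all_exists beads.
have [y' {}beads] := fin_all_exists beads.
have coreP i : core b (C i) (x' i) (y' i) by case: (beads i).
have [TLx TRy] : (forall i, x' i \in TL i) /\ (forall i, y' i \in TR i).
  split=> i; case: (beads i) => _ [_ _ /setP E1] [_ _ /setP E2] _ _.
    by have := E1 (x' i); rewrite !inE eqxx => /andP[].
  by have := E2 (y' i); rewrite !inE eqxx => /andP[].
have inX i z : [|| z \in C i, z \in TL i | z \in TR i] -> z \in X i.
  case: (beads i) => _ _ _ _ [s1 s2 s3].
  by case/or3P; [apply: (subsetP s1) | apply: (subsetP s2) | apply: (subsetP s3)].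
have Xeq i j z : z \in X i -> z \in X j -> i = j.
  move=> zi zj; apply/eqP/negPn/negP=> /dX/pred0P/(_ z) /=; by rewrite zi zj.
have TLR i z : z \in TL i -> z \in TR i -> False.
  by case: (beads i) => _ _ _ /pred0P/(_ z) E _ z1 z2; rewrite /= z1 z2 in E.
have TLC i z : z \in TL i -> z \in C i -> z = x' i.
  by case: (beads i) => _ [_ _ /setP/(_ z) E] _ _ _ z1 z2; apply/eqP; move: E; rewrite !inE z1 z2.
have TRC i z : z \in TR i -> z \in C i -> z = y' i.
  by case: (beads i) => _ _ [_ _ /setP/(_ z) E] _ _ z1 z2; apply/eqP; move: E; rewrite !inE z1 z2.
have Qex i : exists P, [/\ is_path G P, src P = y' i, tgt P = x' (ordS i) &
    {subset pverts P <= TR i :|: TL (ordS i)}].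
  apply: cset_vpath.
  - case: (beads i) => _ _ [cR yR _] _ _; case: (beads (ordS i)) => _ [cL xL _] _ _ _.
    by apply: (csetU _ cR cL yR xL _); [exact: adj_sym | rewrite yx orbT].
  - by rewrite inE TRy.
  - by rewrite inE TLx orbT.
  (* Equal ends would lie in one and the same bead, where the two tails are disjoint. This includes
     [k = 1], where [ordS i = i]. *)
  - apply/eqP=> E; apply: (@TLR i (y' i)) (TRy i).
    have E' : ordS i = i.
      apply: (Xeq _ _ (y' i)); apply: inX; last by rewrite TRy !orbT.
      by rewrite E TLx orbT.
    by have := TLx (ordS i); rewrite -E E'.
have [Q {Qex}QP] := fin_all_exists Qex.
have uQ i : uniq (pverts (Q i)) by case: (QP i) => /and3P[].
have Qin i z : z \in pverts (Q i) -> z \in TR i \/ z \in TL (ordS i).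
  by case: (QP i) => _ _ _ s /s /setUP.
have dQ : disjoint_paths Q.
  move=> i j ij; apply/pred0P=> z /=; apply/negP=> /andP[/Qin zi /Qin zj]; case/negP: ij.
  case: zi zj => zi [] zj.
  - by apply/eqP/(Xeq _ _ z); apply: inX; rewrite ?zi ?zj ?orbT.
  - have E : i = ordS j by apply: (Xeq _ _ z); apply: inX; rewrite ?zi ?zj ?orbT.
    by case: (@TLR i z) => //; rewrite E.
  - have E : ordS i = j by apply: (Xeq _ _ z); apply: inX; rewrite ?zi ?zj ?orbT.
    by case: (@TLR j z) => //; rewrite -E.
  - by apply/eqP/ordS_inj/(Xeq _ _ z); apply: inX; rewrite ?zi ?zj ?orbT.
have QC i j z : z \in pverts (Q i) -> z \in C j -> z = y' i /\ j = i \/ z = x' j /\ j = ordS i.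
  move=> /Qin[zR | zL] zC.
    have E : j = i by apply: (Xeq _ _ z); apply: inX; rewrite ?zR ?zC ?orbT.
    by left; split=> //; apply: TRC zR _; rewrite -E.
  have E : j = ordS i by apply: (Xeq _ _ z); apply: inX; rewrite ?zL ?zC ?orbT.
  by right; split=> //; subst j; apply: TLC.
have QI i j : [disjoint interior (Q i) & C j].
  apply/pred0P=> z /=; apply/negP=> /andP[zi zC].
  have [zQ zs zt] := interior_ends (uQ i) zi; case: (QP i) => _ Es Et _.
  case: (QC i j z zQ zC) => [[E _] | [E Ej]]; first by rewrite Es E eqxx in zs.
  by rewrite Et E Ej eqxx in zt.
have QAB i (H : graph T) (A B : {set T}) : is_path H (Q i) -> y' i \in A -> x' (ordS i) \in B ->
    A \subset C i -> B \subset C (ordS i) -> is_AB_path H A B (Q i).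
  move=> pH yA xB sA sB; case: (QP i) => _ Es Et _.
  rewrite /is_AB_path pH Es Et yA xB /=; apply/allP=> z zi; rewrite !inE negb_or.
  apply/andP; split; apply/negP=> zA.
    by have /pred0P/(_ z) := QI i i; rewrite /= zi (subsetP sA).
  by have /pred0P/(_ z) := QI i (ordS i); rewrite /= zi (subsetP sB).
have dC i j : i != j -> [disjoint C i & C j].
  move=> ij; apply/pred0P=> z /=; apply/negP=> /andP[zi zj]; case/negP: ij.
  by apply/eqP/(Xeq _ _ z); apply: inX; rewrite ?zi ?zj.
case: b coreP {beads} => coreP; last first.
  constructor 2; exists k.
  have BP i : exists B : graph T, [/\ subgraph B G, n_connected 2 B, vset B = C i
      & exists P P', [/\ is_xy_path B (x' i) (y' i) P, is_xy_path B (x' i) (y' i) P'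
      & plen P' = plen P + 1 \/ plen P' = plen P + 2]].
    by case: (coreP i).
  have [B {}BP] := fin_all_exists BP.
  have vB i : vset (B i) = C i by case: (BP i).
  have att i : attachments B Q i = [set x' i; y' i].
    apply/setP=> z; rewrite !inE vB; apply/idP/idP.
      case/andP=> zC /existsP[j zQ]; case: (QC j i z zQ zC) => [[-> ->] | [-> _]];
        by rewrite eqxx ?orbT.
    case: (coreP i) => _ xC yC _; case/orP=> /eqP->; rewrite ?xC ?yC; apply/existsP.
      exists (ord_pred i); case: (QP (ord_pred i)) => _ _; rewrite ord_predK => <- _.
      by rewrite /tgt /pverts mem_last.
    by exists i; case: (QP i) => _ <- _ _; rewrite /pverts mem_head.
  exists B, Q; split; first split=> //.
  - by move=> i; case: (BP i).
  - by move=> i j; rewrite !vB; apply: dC.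
  - move=> i; case: (coreP i) => xy _ yC _; case: (coreP (ordS i)) => _ xC _ _.
    split; first by case: (QP i) => pG _ _ _; apply: QAB; rewrite ?vB.
      by move=> j; rewrite vB; apply: QI.
    by rewrite att cards2 xy.
  exists setT; rewrite cardsT card_ord; split=> // i _.
  case: (BP i) => _ _ _ [P [P' [h1 h2 h3]]].
  by exists (x' i), (y' i), P, P'; rewrite att.
have {}coreP i : exists u, [/\ x' i != y' i, x' i \in C i, y' i \in C i & exists v L,
    [/\ is_theta G u v L, plen (L leg3) = 1, C i = theta_verts L, x' i \in pverts (L leg1)
    & y' i \in pverts (L leg2)]].
  by case: (coreP i) => h1 h2 h3 [u [v [L h4]]]; exists u; split=> //; exists v, L.
have [u {}coreP] := fin_all_exists coreP.
have {}coreP i : exists v, exists L,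
    [/\ is_theta G (u i) v L, plen (L leg3) = 1, C i = theta_verts L, x' i \in pverts (L leg1)
    & y' i \in pverts (L leg2)].
  by case: (coreP i).
have [v {}coreP] := fin_all_exists coreP; have [L {}LP] := fin_all_exists coreP.
have CE i : C i = theta_verts (L i) by case: (LP i).
have LG i m : is_path G (L i m) /\ src (L i m) = u i.
  by case: (LP i) => -[_ /(_ m)/and3P[h /eqP E _] _ _] _ _ _ _.
have LC i m z : z \in pverts (L i m) -> z \in C i.
  by rewrite CE => h; rewrite in_set; apply/existsP; exists m.
(* The theta-necklace consists of the legs and connecting paths only; it is not an induced subgraph,
   since other edges of [G] may join its vertices. *)
pose hV := [set z | [exists j, (z \in theta_verts (L j)) || (z \in pverts (Q j))]].
pose hA := [rel x y | [exists j, [exists m, pedge (L j m) x y] || pedge (Q j) x y]].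
have hAE z w : hA z w -> exists P, [/\ is_path G P, pedge P z w & {subset pverts P <= hV}].
  case/existsP=> j /orP[/existsP[m h] | h].
    exists (L j m); split=> //; first by case: (LG j m).
    move=> t tL; rewrite in_set; apply/existsP; exists j; rewrite in_set; apply/orP; left.
    by apply/existsP; exists m.
  exists (Q j); split=> //; first by case: (QP j).
  by move=> t tQ; rewrite in_set; apply/existsP; exists j; rewrite tQ orbT.
have hsym : symmetric hA.
  by move=> z w; apply/existsP/existsP=> -[j /orP[/existsP[m h] | h]]; exists j;
    apply/orP; [left | right | left | right]; try (apply/existsP; exists m); rewrite pedge_sym.
have hirr : irreflexive hA.
  move=> z; apply/negbTE/negP=> h; have [P [h1 h2 _]] := hAE _ _ h.
  by have := pedge_adj h1 h2; rewrite adj_irr.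
have hvs z w : hA z w -> z \in hV.
  by move=> h; have [P [_ /pedge_verts[h' _] s]] := hAE _ _ h; apply: s.
pose H := Graph hsym hirr hvs.
have HL i m : is_path H (L i m).
  have [h1 h2] := LG i m; apply: path_in => // [|z w zw].
    rewrite in_set; apply/existsP; exists i; apply/orP; left; rewrite in_set; apply/existsP.
    by exists m; rewrite /pverts mem_head.
  by apply/existsP; exists i; apply/orP; left; apply/existsP; exists m.
have HQ i : is_path H (Q i).
  case: (QP i) => h1 _ _ _; apply: path_in => // [|z w zw].
    by rewrite in_set; apply/existsP; exists i; rewrite /pverts mem_head orbT.
  by apply/existsP; exists i; rewrite zw orbT.
have HG : subgraph H G.
  split=> [|z w h]; last by have [P [h1 h2 _]] := hAE _ _ h; apply: pedge_adj h1 h2.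
  apply/subsetP=> z; rewrite in_set => /existsP[j]; case/orP; last first.
    by apply: path_verts; case: (QP j).
  by rewrite in_set => /existsP[m]; apply: path_verts; case: (LG j m).
have cL i m z : z \in pverts (L i m) -> connect (adj H) (u i) z.
  by move=> zL; case: (LG i m) => _ <-; apply: path_connect_src (HL i m) zL.
have csym : connect_sym (adj H) by apply: sym_connect_sym; apply: adj_sym.
have cQ i z : z \in pverts (Q i) -> connect (adj H) (u i) z.
  move=> zQ; apply: connect_trans (path_connect_src (HQ i) zQ); apply: (cL i leg2).
  by case: (QP i) => _ -> _ _; case: (LP i).
have cS i : connect (adj H) (u i) (u (ordS i)).
  apply: (connect_trans (cQ i (x' (ordS i)) _)).
    by case: (QP i) => _ _ <- _; rewrite /tgt /pverts mem_last.
  by rewrite csym; apply: (cL _ leg1); case: (LP (ordS i)).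
have cu n (nk : n < k) : connect (adj H) (u (Ordinal k0)) (u (Ordinal nk)).
  elim: n nk => [|n IHn] nk; first by rewrite (bool_irrelevance nk k0) connect0.
  apply: connect_trans (IHn (ltnW nk)) _.
  have -> : Ordinal nk = ordS (Ordinal (ltnW nk)); last exact: cS.
  by apply: val_inj; rewrite /= modn_small.
have cH z : z \in vset H -> connect (adj H) (u (Ordinal k0)) z.
  rewrite in_set => /existsP[[n nk] h]; apply: connect_trans (cu n nk) _.
  by case/orP: h => [| /cQ //]; rewrite in_set => /existsP[m /cL].
constructor 1; exists 1, H; split; [by left | exact: HG |].
case: HG => HGv HGe; split.
- split; first by apply/set0Pn; exists (src (Q (Ordinal k0))); case/and3P: (HQ (Ordinal k0)).
  by move=> z w zH wH; apply: connect_trans (cH w wH); rewrite csym; apply: cH.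
- move=> z zH; apply: leq_trans (subG z (subsetP HGv z zH)); apply/subset_leq_card/subsetP=> w.
  by rewrite !inE; apply: HGe.
exists u, v, L, Q; split.
- move=> i; case: (LP i) => -[uv hL Linj dL] L1 _ _ _; split=> //; split=> // m.
  by have /and3P[_ h2 h3] := hL m; rewrite /is_xy_path HL h2.
- by move=> i j ij; rewrite -!CE; apply: dC.
- exact: dQ.
- move=> i; split; last by move=> j; rewrite -CE; apply: QI.
  case: (LP i) => _ _ _ _ yL; case: (LP (ordS i)) => _ _ _ xL _.
  apply: QAB; rewrite ?inE //; apply/subsetP=> z; rewrite in_set; exact: LC.
- by [].
Qed.

End Paths.

Lemma subset2 (T : eqType) (x y : T) (s : seq T) :
  x \in s -> y \in s -> {subset [:: x; y] <= s}.
Proof. by move=> xs ys; apply/allP; rewrite /= xs ys. Qed.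

(** * Paths through prescribed vertices, and arcs of a list *)

Section Thru.
Variables (T : finType) (e : rel T).
Hypothesis esym : symmetric e.
Implicit Types (A B : {set T}) (x y : T) (F : seq T).

Definition thru A x y F := exists p, [/\ path e x p, last x p = y, uniq (x :: p),
  {subset x :: p <= A} & {subset F <= x :: p}].

Lemma thru_cset A x y : cset e A -> x \in A -> y \in A -> thru A x y [:: x; y].
Proof.
move=> cA xA yA; have [p [xp lp up sp]] := cset_path cA xA yA.
by exists p; split=> //; apply: subset2; rewrite ?mem_head // -lp mem_last.
Qed.

Lemma thru_sub A B x y F F' : A \subset B -> {subset F' <= F} -> thru A x y F -> thru B x y F'.
Proof.
move=> sA sF [p [h1 h2 h3 h4 h5]]; exists p; split=> // z; first by move/h4/(subsetP sA).
by move/sF/h5.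
Qed.

Lemma thru_cat A B x y x' y' F F' : [disjoint A & B] -> e y x' ->
  thru A x y F -> thru B x' y' F' -> thru (A :|: B) x y' (F ++ F').
Proof.
move=> d yx' [p [p1 p2 p3 p4 p5]] [q [q1 q2 q3 q4 q5]].
exists (p ++ x' :: q); split.
- by rewrite cat_path p1 p2 /= yx'.
- by rewrite last_cat.
- rewrite -cat_cons cat_uniq p3 q3 andbT; apply/hasPn=> z /q4 zB; apply/negP=> /p4 zA.
  by have /pred0P/(_ z) := d; rewrite /= zA zB.
- move=> z; rewrite -cat_cons mem_cat => /orP[/p4 | /q4] zz; rewrite inE zz ?orbT //.
- by move=> z; rewrite -cat_cons !mem_cat => /orP[/p5 -> | /q5 ->]; rewrite ?orbT.
Qed.

(** Both ends are included; an [r] past the end of the list is allowed, and [splice] uses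
    [r = size Q] for a final segment. *)
Definition arc (c : seq T) l r : {set T} := [set z in drop l (take r.+1 c)].

Lemma mem_arc c l r z : uniq c -> (z \in arc c l r) = (z \in c) && (l <= index z c <= r).
Proof.
move=> uc; rewrite inE; apply/idP/and3P.
  move=> zd; have zt := mem_drop zd; have zc := mem_take zt; rewrite zc; split=> //.
    rewrite -[c](cat_take_drop r.+1) index_cat zt.
    by apply: index_drop zd; apply: take_uniq.
  by rewrite -ltnS -in_take.
case=> zc zl zr; have zt : z \in take r.+1 c by rewrite in_take.
apply: drop_index => //; move: zl; by rewrite -{1}[c](cat_take_drop r.+1) index_cat zt.
Qed.

Lemma arc_sub c l r : {subset arc c l r <= c}.
Proof. by move=> z; rewrite inE => /mem_drop/mem_take. Qed.

Lemma cset_seq s : sorted e s -> cset e [set z in s].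
Proof.
case: s => [|x p] /= xp; last exact: path_cset.
by rewrite (_ : [set z in [::]] = set0) ?cset0 //; apply/setP=> z; rewrite !inE.
Qed.

Lemma cset_arc c l r : sorted e c -> cset e (arc c l r).
Proof. by move=> sc; apply: cset_seq; apply/drop_sorted/take_sorted. Qed.

Lemma nth_arc x0 c l r i : uniq c -> l <= i <= r -> i < size c -> nth x0 c i \in arc c l r.
Proof. by move=> uc lir ic; rewrite mem_arc // mem_nth // index_uniq. Qed.

End Thru.

(** * Beads on a cycle *)

Section Beads.
Variables (T : finType) (G : graph T).
Let e := adj G.
Let esym : symmetric e := @adj_sym T G.
Implicit Types (A X Y : {set T}) (c : seq T).

Lemma bead_sub b X Y x y : X \subset Y -> bead G b X x y -> bead G b Y x y.
Proof.
move=> sXY [C [TL [TR [x' [y' [h1 h2 h3 h4 [h5 h6 h7]]]]]]].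
by exists C, TL, TR, x', y'; split=> //; split; apply: subset_trans sXY.
Qed.

Lemma bead_in b X x y : bead G b X x y -> x \in X /\ y \in X.
Proof.
by move=> [C [TL [TR [x' [y' [h1 [_ xT _] [_ yT _] h4 [h5 h6 h7]]]]]]]; split;
  [apply: (subsetP h6) | apply: (subsetP h7)].
Qed.

(** The set [A] meets the old bead only in its end [x], so adding [A] to the left tail creates no
    new contact with the core or the other tail. *)
Lemma bead_extl b X A x y x1 : bead G b X x y -> cset e A -> x \in A -> x1 \in A ->
  (forall z, z \in A -> z \in X -> z = x) -> bead G b (A :|: X) x1 y.
Proof.
move=> [C [TL [TR [x' [y' [h1 [cL xL eL] [cR yR eR] h4 [h5 h6 h7]]]]]]] cA xA x1A AX.
have x'L : x' \in TL by move/setP/(_ x'): eL; rewrite !inE eqxx => /andP[].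
have x'C : x' \in C by move/setP/(_ x'): eL; rewrite !inE eqxx => /andP[].
exists C, (A :|: TL), TR, x', y'; split=> //.
- split; first by apply: (csetU esym cA cL xA xL); rewrite eqxx.
    by rewrite inE x1A.
  apply/setP=> z; move/setP/(_ z): (eL); rewrite !inE => E.
  case zA: (z \in A) => //=; case zC: (z \in C) => /=; last first.
    by symmetry; apply/eqP=> zx'; rewrite zx' x'C in zC.
  have zx := AX z zA (subsetP h5 _ zC); move: E; by rewrite zC andbT zx xL.
- apply/pred0P=> z /=; apply/negP=> /andP[/setUP[zA | zL] zR].
    have zx := AX z zA (subsetP h7 _ zR); have /pred0P/(_ z) := h4.
    by rewrite /= zR zx xL.
  by have /pred0P/(_ z) := h4; rewrite /= zR zL.
- split; first by apply: subset_trans h5 (subsetUr _ _).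
    by apply: setUS.
  by apply: subset_trans h7 (subsetUr _ _).
Qed.

Lemma bead_extr b X A x y y1 : bead G b X x y -> cset e A -> y \in A -> y1 \in A ->
  (forall z, z \in A -> z \in X -> z = y) -> bead G b (A :|: X) x y1.
Proof.
move=> [C [TL [TR [x' [y' [h1 [cL xL eL] [cR yR eR] h4 [h5 h6 h7]]]]]]] cA yA y1A AX.
have y'R : y' \in TR by move/setP/(_ y'): eR; rewrite !inE eqxx => /andP[].
have y'C : y' \in C by move/setP/(_ y'): eR; rewrite !inE eqxx => /andP[].
exists C, TL, (A :|: TR), x', y'; split=> //.
- split; first by apply: (csetU esym cA cR yA yR); rewrite eqxx.
    by rewrite inE y1A.
  apply/setP=> z; move/setP/(_ z): (eR); rewrite !inE => E.
  case zA: (z \in A) => //=; case zC: (z \in C) => /=; last first.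
    by symmetry; apply/eqP=> zx'; rewrite zx' y'C in zC.
  have zy := AX z zA (subsetP h5 _ zC); move: E; by rewrite zC andbT zy yR.
- apply/pred0P=> z /=; apply/negP=> /andP[zL /setUP[zA | zR]].
    have zy := AX z zA (subsetP h6 _ zL); have /pred0P/(_ z) := h4.
    by rewrite /= zL zy yR.
  by have /pred0P/(_ z) := h4; rewrite /= zR zL.
- split; first by apply: subset_trans h5 (subsetUr _ _).
    by apply: subset_trans h6 (subsetUr _ _).
  by apply: setUS.
Qed.

(* The arcs of the cycle between consecutive beads are absorbed in their tails. *)
Lemma arcs_good b c (bs : seq (nat * nat * {set T})) x0 : subcubic G -> is_cycle G c ->
  0 < size bs ->
  (forall B, B \in bs -> [/\ B.1.1 <= B.1.2, B.1.2 < size c,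
     bead G b B.2 (nth x0 c B.1.1) (nth x0 c B.1.2) &
     forall z, z \in B.2 -> z \in c -> B.1.1 <= index z c <= B.1.2]) ->
  pairwise (fun B B' : nat * nat * {set T} => (B.1.2 < B'.1.1) && [disjoint B.2 & B'.2]) bs -> good (size bs) G.
Proof.
move=> sub /and3P[c2 cc uc] bs0 ok pw.
have sc : sorted e c by case: (c) cc => //= x p; rewrite rcons_path => /andP[].
pose B0 := (0, 0, set0 : {set T}); pose k := size bs.
pose l i := (nth B0 bs i).1.1; pose r i := (nth B0 bs i).1.2; pose X i := (nth B0 bs i).2.
have {}ok i : i < k -> [/\ l i <= r i, r i < size c, bead G b (X i) (nth x0 c (l i)) (nth x0 c (r i)) &
     forall z, z \in X i -> z \in c -> l i <= index z c <= r i].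
  by move=> ik; apply: ok; apply: mem_nth.
have {}pw i j : i < j -> j < k -> r i < l j /\ [disjoint X i & X j].
  move=> ij jk; have ik := ltn_trans ij jk.
  by have /andP[] := (pairwiseP B0 pw) i j ik jk ij.
(* The cycle is cut just after each right end. The first bead begins at the head of [c] and the last
   one is prolonged to the end of [c], so the edge that closes the cycle closes the necklace. *)
pose start i := if i is i'.+1 then (r i').+1 else 0.
pose stop i := if i.+1 == k then (size c).-1 else r i.
have startl i : i < k -> start i <= l i by case: i => //= i ik; case: (pw i i.+1 (leqnn _) ik).
have rstop i : i < k -> r i <= stop i.
  by move=> ik; rewrite /stop; case: eqP => // _; case: (ok i ik) => _; case: (size c).
have stopc i : i < k -> stop i < size c.
  by move=> ik; rewrite /stop; case: eqP => // _; [case: (size c) c2 | case: (ok i ik)].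
have lec i : i < k -> l i < size c by move=> ik; case: (ok i ik) => lr rc _ _; apply: leq_ltn_trans rc.
pose Y i := arc c (r i) (stop i) :|: (arc c (start i) (l i) :|: X i).
have Yc i z : i < k -> z \in Y i -> z \in c -> start i <= index z c <= stop i.
  move=> ik; have [lr rc _ Xc] := ok i ik; have := startl i ik; have := rstop i ik.
  rewrite /Y !in_setU !mem_arc // => h1 h2 h zc; move: h; rewrite zc /=.
  case/or3P=> [|| /Xc/(_ zc)] => /andP[i1 i2]; apply/andP; split=> //.
  - exact: leq_trans h2 (leq_trans lr i1).
  - exact: leq_trans i2 (leq_trans lr h1).
  - exact: leq_trans h2 i1.
  - exact: leq_trans i2 h1.
have YX i z : z \in Y i -> z \notin c -> z \in X i.
  by rewrite /Y !in_setU !mem_arc // => h /negbTE zc; rewrite zc in h.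
have beadY i : i < k -> bead G b (Y i) (nth x0 c (start i)) (nth x0 c (stop i)).
  move=> ik; have [lr rc bX Xc] := ok i ik; have sl := startl i ik; have rs := rstop i ik.
  have idn z p q p' : z \in arc c p q -> z \in c /\ p <= index z c <= q.
    by rewrite mem_arc // => /andP[].
  have stc := stopc i ik; have stl := lec i ik.
  apply: (bead_extr (y := nth x0 c (r i))).
  - apply: (bead_extl (x := nth x0 c (l i))) bX _ _ _ _.
    + exact: cset_arc.
    + by apply: nth_arc; rewrite // sl leqnn.
    + by apply: nth_arc; rewrite // ?sl ?leqnn //; apply: leq_ltn_trans stl.
    + move=> z; rewrite mem_arc // => /and3P[zc _ zl] /Xc/(_ zc)/andP[lz _].
      by rewrite -(nth_index x0 zc); congr nth; apply/eqP; rewrite eqn_leq zl lz.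
  - exact: cset_arc.
  - by apply: nth_arc; rewrite // rs leqnn.
  - by apply: nth_arc; rewrite // rs leqnn.
  - move=> z; rewrite mem_arc // => /and3P[zc rz _].
    rewrite -(nth_index x0 zc); case/setUP.
      rewrite nth_index // mem_arc // => /and3P[_ _ zl]; rewrite -(nth_index x0 zc); congr nth.
      by apply/eqP; rewrite eqn_leq rz (leq_trans zl lr).
    rewrite nth_index // => /Xc/(_ zc)/andP[_ zr]; rewrite -(nth_index x0 zc); congr nth.
    by apply/eqP; rewrite eqn_leq rz zr.
have lt_rr i j : i <= j -> j < k -> r i <= r j.
  rewrite leq_eqVlt => /predU1P[-> // | ij] jk; have [h _] := pw i j ij jk.
  by have [lr _ _ _] := ok j jk; apply: leq_trans (ltnW h) lr.
have dY i j : i < j -> j < k -> [disjoint Y i & Y j].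
  move=> ij jk; have ik := ltn_trans ij jk.
  apply/pred0P=> z /=; apply/negP=> /andP[zi zj]; case: (boolP (z \in c)) => zc.
    have /andP[_ h1] := Yc i z ik zi zc; have /andP[h2 _] := Yc j z jk zj zc.
    move: (leq_trans h2 h1); rewrite /stop (_ : (i.+1 == k) = false); last first.
      by apply/negbTE; rewrite neq_ltn (leq_ltn_trans ij jk).
    case: (j) ij jk => // j' ij jk /=; rewrite ltnNge => /negP; apply.
    exact: (@lt_rr i j' ij (ltnW jk)).
  have [_ /pred0P/(_ z)] := pw i j ij jk; by rewrite /= !YX.
apply: (@chain T G b (size bs) (fun i => Y i) (fun i => nth x0 c (start i)) (fun i => nth x0 c (stop i))) => //.
- by move=> i; apply: beadY.
- move=> i j; rewrite neq_ltn => /orP[] ij; first exact: dY.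
  by rewrite disjoint_sym; apply: dY.
- move=> [i ik]; rewrite /=; case: (ltngtP i.+1 (size bs)) ik => // [ik1 _ | ik1 _].
    rewrite modn_small //= /stop (_ : (i.+1 == k) = false); last by apply/negbTE; rewrite neq_ltn ik1.
    by apply: sorted_nth => //; have [lr rc _ _] := ok _ ik1; have [] := pw i i.+1 (leqnn _) ik1;
       move=> h _; apply: leq_ltn_trans (leq_trans h lr) rc.
  rewrite {1}ik1 modnn /= /stop /k ik1 eqxx.
  case: (c) c2 cc => // x p _; rewrite [cycle _ _]/= rcons_path => /andP[_].
  by rewrite (last_nth x0).
Qed.

Lemma xy_pathI x y p : x \in vset G -> path e x p -> last x p = y -> uniq (x :: p) ->
  is_xy_path G x y (VPath x p).
Proof. by move=> xV xp lp up; apply/and3P; split; [apply/and3P | | apply/eqP]. Qed.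

(** The default value of [nth] plays the part of the third leg. *)
Definition legs (P1 P2 P3 : vpath T) (m : 'I_3) := nth P3 [:: P1; P2] m.

Lemma is_theta_legs u w P1 P2 P3 : u != w ->
  is_xy_path G u w P1 -> is_xy_path G u w P2 -> is_xy_path G u w P3 ->
  P1 <> P2 -> P1 <> P3 -> P2 <> P3 ->
  [disjoint interior P1 & interior P2] -> [disjoint interior P1 & interior P3] ->
  [disjoint interior P2 & interior P3] -> is_theta G u w (legs P1 P2 P3).
Proof.
move=> uw h1 h2 h3 n12 n13 n23 d12 d13 d23; split=> //.
- by case=> [[|[|[|]]]].
- by case=> [[|[|[|]]] //= i] [[|[|[|]]] //= j] E; apply: val_inj => //=; exfalso; auto.
- by case=> [[|[|[|]]] //= i] [[|[|[|]]] //= j] _; rewrite /legs //= disjoint_sym.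
Qed.

Lemma theta_legs P1 P2 P3 z :
  (z \in theta_verts (legs P1 P2 P3)) = [|| z \in pverts P1, z \in pverts P2 | z \in pverts P3].
Proof.
rewrite in_set; apply/existsP/or3P=> [[[[|[|[|]]] //= i]] | []]; rewrite /legs /=.
- by constructor 1.
- by constructor 2.
- by constructor 3.
- by exists leg1.
- by exists leg2.
- by exists leg3.
Qed.

(* [w] and the vertex [m] of the arc are the branch vertices of the theta-graph and
   [mw] is its leg of length 1; the two other legs leave [m] along the arc. *)
Lemma tripod_bead x0 c l m r w (La Ra : {set T}) z1 z2 : sorted e c -> uniq c -> l < m -> m < r -> r < size c ->
  w \notin c -> e w (nth x0 c m) -> [disjoint La & Ra] -> w \notin La -> w \notin Ra ->
  (forall z, z \in c -> z \notin La :|: Ra) ->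
  cset e (w |: La) -> z1 \in w |: La -> e z1 (nth x0 c l) ->
  cset e (w |: Ra) -> z2 \in w |: Ra -> e z2 (nth x0 c r) ->
  bead G true (arc c l r :|: (w |: (La :|: Ra))) (nth x0 c l) (nth x0 c r).
Proof.
move=> sc uc lm mr rc wc wm dLR wL wR cLR cL z1L z1l cR z2R z2r.
have mc := ltn_trans mr rc; have lc := ltn_trans lm mc.
set u := nth x0 c m; set xl := nth x0 c l; set xr := nth x0 c r.
have idu : index u c = m by rewrite index_uniq.
have [uC xlC xrC] : [/\ u \in c, xl \in c & xr \in c] by rewrite !mem_nth.
(* Both long legs have this shape: along the arc from [u] to a chosen vertex, over one edge, then
   inside [w |: L] to [w]. *)
have key i lo hi z (L : {set T}) : i < size c -> lo <= m <= hi -> lo <= i <= hi ->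
    cset e (w |: L) -> z \in w |: L -> e z (nth x0 c i) -> (forall z, z \in c -> z \notin L) ->
    thru e (arc c lo hi :|: (w |: L)) u w [:: u; nth x0 c i; z; w].
  move=> ic ml il cLL zL zxi cLd.
  apply: (thru_cat (F := [:: u; nth x0 c i]) (F' := [:: z; w])).
  - apply/pred0P=> y /=; apply/negP=> /andP[/arc_sub yc /setU1P[yw | yL]].
      by rewrite -yw yc in wc.
    by have := cLd y yc; rewrite yL.
  - by rewrite esym; apply: zxi.
  - by apply: thru_cset; [exact: cset_arc | exact: nth_arc | exact: nth_arc].
  - by apply: thru_cset; rewrite // setU11.
have cL' z : z \in c -> z \notin La by move/cLR; rewrite inE negb_or => /andP[].
have cR' z : z \in c -> z \notin Ra by move/cLR; rewrite inE negb_or => /andP[].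
have a1 : l <= m <= m by rewrite (ltnW lm) leqnn.
have a2 : l <= l <= m by rewrite (ltnW lm) leqnn.
have a3 : m <= m <= r by rewrite (ltnW mr) leqnn.
have a4 : m <= r <= r by rewrite (ltnW mr) leqnn.
have [p1 [p1e p1l p1u p1s p1F]] := key l l m z1 La lc a1 a2 cL z1L z1l cL'.
have [p2 [p2e p2l p2u p2s p2F]] := key r m r z2 Ra rc a3 a4 cR z2R z2r cR'.
have idl : index xl c = l by rewrite index_uniq.
have idr : index xr c = r by rewrite index_uniq.
have nw z : z \in c -> z != w by move=> zc; apply: contraNneq wc => <-.
have xl1 : xl \in u :: p1 by apply: p1F; rewrite !inE eqxx orbT.
have xr2 : xr \in u :: p2 by apply: p2F; rewrite !inE eqxx orbT.
have xlu : xl != u by apply/eqP=> E; move: lm; rewrite -idl E idu ltnn.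
have xru : xr != u by apply/eqP=> E; move: mr; rewrite -idr E idu ltnn.
have xl2 : xl \notin u :: p2.
  apply/negP=> /p2s; rewrite in_setU in_setU1 mem_arc // idl xlC leqNgt lm /=.
  by rewrite (negbTE (nw _ xlC)) (negbTE (cR' _ xlC)).
have uV : u \in vset G by move: wm; rewrite esym => /adj_vset.
pose P1 := VPath u p1; pose P2 := VPath u p2; pose P3 := VPath u [:: w].
have wu : w != u by rewrite eq_sym nw.
have h1 : is_xy_path G u w P1 by apply: xy_pathI.
have h2 : is_xy_path G u w P2 by apply: xy_pathI.
have h3 : is_xy_path G u w P3.
  by apply: xy_pathI; rewrite //= ?inE 1?eq_sym ?wu // andbT esym.
have d0 P : [disjoint interior P & interior P3].
  by rewrite disjoint_sym disjoint_has.
have theta : is_theta G u w (legs P1 P2 P3).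
  apply: is_theta_legs => //; rewrite 1?eq_sym //.
  - by move=> E; move: xl2; rewrite -[u :: p2]/(pverts P2) -E xl1.
  - move=> E; move: xl1; rewrite -[u :: p1]/(pverts P1) E !inE (negbTE xlu).
    by rewrite (negbTE (nw _ xlC)).
  - move=> E; move: xr2; rewrite -[u :: p2]/(pverts P2) E !inE (negbTE xru).
    by rewrite (negbTE (nw _ xrC)).
  apply/pred0P=> z /=; apply/negP=> /andP[z1i z2i].
  have [/p1s zp1 zu zw] := @interior_ends _ P1 z p1u z1i; have [/p2s zp2 _ _] := @interior_ends _ P2 z p2u z2i.
  have {}zw : z != w by move: zw; rewrite /tgt /= p1l.
  move: zp1 zp2; rewrite !in_setU !in_set1 (negbTE zw) /=.
  case/orP=> [za | zL] /orP[zb | zR].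
  - move: za zb; rewrite !mem_arc // => /and3P[zc _ le1] /and3P[_ le2 _]; case/negP: zu.
    by rewrite /= -(nth_index x0 zc); apply/eqP; congr nth; apply/eqP; rewrite eqn_leq le1 le2.
  - by have := cR' z (arc_sub za); rewrite zR.
  - by have := cL' z (arc_sub zb); rewrite zL.
  - by have /pred0P/(_ z) := dLR; rewrite /= zL zR.
pose C := theta_verts (legs P1 P2 P3).
have xlCC : xl \in C by rewrite theta_legs xl1.
have xrCC : xr \in C by rewrite theta_legs xr2 orbT.
exists C, [set xl], [set xr], xl, xr; split.
- split=> //; first by apply/eqP=> E; move: (ltn_trans lm mr); rewrite -idl E idr ltnn.
  by exists u, w, (legs P1 P2 P3); split.
- split; rewrite ?set11 //; first exact: cset1.
  by apply/setP=> z; rewrite in_setI in_set1; case: eqP => // ->.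
- split; rewrite ?set11 //; first exact: cset1.
  by apply/setP=> z; rewrite in_setI in_set1; case: eqP => // ->.
- rewrite disjoints1 inE; apply/eqP=> E; move: (ltn_trans lm mr); by rewrite -idl E idr ltnn.
have sC : C \subset arc c l r :|: (w |: (La :|: Ra)).
  have arcS z lo hi : l <= lo -> hi <= r -> z \in arc c lo hi -> z \in arc c l r.
    move=> b1 b2; rewrite !mem_arc // => /and3P[-> b3 b4].
    by rewrite (leq_trans b1 b3) (leq_trans b4 b2).
  apply/subsetP=> z; rewrite theta_legs !in_setU in_set1 => /or3P[/p1s | /p2s |].
  - rewrite !in_setU in_set1; case/or3P=> [/(arcS z l m (leqnn _) (ltnW mr)) | |] ->;
      by rewrite ?orbT.
  - rewrite !in_setU in_set1; case/or3P=> [/(arcS z m r (ltnW lm) (leqnn _)) | |] ->;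
      by rewrite ?orbT.
  - rewrite !inE => /orP[]/eqP->; last by rewrite eqxx ?orbT.
    by rewrite -[_ \in drop _ _](in_set (mem (drop _ _))) -/(arc c l r) nth_arc // (ltnW lm) (ltnW mr).
by split=> //; rewrite sub1set (subsetP sC).
Qed.

End Beads.

(** * From packed items to a good graph *)

Section Engines.
Variables (T : finType) (G : graph T).
Hypothesis cub : cubic G.
Let e := adj G.
Let esym : symmetric e := @adj_sym T G.
Implicit Types (A S : {set T}) (c : seq T).

Lemma cubic_deg3 x : #|[set y | e x y]| <= 3.
Proof.
case: (boolP (x \in vset G)) => [xV | xV]; first by rewrite -/(degree G x) cub.
rewrite (_ : [set _ | _] = set0) ?cards0 //; apply/setP=> y; rewrite !inE.
by apply/negbTE; apply: contra xV => /adj_vset.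
Qed.

Lemma cubic_subcubic : subcubic G.
Proof. by move=> x xV; rewrite cub. Qed.

(** The connecting paths are [u j], [d j], [v j]; the choice [d j = u j] encodes a path of length
    1. *)
Lemma close_good k (I : finType) (J : {set I}) (u d v : I -> T) P c :
  is_path G P -> is_cycle G c -> (forall z, z \in pverts P -> z \notin c) -> k <= #|J| ->
  (forall j, j \in J -> [/\ u j \in pverts P, v j \in c, e (d j) (v j) &
     d j = u j \/ [/\ d j \notin pverts P, d j \notin c & e (u j) (d j)]]) ->
  (forall i j, i \in J -> j \in J -> i != j -> [/\ u i != u j, v i != v j & d i != d j]) ->
  good k G.
Proof.
move=> pP cc Pc kJ ok inj; constructor 3; exists P, c; split=> //; split.
  by apply/pred0P=> z /=; rewrite !in_set; apply/negP=> /andP[/Pc/negP].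
pose f (i : 'I_k) : I := enum_val (widen_ord kJ i).
have fJ i : f i \in J by apply: enum_valP.
have finj i j : i != j -> f i != f j.
  apply: contra => /eqP/enum_val_inj/(congr1 val) /= E; exact/eqP/val_inj.
pose R j := VPath (u j) (if d j == u j then [:: v j] else [:: d j; v j]).
have inR j z : z \in pverts (R j) -> [\/ z = u j, z = d j | z = v j].
  rewrite /R; case: ifP => _; rewrite !inE.
    by case/orP=> /eqP->; [constructor 1 | constructor 3].
  by case/or3P=> /eqP->; [constructor 1 | constructor 2 | constructor 3].
have nPc z z' : z \in pverts P -> z' \in c -> z != z'.
  by move=> /Pc zc z'c; apply: contraNneq zc => ->.
exists (fun i => R (f i)); split=> [i j /finj ij | i]; last first.
  have [uP vc dv du] := ok _ (fJ i); set j := f i in uP vc dv du *.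
  have uv : u j != v j by apply: nPc.
  have [uV _] : u j \in vset G /\ true by split=> //; apply: path_verts pP _ uP.
  split; last by rewrite /R /plen; case: ifP.
  rewrite /is_AB_path /R; case: eqP => [E | ne].
    apply/and4P; split; rewrite ?in_set //.
    apply/and3P; split; rewrite //= ?andbT ?inE //.
    by move: dv; rewrite E.
  case: du => // -[dP dc ud]; apply/and4P; split; rewrite ?in_set //.
    apply/and3P; split=> //; first by rewrite /= -/e ud dv.
    rewrite [uniq _]/= !inE negb_or uv (eq_sym (u j)) !andbT; apply/andP; split; first exact/eqP.
    by apply: contraNneq dc => ->.
  by rewrite /= andbT !inE negb_or dP.
apply/pred0P=> z /=; apply/negP=> /andP[/inR zi /inR zj].
have [ui vi dvi dui] := ok _ (fJ i); have [uj vj dvj duj] := ok _ (fJ j).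
have [nu nv nd] := inj _ _ (fJ i) (fJ j) ij.
have cross x y : x \in J -> y \in J -> x != y -> u x != d y /\ d x != v y.
  move=> xJ yJ xy; have [ux vx dvx dux] := ok _ xJ; have [uy vy dvy duy] := ok _ yJ.
  have [n1 n2 n3] := inj _ _ xJ yJ xy; split.
    by case: duy => [-> // | [dP _ _]]; apply: contraNneq dP => <-.
  by case: dux => [-> | [_ dc _]]; [apply: nPc | apply: contraNneq dc => ->].
have [c1 c2] := cross _ _ (fJ i) (fJ j) ij.
have ji : f j != f i by rewrite eq_sym.
have [c3 c4] := cross _ _ (fJ j) (fJ i) ji.
have c5 := nPc _ _ ui vj; have c6 := nPc _ _ uj vi.
case: zi => E; subst z; case: zj => E.
all: by move: nu nv nd c1 c2 c3 c4 c5 c6; rewrite ?E eqxx.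
Qed.

Section Packed.
Variables (b d : bool) (k : nat) (c : seq T) (I : finType) (J : {set I}) (a : I -> T).
Variables (X : I -> {set T}) (S2 S3 : {set T}) (t2 t3 z2 z3 : I -> T) (x0 : T).
Hypotheses (k0 : 0 < k) (cyc : is_cycle G c).
Hypotheses (aC : forall j, j \in J -> a j \in c) (ainj : {in J &, injective a}).
Hypothesis Xc : forall j z, j \in J -> z \in X j -> z \notin c.
Hypothesis XX : forall i j z, i \in J -> j \in J -> z \in X i -> z \in X j -> i = j.
Hypotheses (cS2 : cset e S2) (cS3 : cset e S3).
Hypotheses (S2c : forall z, z \in S2 -> z \notin c) (S3c : forall z, z \in S3 -> z \notin c).
Hypotheses (S2X : forall j z, j \in J -> z \in X j -> z \notin S2)
  (S3X : forall j z, j \in J -> z \in X j -> z \notin S3).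
Hypothesis S23 : d -> [disjoint S2 & S3].
Hypotheses (t2P : forall j, j \in J -> [/\ t2 j \in S2, z2 j \in X j & e (z2 j) (t2 j)])
  (t3P : forall j, j \in J -> [/\ t3 j \in S3, z3 j \in X j & e (z3 j) (t3 j)]).

Definition pos j := index (a j) c.

(** When [d] is false there is a single rail, passed both as [S2] and as [S3]; the bead then uses
    only the first of the two sets of its block. *)
Definition support B := X (fst3 B) :|: X (snd3 B) :|: X (trd3 B) :|: set2 B :|:
  (if d then set3 B else set0).

Lemma pos_inj : {in J &, injective pos}.
Proof.
move=> i j iJ jJ E; apply: ainj => //.
by rewrite -(nth_index x0 (aC iJ)) -/(pos i) E /pos nth_index ?aC.
Qed.

(** Items with the same terminal [v] reach it from different neighbours of [v], because their sets
    [X j] are disjoint; and [v] has at most three neighbours. *)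
Lemma fibers_deg (S : {set T}) (t z : I -> T) :
  (forall j, j \in J -> [/\ t j \in S, z j \in X j & e (z j) (t j)]) -> fibers3 t J.
Proof.
move=> tP v; apply: leq_trans (cubic_deg3 v).
have <- : #|z @: [set j in J | t j == v]| = #|[set j in J | t j == v]|.
  apply: card_in_imset => i j; rewrite !inE => /andP[iJ _] /andP[jJ _] E.
  by have [_ zi _] := tP i iJ; have [_ zj _] := tP j jJ; apply: (XX iJ jJ zi); rewrite E.
apply/subset_leq_card/subsetP=> y /imsetP[j]; rewrite !inE => /andP[jJ /eqP<-] ->.
by have [_ _] := tP j jJ; rewrite esym.
Qed.

(** This reduces everything to a construction inside one block: distinct blocks occupy disjoint
    stretches of the cycle, disjoint parts of the rails and different items, so beads built inside
    them are disjoint. *)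
Lemma packed_good : 4 * 12 ^ k <= #|J|.+1 ->
  (forall B, block_ok e pos t2 t3 J S2 S3 B -> exists l r,
    [/\ pos (fst3 B) <= l, l <= r, r <= pos (trd3 B) &
        bead G b (arc c l r :|: support B) (nth x0 c l) (nth x0 c r)]) -> good k G.
Proof.
move=> le H; case/and3P: (cyc) => _ _ uc.
have t2S j : j \in J -> t2 j \in S2 by case/t2P.
have t3S j : j \in J -> t3 j \in S3 by case/t3P.
have [bs [szb okb pwb]] := packing esym cubic_deg3 cS2 cS3 pos_inj t2S t3S
  (fibers_deg t2P) (fibers_deg t3P) le.
have {}H B : exists lr : nat * nat, block_ok e pos t2 t3 J S2 S3 B ->
    [/\ pos (fst3 B) <= lr.1, lr.1 <= lr.2, lr.2 <= pos (trd3 B) &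
      bead G b (arc c lr.1 lr.2 :|: support B) (nth x0 c lr.1) (nth x0 c lr.2)].
  case: (boolP (block_ok e pos t2 t3 J S2 S3 B)) => [/H[l [r h]] | _]; last by exists (0, 0).
  by exists (l, r).
have [f fP] := fin_all_exists H.
pose F B := (f B, arc c (f B).1 (f B).2 :|: support B).
have suppc B z : block_ok e pos t2 t3 J S2 S3 B -> z \in support B -> z \notin c.
  case/and5P=> j1 j2 j3 _ /and3P[_ /and5P[_ s2 _ _ _] /and5P[_ s3 _ _ _]].
  rewrite !in_setU -!orbA; case/or4P; try by apply: Xc.
  case/orP=> [/(subsetP s2)/S2c // |]; case: d; last by rewrite inE.
  by move/(subsetP s3)/S3c.
have -> : k = size (map F bs) by rewrite size_map.
apply: (arcs_good (b := b) (x0 := x0) (c := c)) => //.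
- exact: cubic_subcubic.
- by rewrite size_map szb.
- move=> _ /mapP[B Bbs ->] /=; have ok := allP okb B Bbs; have [h1 h2 h3 h4] := fP B ok.
  split=> //.
    apply: leq_ltn_trans h3 _; rewrite /pos index_mem; apply: aC.
    by case/and5P: ok.
  move=> z /setUP[| /(suppc _ _ ok)/negP //]; by rewrite mem_arc // => /andP[].
- rewrite pairwise_map; apply: (@sub_in_pairwise _ (block_ok e pos t2 t3 J S2 S3)) pwb => //.
  move=> B B' okB okB' /and3P[lt d2 d3]; rewrite /=.
  have [h1 h2 h3 _] := fP B okB; have [h1' h2' h3' _] := fP B' okB'.
  have lt' : (f B).2 < (f B').1 by apply: leq_ltn_trans h3 (leq_trans lt h1').
  rewrite lt' /=; apply/pred0P=> z /=; apply/negP=> /andP[/setUP[zi | zi] /setUP[zj | zj]].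
  + move: zi zj; rewrite !mem_arc // => /and3P[_ _ l1] /and3P[_ l2 _].
    by move: (leq_trans l2 l1); rewrite leqNgt lt'.
  + by have := suppc _ _ okB' zj; rewrite (arc_sub zi).
  + by have := suppc _ _ okB zi; rewrite (arc_sub zj).
  + have {lt h1 h2 h3 h1' h2' h3' lt'} lt : pos (trd3 B) < pos (fst3 B') by [].
    case/and5P: okB => i1 i2 i3 l1 /and3P[l2 /and5P[_ s2 _ _ _] /and5P[_ s3 _ _ _]].
    case/and5P: okB' => j1 j2 j3 l1' /and3P[l2' /and5P[_ s2' _ _ _] /and5P[_ s3' _ _ _]].
    have XE i j : i \in J -> j \in J -> z \in X i -> z \in X j -> pos i = pos j.
      by move=> iJ jJ zXi zXj; rewrite (XX iJ jJ zXi zXj).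
    have zX B0 : fst3 B0 \in J -> snd3 B0 \in J -> trd3 B0 \in J ->
        pos (fst3 B0) < pos (snd3 B0) -> pos (snd3 B0) < pos (trd3 B0) ->
        set2 B0 \subset S2 -> set3 B0 \subset S3 ->
        z \in support B0 -> [\/ exists i, [/\ i \in J, z \in X i & pos (fst3 B0) <= pos i <= pos (trd3 B0)],
          z \in set2 B0 /\ z \in S2 | d /\ z \in set3 B0 /\ z \in S3].
      move=> k1 k2 k3 m1 m2 n2 n3; have m3 := ltn_trans m1 m2; rewrite !in_setU -!orbA; case/or4P=> [h | h | h | ].
      - constructor 1; exists (fst3 B0); split=> //; by rewrite leqnn (ltnW m3).
      - constructor 1; exists (snd3 B0); split=> //; by rewrite (ltnW m1) (ltnW m2).
      - constructor 1; exists (trd3 B0); split=> //; by rewrite leqnn (ltnW m3).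
      - case/orP=> [h | ]; first by constructor 2; split=> //; apply: (subsetP n2).
        case: d => [h | ]; last by rewrite inE.
        by constructor 3; split=> //; split=> //; apply: (subsetP n3).
    case: (zX B i1 i2 i3 l1 l2 s2 s3 zi) => [[i [iJ zXi /andP[_ li]]] | [zs zS] | [dd [zs zS]]];
    case: (zX B' j1 j2 j3 l1' l2' s2' s3' zj) => [[j [jJ zXj /andP[lj _]]] | [zs' zS'] | [dd' [zs' zS']]].
    * move: (leq_trans lj (eq_leq (XE _ _ jJ iJ zXj zXi))) => h.
      by move: (leq_trans h li); rewrite leqNgt lt.
    * by have := S2X iJ zXi; rewrite zS'.
    * by have := S3X iJ zXi; rewrite zS'.
    * by have := S2X jJ zXj; rewrite zS.
    * by have /pred0P/(_ z) := d2; rewrite /= zs zs'.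
    * by have /pred0P/(_ z) := S23 dd'; rewrite /= zS zS'.
    * by have := S3X jJ zXj; rewrite zS.
    * by have /pred0P/(_ z) := S23 dd; rewrite /= zS zS'.
    * by have /pred0P/(_ z) := d3; rewrite /= zs zs'.
Qed.

End Packed.

End Engines.

(** * Gadgets along a cycle *)

Section Gadgets.
Variables (T : finType) (G : graph T).
Hypothesis cub : cubic G.
Let e := adj G.
Let esym : symmetric e := @adj_sym T G.
Implicit Types (A S L Y : {set T}) (c : seq T).

(* A connected set that leads from [q], which has a neighbour on the cycle, to [A]. *)
Definition arm q L (A : pred T) :=
  [/\ q \notin L, cset e (q |: L) & exists2 z, z \in q |: L & A z].

Definition sees S z := [exists s in S, e z s].

Lemma seesI S z s : s \in S -> e z s -> sees S z.
Proof. by move=> sS zs; apply/existsP; exists s; rewrite sS. Qed.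

Lemma seesS S S' z : S \subset S' -> sees S z -> sees S' z.
Proof. by move=> sS /existsP[y /andP[yS zy]]; apply/existsP; exists y; rewrite (subsetP sS). Qed.

Lemma armS q L (A B : pred T) : (forall z, A z -> B z) -> arm q L A -> arm q L B.
Proof. by move=> AB [h1 h2 [z h3 h4]]; split=> //; exists z => //; apply: AB. Qed.

Lemma cset_joint w L z t A t' z' Y : cset e (w |: L) -> z \in w |: L -> e z t -> t \in A ->
  cset e A -> t' \in A -> e z' t' -> z' \in Y -> cset e Y -> cset e (w |: (L :|: A :|: Y)).
Proof.
move=> cL zL zt tA cA t'A zt' zY cY; rewrite -setUA setUA.
apply: (csetU esym cL _ zL (b := t)); last by rewrite zt orbT.
  by apply: (csetU esym cA cY t'A zY); rewrite esym zt' orbT.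
by rewrite inE tA.
Qed.

Variables (k : nat) (c : seq T) (I : finType) (J : {set I}) (a w : I -> T).
Variables (X L R : I -> {set T}) (x0 : T).
Hypotheses (k0 : 0 < k) (cyc : is_cycle G c).
Hypotheses (aC : forall j, j \in J -> a j \in c) (ainj : {in J &, injective a}).
Hypothesis Xc : forall j z, j \in J -> z \in X j -> z \notin c.
Hypothesis XX : forall i j z, i \in J -> j \in J -> z \in X i -> z \in X j -> i = j.
Hypothesis wP : forall j, j \in J -> [/\ w j \in X j, e (w j) (a j), L j \subset X j,
  R j \subset X j & [disjoint L j & R j]].

Let pos j := index (a j) c.
Let nth_pos j : j \in J -> nth x0 c (pos j) = a j.
Proof. by move=> jJ; rewrite nth_index ?aC. Qed.
Let pos_lt j : j \in J -> pos j < size c.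
Proof. by move=> jJ; rewrite index_mem aC. Qed.

Lemma arm_terminals (M : I -> {set T}) S : (forall j, j \in J -> M j \subset X j) ->
  (forall j, j \in J -> arm (w j) (M j) (sees S)) ->
  exists t z : I -> T, forall j, j \in J ->
    [/\ t j \in S, z j \in w j |: M j, z j \in X j & e (z j) (t j)].
Proof.
move=> MX armM; have H j : exists t, exists z, j \in J ->
    [/\ t \in S, z \in w j |: M j, z \in X j & e z t].
  case: (boolP (j \in J)) => jJ; last by exists x0, x0.
  case: (armM j jJ) => _ _ [z zM /existsP[t /andP[tS zt]]]; exists t, z => _; split=> //.
  by case/setU1P: zM => [->|/(subsetP (MX j jJ))] //; case: (wP jJ).
have [t {}H] := fin_all_exists H; have [z {}H] := fin_all_exists H; by exists t, z.
Qed.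

(** In a block [j1], [j2], [j3] the centre of the tripod is [w j2]. Its left arm continues through
    the part of [S2] to [w j1] and so to the cycle at [a j1]; its right arm continues through the
    part of [S3] to [w j3] and [a j3]. *)
Lemma two_rails S2 S3 : cset e S2 -> cset e S3 -> [disjoint S2 & S3] ->
  (forall z, z \in S2 -> z \notin c) -> (forall z, z \in S3 -> z \notin c) ->
  (forall j z, j \in J -> z \in X j -> z \notin S2 :|: S3) ->
  (forall j, j \in J -> arm (w j) (L j) (sees S2) /\ arm (w j) (R j) (sees S3)) ->
  4 * 12 ^ k <= #|J|.+1 -> good k G.
Proof.
move=> cS2 cS3 dS S2c S3c SX arms le; case/and3P: (cyc) => c2 cc uc.
have sc : sorted e c by case: (c) cc => //= x p; rewrite rcons_path => /andP[].
have [S2X S3X] : (forall j z, j \in J -> z \in X j -> z \notin S2) /\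
    (forall j z, j \in J -> z \in X j -> z \notin S3).
  by split=> j z jJ /(SX j z jJ); rewrite inE negb_or => /andP[].
have [t2 [z2 t2P]] : exists t z : I -> T, forall j, j \in J ->
    [/\ t j \in S2, z j \in w j |: L j, z j \in X j & e (z j) (t j)].
  by apply: arm_terminals => j jJ; [case: (wP jJ) | case: (arms j jJ)].
have [t3 [z3 t3P]] : exists t z : I -> T, forall j, j \in J ->
    [/\ t j \in S3, z j \in w j |: R j, z j \in X j & e (z j) (t j)].
  by apply: arm_terminals => j jJ; [case: (wP jJ) | case: (arms j jJ)].
apply: (@packed_good T G cub true true k c I J a X S2 S3 t2 t3 z2 z3 x0) => //.
- by move=> j /t2P[].
- by move=> j /t3P[].
move=> B; case: B => [[[[j1 j2] j3] A2] A3] /and5P[]; rewrite /fst3 /snd3 /trd3 /set2 /set3 /=.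
move=> j1J j2J j3J lt12 /and3P[lt23 /and5P[cA2 sA2 u1 u2 _] /and5P[cA3 sA3 _ v2 v3]].
have [n12 n23 n13] : [/\ j1 <> j2, j2 <> j3 & j1 <> j3].
  split=> E; [move: lt12 | move: lt23 | move: (ltn_trans lt12 lt23)]; by rewrite E ltnn.
exists (pos j1), (pos j3); split=> //; first by rewrite ltnW // (ltn_trans lt12).
have [w1X w1a L1X _ _] := wP j1J; have [w2X w2a L2X R2X d2] := wP j2J.
have [w3X w3a _ R3X _] := wP j3J.
have [[wL1 cL1 _] _] := arms _ j1J; have [[wL2 cL2 _] [wR2 cR2 _]] := arms _ j2J.
have [_ [wR3 cR3 _]] := arms _ j3J.
have [t1S z1L z1X zt1] := t2P _ j1J; have [t2S z2L z2X zt2] := t2P _ j2J.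
have [t2S' z2R z2X' zt2'] := t3P _ j2J; have [t3S z3R z3X zt3] := t3P _ j3J.
have Y1 : w j1 |: L j1 \subset X j1 by rewrite subUset sub1set w1X.
have Y3 : w j3 |: R j3 \subset X j3 by rewrite subUset sub1set w3X.
pose La := L j2 :|: A2 :|: (w j1 |: L j1); pose Ra := R j2 :|: A3 :|: (w j3 |: R j3).
have La_in z : z \in La -> [\/ z \in L j2 /\ z \in X j2, z \in S2 /\ z \in A2 | z \in X j1].
  case/setUP=> [/setUP[zL | zA] | /(subsetP Y1)]; last by constructor 3.
    by constructor 1; rewrite (subsetP L2X).
  by constructor 2; rewrite (subsetP sA2).
have Ra_in z : z \in Ra -> [\/ z \in R j2 /\ z \in X j2, z \in S3 /\ z \in A3 | z \in X j3].
  case/setUP=> [/setUP[zL | zA] | /(subsetP Y3)]; last by constructor 3.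
    by constructor 1; rewrite (subsetP R2X).
  by constructor 2; rewrite (subsetP sA3).
have nX i j z : i \in J -> j \in J -> i <> j -> z \in X i -> z \in X j -> False.
  by move=> iJ jJ ij zi zj; apply: ij; apply: XX zi zj.
have nS2 j z : j \in J -> z \in X j -> z \in S2 -> False by move=> jJ /(S2X _ _ jJ)/negP.
have nS3 j z : j \in J -> z \in X j -> z \in S3 -> False by move=> jJ /(S3X _ _ jJ)/negP.
apply: (@bead_sub _ _ _ (arc c (pos j1) (pos j3) :|: (w j2 |: (La :|: Ra)))).
  apply: setUS; apply/subsetP=> z zz.
  rewrite /support /fst3 /snd3 /trd3 /set2 /set3 /= !(in_setU z).
  case/setU1P: zz => [-> | /setUP[/La_in | /Ra_in]]; first by rewrite w2X !orbT.
    by case=> [[_ ->] | [_ ->] | ->]; rewrite ?orbT.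
  by case=> [[_ ->] | [_ ->] | ->]; rewrite ?orbT.
rewrite -/pos; apply: (@tripod_bead _ _ x0 c (pos j1) (pos j2) (pos j3) (w j2) La Ra (w j1) (w j3)) => //.
- exact: pos_lt.
- by apply/negP=> /negPn; rewrite (Xc j2J).
- by rewrite nth_pos.
- apply/pred0P=> z /=; apply/negP=> /andP[/La_in zL /Ra_in zR].
  case: zL zR => [[zL y2] | [zS zA] | y1] [[zR y2'] | [zS' zA'] | y3'].
  + by have /pred0P/(_ z) := d2; rewrite /= zL zR.
  + exact: nS3 y2 zS'.
  + exact: nX n23 y2 y3'.
  + exact: nS2 y2' zS.
  + by have /pred0P/(_ z) := dS; rewrite /= zS zS'.
  + exact: nS2 y3' zS.
  + exact: nX n12 y1 y2'.
  + exact: nS3 y1 zS'.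
  + exact: nX n13 y1 y3'.
- apply/negP=> /La_in[[zL _] | [zS _] | y1]; [by rewrite zL in wL2 | exact: nS2 w2X zS | exact: nX n12 y1 w2X].
- apply/negP=> /Ra_in[[zL _] | [zS _] | y1]; [by rewrite zL in wR2 | exact: nS3 w2X zS | exact: nX n23 w2X y1].
- move=> z zc; rewrite inE; apply/negP=> /orP[/La_in | /Ra_in].
    by case=> [[_ /(Xc j2J)] | [/S2c] | /(Xc j1J)]; rewrite zc.
  by case=> [[_ /(Xc j2J)] | [/S3c] | /(Xc j3J)]; rewrite zc.
- by apply: (cset_joint cL2 z2L zt2 u2 cA2 u1 zt1 z1L).
- by rewrite !inE eqxx !orbT.
- by rewrite nth_pos.
- by apply: (cset_joint cR2 z2R zt2' v2 cA3 v3 zt3 z3R).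
- by rewrite !inE eqxx !orbT.
- by rewrite nth_pos.
Qed.

(** The left arm already ends at the foot [b j], so one rail is enough. The boolean [o] tells on
    which side of [a j] that foot lies; the other arm must return to the cycle on the opposite
    side. *)
Lemma oriented_rail o S (b : I -> T) : cset e S -> (forall z, z \in S -> z \notin c) ->
  (forall j z, j \in J -> z \in X j -> z \notin S) ->
  (forall j, j \in J -> [/\ b j \in c, arm (w j) (L j) (e^~ (b j)) & arm (w j) (R j) (sees S)]) ->
  (forall j, j \in J -> if o then index (b j) c < pos j else pos j < index (b j) c) ->
  (forall i j, i \in J -> j \in J -> pos i < pos j ->
     pos i < index (b j) c /\ index (b i) c < pos j) ->
  4 * 12 ^ k <= #|J|.+1 -> good k G.
Proof.
move=> cS Sc SX arms orient sep le; case/and3P: (cyc) => c2 cc uc.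
have sc : sorted e c by case: (c) cc => //= x p; rewrite rcons_path => /andP[].
have [t2 [z2 t2P]] : exists t z : I -> T, forall j, j \in J ->
    [/\ t j \in S, z j \in w j |: R j, z j \in X j & e (z j) (t j)].
  by apply: arm_terminals => j jJ; [case: (wP jJ) | case: (arms j jJ)].
apply: (@packed_good T G cub true false k c I J a X S S t2 t2 z2 z2 x0) => //.
- by move=> j /t2P[].
- by move=> j /t2P[].
move=> B; case: B => [[[[j1 j2] j3] A2] A3] /and5P[]; rewrite /fst3 /snd3 /trd3 /set2 /set3 /=.
move=> j1J j2J j3J lt12 /and3P[lt23 /and5P[cA2 sA2 u1 u2 u3] _].
(* The item through which the second arm returns: the last of the block if [b j2] precedes [a j2],
   the first if it follows. *)
have [jf [jfJ uf nf hf]] : exists jf, [/\ jf \in J, t2 jf \in A2, jf <> j2 &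
    jf = if o then j3 else j1].
  exists (if o then j3 else j1); split=> //; case: (o) => // E.
    by move: lt23; rewrite E ltnn.
  by move: lt12; rewrite E ltnn.
have [w2X w2a L2X R2X d2] := wP j2J; have [wfX wfa _ RfX _] := wP jfJ.
have [b2c [wL2 cL2 [zb zbL zbb]] [wR2 cR2 _]] := arms _ j2J.
have [_ _ [wRf cRf _]] := arms _ jfJ.
have [t2S z2R z2X zt2] := t2P _ j2J; have [tfS zfR zfX ztf] := t2P _ jfJ.
have Yf : w jf |: R jf \subset X jf by rewrite subUset sub1set wfX.
pose Ra := R j2 :|: A2 :|: (w jf |: R jf).
have Ra_in z : z \in Ra -> [\/ z \in R j2 /\ z \in X j2, z \in S /\ z \in A2 | z \in X jf].
  case/setUP=> [/setUP[zL | zA] | /(subsetP Yf)]; last by constructor 3.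
    by constructor 1; rewrite (subsetP R2X).
  by constructor 2; rewrite (subsetP sA2).
have nX z : z \in X j2 -> z \in X jf -> False.
  by move=> zi zj; apply: nf; apply: XX zj zi.
have nS j z : j \in J -> z \in X j -> z \in S -> False by move=> jJ /(SX _ _ jJ)/negP.
have wc : w j2 \notin c by apply: Xc w2X.
have dLR : [disjoint L j2 & Ra].
  apply/pred0P=> z /=; apply/negP=> /andP[zL /Ra_in[[zR _] | [zS _] | zf]].
  - by have /pred0P/(_ z) := d2; rewrite /= zL zR.
  - exact: nS (subsetP L2X _ zL) zS.
  - exact: nX (subsetP L2X _ zL) zf.
have wRa : w j2 \notin Ra.
  by apply/negP=> /Ra_in[[zR _] | [zS _] | zf]; [rewrite zR in wR2 | exact: nS w2X zS | exact: nX zf].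
have cLRa z : z \in c -> z \notin L j2 :|: Ra.
  move=> zc; rewrite inE; apply/negP=> /orP[/(subsetP L2X)/(Xc j2J) | /Ra_in].
    by rewrite zc.
  by case=> [[_ /(Xc j2J)] | [/Sc] | /(Xc jfJ)]; rewrite zc.
have cRa : cset e (w j2 |: Ra) by apply: (cset_joint cR2 z2R zt2 u2 cA2 uf ztf zfR).
have wfRa : w jf \in w j2 |: Ra by rewrite !inE eqxx !orbT.
have nb2 : nth x0 c (index (b j2) c) = b j2 by rewrite nth_index.
have supp l r : arc c l r :|: (w j2 |: (L j2 :|: Ra)) \subset
    arc c l r :|: support false X (j1, j2, j3, A2, A3).
  apply: setUS; apply/subsetP=> z zz.
  rewrite /support /fst3 /snd3 /trd3 /set2 /set3 /= !(in_setU z) in_set0 orbF.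
  case/setU1P: zz => [-> | /setUP[/(subsetP L2X)-> | /Ra_in]]; first by rewrite w2X !orbT.
    by rewrite !orbT.
  case=> [[_ ->] | [_ ->] | ]; rewrite ?orbT //.
  by rewrite hf; case: (o) => ->; rewrite ?orbT.
have [h1 _] := sep _ _ j1J j2J lt12; have [_ h2] := sep _ _ j2J j3J lt23.
have := orient _ j2J; case: o hf {orient} => hf ob; subst jf.
- exists (index (b j2) c), (pos j3); split=> //.
  + exact: ltnW.
  + by apply: ltnW; apply: ltn_trans ob lt23.
  apply: bead_sub (supp _ _) _.
  apply: (@tripod_bead _ _ x0 c _ (pos j2) _ (w j2) (L j2) Ra zb (w j3)) => //.
  + exact: pos_lt.
  + by rewrite nth_pos.
  + by rewrite nb2.
  + by rewrite nth_pos.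
- exists (pos j1), (index (b j2) c); split=> //.
  + by apply: ltnW; apply: ltn_trans lt12 ob.
  + exact: ltnW.
  apply: bead_sub (supp _ _) _; rewrite [L j2 :|: Ra]setUC.
  apply: (@tripod_bead _ _ x0 c _ (pos j2) _ (w j2) Ra (L j2) (w j1) zb) => //.
  + by rewrite index_mem.
  + by rewrite nth_pos.
  + by rewrite disjoint_sym.
  + by move=> z /cLRa; rewrite setUC.
  + by rewrite nth_pos.
  + by rewrite nb2.
Qed.

End Gadgets.

Section Rails.
Variables (T : finType) (G : graph T).
Hypothesis cub : cubic G.
Let e := adj G.
Let esym : symmetric e := @adj_sym T G.
Implicit Types (A S L X Y : {set T}) (c : seq T).

Lemma half_card (I : finType) (J : {set I}) (A : pred I) n : 2 * n <= #|J| ->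
  exists o : bool, n <= #|[set j in J | A j == o]|.
Proof.
move=> le; case: (leqP n #|[set j in J | A j == true]|) => [h | h]; first by exists true.
exists false; move: le h; have := cardsID [set j | A j] J.
have -> : J :&: [set j | A j] = [set j in J | A j == true] by apply/setP=> j; rewrite !inE eqb_id.
have -> : J :\: [set j | A j] = [set j in J | A j == false].
  by apply/setP=> j; rewrite !inE eqbF_neg andbC.
clear; lia.
Qed.

(** Half of the items have [b j] on the same side of [a j], which explains the 8 in place of 4.
    Disjointness of the intervals between [a j] and [b j], together with [a i <> b j], gives the
    separation that [oriented_rail] asks for. *)
Lemma rail k c (I : finType) (J : {set I}) (a w b : I -> T) (X L R : I -> {set T}) S :
  0 < k -> is_cycle G c ->
  (forall j, j \in J -> a j \in c) -> {in J &, injective a} ->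
  (forall j z, j \in J -> z \in X j -> z \notin c) ->
  (forall i j z, i \in J -> j \in J -> z \in X i -> z \in X j -> i = j) ->
  (forall j, j \in J -> [/\ w j \in X j, e (w j) (a j), L j \subset X j,
     R j \subset X j & [disjoint L j & R j]]) ->
  cset e S -> (forall z, z \in S -> z \notin c) ->
  (forall j z, j \in J -> z \in X j -> z \notin S) ->
  (forall j, j \in J -> [/\ b j \in c, arm G (w j) (L j) (e^~ (b j)) &
     arm G (w j) (R j) (sees G S)]) ->
  (forall i j, i \in J -> j \in J -> a i <> b j) ->
  {in J &, forall i j, i != j ->
     maxn (index (a i) c) (index (b i) c) <= minn (index (a j) c) (index (b j) c) \/
     maxn (index (a j) c) (index (b j) c) <= minn (index (a i) c) (index (b i) c)} ->
  8 * 12 ^ k <= #|J| -> good k G.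
Proof.
move=> k0 cyc aC ainj Xc XX wP cS Sc SX arms ab sep le.
have [x0 _] : exists x : T, x \in c by case/and3P: (cyc); case: (c) => // x s; exists x; rewrite mem_head.
have idx x y : x \in c -> y \in c -> x <> y -> index x c != index y c.
  move=> xc yc xy; apply/eqP=> E; apply: xy.
  by rewrite -(nth_index x0 xc) E nth_index.
have bC j : j \in J -> b j \in c by move=> jJ; case: (arms j jJ).
have [o ho] : exists o : bool, 4 * 12 ^ k <= #|[set j in J | (index (b j) c < index (a j) c) == o]|.
  by apply: half_card; rewrite mulnA.
set J' := [set j in J | _] in ho.
have J'J j : j \in J' -> j \in J by rewrite inE => /andP[].
apply: (@oriented_rail T G cub k c I J' a w X L R x0 k0 cyc _ _ _ _ _ o S b) => //.
- by move=> j /J'J; apply: aC.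
- by move=> i j /J'J iJ /J'J jJ; apply: ainj.
- by move=> j z /J'J; apply: Xc.
- by move=> i j z /J'J iJ /J'J jJ; apply: XX.
- by move=> j /J'J; apply: wP.
- by move=> j z /J'J; apply: SX.
- by move=> j /J'J; apply: arms.
- move=> j jJ'; have jJ := J'J j jJ'; move: jJ'; rewrite inE => /andP[_ /eqP]; case: o {ho J' J'J} => // h.
  by rewrite ltn_neqAle idx ?aC ?bC //=; [rewrite leqNgt h | apply: ab].
- move=> i j /J'J iJ /J'J jJ lt.
  have ne : i != j by apply: contraTneq lt => ->; rewrite ltnn.
  have n1 := idx _ _ (aC i iJ) (bC j jJ) (ab i j iJ jJ).
  have n2 := idx _ _ (aC j jJ) (bC i iJ) (ab j i jJ iJ).
  by move: lt n1 n2 (sep i j iJ jJ ne); clear; lia.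
- by apply: leq_trans ho _.
Qed.

(* Consecutive beads are connected through [S] and the next [X j] back to the cycle. *)
Lemma bead_rail b k c (I : finType) (J : {set I}) (a x y : I -> T) (X : I -> {set T}) S :
  0 < k -> is_cycle G c ->
  (forall j, j \in J -> a j \in c) -> {in J &, injective a} ->
  (forall j z, j \in J -> z \in X j -> z \notin c) ->
  (forall i j z, i \in J -> j \in J -> z \in X i -> z \in X j -> i = j) ->
  cset e S -> (forall z, z \in S -> z \notin c) ->
  (forall j z, j \in J -> z \in X j -> z \notin S) ->
  (forall j, j \in J -> [/\ cset e (X j), bead G b (X j) (x j) (y j), e (a j) (x j)
     & sees G S (y j)]) ->
  4 * 12 ^ k <= #|J| -> good k G.
Proof.
move=> k0 cyc aC ainj Xc XX cS Sc SX bP le; case/and3P: (cyc) => c2 cc uc.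
have [x0 _] : exists x : T, x \in c by case: (c) c2 => // z; exists z; rewrite mem_head.
have H j : exists t, j \in J -> [/\ t \in S, y j \in X j & e (y j) t].
  case: (boolP (j \in J)) => jJ; last by exists x0.
  have [_ bj _ /existsP[t /andP[tS yt]]] := bP j jJ.
  by exists t => _; split=> //; case: (bead_in bj).
have [t tP] := fin_all_exists H.
apply: (@packed_good T G cub b false k c I J a X S S t t y y x0) => //; last first.
- move=> B; case: B => [[[[j1 j2] j3] A2] A3] /and5P[].
  rewrite /fst3 /snd3 /trd3 /set2 /set3 /pos /=.
  move=> j1J j2J j3J lt12 /and3P[lt23 /and5P[cA2 sA2 u1 u2 _] _].
  exists (index (a j1) c), (index (a j2) c); split=> //; [exact: ltnW | exact: ltnW |].
  have [cX1 b1 ax1 _] := bP j1 j1J; have [cX2 b2 ax2 _] := bP j2 j2J.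
  have [t1S y1X yt1] := tP _ j1J; have [t2S y2X yt2] := tP _ j2J.
  have [x1X _] := bead_in b1; have [x2X _] := bead_in b2.
  have n12 : j1 <> j2 by move=> E; move: lt12; rewrite E ltnn.
  have AS z : z \in A2 -> z \in S by apply: (subsetP sA2).
  have cB : cset e (y j1 |: (A2 :|: X j2) :|: [set a j2]).
    apply: (csetU esym _ (cset1 e (a j2)) (a := x j2) (b := a j2)).
    - apply: (csetU1 esym _ _ yt1); last by rewrite inE u1.
      by apply: (csetU esym cA2 cX2 u2 y2X); rewrite esym yt2 orbT.
    - by rewrite !inE x2X !orbT.
    - exact: set11.
    - by rewrite esym ax2 orbT.
  have ac1 := aC j1 j1J; have ac2 := aC j2 j2J.
  rewrite !nth_index //.
  (* The bead of [j1] is entered from [a j1]; its right tail runs over the rail and through the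
     whole of [X j2] down to [a j2]. *)
  have E1 : bead G b ([set a j1; x j1] :|: X j1) (a j1) (y j1).
    apply: (bead_extl b1).
    - by apply: (csetU esym (cset1 e (a j1)) (cset1 e (x j1)) (set11 _) (set11 _)); rewrite ax1 orbT.
    - by rewrite !inE eqxx orbT.
    - by rewrite !inE eqxx.
    - by move=> z; rewrite !inE => /orP[]/eqP-> // aX; have := Xc j1 _ j1J aX; rewrite ac1.
  have E2 : bead G b ((y j1 |: (A2 :|: X j2) :|: [set a j2]) :|: ([set a j1; x j1] :|: X j1)) (a j1) (a j2).
    apply: (bead_extr E1 cB).
    - by rewrite !inE eqxx.
    - by rewrite !inE eqxx !orbT.
    - move=> z /setUP[/setU1P[-> // | /setUP[zA | z2]] | /set1P->].
      + rewrite !inE -orbA => /or3P[/eqP E | /eqP E | z1].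
        * by have := Sc z (AS z zA); rewrite E ac1.
        * by have := SX j1 _ j1J x1X; rewrite -E (AS z zA).
        * by have := SX j1 _ j1J z1; rewrite (AS z zA).
      + rewrite !inE -orbA => /or3P[/eqP E | /eqP E | z1].
        * by have := Xc j2 z j2J z2; rewrite E ac1.
        * by case: n12; apply: (XX _ _ (x j1)); rewrite // -E.
        * by case: n12; apply: (XX _ _ z).
      + rewrite !inE -orbA => /or3P[/eqP E | /eqP E | z1].
        * by case: n12; symmetry; apply: ainj.
        * by have := Xc j1 _ j1J x1X; rewrite -E ac2.
        * by have := Xc j1 _ j1J z1; rewrite ac2.
  apply: bead_sub E2; apply/subsetP=> z.
  have arcI i j l : index (a i) c <= index (a l) c <= index (a j) c -> l \in J ->
      a l \in arc c (index (a i) c) (index (a j) c).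
    by move=> h lJ; rewrite mem_arc // aC.
  rewrite /support /fst3 /snd3 /trd3 /set2 !(in_setU z) !in_set1 in_set0 orbF -!orbA.
  case/or4P=> [/eqP-> | -> | -> | ]; rewrite ?y1X ?orbT //.
  case/or4P=> [/eqP-> | /eqP-> | /eqP-> | ->]; rewrite ?x1X ?orbT //.
  + by rewrite arcI // leqnn andbT ltnW.
  + by rewrite arcI // leqnn ltnW.
- exact: leq_trans le _.
Qed.

Lemma sub_cycle P Y x0 i j : sorted e P -> uniq P -> i < j -> j < size P -> cset e Y ->
  (forall z, z \in Y -> z \notin P) -> sees G Y (nth x0 P i) -> sees G Y (nth x0 P j) ->
  exists q, [/\ {subset q <= Y} & is_cycle G (take (j - i).+1 (drop i P) ++ q)].
Proof.
move=> sP uP ij jP cY YP /existsP[y /andP[yY iy]] /existsP[y' /andP[y'Y jy']].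
have [q [qp ql qu qY]] := cset_path cY y'Y yY.
have {}jy' : e (nth x0 P j) y' by [].
have {}iy : e (nth x0 P i) y by [].
exists (y' :: q); split=> //.
set s := take _ _; have us : uniq s by apply/take_uniq/drop_uniq.
have ss : sorted e s by apply/take_sorted/drop_sorted.
have szs : size s = (j - i).+1.
  by rewrite size_takel // size_drop; move: ij jP; clear; lia.
have s0 : nth x0 s 0 = nth x0 P i by rewrite nth_take // nth_drop addn0.
have sl : last x0 s = nth x0 P j.
  by rewrite -nth_last szs nth_take // nth_drop; congr nth; move: ij; clear; lia.
have sP' z : z \in s -> z \in P by move=> /mem_take/mem_drop.
apply/and3P; split.
- by rewrite size_cat szs /=; move: ij; clear; lia.
- case: (s) szs s0 sl ss => //= z s' _ Ez El ss.
  rewrite rcons_path cat_path last_cat /= ql ss qp -/e El jy'.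
  by rewrite Ez esym iy.
- rewrite cat_uniq us qu andbT; apply/hasPn=> z /qY/YP zP; apply/negP=> /sP' h.
  by rewrite h in zP.
Qed.

End Rails.

(** * Two arms from a vertex to differently labelled exits *)

Lemma menger_dec (T : finType) (e : rel T) (A B : {set T}) k : linked e k A B \/
  exists2 S : {set T}, #|S| < k & forall a b, a \in A -> b \in B -> a \notin S ->
    ~~ connect (restr e (~: S)) a b.
Proof.
case: (boolP [forall S : {set T}, (#|S| < k) ==> [exists a : T, exists b,
   [&& a \in A, b \in B, a \notin S & connect (restr e (~: S)) a b]]]) => [H | ].
  left; apply: menger => S sS; rewrite leqNgt; apply/negP=> ltS.
  move/forallP/(_ S): H; rewrite ltS => /existsP[u /existsP[v /and4P[uA vB uS uv]]].
  have uS' : u \in ~: S by rewrite inE.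
  have [p [up lp _ pS]] := conn_path uS' uv.
  have /sS/hasP[z zp zS] : pth e A B (u :: p) by rewrite /= up uA lp vB.
  by move/(_ z zp): pS; rewrite inE zS.
case/forallPn=> S; rewrite negb_imply => /andP[ltS nS]; right; exists S => // a b aA bB aS.
apply/negP=> ab; case/negP: nS; apply/existsP; exists a; apply/existsP; exists b.
by rewrite aA bB aS.
Qed.

Section Fans.
Variables (T : finType) (e : rel T).
Hypothesis esym : symmetric e.
Implicit Types (C D S X : {set T}).

Section Labels.
Variables (L : finType) (lab : T -> L -> bool) (D : {set T}) (q : T).

(* Edges of [D - q], together with edges from the vertices of [D - q] to their labels. *)
Definition lab_rel : rel (T + L) := fun u v => match u, v with
  | inl u, inl v => [&& u \in D :\ q, v \in D :\ q & e u v]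
  | inl u, inr z => (u \in D :\ q) && lab u z
  | _, _ => false
  end.

Lemma lab_path u p z : path lab_rel (inl u) p -> last (inl u) p = inr z ->
  exists l, [/\ p = rcons (map inl l) (inr z), path e u l, {subset u :: l <= D :\ q} &
    lab (last u l) z].
Proof.
elim: p u => //= -[v | z'] p IHp u.
  case/andP=> /and3P[uD vD uv] vp lp; have [l [-> vl sl ll]] := IHp v vp lp.
  exists (v :: l); split=> //=; first by rewrite uv.
  by move=> x /predU1P[-> // | /sl].
case: p {IHp} => [|x p] /=; last by case: x => ? /andP[].
by rewrite andbT => /andP[uD lu] [<-]; exists [::]; split=> // x; rewrite inE => /eqP->.
Qed.

(** Menger's theorem for two paths, from the surroundings of [q] to the labels. Two disjoint paths
    are two arms with different labels. Otherwise at most one element separates: if it is a label,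
    or nothing, all labels agree; if it is a vertex [s], the component of [q] in [D :\ s] carries no
    label. *)
Lemma fan : cset e D -> q \in D ->
  [\/ exists (L1 L2 : {set T}) u1 u2 z1 z2, [/\ L1 \subset D :\ q, L2 \subset D :\ q & [disjoint L1 & L2]] /\
      [/\ cset e (q |: L1), u1 \in q |: L1 & lab u1 z1] /\
      [/\ cset e (q |: L2), u2 \in q |: L2, lab u2 z2 & z1 != z2],
    (forall u v z z', u \in D -> v \in D -> lab u z -> lab v z' -> z = z') |
    exists s (C : {set T}), [/\ s \in D :\ q, q \in C, C \subset D :\ s & cset e C] /\
      (forall u v, u \in C -> v \in D -> e u v -> v \in C \/ v = s) /\
      (forall u z, u \in C -> ~~ lab u z)].
Proof.
move=> cD qD.
(* Since [lab_rel] leaves out the edges at [q], a label carried by [q] itself is put directly among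
   the starting points. *)
pose A : {set T + L} := [set x | match x with inl u => (u \in D :\ q) && e q u | inr z => lab q z end].
pose B : {set T + L} := [set x | if x is inr z then true else false].
have arm_of s : pth lab_rel A B s -> exists (l : seq T) z u, [/\ s = rcons (map inl l) (inr z),
    [set x in l] \subset D :\ q, cset e (q |: [set x in l]), u \in q |: [set x in l] & lab u z].
  case: s => //= -[u | z] p /and3P[up uA lB].
    have /andP[uD qu] : (u \in D :\ q) && e q u by move: uA; rewrite in_set.
    have [z lp] : exists z, last (inl u) p = inr z.
      by move: lB; case: (last (inl u) p) => [x|z _]; [rewrite in_set | exists z].
    have [l [-> ul sl ll]] := lab_path up lp.
    exists (u :: l), z, (last u l); split=> //.
    - by apply/subsetP=> x; rewrite in_set => /sl.
    - have := @path_cset _ e esym q (u :: l); rewrite /= qu ul => /(_ isT).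
      by congr (cset e _); apply/setP=> x; rewrite !inE.
    - by rewrite in_setU1 in_set mem_last orbT.
  have qz : lab q z by move: uA; rewrite in_set.
  clear uA lB; case: p up => [_ | x p] /=; last by case: x.
  exists [::], z, q; rewrite (_ : [set x in [::]] = set0); last by apply/setP=> x; rewrite !inE.
  by rewrite sub0set setU0 set11; split=> //; apply: cset1.
case: (menger_dec lab_rel A B 2) => [[ps [sz al pw]] | [S ltS sepS]].
  case: ps sz al pw => [|s1 [|s2 [|]]] //= _ /and3P[p1 p2 _]; rewrite !andbT => d.
  have [l1 [z1 [u1 [E1 sl1 c1 u1l lu1]]]] := arm_of _ p1.
  have [l2 [z2 [u2 [E2 sl2 c2 u2l lu2]]]] := arm_of _ p2.
  constructor 1; exists [set x in l1], [set x in l2], u1, u2, z1, z2; split; split=> //.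
    apply/pred0P=> x /=; rewrite !in_set; apply/negP=> /andP[x1 x2].
    have /pred0P/(_ (inl x)) := d; rewrite /= E1 E2 !mem_rcons !in_cons /=.
    by rewrite !mem_map ?x1 ?x2 //; move=> ? ? [].
  split=> //; apply/eqP=> zz; have /pred0P/(_ (inr z1)) := d.
  by rewrite /= E1 E2 zz !mem_rcons !mem_head.
pose Z := [set s | (inl s \in S) && (s != q)].
have reach u z : connect (restr e (D :\: Z)) q u -> lab u z -> inr z \in S.
  move=> qu uz; have qDZ : q \in D :\: Z by rewrite !inE eqxx andbF.
  have [p [qp lp up sp]] := conn_path qDZ qu; apply/negPn/negP=> zS.
  have sDZ v : v \in p -> v \in D :\ q /\ inl v \notin S.
    move=> vp; have vq : v != q by apply: contraTneq vp => ->; case/andP: up.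
    by have := sp v; rewrite inE vp orbT => /(_ isT); rewrite !inE vq andbT => /andP[-> ->].
  case: p qp lp up sp sDZ => [|v p] /= qp lp up sp sDZ.
    have := sepS (inr z) (inr z); rewrite !in_set lp uz zS connect0 => H; by have := H isT isT isT.
  case/andP: qp => qv vp; have [vD vS] := sDZ v (mem_head _ _).
  have vA : inl v \in A by rewrite in_set vD qv.
  have zB : inr z \in B by rewrite in_set.
  apply: (negP (sepS _ _ vA zB vS)).
  have -> : inr z = last (inl v) (rcons (map inl p) (inr z)) :> T + L by rewrite last_rcons.
  apply: path_conn.
    rewrite rcons_path last_map lp /= uz andbT; apply/andP; split; last first.
      by have := sDZ u; rewrite -lp mem_last => /(_ isT)[].
    clear -vp sDZ; elim: p v vp sDZ => //= w p IHp v /andP[vw wp] sDZ.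
    have [vD _] := sDZ v (mem_head _ _).
    have wD : w \in D :\ q by case: (sDZ w) => //; rewrite !inE eqxx orbT.
    rewrite vD wD vw IHp // => x xp; apply: sDZ; by apply/orP; right.
  move=> x; rewrite in_cons mem_rcons in_cons => /or3P[/eqP-> | /eqP-> | /mapP[y yp ->]].
  - by rewrite in_setC.
  - by rewrite in_setC.
  - by rewrite in_setC; case: (sDZ y) => //; rewrite in_cons yp orbT.
have S1 x y : x \in S -> y \in S -> x = y.
  move: ltS; rewrite ltnS leq_eqVlt ltnS leqn0 cards_eq0 => /orP[/cards1P[a ->] | /eqP->].
    by move=> /set1P-> /set1P->.
  by rewrite inE.
case: (boolP [exists s in D :\ q, inl s \in S]) => [/existsP[s /andP[sD sS]] | nS].
  have qDs : q \in D :\ s by move: sD; rewrite !inE eq_sym qD => /andP[->].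
  have qs : q != s by move: qDs; rewrite !inE => /andP[].
  have ZE : Z = [set s].
    apply/setP=> x; rewrite !inE; apply/andP/eqP=> [[xS _] | ->]; first by case: (S1 _ _ xS sS).
    by rewrite sS eq_sym.
  constructor 3; exists s, (ccomp e (D :\ s) q); split; last split.
  - by split=> //; [apply: mem_ccomp | apply: ccomp_sub | apply: ccomp_cset].
  - move=> u v uC vD uv; case: (altP (v =P s)) => [-> | vs]; [by right | left].
    by apply: ccomp_closed uC _ uv; rewrite !inE vs.
  - move=> u z; rewrite inE => /andP[_ qu]; apply/negP=> uz.
    by have := reach u z; rewrite ZE => /(_ qu uz) zS; have := S1 _ _ zS sS.
constructor 2; move/existsPn: nS => nS u v z z' uD vD uz vz'.
have inS u' y : u' \in D -> lab u' y -> inr y \in S.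
  move=> u'D u'y; apply: (reach u') => //.
  have -> : D :\: Z = D; last by apply: (csetP _ _ cD).
  apply/setP=> x; rewrite !inE; case xD: (x \in D); rewrite ?andbF //= andbT.
  by have := nS x; rewrite !inE xD andbT andbC => ->.
by have := S1 _ _ (inS _ _ uD uz) (inS _ _ vD vz') => -[].
Qed.

End Labels.
End Fans.

(** * Consequences of cubicity and 3-connectivity *)

Section ThreeConnected.
Variables (T : finType) (G : graph T).
Hypotheses (cub : cubic G) (con3 : n_connected 3 G).
Let e := adj G.
Let V := vset G.
Let esym : symmetric e := @adj_sym T G.
Implicit Types (A C D S U X Y : {set T}) (c : seq T).

Lemma adj_V x y : e x y -> x \in V /\ y \in V.
Proof. by move=> xy; split; [exact: adj_vset xy | apply: adj_vset; rewrite adj_sym; exact: xy]. Qed.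

Lemma adj_ne x y : e x y -> x != y.
Proof. by apply: contraTneq => ->; rewrite /e adj_irr. Qed.

Lemma no_cut U S x y : #|S| <= 2 -> x \in U -> x \in V -> x \notin S ->
  y \in V -> y \notin U -> y \notin S ->
  (forall u v, u \in U -> e u v -> v \in U \/ v \in S) -> False.
Proof.
move=> S2 xU xV xS yV yU yS clU; case: con3 => _ /(_ (S :&: V)) [].
- exact: subsetIr.
- by rewrite ltnS; apply: leq_trans S2; apply/subset_leq_card/subsetIl.
move=> _ /(_ x y); rewrite !inE xV yV (negbTE xS) (negbTE yS) => /(_ isT isT) xy.
suff: y \in U by rewrite (negbTE yU).
have : closed (del_adj G (S :&: V)) [pred z | (z \in U)].
  apply: (intro_closed (sym_connect_sym (@del_adj_sym T G (S :&: V)))) => u v /and3P[uv uS vS] uU.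
  case: (clU u v uU uv) => // vS'; case/negP: vS; rewrite inE vS'; by case: (adj_V uv).
by move/closed_connect/(_ _ _ xy); rewrite !inE xU => <-.
Qed.

Lemma path3_nbrs x a b d : e x a -> e x b -> e x d -> a != b -> a != d -> b != d ->
  forall y, e x y -> [|| y == a, y == b | y == d].
Proof.
move=> xa xb xd ab ad bd y xy.
have s3 : [set a; b; d] \subset [set z | e x z].
  by apply/subsetP=> z; rewrite !inE -orbA => /or3P[] /eqP->.
have c3 : #|[set a; b; d]| = 3.
  by rewrite setUC cardsU1 cards2 ab !inE negb_or ![d == _]eq_sym ad bd.
have /eqP E : [set a; b; d] == [set z | e x z].
  by rewrite eqEcard s3 c3; apply: cubic_deg3.
have : y \in [set a; b; d] by rewrite E in_set.
by rewrite !inE -orbA.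
Qed.

Lemma third_nbr x a b : x \in V -> exists y, [/\ e x y, y != a & y != b].
Proof.
move=> xV; have : 0 < #|[set y | e x y] :\: [set a; b]|.
  have := cardsID [set a; b] [set y | e x y]; rewrite -[#|[set y | e x y]|]/(degree G x) cub //.
  have : #|[set y | e x y] :&: [set a; b]| <= 2.
    by apply: leq_trans (subset_leq_card (subsetIr _ _)) _; rewrite cards2; case: eqP.
  by clear; lia.
rewrite card_gt0 => /set0Pn[y]; rewrite !inE negb_or => /andP[/andP[ya yb] xy]; by exists y.
Qed.

Section Cycle.
Variable c : seq T.
Hypothesis cyc : is_cycle G c.

Lemma cycle_V x : x \in c -> x \in V.
Proof.
case/and3P: cyc => c2 cc _ xc; have := next_cycle cc xc => xn.
by case: (adj_V xn).
Qed.

(** Two of the three neighbours of [x] are its distinct neighbours along the cycle. Consequently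
    disjoint sets off the cycle have their feet at different vertices of it. *)
Lemma cycle_foot x u v : x \in c -> u \notin c -> v \notin c -> e x u -> e x v -> u = v.
Proof.
case/and3P: cyc => c2 cc uc xc uC vC xu xv.
have xn : e x (next c x) := next_cycle cc xc.
have px : e x (prev c x) by rewrite esym; apply: prev_cycle cc xc.
have nc : next c x \in c by rewrite mem_next.
have pc : prev c x \in c by rewrite mem_prev.
have np : next c x != prev c x.
  apply/eqP=> E; have nn : next c (next c x) = x by rewrite E next_prev.
  have [i s Es] := rot_to xc.
  have us : uniq (x :: s) by rewrite -Es rot_uniq.
  have szs : 2 < size (x :: s) by rewrite -Es size_rot.
  move: nn; rewrite -!(next_rot i uc) Es; case: s us szs {Es} => [|y [|z s]] //=.
  rewrite !inE !negb_or -!andbA => /and5P[xy xz _ _ _] _.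
  by rewrite eqxx [y == x]eq_sym (negbTE xy) eqxx => zx; rewrite zx eqxx in xz.
have un : u != next c x by apply: contraNneq uC => ->.
have up : u != prev c x by apply: contraNneq uC => ->.
rewrite eq_sym in un; rewrite eq_sym in up.
have /or3P[/eqP E | /eqP E | /eqP->] // := path3_nbrs xn px xu np un up xv.
  by rewrite E nc in vC.
by rewrite E pc in vC.
Qed.

Lemma off_cycle p s : exists y, [/\ y \in c, y != p & y != s].
Proof.
case/and3P: cyc => c2 _ uc; have cE : #|[set y in c]| = size c by rewrite cardsE; apply/card_uniqP.
have : 0 < #|[set y in c] :\: [set p; s]|.
  have := cardsID [set p; s] [set y in c]; rewrite cE.
  have : #|[set y in c] :&: [set p; s]| <= 2.
    by apply: leq_trans (subset_leq_card (subsetIr _ _)) _; rewrite cards2; case: eqP.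
  by move: c2; clear; lia.
rewrite card_gt0 => /set0Pn[y]; rewrite !inE negb_or => /andP[/andP[ya yb] yc]; by exists y.
Qed.

Lemma no_cut_off C p s x : x \in C -> x \in V -> (forall z, z \in C -> z \notin c) ->
  p \notin C -> s \notin C ->
  (forall u v, u \in C -> e u v -> [\/ v \in C, v = p | v = s]) -> False.
Proof.
move=> xC xV Cc pC sC cl; have [y [yc yp ys]] := off_cycle p s.
apply: (@no_cut C [set p; s] x y) => //.
- by rewrite cards2; case: eqP.
- by rewrite !inE negb_or; apply/andP; split; apply: contraTneq xC => ->.
- exact: cycle_V.
- by apply/negP=> /Cc; rewrite yc.
- by rewrite !inE negb_or yp.
- by move=> u v uC /(cl _ _ uC)[-> | -> | ->]; rewrite ?inE ?eqxx ?orbT; [left | right | right].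
Qed.

(** Vertices are labelled by the kind of exit they offer. Both kinds occur, so the labels do not all
    agree; and a vertex [s] cutting [q] off from all labels would, together with the foot [p],
    separate the component of [q] from the cycle. *)
Lemma two_arms X q p (A1 A2 : pred T) : cset e X -> q \in X -> (forall z, z \in X -> z \notin c) ->
  p \in c -> e q p ->
  (forall u v, u \in X -> e u v -> [\/ v \in X, v = p, A1 u | A2 u]) ->
  (exists2 u, u \in X & A1 u) -> (exists2 u, u \in X & A2 u) ->
  exists L R : {set T}, [/\ L \subset X, R \subset X, [disjoint L & R],
    arm G q L A1 & arm G q R A2].
Proof.
move=> cX qX Xc pc qp out [u1 u1X A1u1] [u2 u2X A2u2].
case: (fan esym (fun u (o : bool) => if o then A1 u else A2 u) cX qX).
- have arm_of (L : {set T}) u (A : pred T) : L \subset X :\ q -> cset e (q |: L) -> u \in q |: L -> A u -> arm G q L A.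
    move=> sL cL uL Au; split=> //; last by exists u.
    by apply/negP=> /(subsetP sL); rewrite !inE eqxx.
  case=> L1 [L2 [v1 [v2 [o1 [o2 [[s1 s2 d] [[c1 v1L lv1] [c2 v2L lv2 o12]]]]]]]].
  have [t1 t2] : L1 \subset X /\ L2 \subset X.
    by split; [apply: subset_trans s1 _ | apply: subset_trans s2 _]; apply: subsetDl.
  case: o1 o2 o12 lv1 lv2 => [] [] // _ lv1 lv2.
    by exists L1, L2; split=> //; [apply: arm_of lv1 | apply: arm_of lv2].
  exists L2, L1; split=> //; [by rewrite disjoint_sym | exact: arm_of lv2 | exact: arm_of lv1].
- by move/(_ u1 u2 true false u1X u2X A1u1 A2u2).
case=> s [C [[sX qC sC cC] [clC noC]]]; exfalso.
have CX u : u \in C -> u \in X by move/(subsetP sC); rewrite inE => /andP[].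
have qV : q \in V by case: (adj_V qp).
apply: (@no_cut_off C p s q) => //.
- by move=> z /CX; apply: Xc.
- by apply/negP=> /CX/Xc; rewrite pc.
- by apply/negP=> /(subsetP sC); rewrite !inE eqxx.
- move=> u v uC uv; case: (out u v (CX u uC) uv) => [vX | -> | A | A].
  + by case: (clC u v uC vX uv) => [h | ->]; [constructor 1 | constructor 3].
  + by constructor 2.
  + by have := noC u true uC; rewrite A.
  + by have := noC u false uC; rewrite A.
Qed.

End Cycle.
End ThreeConnected.

(** * Sets with three exit edges *)

Section Blobs.
Variables (T : finType) (G : graph T).
Hypotheses (cub : cubic G) (con3 : n_connected 3 G).
Let e := adj G.
Let V := vset G.
Let esym : symmetric e := @adj_sym T G.
Implicit Types (A C D R S U X Y : {set T}).

Lemma bead_edgel b X x y x' : bead G b X x y -> e x' x -> x' \notin X -> bead G b (x' |: X) x' y.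
Proof.
move=> bX xx x'X; apply: (@bead_sub _ _ _ ([set x'; x] :|: X)).
  by rewrite -setUA subUset subsetUl subUset subsetUr andbT sub1set inE (bead_in bX).1 orbT.
apply: (bead_extl bX); rewrite ?inE ?eqxx ?orbT //.
  by apply: (csetU esym (cset1 e x') (cset1 e x) (set11 _) (set11 _)); rewrite xx orbT.
by move=> z /set2P[] -> //; rewrite (negbTE x'X).
Qed.

Lemma bead_edger b X x y y' : bead G b X x y -> e y y' -> y' \notin X -> bead G b (y' |: X) x y'.
Proof.
move=> bX yy y'X; apply: (@bead_sub _ _ _ ([set y'; y] :|: X)).
  by rewrite -setUA subUset subsetUl subUset subsetUr andbT sub1set inE (bead_in bX).2 orbT.
apply: (bead_extr bX); rewrite ?inE ?eqxx ?orbT //.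
  apply: (csetU esym (cset1 e y') (cset1 e y) (set11 _) (set11 _)); by rewrite esym yy orbT.
by move=> z /set2P[] -> //; rewrite (negbTE y'X).
Qed.

(* Exactly three edges leave [D]: [qp], [q'p'] and [q''o]. *)
Definition blob D p p' o q q' q'' :=
  [/\ cset e D /\ D \subset V, [/\ q \in D, q' \in D & q'' \in D],
      [/\ p \notin D, p' \notin D & o \notin D], [/\ p != p', p != o & p' != o] &
      [/\ e q p, e q' p', e q'' o & forall u v, u \in D -> v \notin D -> e u v ->
        [\/ u = q /\ v = p, u = q' /\ v = p' | u = q'' /\ v = o]]].

Section Induced.
Variable D : {set T}.

Lemma restr_irr : irreflexive (restr e D).
Proof. by move=> x; rewrite restrE /e adj_irr. Qed.

Lemma restr_in x y : restr e D x y -> x \in D.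
Proof. by case/and3P. Qed.

Definition induced := Graph (restr_sym esym D) restr_irr restr_in.

End Induced.

Lemma avoid2 (p p' o s t : T) : p != p' -> p != o -> p' != o ->
  exists2 y, y \in [:: p; p'; o] & (y != s) && (y != t).
Proof.
move=> n1 n2 n3; case: (boolP ((p != s) && (p != t))) => h1; first by exists p; rewrite ?inE ?eqxx.
case: (boolP ((p' != s) && (p' != t))) => h2; first by exists p'; rewrite ?inE ?eqxx ?orbT.
exists o; rewrite ?inE ?eqxx ?orbT //; move: h1 h2; rewrite !negb_and !negbK.
case/orP=> /eqP E1 /orP[] /eqP E2; subst; rewrite ?eqxx // in n1 *; rewrite ![o == _]eq_sym ?n2 ?n3 //.
Qed.

Lemma mem_ends (a b z : T) s : (z \in a :: rcons s b) = [|| z == a, z == b | z \in s].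
Proof. by rewrite in_cons mem_rcons in_cons. Qed.

Lemma uniq_ends (a b : T) s :
  uniq (a :: rcons s b) = [&& a != b, a \notin s, b \notin s & uniq s].
Proof. by rewrite cons_uniq rcons_uniq mem_rcons in_cons negb_or -andbA. Qed.

Section Blob.
Variables (D : {set T}) (p p' o q q' q'' : T).
Hypothesis blobD : blob D p p' o q q' q''.

(** One of the three outer ends of the blob differs from both [s] and [t]; it would be separated
    from [U] by these two vertices. *)
Lemma blob_cut U s t x : U \subset D -> x \in U -> s \notin U -> t \notin U ->
  (forall u v, u \in U -> e u v -> [\/ v \in U, v = s | v = t]) -> False.
Proof.
case: blobD => [[cD DV] [qD q'D q''D] [pD p'D oD] [n1 n2 n3] [qp q'p' q''o _]].
move=> UD xU sU tU cl; have [y yy /andP[ys yt]] := avoid2 s t n1 n2 n3.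
apply: (@no_cut T G con3 U [set s; t] x y) => //.
- by rewrite cards2; case: eqP.
- by apply: (subsetP DV); apply: (subsetP UD).
- by rewrite !inE negb_or; apply/andP; split; apply: contraTneq xU => ->.
- move: yy; rewrite !inE => /or3P[] /eqP->; [move: qp | move: q'p' | move: q''o];
  by rewrite esym => /adj_vset.
- apply/negP=> /(subsetP UD) yD; move: yy; rewrite !inE => /or3P[] /eqP E;
    [move: pD | move: p'D | move: oD]; by rewrite -E yD.
- by rewrite !inE negb_or ys.
- by move=> u v uU /(cl _ _ uU)[-> | -> | ->]; rewrite ?inE ?eqxx ?orbT; [left | right | right].
Qed.

(** Otherwise [a] and [y] would separate [D :\ a]. Hence the three exits start at different
    vertices: if two started at [a], the rest of the blob would have only one exit. *)
Lemma blob_one_exit a y : 1 < #|D| -> a \in D -> y \notin D ->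
  (forall u v, u \in D -> u != a -> v \notin D -> e u v -> v = y) -> False.
Proof.
move=> D1 aD yD H.
have [x] : exists x, x \in D :\ a by apply/set0Pn; rewrite -card_gt0; move: D1; rewrite (cardsD1 a) aD.
move=> xD; apply: (@blob_cut (D :\ a) a y x) => //.
- exact: subsetDl.
- by rewrite !inE eqxx.
- by rewrite inE (negbTE yD) andbF.
- move=> u v /setD1P[ua uD] uv; case: (boolP (v \in D)) => vD; last by constructor 3; apply: H uv.
  by case: (altP (v =P a)) => [-> | va]; [constructor 2 | constructor 1; rewrite !inE va].
Qed.

Lemma blob_entries : 1 < #|D| -> [/\ q != q', q != q'' & q' != q''].
Proof.
case: blobD => [[cD DV] [qD q'D q''D] [pD p'D oD] [n1 n2 n3] [qp q'p' q''o out]].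
move=> D1; split; apply/eqP=> E.
- apply: (@blob_one_exit q' o) => // u v uD ua vD /(out _ _ uD vD)[[Eu _] | [Eu _] | []] //;
    by rewrite Eu ?E eqxx in ua.
- apply: (@blob_one_exit q'' p') => // u v uD ua vD /(out _ _ uD vD)[[Eu _] | [] | [Eu _]] //;
    by rewrite Eu ?E eqxx in ua.
- apply: (@blob_one_exit q'' p) => // u v uD ua vD /(out _ _ uD vD)[[] | [Eu _] | [Eu _]] //;
    by rewrite Eu ?E eqxx in ua.
Qed.

(** If [a] were a cut vertex, every component of [D :\ a] would contain at least two of the three
    entries, since otherwise [a] and one outer end would cut it off. Two components cannot both
    contain two of three. *)
Lemma blob_2connected : 2 < #|D| -> n_connected 2 (induced D).
Proof.
case: (blobD) => [[cD DV] [qD q'D q''D] [pD p'D oD] [n1 n2 n3] [qp q'p' q''o out]].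
move=> D2; split=> // S sSD; rewrite ltnS => S1.
have cDS : cset e (D :\: S).
  move: S1; rewrite leq_eqVlt ltnS leqn0 cards_eq0 => /orP[/cards1P[a Sa] | /eqP->]; last by rewrite setD0.
  subst S; apply/csetP=> x y xD yD; apply/negPn/negP=> nxy.
  pose K z := ccomp e (D :\ a) z.
  have two z : z \in D :\ a -> ~~ [|| (q \notin K z) && (q' \notin K z),
      (q \notin K z) && (q'' \notin K z) | (q' \notin K z) && (q'' \notin K z)].
    have [X XE] : exists X, X = K z by exists (K z).
    rewrite -XE => zD; have sX : X \subset D :\ a by rewrite XE; apply: ccomp_sub.
    have zX : z \in X by rewrite XE; apply: mem_ccomp.
    have Xcl u v : u \in X -> v \in D :\ a -> e u v -> v \in X by rewrite XE; apply: ccomp_closed.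
    have key y0 : (forall u v, u \in X -> v \notin D -> e u v -> v = y0) -> y0 \notin D -> False.
      move=> H y0D; apply: (@blob_cut X a y0 z) => //.
      - by apply: subset_trans sX (subsetDl _ _).
      - by apply/negP=> /(subsetP sX); rewrite !inE eqxx.
      - by apply/negP=> /(subsetP sX); rewrite inE (negbTE y0D) andbF.
      - move=> u v uX uv; case: (boolP (v \in D)) => vD; last by constructor 3; apply: H uv.
        case: (altP (v =P a)) => [-> | va]; [by constructor 2 | constructor 1].
        by apply: Xcl uX _ uv; rewrite !inE va.
    have uD u : u \in X -> u \in D by move/(subsetP sX); rewrite inE => /andP[].
    apply/negP=> /or3P[] /andP[h1 h2].
    - apply: (key o) => // u v uX vD /(out _ _ (uD _ uX) vD)[[E _] | [E _] | []] //;
        by rewrite -E uX in h1 h2.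
    - apply: (key p') => // u v uX vD /(out _ _ (uD _ uX) vD)[[E _] | [] | [E _]] //;
        by rewrite -E uX in h1 h2.
    - apply: (key p) => // u v uX vD /(out _ _ (uD _ uX) vD)[[] | [E _] | [E _]] //;
        by rewrite -E uX in h1 h2.
  have yx : y \notin K x by rewrite in_set yD (negbTE nxy).
  have /pred0P d := ccomp_disj esym yx yD.
  have {}d z : (z \in K x) && (z \in K y) = false := d z.
  move: (two x xD) (two y yD) (d q) (d q') (d q'').
  move: (q \in K x) (q' \in K x) (q'' \in K x) (q \in K y) (q' \in K y) (q'' \in K y).
  by move=> [] [] [] [] [] [].
split.
  apply/set0Pn; have : 0 < #|D :\: S| by rewrite cardsD; move: D2 S1 (subset_leq_card (subsetIr D S)); clear; lia.
  by rewrite card_gt0 => /set0Pn.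
move=> x y xD yD; apply: connect_sub (csetP _ _ cDS x y xD yD) => u v; rewrite restrE.
case/and3P=> uv /setDP[uD uS] /setDP[vD vS]; apply: connect1.
by apply/and3P; split=> //; apply/and3P; split.
Qed.

Lemma wiggly_blob s s' : 2 < #|D| -> q != q' ->
  path e q s -> last q s = q' -> uniq (q :: s) -> {subset s <= D} ->
  path e q s' -> last q s' = q' -> uniq (q :: s') -> {subset s' <= D} ->
  size s' = size s + 1 \/ size s' = size s + 2 -> bead G false D q q'.
Proof.
case: (blobD) => [[cD DV] [qD q'D q''D] _ _ _] D2 qq h1 h2 h3 h4 h1' h2' h3' h4' h5.
have xy t : path e q t -> last q t = q' -> uniq (q :: t) -> {subset t <= D} ->
    is_xy_path (induced D) q q' (VPath q t).
  move=> t1 t2 t3 t4; apply: xy_pathI => //=; apply: restr_path => //.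
  by apply/allP.
exists D, [set q], [set q'], q, q'; split.
- split=> //; exists (induced D); split=> //.
  + by split=> // u v /and3P[].
  + exact: blob_2connected.
  + by exists (VPath q s), (VPath q s'); split=> //; apply: xy.
- split; rewrite ?set11 //; first exact: cset1.
  by apply/setP=> z; rewrite in_setI in_set1; case: eqP => // ->.
- split; rewrite ?set11 //; first exact: cset1.
  by apply/setP=> z; rewrite in_setI in_set1; case: eqP => // ->.
- by rewrite disjoints1 inE.
- by rewrite !sub1set.
Qed.

(* A non-separating path between two exits, the third exit being the anchor. *)
Lemma blob_spine : 1 < #|D| -> exists g, let R := D :\: [set z in q :: g] in
  [/\ [/\ path e q g, last q g = q', uniq (q :: g) & {subset q :: g <= D}],
      cset e R, q'' \in R & forall y, y \in q :: g -> exists2 z, z \in R & e y z].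
Proof.
move=> D1; have [qq' _ _] := blob_entries D1.
case: (blobD) => [[cD DV] [qD q'D q''D] [pD p'D oD] [n1 n2 n3] [qp q'p' q''o out]].
(* Edges without an end in [D] are dropped, so that a path from [p] to [p'] in [U] runs inside [D]
   apart from its ends, and the anchor [o] is adjacent to [q''] only. *)
pose eD u v := e u v && ((u \in D) || (v \in D)).
have eDs : symmetric eD by move=> u v; rewrite /eD esym orbC.
pose U := o |: (p |: (p' |: D)).
have inU z : z \in U -> [\/ z \in D, z = p, z = p' | z = o].
  by case/setU1P=> [| /setU1P[| /setU1P[]]]; [constructor 4 | constructor 2 | constructor 3 | constructor 1].
have DU z : z \in D -> z \in U by move=> zD; rewrite !inE zD !orbT.
have outU u v : u \in D -> e u v -> v \in U.
  move=> uD uv; case: (boolP (v \in D)) => [/DU // | vD].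
  by case: (out u v uD vD uv) => -[_ ->]; rewrite !inE eqxx ?orbT.
have oU : [set o] \subset U by rewrite sub1set !inE eqxx.
have C3 X : X != set0 -> X \subset U -> [disjoint X & p |: (p' |: [set o])] -> cset eD X ->
    2 < #|nbrs eD U X|.
  move=> /set0Pn[x xX] /subsetP XU /pred0P dX _; rewrite ltnNge; apply/negP=> le2.
  have XD z : z \in X -> z \in D.
    by move=> zX; case: (inU z (XU z zX)) => // E; have := dX z; rewrite /= zX E !inE eqxx ?orbT.
  have nb u v : u \in X -> e u v -> v \in X \/ v \in nbrs eD U X.
    move=> uX uv; case: (boolP (v \in X)) => vX; [by left | right].
    rewrite in_set (outU u v (XD _ uX) uv) vX; apply/existsP; exists u.
    by rewrite uX /eD uv (XD _ uX).
  have [y yo yn] : exists2 y, y \in [:: p; p'; o] & y \notin nbrs eD U X.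
    case: (boolP (has (predC [in nbrs eD U X]) [:: p; p'; o])) => [/hasP[y] | /hasPn H]; first by exists y.
    suff: 3 <= #|nbrs eD U X| by rewrite ltnNge le2.
    apply: leq_trans (_ : #|[set z in [:: p; p'; o]]| <= _).
      by rewrite cardsE (card_uniqP _) //= !inE negb_or n1 n2 n3.
    by apply/subset_leq_card/subsetP=> z; rewrite in_set => /H; rewrite negbK.
  have yV : y \in V /\ y \notin X.
    have ad a b : e a b -> b \notin D -> b \in V /\ b \notin X.
      by move=> ab bD; split; [case: (adj_V ab) | apply: contra bD; apply: XD].
    move: yo; rewrite !inE => /or3P[] /eqP->; [exact: ad qp pD | exact: ad q'p' p'D | exact: ad q''o oD].
  case: yV => yV yX; apply: (@no_cut T G con3 X (nbrs eD U X) x y) => //.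
  - by apply: (subsetP DV); apply: XD.
  - by rewrite in_set xX andbF.
have [g0 [g0p g0l g0u g0D]] := cset_path cD qD q'D.
have us0 : uniq (p :: rcons (q :: g0) p').
  rewrite cons_uniq rcons_uniq g0u andbT mem_rcons in_cons negb_or n1 /=.
  by apply/andP; split; [apply: contra pD | apply: contra p'D]; apply: g0D.
have as0 : all [in U :\: [set o]] (p :: rcons (q :: g0) p').
  apply/allP=> z; rewrite in_cons mem_rcons in_cons => /or3P[/eqP-> | /eqP-> | zg].
  - by rewrite !inE n2 eqxx !orbT.
  - by rewrite !inE n3 eqxx !orbT.
  - have zD := g0D z zg; rewrite in_setD1 DU // andbT; by apply: contraNneq oD => <-.
have st0 : stpath eD U [set o] p p' (p :: rcons (q :: g0) p').
  apply/and5P; split=> //=.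
  - by rewrite last_rcons.
  - rewrite {1}/eD esym qp qD orbT /= rcons_path g0l {2}/eD q'p' q'D andbT.
    apply: (@sub_in_path _ [in D] e) g0p; last by apply/allP.
    by move=> u v uD vD uv; rewrite /eD uv [u \in D]uD.
  - by apply/andP; split; [exact: us0 | exact: as0].
have [l [lP anc nbr]] := @nonsep T eD eDs U [set o] p p' oU C3 _ st0.
case/and5P: lP => l0 /eqP hl /eqP ll sl /andP[ul /allP lU].
case: l l0 hl ll sl ul lU anc nbr => // x0 s _ /= -> {x0}.
case/lastP: s => [/= E | s y]; first by rewrite E eqxx in n1.
rewrite last_rcons => -> {y} sl ul lU anc nbr.
have sD z : z \in s -> z \in D.
  move=> zs; have /setD1P[zo zU] : z \in U :\ o.
    by apply: lU; rewrite in_cons mem_rcons in_cons zs !orbT.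
  case: (inU z zU) => // E; subst z; last by rewrite eqxx in zo.
    by move: ul; rewrite mem_rcons in_cons zs orbT.
  by case/andP: ul => _; rewrite rcons_uniq zs.
have us : uniq s by case/andP: ul => _; rewrite rcons_uniq => /andP[].
case: s sl ul lU anc nbr sD us => [|q1 g] sl ul lU anc nbr sD us.
  by move: sl; rewrite /= /eD (negbTE pD) (negbTE p'D) andbF.
move: sl; rewrite /= rcons_path => /and3P[/andP[pq1 _] gp /andP[lp' _]].
have q1D : q1 \in D by apply: sD; apply: mem_head.
have q1q : q1 = q.
  by rewrite esym in pq1; case: (out q1 p q1D pD pq1) => -[// _ E]; [rewrite E eqxx in n1 | rewrite E eqxx in n2].
subst q1.
have lD : last q g \in D by apply: sD; apply: mem_last.
have lq' : last q g = q'.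
  case: (out _ p' lD p'D lp') => -[E1 E2] //; first by rewrite E2 eqxx in n1.
  by rewrite E2 eqxx in n3.
have ge : path e q g by apply: sub_path gp => u v /andP[].
exists g; set R := D :\: _.
have offE z : z \in offp U (p :: rcons (q :: g) p') -> z \in R \/ z = o.
  rewrite in_set mem_ends => /andP[zU /norP[zp /norP[zp' zg]]].
  case: (inU z zU) zp zp' => [zD | -> | -> | ->]; rewrite ?eqxx // => _ _; last by right.
  by left; apply/setDP; split; rewrite ?in_set.
have Roff z : z \in R -> z \in offp U (p :: rcons (q :: g) p').
  case/setDP=> zD; rewrite in_set => zg; rewrite in_set DU // mem_ends.
  apply/norP; split; last (apply/norP; split=> //); by apply: contraTneq zD => ->.
have onb v : eD o v -> v = q''.
  case/andP=> ov; rewrite (negbTE oD) /= => vD; rewrite esym in ov.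
  by case: (out v o vD oD ov) => -[] // _ E; [rewrite -E eqxx in n2 | rewrite -E eqxx in n3].
have ancR y : y \in R -> connect (restr eD (offp U (p :: rcons (q :: g) p'))) o y.
  by move=> yR; have := anc y (Roff y yR); rewrite in_set => /andP[_ /existsP[a /andP[/set1P->]]].
have nbrR y : y \in q :: g -> exists2 z, z \in R \/ z = o & e y z.
  move=> yg; have yD := sD y yg; have [|||z /offE zR /andP[yz _]] := nbr y; last by exists z.
  - by rewrite mem_ends yg !orbT.
  - by apply: contraTneq yD => ->.
  - by apply: contraTneq yD => ->.
have oq'' y : y \in D -> e y o -> y = q''.
  by move=> yD yo; apply: onb; rewrite /eD esym yo yD orbT.
(* If [q''] were on the path, nothing but [o] would be anchored, so every vertex of the path would
   be adjacent to [o] and hence equal to [q''], against [q != q']. *)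
have q''R : q'' \in R.
  rewrite in_setD q''D andbT in_set; apply/negP=> q''g.
  have R0 y : y \notin R.
    apply/negP=> yR; have := @connect_stable _ eD _ (pred1 o) o y _ (ancR y yR) (eqxx o).
    have /negbTE yo : y != o by apply: contraTneq yR => ->; rewrite in_setD (negbTE oD) andbF.
    rewrite /= yo; move=> H; suff: false by []; apply: H => u v _ vo uv /eqP Eu; subst u.
    case: (offE v vo) => [vR | ->]; last exact: eqxx.
    by move: vR; rewrite (onb v uv) in_setD in_set q''g.
  have all_q y : y \in q :: g -> y = q''.
    move=> yg; have [z [zR | ->] yz] := nbrR y yg; last by apply: oq''; rewrite ?sD.
    by rewrite (negbTE (R0 z)) in zR.
  case/negP: qq'; rewrite (all_q q (mem_head _ _)) -lq'; apply/eqP; symmetry.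
  by apply: all_q; apply: mem_last.
split=> //.
- apply: (@cset_center _ e esym _ q'') => y yR.
  pose P z := (z == o) || connect (restr e R) q'' z.
  have : P y.
    apply: (@connect_stable _ eD _ P o y _ (ancR y yR)); last by rewrite /P eqxx.
    move=> u v uo vo uv; rewrite /P; case: (altP (v =P o)) => //= vno.
    have vR : v \in R by case: (offE v vo) => // E; rewrite E eqxx in vno.
    case: (altP (u =P o)) => [E _ | uno /= qu]; first by subst u; rewrite (onb v uv) connect0.
    have uR : u \in R by case: (offE u uo) => // E; rewrite E eqxx in uno.
    apply: connect_trans qu (connect1 _); rewrite restrE uR vR; by case/andP: uv => ->.
  by rewrite /P; case: eqP => // E; move: yR; rewrite E in_setD (negbTE oD) andbF.
- move=> y yg; have [z [zR | E] yz] := nbrR y yg; first by exists z.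
  have yq : y = q'' by apply: oq''; rewrite ?sD // -E.
  by move: q''R; rewrite in_setD in_set -yq yg.
Qed.

End Blob.
End Blobs.

(** * The inductive step for blobs *)

Section Spine.
Variables (T : finType) (G : graph T).
Hypotheses (cub : cubic G) (con3 : n_connected 3 G).
Let e := adj G.
Let V := vset G.
Let esym : symmetric e := @adj_sym T G.
Implicit Types (A C R S U X Y : {set T}).

Variables (D : {set T}) (p p' o q q' q'' : T) (g : seq T).
Hypotheses (blobD : blob G D p p' o q q' q'') (D1 : 1 < #|D|).
Hypothesis IH : forall (D' : {set T}) a b c x y z, #|D'| < #|D| -> 1 < #|D'| -> blob G D' a b c x y z ->
  exists b0, bead G b0 D' x y.
Let gs := q :: g.
Let n := size g.
Let R := D :\: [set z in gs].
Hypotheses (gp : path e q g) (gl : last q g = q') (gu : uniq gs) (gD : {subset gs <= D}).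
Hypotheses (cR : cset e R) (q''R : q'' \in R).
Hypothesis nbrR : forall y, y \in gs -> exists2 z, z \in R & e y z.

Let gi i := nth q gs i.
Let cD : cset e D. Proof. by case: blobD => -[]. Qed.
Let DV : D \subset V. Proof. by case: blobD => -[]. Qed.
Let oD : o \notin D. Proof. by case: blobD => _ _ []. Qed.
Let q''o : e q'' o. Proof. by case: blobD => _ _ _ _ []. Qed.

Lemma spine_in i : i <= n -> gi i \in gs.
Proof. by move=> h; apply: mem_nth. Qed.

Lemma spine_inj i j : i <= n -> j <= n -> gi i = gi j -> i = j.
Proof. by move=> hi hj /eqP; rewrite nth_uniq // => /eqP. Qed.

Lemma spine_adj i : i < n -> e (gi i) (gi i.+1).
Proof. by move=> h; apply: (pathP q gp). Qed.

Lemma spine_off y : y \in gs -> y \notin R.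
Proof. by move=> yg; rewrite in_setD in_set yg. Qed.

Lemma R_D z : z \in R -> z \in D. Proof. by case/setDP. Qed.

Lemma spinen : gi n = q'. Proof. by rewrite /gi nth_last. Qed.

(** With [p] and [p'] added at its ends, the spine gives each of its vertices two neighbours, so
    exactly one neighbour is left in [R]. *)
Lemma spine_uniq y z z' : y \in gs -> z \in R -> z' \in R -> e y z -> e y z' -> z = z'.
Proof.
case: blobD => [_ _ [pD p'D _] [n1 _ _] [qp q'p' _ _]] yg zR z'R yz yz'.
have pq : e p q by rewrite esym; exact: qp.
have {}q'p' : e q' p' by exact: q'p'.
have pe : path e p (rcons gs p') by rewrite rcons_path /= pq gp gl q'p'.
have ue : uniq (p :: rcons gs p').
  rewrite cons_uniq rcons_uniq gu andbT mem_rcons in_cons negb_or n1 /=.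
  by apply/andP; split; [apply: contra pD | apply: contra p'D]; apply: gD.
have offR x : x \in p :: rcons gs p' -> x \notin R.
  rewrite mem_ends => /or3P[/eqP-> | /eqP-> | /spine_off //]; by apply/negP=> /R_D; apply/negP.
set l := p :: rcons gs p' in ue offR.
have [i ig yi] : exists2 i, i < size gs & y = nth q l i.+1.
  exists (index y gs); first by rewrite index_mem.
  by rewrite -[RHS]/(nth q (rcons gs p') (index y gs)) nth_rcons index_mem yg nth_index.
have szl : size l = (size gs).+2 by rewrite /l -[size _]/(size (rcons gs p')).+1 size_rcons.
have e1 : e (nth q l i) y.
  by rewrite yi; apply: (pathP q pe); rewrite size_rcons ltnW.
have e2 : e y (nth q l i.+2).
  by rewrite yi; apply: (pathP q pe); rewrite size_rcons.
have i2 : i.+2 < size l by rewrite szl !ltnS.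
have i0 : i < size l by apply: ltn_trans i2; apply: ltnW.
rewrite esym in e1.
have ne1 : nth q l i != nth q l i.+2 by rewrite nth_uniq // neq_ltn ltnS leqW.
have ne x k : x \in R -> k < size l -> nth q l k != x.
  by move=> xR kl; apply: contraTneq xR => <-; apply: offR; apply: mem_nth.
have := path3_nbrs cub e1 e2 yz ne1 (ne _ _ zR i0) (ne _ _ zR i2) yz'.
by rewrite ![z' == nth _ _ _]eq_sym (negbTE (ne _ _ z'R i0)) (negbTE (ne _ _ z'R i2)) => /eqP.
Qed.

Lemma spine_exits u v : u \in R -> v \notin R -> e u v -> v \in gs \/ u = q'' /\ v = o.
Proof.
case: blobD => [_ _ _ _ [_ _ _ out]] uR vR uv; case: (boolP (v \in gs)) => vg; first by left.
right; have vD : v \notin D by apply: contra vR => vD; rewrite in_setD vD andbT in_set.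
have uD := R_D uR; have ug : u \notin gs by move: uR; rewrite in_setD in_set => /andP[].
case: (out u v uD vD uv) => [[E _] | [E _] | //]; case/negP: ug; rewrite E ?mem_head //.
by rewrite -gl mem_last.
Qed.

Lemma spine_cases v : v \in gs -> exists2 i, i <= n & v = gi i.
Proof.
move=> vg; exists (index v gs); last by rewrite /gi nth_index.
by move: vg; rewrite -index_mem.
Qed.

Lemma spine_ext b X i j : X \subset D -> i <= j -> j <= n ->
  (forall z, z \in X -> z \in gs -> z \in arc gs i j) ->
  bead G b X (gi i) (gi j) -> bead G b D q q'.
Proof.
move=> sX ij jn Xg bX; have sg : sorted e gs by exact: gp.
have jg : j < size gs by [].
have ig : i < size gs by apply: leq_ltn_trans ij _.
have arcD l r : arc gs l r \subset D by apply/subsetP=> z /arc_sub/gD.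
have idx z : z \in gs -> gi (index z gs) = z by move=> zg; rewrite /gi nth_index.
have E1 : bead G b (arc gs 0 i :|: X) (gi 0) (gi j).
  apply: (bead_extl bX).
  - exact: cset_arc.
  - by apply: nth_arc; rewrite ?leqnn.
  - by apply: nth_arc.
  - move=> z; rewrite mem_arc // => /and3P[zg _ zi] zX.
    have := Xg z zX zg; rewrite mem_arc // => /and3P[_ iz _]; rewrite -(idx z zg); congr gi.
    by apply/eqP; rewrite eqn_leq zi iz.
have E2 : bead G b (arc gs j n :|: (arc gs 0 i :|: X)) (gi 0) (gi n).
  apply: (bead_extr E1).
  - exact: cset_arc.
  - by apply: nth_arc; rewrite ?leqnn.
  - by apply: nth_arc; rewrite ?leqnn ?jn.
  - move=> z; rewrite mem_arc // => /and3P[zg jz _] zX; rewrite -(idx z zg); congr gi.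
    apply/eqP; rewrite eqn_leq jz andbT; case/setUP: zX => [| /Xg/(_ zg)].
      by rewrite mem_arc // => /and3P[_ _ zi]; apply: leq_trans zi ij.
    by rewrite mem_arc // => /and3P[].
rewrite spinen in E2; apply: bead_sub E2; by rewrite !subUset !arcD.
Qed.

(* The reason why [gi i] is not the centre of a tripod between [q], [q'] and the rest:
   [s] separates its neighbour in [R] from the spine. *)
Definition bad i s C := [/\ s \in R, s \notin C, C \subset R, cset e C &
  [/\ exists2 u, u \in C & e u (gi i),
      (forall u v, u \in C -> v \in R -> e u v -> v \in C \/ v = s),
      (forall u j, u \in C -> j <= n -> e u (gi j) -> j = i) & q'' \in C]].

(** A vertex of [R] is labelled by the side of [i] on which it has a neighbour in the spine, and
    [fan] starts at the neighbour [w] of [gi i]. Arms to both sides give a tripod. The neighbours of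
    the two ends of the spine have different labels. A separating vertex [s] makes [i] bad, where
    [q''] lies in [C] because otherwise [s] and [gi i] would cut [C] off. *)
Lemma good_index i : 0 < i -> i < n ->
  (exists b, bead G b D q q') \/ exists s C, bad i s C.
Proof.
move=> i0 iN; have [w wR iw] := nbrR (spine_in (ltnW iN)); rewrite esym in iw.
pose lab u (b : bool) := [exists j : 'I_n.+1, e u (gi j) && (if b then j < i else i < j)].
have labI u j : j <= n -> e u (gi j) -> j != i -> lab u (j < i).
  move=> jn uj ji; apply/existsP; exists (Ordinal (jn : j < n.+1)); rewrite uj /=.
  by case: ltngtP ji.
case: (fan esym lab cR wR).
- case=> La [Ra [u1 [u2 [b1 [b2 H]]]]]; left; exists true.
  have {b1 b2 H} [La' [Ra' [v1 [v2 [[s1 s2 d] [[c1 v1L lv1] [c2 v2L lv2]]]]]]] :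
    exists (La Ra : {set T}) u1 u2, [/\ La \subset R :\ w, Ra \subset R :\ w & [disjoint La & Ra]] /\
      [/\ cset e (w |: La), u1 \in w |: La & lab u1 true] /\
      [/\ cset e (w |: Ra), u2 \in w |: Ra & lab u2 false].
    case: H => [[s1 s2 d] [[c1 v1L lv1] [c2 v2L lv2 b12]]].
    case: b1 b2 b12 lv1 lv2 => [] [] // _ lv1 lv2; first by exists La, Ra, u1, u2.
    by exists Ra, La, u2, u1; rewrite disjoint_sym.
  case/existsP: lv1 => j1 /andP[e1 j1i]; case/existsP: lv2 => j2 /andP[e2 j2i].
  have wRa (A : {set T}) : A \subset R :\ w -> w \notin A.
    by move=> sA; apply/negP=> /(subsetP sA); rewrite !inE eqxx.
  have AR (A : {set T}) z : A \subset R :\ w -> z \in A -> z \in R.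
    by move=> sA /(subsetP sA)/setD1P[].
  have j2n : j2 < size gs := ltn_ord j2.
  have bX := @tripod_bead T G q gs j1 i j2 w La' Ra' v1 v2 gp gu j1i j2i j2n.
  apply: (@spine_ext true _ j1 j2) (bX _ iw d (wRa _ s1) (wRa _ s2) _ c1 v1L e1 c2 v2L e2).
  + rewrite !subUset sub1set (R_D wR) /=; apply/and3P; split.
    * by apply/subsetP=> z /arc_sub/gD.
    * by apply/subsetP=> z /(AR _ _ s1)/R_D.
    * by apply/subsetP=> z /(AR _ _ s2)/R_D.
  + exact: ltnW (ltn_trans j1i j2i).
  + by rewrite -ltnS.
  + move=> z zX zg; case/setUP: zX => // zX; case/negP: (spine_off zg).
    by case/setU1P: zX => [-> // | /setUP[/(AR _ _ s1) | /(AR _ _ s2)]].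
  + by apply: contraL wR; apply: spine_off.
  + move=> z zg; rewrite inE negb_or; apply/andP; split; apply: contraL zg.
      by move/(AR _ _ s1); apply: contraL; apply: spine_off.
    by move/(AR _ _ s2); apply: contraL; apply: spine_off.
- have [w0 w0R e0] := nbrR (spine_in (leq0n n)); have [wn wnR en] := nbrR (spine_in (leqnn n)).
  rewrite esym in e0; rewrite esym in en.
  move/(_ w0 wn true false w0R wnR); have := labI _ _ (leq0n n) e0; have := labI _ _ (leqnn n) en.
  rewrite i0 ltnNge (ltnW iN) /= => h1 h2 h; suff: true = false by [].
  by apply: h; [apply: h2; rewrite neq_ltn i0 | apply: h1; rewrite neq_ltn iN orbT].
- case=> s [C [[sR wC sC cC] [clC noC]]]; right; exists s, C.
  have CR u : u \in C -> u \in R by move/(subsetP sC)/setD1P=> [].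
  have sNC : s \notin C by apply/negP=> /(subsetP sC); rewrite !inE eqxx.
  have lab_i u j : u \in C -> j <= n -> e u (gi j) -> j = i.
    move=> uC jn uj; apply/eqP; apply: contraNT (noC u (j < i) uC); exact: labI.
  have sR' : s \in R by case/setD1P: sR.
  split=> //; first by apply/subsetP.
  split=> //; first by exists w.
  apply/negPn/negP=> q''C; apply: (@blob_cut _ _ con3 _ _ _ _ _ _ _ blobD C s (gi i) w) => //.
  + by apply/subsetP=> u /CR/R_D.
  + by apply: contraL (spine_in (ltnW iN)) => /CR; apply: contraL; apply: spine_off.
  + move=> u v uC uv; case: (boolP (v \in R)) => vR.
      by case: (clC u v uC vR uv) => [h | ->]; [constructor 1 | constructor 2].
    case: (spine_exits (CR u uC) vR uv) => [vg | [E _]]; last by rewrite -E uC in q''C.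
    have [j jn E] := spine_cases vg; subst v; rewrite (lab_i u j uC jn uv); by constructor 3.
Qed.

(** Both [C] and [C'] contain [q''], and neither contains the other's neighbour of the spine; so
    each contains the other's separating vertex. Then their union is closed in [R], hence all of
    [R], although it misses the neighbour of the first spine vertex. *)
Lemma bad_unique i i' s s' C C' : 0 < i -> i < n -> 0 < i' -> i' < n -> i != i' ->
  bad i s C -> bad i' s' C' -> False.
Proof.
move=> i0 iN i0' iN' ii' [sR sC CR cC [[u uC ui] clC labC qC]]
  [sR' sC' CR' cC' [[u' uC' ui'] clC' labC' qC']].
have u'C : u' \notin C.
  by apply/negP=> u'C; case/eqP: ii'; rewrite (labC u' i' u'C (ltnW iN') ui').
have nuC' : u \notin C'.
  by apply/negP=> nuC; case/eqP: ii'; rewrite (labC' u i nuC (ltnW iN) ui).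
have [x [y [xC' yC' xy xC yC]]] := @cset_exit _ e C' [in C] q'' u' cC' qC' uC' qC u'C.
have sC'2 : s \in C' by case: (clC x y xC (subsetP CR' _ yC') xy) yC => [-> // | <-].
have [x' [y' [xC2 yC2 xy' xC2' yC2']]] := @cset_exit _ e C [in C'] q'' u cC qC uC qC' nuC'.
have s'C2 : s' \in C by case: (clC' x' y' xC2' (subsetP CR _ yC2) xy') yC2' => [-> // | <-].
have [w wR e0] := nbrR (spine_in (leq0n n)); rewrite esym in e0.
have : w \in C :|: C'.
  apply: (@cset_stable _ e R [in C :|: C'] q'' w cR q''R wR); last by rewrite inE qC.
  move=> a b aR bR ab /setUP[aC | aC]; rewrite inE.
    by case: (clC a b aC bR ab) => [-> // | ->]; rewrite sC'2 orbT.
  by case: (clC' a b aC bR ab) => [-> | ->]; rewrite ?s'C2 ?orbT.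
case/setUP=> wC; first by have := labC w 0 wC (leq0n n) e0; move: i0; case: (i).
by have := labC' w 0 wC (leq0n n) e0; move: i0'; case: (i').
Qed.

Lemma card3_gt (a b d : T) X : a != b -> a != d -> b != d -> a \in X -> b \in X -> d \in X ->
  2 < #|X|.
Proof.
move=> ab ad bd aX bX dX; apply: leq_trans (_ : #|[set z in [:: a; b; d]]| <= _).
  by rewrite cardsE (card_uniqP _) //= !inE negb_or ab ad bd.
by apply/subset_leq_card/subsetP=> z; rewrite !inE => /or3P[] /eqP->.
Qed.

Lemma R_proper : #|R| < #|D|.
Proof.
apply: proper_card; apply/properP; split; first exact: subsetDl.
by exists q; [apply/gD/mem_head | apply/spine_off/mem_head].
Qed.

Lemma spine_nbr i : i <= n -> exists w, [/\ w \in R, e w (gi i) &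
  forall u, u \in R -> e u (gi i) -> u = w].
Proof.
move=> le; have [w wR iw] := nbrR (spine_in le); exists w; split=> //; first by rewrite esym.
by move=> u uR; rewrite esym => ui; apply: spine_uniq (spine_in le) uR wR ui iw.
Qed.

(** The spine is the edge [qq']. If its ends have the same neighbour in [R], then [R] is that single
    vertex, and the triangle has paths of lengths 1 and 2. Otherwise [R] is a smaller blob with
    exits to [q], [q'] and [o]. *)
Lemma spine1 : n = 1 -> exists b, bead G b D q q'.
Proof.
move=> n1; have [qq' _ _] := blob_entries con3 blobD D1.
have [w0 [w0R e0 u0]] := spine_nbr (leq0n n); have [w1 [w1R e1 u1]] := spine_nbr (leqnn n).
rewrite spinen in e1 u1.
have gcases v : v \in gs -> v = q \/ v = q'.
  move/spine_cases=> [i]; rewrite {1}n1 => le ->; case: i le => [|[|]] // _; first by left.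
  by right; rewrite -spinen n1.
have qR : q \notin R by apply/spine_off/mem_head.
have q'R : q' \notin R by rewrite -spinen; apply/spine_off/spine_in.
have qD : q \in D by apply/gD/mem_head.
have q'D : q' \in D by rewrite -spinen; apply/gD/spine_in.
have qq1 : e q q' by rewrite -spinen n1; apply: (@spine_adj 0); rewrite n1.
have neR x y : x \in R -> y \notin R -> x != y by move=> xR; apply: contraNneq => <-.
case: (altP (w0 =P w1)) => [E | ne].
  subst w1; have R1 x : x \in R -> x = w0.
    move=> xR; apply/eqP/negPn/negP=> xw.
    apply: (@blob_cut _ _ con3 _ _ _ _ _ _ _ blobD (R :\ w0) w0 o x) => //.
    + exact: (subset_trans (subsetDl R _) (subsetDl D _)).
    + by rewrite in_setD1 xw.
    + by rewrite in_setD1 eqxx.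
    + by apply/negP=> /setD1P[_ /R_D]; apply/negP.
    + move=> u v /setD1P[uw uR] uv; case: (boolP (v \in R)) => vR.
        by case: (altP (v =P w0)) => [-> | vw]; [constructor 2 | constructor 1; rewrite in_setD1 vw].
      case: (spine_exits uR vR uv) => [vg | [_ ->]]; last by constructor 3.
      case: (gcases v vg) => E; subst v; first by rewrite (u0 u uR uv) eqxx in uw.
      by rewrite (u1 u uR uv) eqxx in uw.
  have w0q := neR _ _ w0R qR; have w0q' := neR _ _ w0R q'R.
  exists false; apply: (@wiggly_blob _ _ con3 _ _ _ _ _ _ _ blobD [:: q'] [:: w0; q']) => //=.
  - by apply: (card3_gt w0q w0q' qq') => //; apply: R_D.
  - by rewrite /= andbT.
  - by rewrite inE qq'.
  - by move=> z; rewrite inE => /eqP->.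
  - by apply/and3P; split=> //; rewrite adj_sym.
  - by rewrite !inE negb_or eq_sym w0q qq' w0q'.
  - by move=> z; rewrite !inE => /orP[] /eqP-> //; apply: R_D.
  - by left.
have R2 : 1 < #|R|.
  rewrite (cardsD1 w0) w0R (cardsD1 w1) (_ : w1 \in R :\ w0) //.
  by rewrite in_setD1 eq_sym ne.
have [qD' q'D' n2 n3] : [/\ q != o, q' != o, true & true].
  by split=> //; apply: contraNneq oD => <-.
have [|b bR] := IH R_proper R2 (a := q) (b := q') (c := o) (x := w0) (y := w1) (z := q'').
  split=> //.
  - by split=> //; apply: subset_trans DV; apply: subsetDl.
  - by split=> //; apply: contra oD; apply: R_D.
  - split=> // u v uR vR uv; case: (spine_exits uR vR uv) => [vg | E]; last by constructor 3.
    by case: (gcases v vg) => E; subst v; [constructor 1; rewrite (u0 u) | constructor 2; rewrite (u1 u)].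
exists b; have eq0 : e q w0 by rewrite esym.
have b1 := bead_edgel bR eq0 qR; have b2 := bead_edger b1 e1 _.
apply: bead_sub (b2 _); last by rewrite in_setU1 negb_or eq_sym qq'.
by rewrite !subUset !sub1set qD q'D subsetDl.
Qed.

(** Enlarging [C] as long as [s] has two neighbours in it, one reaches a single edge [vs] between
    [C] and [R :\: C]. Then [R :\: C] has exits to [q], [q'], [v], and [C] has exits to [s], [gi 1],
    [o]: whichever has two vertices is a smaller blob. If both are single vertices, there are paths
    of lengths 2 and 4. *)
Lemma spine2_bad s C : n = 2 -> bad 1 s C -> exists b, bead G b D q q'.
Proof.
move=> n2; have [m] := ubnP (#|R| - #|C|); elim: m s C => // m IHm s C lem [sR sC CR cC].
case=> [[u1 u1C e1] clC labC qC].
have [w0 [w0R e0 uq0]] := spine_nbr (leq0n n); have [w2 [w2R e2 uq2]] := spine_nbr (leqnn n).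
have labC' u j : u \in C -> j <= 2 -> e u (gi j) -> j = 1.
  by move=> uC; rewrite -n2; apply: labC.
have le1 : 1 <= n by rewrite n2.
have w0C : w0 \notin C by apply/negP=> w0C; have := labC w0 0 w0C (leq0n n) e0.
have w2C : w2 \notin C by apply/negP=> w2C; have := labC w2 n w2C (leqnn n) e2; rewrite n2.
have gR j : j <= n -> gi j \notin R by move=> jn; apply/spine_off/spine_in.
have [v vC vs] : exists2 v, v \in C & e v s.
  have [a [b [aR bR ab aC bC]]] := @cset_exit _ e R [in C] u1 w0 cR (subsetP CR _ u1C) w0R u1C w0C.
  by case: (clC a b aC bR ab) bC => [-> // | <- _]; exists a.
have g02 : gi 0 != gi 2.
  by apply/eqP=> E; have := @spine_inj 0 2 (leq0n n); rewrite n2 => /(_ isT E).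
case: (boolP [exists v' in C, (v' != v) && e v' s]) => [/existsP[v' /and3P[v'C v'v v's]] | none].
  have sV : s \in V by apply/(subsetP DV)/R_D.
  have [y [sy yv yv']] := third_nbr cub v v' sV.
  rewrite esym in vs; rewrite esym in v's.
  have all_s z : e s z -> [|| z == v, z == v' | z == y].
    by apply: (path3_nbrs cub vs v's sy); rewrite eq_sym.
  have cover : (forall a, e s a -> a \in R -> a \in s |: C) -> R \subset s |: C.
    move=> H; apply/subsetP=> z zR; apply: (@cset_stable _ e R [in s |: C] s z cR sR zR).
      move=> a b aR bR ab /setU1P[E | aC]; first by subst a; apply: H.
      by case: (clC a b aC bR ab) => [bC | ->]; rewrite in_setU1 ?bC ?eqxx ?orbT.
    by rewrite setU11.
  have s_of w : R \subset s |: C -> w \in R -> w \notin C -> w = s.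
    by move=> /subsetP sub /sub /setU1P[-> // | ->].
  (* Otherwise [R] is [s |: C], and [s], which has two neighbours in [C], would also be adjacent to
     both ends of the spine. *)
  have yR : y \in R :\: C.
    rewrite in_setD; case: (boolP ((y \notin C) && (y \in R))) => // h; exfalso.
    have sub : R \subset s |: C.
      apply: cover => a sa aR; case/or3P: (all_s a sa) => /eqP E; subst a;
        rewrite in_setU1 ?vC ?v'C ?orbT //.
      by rewrite negb_and negbK aR orbF in h; rewrite h orbT.
    have E0 := s_of w0 sub w0R w0C; have E2 := s_of w2 sub w2R w2C.
    rewrite E0 in e0; rewrite E2 n2 in e2.
    have ysv x : e s x -> x \notin R -> x = y.
      move=> sx xR; case/or3P: (all_s x sx) => /eqP E //; rewrite E (subsetP CR) // in xR.
    by rewrite (ysv _ e0 (gR 0 (leq0n n))) (ysv _ e2) ?eqxx in g02; rewrite // -n2; apply: gR.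
  case/setDP: yR => yR yC.
  apply: (IHm y (s |: C)).
    have := subset_leq_card (_ : s |: C \subset R); rewrite subUset sub1set sR CR => /(_ isT).
    by move: lem; rewrite cardsU1 sC; clear; lia.
  split=> //.
  - by rewrite in_setU1 negb_or yC andbT eq_sym; apply: adj_ne sy.
  - by rewrite subUset sub1set sR.
  - exact: csetU1 cC vC vs.
  split.
  - by exists u1; rewrite // in_setU1 u1C orbT.
  - move=> a b /setU1P[-> | aC] bR ab.
      by case/or3P: (all_s b ab) => /eqP->; rewrite ?in_setU1 ?vC ?v'C ?orbT; [left | left | right].
    by left; case: (clC a b aC bR ab) => [bC | ->]; rewrite in_setU1 ?bC ?eqxx ?orbT.
  - move=> a j /setU1P[-> | aC] jn aj; last exact: labC aC jn aj.
    case/negP: (gR j jn); case/or3P: (all_s _ aj) => /eqP-> //; exact: (subsetP CR).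
  - by rewrite in_setU1 qC orbT.
have vuniq v' : v' \in C -> e v' s -> v' = v.
  move=> v'C v's; apply/eqP/negPn/negP=> ne; move/existsPn/(_ v'): none.
  by rewrite v'C ne v's.
have sY : s \in R :\: C by rewrite in_setD sC.
have CsE a b : a \in C -> b \in R -> b \notin C -> e a b -> b = s.
  by move=> aC bR bC ab; case: (clC a b aC bR ab) => // h; rewrite h in bC.
have cY : cset e (R :\: C) by apply: (cset_diff esym cR sR sC) => a b aC bR bC; apply: CsE.
have q_2 : q' = gi 2 by rewrite -spinen n2.
have qD : q \in D by apply/gD/mem_head.
have q'D : q' \in D by rewrite -spinen; apply/gD/spine_in.
have g1D : gi 1 \in D by apply/gD/spine_in.
have [qR q'R g1R] : [/\ q \notin R, q' \notin R & gi 1 \notin R].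
  by split; [apply: (gR 0) | rewrite q_2 -n2; apply: gR | apply: gR].
have qq' : q != q' by rewrite q_2.
have RD : R \subset D by exact: subsetDl.
have g01 : e q (gi 1) by apply: (@spine_adj 0); rewrite n2.
have g12 : e (gi 1) q' by rewrite q_2; apply: (@spine_adj 1); rewrite n2.
have q1 : q != gi 1 by apply: adj_ne g01.
have q1' : gi 1 != q' by apply: adj_ne g12.
rewrite n2 -q_2 in e2 uq2.
have gcases x : x \in gs -> [\/ x = q, x = gi 1 | x = q'].
  move/spine_cases=> [i]; rewrite n2 => le ->; case: i le => [|[|[|]]] // _;
    [constructor 1 | constructor 2 | constructor 3]; by rewrite ?q_2.
have nR x y : x \in R -> y \notin R -> x != y by move=> xR; apply: contraNneq => <-.
case: (ltnP 1 #|R :\: C|) => cardY.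
  have ltY : #|R :\: C| < #|D| by apply: leq_ltn_trans R_proper; apply/subset_leq_card/subsetDl.
  have [|b bY] := IH ltY cardY (a := q) (b := q') (c := v) (x := w0) (y := w2) (z := s).
    split.
    - by split=> //; apply: subset_trans (subset_trans RD DV); apply: subsetDl.
    - by split=> //; rewrite in_setD ?w0C ?w2C.
    - by split; rewrite in_setD ?(negbTE qR) ?(negbTE q'R) ?vC ?andbF.
    - by split=> //; rewrite eq_sym; apply: (nR v) => //; apply: (subsetP CR).
    - split=> //; first by rewrite adj_sym.
      move=> a b /setDP[aR aC]; rewrite in_setD => h ab.
      case: (boolP (b \in R)) h => [bR | bR _]; last first.
        case: (spine_exits aR bR ab) => [/gcases[E | E | E] | [E _]].
        * by constructor 1; split=> //; apply: uq0 => //; rewrite /gi /= -E.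
        * by subst b; have [w1 [_ _ uq1]] := spine_nbr le1; move: aC; rewrite (uq1 a aR ab)
            -(uq1 u1 (subsetP CR _ u1C) e1) u1C.
        * by constructor 2; split=> //; apply: uq2 => //; rewrite -E.
        * by rewrite E qC in aC.
      rewrite andbT negbK => bC; constructor 3; have ba : e b a by rewrite esym.
      have as_ := CsE b a bC aR aC ba; split=> //; apply: vuniq => //; by rewrite -as_.
  have Ysub : R :\: C \subset D by apply: subset_trans RD; apply: subsetDl.
  exists b; have q0 : e q w0 by rewrite esym.
  have b1 := bead_edgel bY q0 _; have {}b1 := b1 _.
  have qY : q \notin R :\: C by rewrite in_setD (negbTE qR) andbF.
  have {}b1 := b1 qY; have b2 := bead_edger b1 e2 _.
  apply: bead_sub (b2 _); last by rewrite in_setU1 negb_or eq_sym qq' in_setD (negbTE q'R) andbF.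
  by rewrite !subUset !sub1set qD q'D.
have Y1 x : x \in R -> x \notin C -> x = s.
  move=> xR xC; apply/eqP; move/card_le1P: cardY => /(_ s sY) H.
  by have := H x; rewrite in_setD xR xC inE => <-.
have {Y1} [Es0 Es2] := (Y1 w0 w0R w0C, Y1 w2 w2R w2C); subst w0 w2.
have vR := subsetP CR _ vC.
have e10 : e q s by rewrite esym.
have sv : e s v by rewrite esym.
have u1v : e u1 (gi 1) := e1.
case: (ltnP 1 #|C|) => cardC.
  have ltC : #|C| < #|D| by apply: leq_ltn_trans R_proper; apply: subset_leq_card.
  have [|b bC] := IH ltC cardC (a := s) (b := gi 1) (c := o) (x := v) (y := u1) (z := q'').
    split.
    - by split=> //; apply: subset_trans (subset_trans CR RD) DV.
    - by [].
    - split=> //; first by apply: contra g1R; apply: (subsetP CR).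
      by apply: contra oD => /(subsetP CR)/R_D.
    - split; first exact: (nR _ _ sR g1R).
        by apply: contraNneq oD => <-; apply: R_D.
      by apply: contraNneq oD => <-.
    - split=> // a b aC bC ab; case: (boolP (b \in R)) => bR.
        by constructor 1; have E := CsE a b aC bR bC ab; split=> //; apply: vuniq; rewrite // -E.
      case: (spine_exits (subsetP CR _ aC) bR ab) => [bg | E]; last by constructor 3.
      have [j jn E] := spine_cases bg; subst b; have E := labC a j aC jn ab; subst j.
      constructor 2; split=> //; have [w1 [_ _ uq1]] := spine_nbr le1.
      by rewrite (uq1 a (subsetP CR _ aC) ab) -(uq1 u1 (subsetP CR _ u1C) e1).
  have CD := subset_trans CR RD.
  have nC x : x \notin R -> x \notin C by apply: contra; apply: (subsetP CR).
  have b1 := bead_edgel bC sv sC.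
  have b2 : bead G b (q |: (s |: C)) q u1.
    by apply: (bead_edgel b1 e10); rewrite !in_setU1 negb_or (eq_sym q) (nR _ _ sR qR) nC.
  have b3 : bead G b (gi 1 |: (q |: (s |: C))) q (gi 1).
    apply: (bead_edger b2 e1); rewrite !in_setU1 !negb_or (nC _ g1R) andbT (eq_sym (gi 1)) q1.
    by rewrite eq_sym (nR _ _ sR g1R).
  exists b; apply: bead_sub (bead_edger b3 g12 _); last first.
    rewrite !in_setU1 !negb_or (nC _ q'R) andbT eq_sym q1' eq_sym qq'.
    by rewrite eq_sym (nR _ _ sR q'R).
  by rewrite !subUset !sub1set q'D g1D qD (R_D sR) CD.
have C1 x : x \in C -> x = v.
  move=> xC; apply/eqP; move/card_le1P: cardC => /(_ v vC) H.
  by have := H x; rewrite xC inE => <-.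
have E1 := C1 u1 u1C; subst u1.
exists false; have sq := nR _ _ sR qR; have sq' := nR _ _ sR q'R.
apply: (@wiggly_blob _ _ con3 _ _ _ _ _ _ _ blobD [:: gi 1; q'] [:: s; v; gi 1; q']) => //.
- by apply: (card3_gt sq sq' qq') => //; apply: R_D.
- by apply/and3P; split.
- by rewrite /= !inE negb_or q1 qq' q1'.
- by move=> z; rewrite !inE => /orP[] /eqP->.
- by apply/and5P; split.
- rewrite /= !inE !negb_or q1 qq' q1' (eq_sym q s) sq sq' (nR _ _ sR g1R).
  rewrite (eq_sym q v) (nR _ _ vR qR) (nR _ _ vR g1R) (nR _ _ vR q'R) /= !andbT.
  exact: adj_ne sv.
- by move=> z; rewrite !inE => /or4P[] /eqP-> //; apply: R_D.
- by right.
Qed.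

(** With at least two inner vertices on the spine, one of them is not bad; the shorter spines are
    the two special cases. *)
Lemma spine_bead : exists b, bead G b D q q'.
Proof.
have [qq' _ _] := blob_entries con3 blobD D1.
have n0 : 0 < n by rewrite lt0n; apply: contraNneq qq' => E; rewrite -spinen E.
move: (n0); rewrite leq_eqVlt => /predU1P[E | n1]; first by apply: spine1.
move: (n1); rewrite leq_eqVlt => /predU1P[E | n2].
  case: (good_index (ltnSn 0) n1) => // -[s [C bC]]; exact: spine2_bad bC.
case: (good_index (ltnSn 0) n1) => // -[s [C bC]].
case: (good_index (ltn0Sn 1) n2) => // -[s' [C' bC']].
by case: (@bad_unique 1 2 s s' C C').
Qed.

End Spine.

Theorem blob_bead (T : finType) (G : graph T) : cubic G -> n_connected 3 G ->
  forall (D : {set T}) p p' o q q' q'', 1 < #|D| -> blob G D p p' o q q' q'' ->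
  exists b, bead G b D q q'.
Proof.
move=> cub con3 D; have [m] := ubnP #|D|; elim: m D => // m IHm D ltm p p' o q q' q'' D1 bD.
have [g [[h1 h2 h3 h4] h5 h6 h7]] := blob_spine con3 bD D1.
apply: (@spine_bead T G cub con3 D p p' o q q' q'' g) => //.
by move=> D' a b c x y z lt; apply: IHm; apply: leq_trans lt _.
Qed.

(** * Depth-first search for a comb or a family of pieces *)

Section Search.
Variables (T : finType) (G : graph T).
Hypothesis cub : cubic G.
Let e := adj G.
Let V := vset G.
Let esym : symmetric e := @adj_sym T G.
Variables (c : seq T) (K : {set T}) (n : nat).
Hypotheses (Kc : forall z, z \in K -> z \notin c) (KV : K \subset V).
Implicit Types (D X Y Z : {set T}) (Q : seq T).

Definition feet x := #|[set z | (z \in c) && e x z]|.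

(* A set [h.2] with one or two feet hangs by a single edge from the vertex [h.1] of
   the spine [Q] of the comb. *)
Definition hung_ok Q (h : T * {set T}) := [/\ h.1 \in Q, h.2 \subset K, cset e h.2,
  (forall z, z \in h.2 -> z \notin Q) & [/\ 0 < wt feet h.2 <= 2,
  exists2 d0, d0 \in h.2 & e h.1 d0 /\ (forall u, u \in h.2 -> e h.1 u -> u = d0)
  & forall u v, u \in h.2 -> e u v -> [\/ v \in h.2, v \in Q | v \in c]]].

Definition comb_ok Q (dir : seq T) (hung : seq (T * {set T})) :=
  [/\ sorted e Q, uniq Q, {subset Q <= K}, uniq dir &
   [/\ (forall x, x \in dir -> x \in Q /\ 0 < feet x), (forall h, h \in hung -> hung_ok Q h)
     & pairwise (fun h h' : T * {set T} => [disjoint h.2 & h'.2]) hung]].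

(* A piece [(X, x, O)] is a connected set [X] with exactly two feet, the vertex [x]
   through which it is attached to the rest, and a connected set [O] through [x]
   that provides a third foot. *)
Definition piece := ({set T} * T * {set T})%type.
Implicit Types (f : piece) (F : seq piece).

Definition cov F := [set z | has (fun f : piece => z \in f.1.1 :|: f.2) F].

Definition piece_ok Z f := [/\ cset e f.1.1, cset e f.2, [disjoint f.1.1 & f.2],
  f.1.2 \in f.2 & [/\ wt feet f.1.1 = 2, 0 < wt feet f.2, exists2 u, u \in f.1.1 & e u f.1.2,
  exists2 v, v \in Z & e f.1.2 v &
  forall u v, u \in f.1.1 -> e u v -> [\/ v \in f.1.1, v = f.1.2, v \in Z | v \in c]]].

Definition pieces_ok X Z F := [/\ forall f : piece, f \in F -> f.1.1 :|: f.2 \subset X,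
  forall f, f \in F -> piece_ok Z f &
  pairwise (fun f f' : piece => [disjoint f.1.1 :|: f.2 & f'.1.1 :|: f'.2]) F].

Lemma feet1 x y z t : (forall v, e x v -> [\/ v = y, v = z | v = t]) -> y \notin c -> z \notin c ->
  feet x <= (t \in c).
Proof.
move=> all3 yc zc; case: (boolP (t \in c)) => tc.
  apply: leq_trans (_ : #|[set t]| <= 1); last by rewrite cards1.
   apply/subset_leq_card/subsetP=> v; rewrite !inE => /andP[vc xv].
  by case: (all3 v xv) vc => -> //; rewrite ?(negbTE yc) ?(negbTE zc).
rewrite leqn0 cards_eq0; apply/eqP/setP=> v; rewrite !inE; apply/negbTE/negP=> /andP[vc xv].
by case: (all3 v xv) vc => ->; apply/negP.
Qed.

Lemma piece_okS Z Z' f : {subset Z <= Z'} -> piece_ok Z f -> piece_ok Z' f.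
Proof.
move=> sZ [h1 h2 h3 h4 [h5 h6 h7 [v vZ xv] h8]]; split=> //; split=> //; first by exists v; [apply: sZ |].
by move=> u v' uX /(h8 _ _ uX)[h | h | /sZ h | h]; [constructor 1 | constructor 2 | constructor 3 | constructor 4].
Qed.

Lemma cov_sub X Z F : pieces_ok X Z F -> cov F \subset X.
Proof. by case=> h _ _; apply/subsetP=> z; rewrite in_set => /hasP[f /h /subsetP s /s]. Qed.

Lemma cov_cat F F' : cov (F ++ F') = cov F :|: cov F'.
Proof. by apply/setP=> z; rewrite in_setU !in_set has_cat. Qed.

(* What is known of a component [X] of what remains after removing the current
   depth-first search path [rcons Q q]. *)
Definition state Q q X x dir hung := [/\ comb_ok (rcons Q q) dir hung,
  [/\ X \subset K, cset e X, x \in X & e q x], forall z, z \in X -> z \notin rcons Q q,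
  forall u v, u \in X -> e u v -> [\/ v \in X, v \in rcons Q q | v \in c] &
  [/\ forall h : T * {set T}, h \in hung -> [disjoint h.2 & X], 2 < wt feet X & size dir + size hung <= n]].

(** A leaf of the search yields one piece from at most 4 feet, and each item added to the comb, of
    which at most [n - i] remain, costs at most 2 feet: hence the factor. The last clause keeps what
    is left of [X] connected to the search path. *)
Definition found Q q X (i : nat) := exists F, [/\ 0 < size F,
  wt feet X <= (4 + 2 * (n - i)) * size F,
  pieces_ok X ([set z in rcons Q q] :|: X :\: cov F) F & cset e (q |: X :\: cov F)].

(** Apart from [q], the vertex [x] has at most two neighbours, counting feet and branches. As [X]
    has more than two feet and no branch has more than two, some branch has exactly two; it becomes
    the core of a piece, and the rest of [X], through [x], provides the third foot. *)
Lemma found_leaf Q q X x dir hung : state Q q X x dir hung ->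
  (forall y, y \in nb e (X :\ x) x -> wt feet (ccomp e (X :\ x) y) <= 2) ->
  found Q q X (size dir + size hung).
Proof.
move=> [[_ _ QK _ _] [XK cX xX qx] XQ clX [_ wX _]] small.
have qQ : q \in rcons Q q by rewrite mem_rcons mem_head.
have qc := Kc (QK q qQ).
have qX : q \notin X by apply: contraL qQ; apply: XQ.
have bound : feet x + #|nb e (X :\ x) x| <= 2.
  have := @nb_card _ e (cubic_deg3 cub) (X :\ x) x (q |: [set z | (z \in c) && e x z]).
  rewrite cardsU1 !inE (negbTE qc) /= add1n addnS addnC ltnS; apply.
    apply/pred0P=> z /=; rewrite !inE; apply/negP=> /andP[/orP[/eqP-> | /andP[zc _]] /andP[_ zX]].
      by rewrite zX in qX.
    by have := Kc (subsetP XK _ zX); rewrite zc.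
  by move=> y; rewrite !inE => /orP[/eqP-> | /andP[]] //; rewrite -/e esym.
have wD := wtD1 feet xX; have wC := wt_comps esym feet cX xX.
have [y yn wy] : exists2 y, y \in nb e (X :\ x) x & wt feet (ccomp e (X :\ x) y) = 2.
  case: (boolP [exists y in nb e (X :\ x) x, 1 < wt feet (ccomp e (X :\ x) y)]).
    by case/existsP=> y /andP[yn wy]; exists y => //; apply/eqP; rewrite eqn_leq wy small.
  move/existsPn=> no; suff: wt feet X <= 2 by rewrite leqNgt wX.
  rewrite wD; apply: leq_trans bound; rewrite leq_add2l; apply: leq_trans wC _.
  rewrite -sum1_card; apply: leq_sum => y yn; by have := no y; rewrite yn -leqNgt.
have wX4 : wt feet X <= 4.
  have : \sum_(y in nb e (X :\ x) x) wt feet (ccomp e (X :\ x) y) <= 2 * #|nb e (X :\ x) x|.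
    by rewrite mulnC -sum_nat_const; apply: leq_sum.
  by move: wC bound wD; clear; lia.
set X1 := ccomp e (X :\ x) y in wy.
have sX1 : X1 \subset X :\ x by apply: ccomp_sub.
have sX1X := subset_trans sX1 (subsetDl _ _).
have xX1 : x \notin X1 by apply/negP=> /(subsetP sX1); rewrite !inE eqxx.
have yx : y \in X :\ x /\ e x y by move: yn; rewrite in_set => /andP[].
have yX1 : y \in X1 by apply: mem_ccomp; case: yx.
have X1cl u v : u \in X1 -> v \in X -> e u v -> v \in X1 \/ v = x.
  move=> uX1 vX uv; case: (altP (v =P x)) => vx; [by right | left].
  by apply: ccomp_closed uX1 _ uv; rewrite in_setD1 vx.
have cX1 : cset e X1 by apply: ccomp_cset; case: yx.
have cO : cset e (X :\: X1) by apply: cset_diff_comp.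
clearbody X1; pose f : piece := (X1, x, X :\: X1); exists [:: f].
have covE : cov [:: f] = X.
  apply/setP=> z; rewrite in_set /= orbF !inE; case: (boolP (z \in X1)) => //= zX1.
  by rewrite (subsetP sX1X).
rewrite covE setDv !setU0; split=> //; last exact: cset1.
  by rewrite muln1; apply: leq_trans wX4 (leq_addr _ _).
split=> //; move=> f'; rewrite inE => /eqP-> /=.
  by rewrite subUset sX1X subsetDl.
split=> //=.
- by rewrite disjoint_subset; apply/subsetP=> z zX1; rewrite !inE zX1.
- by rewrite inE xX1.
- split=> //.
  + by move: wX; rewrite (wtD feet sX1X) wy; clear; lia.
  + by exists y => //; rewrite esym; case: yx.
  + by exists q; rewrite ?in_set // esym.
  + move=> u v uX1 uv; case: (clX u v (subsetP sX1X _ uX1) uv) => [vX | vQ | vc].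
    * by case: (X1cl u v uX1 vX uv) => h; [constructor 1 | constructor 2].
    * by constructor 3; rewrite in_set.
    * by constructor 4.
Qed.

Lemma found_step Q q X D x i i' : e q x -> x \in X -> D \subset X :\ x ->
  cset e (X :\: D) -> wt feet X <= wt feet D + 2 * (i' - i) -> i <= i' -> i' <= n ->
  found (rcons Q q) x D i' -> found Q q X i.
Proof.
move=> qx xX sD cXD wX ii' i'n [F [F0 wD okF cF]]; have sC := cov_sub okF.
have sDX := subset_trans sD (subsetDl _ _).
have xD : x \notin D by apply/negP=> /(subsetP sD); rewrite !inE eqxx.
have xC : x \notin cov F by apply: contra xD; apply: (subsetP sC).
exists F; split=> //.
- apply: leq_trans wX _; have -> : n - i = n - i' + (i' - i) by move: ii' i'n; clear; lia.
  rewrite mulnDr addnA mulnDl; apply: leq_add => //; by apply: leq_pmulr.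
- case: okF => h1 h2 h3; split=> // f fF; first exact: subset_trans (h1 f fF) sDX.
  apply: piece_okS (h2 f fF) => z /setUP[|/setDP[zD zC]]; last first.
    by rewrite in_setU in_setD zC (subsetP sDX) ?orbT.
  rewrite in_set mem_rcons in_cons => /predU1P[-> | zQ]; last by rewrite in_setU in_set zQ.
  by rewrite in_setU in_setD xC xX orbT.
- have -> : X :\: cov F = (X :\: D) :|: (x |: D :\: cov F).
    apply/setP=> z; rewrite !(in_setU, in_setD, in_set1).
    case: (altP (z =P x)) => [-> | zx] /=; first by rewrite xX xC orbT.
    case: (boolP (z \in D)) => zD /=; first by rewrite (subsetP sDX _ zD).
    by rewrite (contra (subsetP sC z) zD) !andbF orbF.
  apply: (csetU1 esym _ _ qx); last by rewrite in_setU in_setD xD xX.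
  apply: (csetU esym cXD cF (a := x) (b := x)); rewrite ?eqxx ?setU11 //.
  by rewrite in_setD xD.
Qed.

Lemma found_two Q q X D D' x i : e q x -> x \in X -> X = x |: (D :|: D') ->
  [disjoint D & D'] -> x \notin D -> x \notin D' -> wt feet X <= wt feet D + wt feet D' ->
  found (rcons Q q) x D i -> found (rcons Q q) x D' i -> found Q q X i.
Proof.
move=> qx xX XE dD xD xD' wX [F [F0 wD okF cF]] [F' [F0' wD' okF' cF']].
have sC := cov_sub okF; have sC' := cov_sub okF'.
have sDX : D \subset X by rewrite XE; apply/subsetP=> z zD; rewrite !inE zD !orbT.
have sDX' : D' \subset X by rewrite XE; apply/subsetP=> z zD; rewrite !inE zD !orbT.
have xC : x \notin cov (F ++ F').
  by rewrite cov_cat in_setU negb_or (contra (subsetP sC x) xD) (contra (subsetP sC' x) xD').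
have nD z : z \in D -> z \in D' -> False.
  by move=> z1 z2; have /pred0P/(_ z) := dD; rewrite /= z1 z2.
exists (F ++ F'); split=> //.
- by rewrite size_cat addn_gt0 F0.
- by apply: leq_trans wX _; rewrite size_cat mulnDr leq_add.
- case: okF okF' => h1 h2 h3 [h1' h2' h3']; split.
  + move=> f; rewrite mem_cat => /orP[/h1 h | /h1' h]; [exact: subset_trans h sDX | exact: subset_trans h sDX'].
  + have sub z A : z \in [set z in rcons (rcons Q q) x] :|: A ->
        (z \in A -> z \in X :\: cov (F ++ F')) -> z \in [set z in rcons Q q] :|: X :\: cov (F ++ F').
      rewrite in_setU in_set mem_rcons in_cons -orbA => /or3P[/eqP-> _ | zQ _ | zA /(_ zA) h].
      * by rewrite in_setU in_setD xC xX orbT.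
      * by rewrite in_setU in_set zQ.
      * by rewrite in_setU h orbT.
    move=> f; rewrite mem_cat => /orP[/h2 | /h2']; apply: piece_okS => z /sub; apply=> /setDP[zD zC].
      rewrite in_setD (subsetP sDX) // cov_cat in_setU (negbTE zC) andbT /=.
      by apply/negP=> /(subsetP sC')/(nD z zD).
    rewrite in_setD (subsetP sDX') // cov_cat in_setU (negbTE zC) andbT orbF.
    by apply/negP=> /(subsetP sC) zD2; apply: (nD z).
  + rewrite pairwise_cat h3 h3' !andbT; apply/allrelP=> f f' /h1 s1 /h1' s2.
    exact: disjointWl s1 (disjointWr s2 dD).
- have -> : X :\: cov (F ++ F') = (x |: D :\: cov F) :|: (x |: D' :\: cov F').
    apply/setP=> z; rewrite XE cov_cat !(in_setU, in_setD, in_set1).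
    case: (altP (z =P x)) => [-> | zx] /=.
      by rewrite -in_setU -cov_cat xC.
    case: (boolP (z \in D)) => zD /=.
      have zD' : z \notin D' by apply/negP; apply: nD.
      by rewrite (negbTE zD') (negbTE (contra (subsetP sC' z) zD')) !andbF !orbF.
    by rewrite (negbTE (contra (subsetP sC z) zD)) /=.
  apply: (csetU1 esym _ _ qx); last by rewrite in_setU setU11.
  by apply: (csetU esym cF cF' (a := x) (b := x)); rewrite ?eqxx ?setU11.
Qed.

Lemma comb_next Q q X x dir hung : state Q q X x dir hung ->
  comb_ok (rcons (rcons Q q) x) dir hung.
Proof.
move=> [[h1 h2 h3 h4 [h5 h6 h7]] [XK cX xX qx] XQ clX [hX _ _]].
split=> //.
- case: (Q) h1 => [|a s] /=; first by rewrite qx.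
  by move=> h; rewrite rcons_path h last_rcons.
- by rewrite rcons_uniq XQ.
- by move=> z; rewrite mem_rcons in_cons => /predU1P[-> | /h3 //]; apply: (subsetP XK).
split=> //.
- by move=> z /h5[zQ ->]; rewrite mem_rcons in_cons zQ orbT.
- move=> h hh; have [k1 k2 k3 k4 [k5 k6 k7]] := h6 h hh; split=> //.
  + by rewrite mem_rcons in_cons k1 orbT.
  + move=> z zh; rewrite mem_rcons in_cons negb_or k4 // andbT.
    by apply: contraTneq zh => ->; apply/negP=> xh; have /pred0P/(_ x) := hX h hh; rewrite /= xh xX.
  + split=> // u v uh uv; case: (k7 u v uh uv) => [-> | vQ | ->]; [constructor 1 | constructor 2 | constructor 3] => //.
    by rewrite mem_rcons in_cons vQ orbT.
Qed.

Lemma state_next Q q X x y dir hung dir' hung' : state Q q X x dir hung ->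
  y \in nb e (X :\ x) x -> 2 < wt feet (ccomp e (X :\ x) y) ->
  comb_ok (rcons (rcons Q q) x) dir' hung' ->
  (forall h, h \in hung' -> [disjoint h.2 & ccomp e (X :\ x) y]) ->
  size dir' + size hung' <= n ->
  state (rcons Q q) x (ccomp e (X :\ x) y) y dir' hung'.
Proof.
move=> [_ [XK cX xX qx] XQ clX _]; rewrite in_set => /andP[yX xy] wD ok hD le.
set D := ccomp e (X :\ x) y in wD hD *; have sD : D \subset X :\ x by apply: ccomp_sub.
have sDX := subset_trans sD (subsetDl _ _).
have Dcl u v : u \in D -> v \in X -> v != x -> e u v -> v \in D.
  by move=> uD vX vx uv; apply: ccomp_closed uD _ uv; rewrite in_setD1 vx.
have cD : cset e D by apply: ccomp_cset.
have yD : y \in D by apply: mem_ccomp.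
clearbody D; split=> //.
- by split=> //; apply: subset_trans sDX XK.
- move=> z zD; have /setD1P[zx zX] := subsetP sD z zD.
  by rewrite mem_rcons in_cons negb_or zx XQ.
- move=> u v uD uv; case: (clX u v (subsetP sDX _ uD) uv) => [vX | vQ | vc].
  + case: (altP (v =P x)) => [-> | vx]; first by constructor 2; rewrite mem_rcons mem_head.
    by constructor 1; apply: Dcl uv.
  + by constructor 2; rewrite mem_rcons in_cons vQ orbT.
  + by constructor 3.
Qed.

Definition comb := exists Q dir hung, comb_ok Q dir hung /\ size dir + size hung = n.

(** Besides [q] and the branch [D], the vertex [x] has one further neighbour [t]. If [t] is on the
    cycle, [x] is a direct item. If [t] opens a second branch with more than two feet, both are
    searched and their pieces united; a branch with one or two feet is hung on the comb; one without
    feet is passed over. *)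
Theorem search Q q X x dir hung : state Q q X x dir hung ->
  comb \/ found Q q X (size dir + size hung).
Proof.
have [m] := ubnP #|X|; elim: m Q q X x dir hung => // m IHm Q q X x dir hung ltm st.
case: (st) => [[h1 h2 h3 h4 [h5 h6 h7]] [XK cX xX qx] XQ clX [hX wX le]].
move: le; rewrite leq_eqVlt => /predU1P[E | lt_n].
  by left; exists (rcons Q q), dir, hung; split=> //; split.
case: (boolP [exists y in nb e (X :\ x) x, 2 < wt feet (ccomp e (X :\ x) y)]); last first.
  move/existsPn=> no; right; apply: (found_leaf st) => y yn.
  by have := no y; rewrite yn -leqNgt.
case/existsP=> y /andP[yn wy]; have := yn; rewrite in_set => /andP[/setD1P[yx yX] xy].
set D := ccomp e (X :\ x) y in wy.
have sD : D \subset X :\ x by apply: ccomp_sub.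
have xD : x \notin D by apply/negP=> /(subsetP sD); rewrite !inE eqxx.
have sDX := subset_trans sD (subsetDl _ _).
have ltX (A : {set T}) : A \subset X :\ x -> #|A| < m.
  move=> sA; have := subset_leq_card sA; rewrite -ltnS in ltm; move: ltm.
  by rewrite (cardsD1 x X) xX; clear; lia.
have cXD : cset e (X :\: D) by apply: cset_diff_comp.
have qX : q \notin X by apply/negP=> /XQ; rewrite mem_rcons mem_head.
have qK : q \in K by apply: h3; rewrite mem_rcons mem_head.
have xV := subsetP KV _ (subsetP XK _ xX).
have [t [xt tq ty]] := third_nbr cub q y xV.
have xq : e x q by rewrite esym.
have qy : q != y by apply: contraNneq qX => ->.
have all3 v : e x v -> [\/ v = q, v = y | v = t].
  rewrite eq_sym in tq; rewrite eq_sym in ty.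
  by move/(path3_nbrs cub xq xy xt qy tq ty)/or3P=> [] /eqP->; [constructor 1 | constructor 2 | constructor 3].
have yc := Kc (subsetP XK _ yX); have qc := Kc qK.
have fx : feet x <= (t \in c) by apply: feet1 all3 qc yc.
have wXE := wtD1 feet xX.
have okn := comb_next st.
(* As [x] has only the neighbours [q], [y] and [t], what lies outside [D] can only be the component
   of [t]. *)
have rest z : z \in X :\ x -> z \notin D -> [/\ t \in X :\ x, t \notin D & z \in ccomp e (X :\ x) t].
  move=> zX zD; have [|u [v [uc vx uv]]] := ccomp_nbr cX zX; first by apply/set0Pn; exists x; rewrite inE set11.
  move: vx; rewrite inE => /andP[/set1P E _]; subst v; rewrite esym in uv.
  have uX : u \in X :\ x by apply: (subsetP (ccomp_sub _ _ _)) uc.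
  have zu : z \in ccomp e (X :\ x) u by rewrite (ccomp_sym esym uc) mem_ccomp.
  case: (all3 u uv) => E; subst u.
  - by move: uX; rewrite !inE (negbTE qX) andbF.
  - by rewrite zu in zD.
  - split=> //; apply: contra zD => tD; by rewrite /D -(ccomp_sym esym tD).
have IH dir' hung' : comb_ok (rcons (rcons Q q) x) dir' hung' ->
    (forall h, h \in hung' -> [disjoint h.2 & D]) -> size dir' + size hung' <= n ->
    size dir + size hung <= size dir' + size hung' ->
    wt feet X <= wt feet D + 2 * (size dir' + size hung' - (size dir + size hung)) ->
    comb \/ found Q q X (size dir + size hung).
  move=> ok dis le ge w; case: (IHm _ _ _ _ _ _ (ltX _ sD) (state_next st yn wy ok dis le)); first by left.
  by move=> fd; right; apply: (found_step qx xX sD cXD w ge le fd).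
have disD h : h \in hung -> [disjoint h.2 & D].
  by move=> hh; apply: disjointWr sDX (hX h hh).
case: (boolP ((t \in X) && (t \notin D))) => [/andP[tX tD] | tXD]; last first.
  have XE : X :\ x = D.
    apply/eqP; rewrite eqEsubset sD andbT; apply/subsetP=> z zX.
    by apply: contraNT tXD => /(rest z zX)[/setD1P[_ ->] ->].
  rewrite XE in wXE.
  case: (posnP (feet x)) => f0.
    by apply: (IH dir hung) => //; [exact: ltnW | rewrite wXE f0 add0n leq_addr].
  have xdir : x \notin dir.
    apply/negP=> /h5[]; rewrite (negbTE (XQ x xX)) //.
  apply: (IH (x :: dir) hung) => //=; last 1 first.
  - by rewrite wXE; move: fx; case: (t \in c); clear; lia.
  - case: okn => k1 k2 k3 k4 [k5 k6 k7]; split=> //=; first by rewrite xdir.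
    split=> // z; rewrite in_cons => /predU1P[-> | /k5 //].
    by rewrite mem_rcons mem_head.
have tx : t != x by rewrite eq_sym; apply: adj_ne xt.
have tX' : t \in X :\ x by rewrite in_setD1 tx.
have tc := Kc (subsetP XK _ tX).
have f0 : feet x = 0 by apply/eqP; move: fx; rewrite (negbTE tc) leqn0.
set D2 := ccomp e (X :\ x) t in rest.
have sD2 : D2 \subset X :\ x by apply: ccomp_sub.
have tn : t \in nb e (X :\ x) x by rewrite in_set tX'.
have dD : [disjoint D & D2] by apply: ccomp_disj.
have tD2 : t \in D2 by apply: mem_ccomp.
have XE : X :\ x = D :|: D2.
  apply/eqP; rewrite eqEsubset; apply/andP; split; last by rewrite subUset sD sD2.
  apply/subsetP=> z zX; rewrite in_setU; case: (boolP (z \in D)) => //= zD.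
  by case: (rest z zX zD).
rewrite XE wtU // f0 add0n in wXE.
have xD2 : x \notin D2 by apply/negP=> /(subsetP sD2); rewrite !inE eqxx.
case: (ltnP 2 (wt feet D2)) => w2.
  have dis2 h : h \in hung -> [disjoint h.2 & D2].
    by move=> hh; apply: disjointWr (subset_trans sD2 (subsetDl _ _)) (hX h hh).
  case: (IHm _ _ _ _ _ _ (ltX _ sD) (state_next st yn wy okn disD (ltnW lt_n))); first by left.
  case: (IHm _ _ _ _ _ _ (ltX _ sD2) (state_next st tn w2 okn dis2 (ltnW lt_n))); first by left.
  move=> fd2 fd1; right; apply: (@found_two Q q X D D2 x) => //; last by rewrite wXE.
  by rewrite -XE setD1K.
case: (posnP (wt feet D2)) => w0.
  by apply: (IH dir hung) => //; [exact: ltnW | rewrite wXE w0 addn0 leq_addr].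
have D2cl u v : u \in D2 -> v \in X :\ x -> e u v -> v \in D2 by apply: ccomp_closed.
apply: (IH dir ((x, D2) :: hung)) => /=; last 1 first.
- by rewrite wXE leq_add2l; move: w2; clear; lia.
- case: okn => k1 k2 k3 k4 [k5 k6 k7]; split=> //=; split=> //=; last first.
    rewrite k7 andbT; apply/allP=> h hh /=; rewrite disjoint_sym.
    exact: disjointWr (subset_trans sD2 (subsetDl _ _)) (hX h hh).
  move=> h; rewrite in_cons => /predU1P[-> | /k6 //]; split=> /=.
  + by rewrite mem_rcons mem_head.
  + exact: subset_trans sD2 (subset_trans (subsetDl _ _) XK).
  + exact: ccomp_cset.
  + move=> z /(subsetP sD2)/setD1P[zx zX]; by rewrite mem_rcons in_cons negb_or zx XQ.
  + split; first by rewrite w0 w2.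
      exists t => //; split=> // u uD xu; case: (all3 u xu) => E //; subst u.
        by have /setD1P[_] := subsetP sD2 _ uD; rewrite (negbTE qX).
      by have /pred0P/(_ y) := dD; rewrite /= uD /D mem_ccomp // !inE yx.
    move=> u v uD uv; have /setD1P[_ uX] := subsetP sD2 _ uD.
    case: (clX u v uX uv) => [vX | vQ | vc]; [|constructor 2; by rewrite mem_rcons in_cons vQ orbT | by constructor 3].
    case: (altP (v =P x)) => [-> | vx]; first by constructor 2; rewrite mem_rcons mem_head.
    by constructor 1; apply: D2cl uD _ uv; rewrite in_setD1 vx.
- move=> h; rewrite in_cons => /predU1P[-> /= | /disD //]; by rewrite disjoint_sym.
- by rewrite addnS.
- by rewrite addnS leqnSn.
Qed.

End Search.

(** * A cycle with many feet *)

Section Diameter.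
Variables (T : finType) (G : graph T).
Hypotheses (cub : cubic G) (con3 : n_connected 3 G).
Let e := adj G.
Let V := vset G.
Let esym : symmetric e := @adj_sym T G.
Implicit Types (A B K S X : {set T}).

Lemma dist_path x y P : is_xy_path G x y P -> dist G x y <= plen P.
Proof.
move=> pP; rewrite leqNgt; apply/negP=> lt; move: (lt); rewrite /dist => /(before_find 0).
have ltN : plen P < #|V|.
  by apply: leq_trans lt _; rewrite -[X in _ <= X](size_iota 0); apply: find_size.
rewrite nth_iota // add0n => /negbT/existsPn/(_ (in_tuple (steps P)))/negP; apply.
case/and3P: (pP) => _ /eqP sP _; by move: pP; rewrite -sP; case: (P).
Qed.

Lemma diameter_dist D : 0 < D -> D <= diameter G ->
  exists x y, [/\ x \in V, y \in V & D <= dist G x y].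
Proof.
move=> D0; case: (boolP [exists x in V, exists y in V, D <= dist G x y]).
  by case/existsP=> x /andP[xV /existsP[y /andP[yV le]]] _; exists x, y.
move/existsPn=> no; rewrite leqNgt => /negP[]; rewrite -[D]prednK // ltnS.
apply/bigmax_leqP=> x xV; apply/bigmax_leqP=> y yV; rewrite -ltnS prednK // ltnNge.
by have := no x; rewrite xV => /existsPn/(_ y); rewrite yV.
Qed.

Lemma con3_cset S : #|S| <= 2 -> cset e (V :\: S).
Proof.
move=> S2; apply/csetP=> x y /setDP[xV xS] /setDP[yV yS]; case: con3 => _ /(_ (S :&: V)) [].
- exact: subsetIr.
- by rewrite ltnS; apply: leq_trans S2; apply/subset_leq_card/subsetIl.
move=> _ /(_ x y); rewrite !in_setD !in_setI (negbTE xS) (negbTE yS) xV yV => /(_ isT isT).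
apply: connect_sub => u v /and3P[uv uS vS]; apply: connect1.
have [uV vV] := adj_V uv; move: uS vS; rewrite !in_setI uV vV !andbT => uS vS.
by rewrite restrE (uv : e u v) !in_setD uS vS uV vV.
Qed.

(** A separator of at most two vertices, with [s] and [t] taken out of it, would separate [s] from
    [t] in [G]; they are not adjacent, so a path between them avoiding it has inner vertices and
    yields a path between the neighbourhoods. *)
Lemma three_paths s t : s \in V -> t \in V -> s != t -> ~~ e s t ->
  linked (restr e (V :\: [set s; t])) 3 [set y | e s y] [set y | e t y].
Proof.
move=> sV tV st nst; apply: menger => S sepS; rewrite leqNgt; apply/negP=> S2.
pose S' := S :\: [set s; t].
have cV : cset e (V :\: S').
  by apply: con3_cset; apply: leq_trans (subset_leq_card (subsetDl _ _)) _; rewrite -ltnS.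
have [sV' tV'] : s \in V :\: S' /\ t \in V :\: S' by rewrite !inE !eqxx ?orbT.
have [p [sp lp up pV]] := cset_path cV sV' tV'.
case/lastP: p sp lp up pV => [_ /= E | p t']; first by rewrite E eqxx in st.
rewrite last_rcons => + E; subst t'; rewrite rcons_path => /andP[sp lt] up pV.
case: p sp lt up pV => [_ /= | y p /= /andP[sy yp] lt up pV]; first by rewrite (negbTE nst).
have pW z : z \in y :: p -> z \in V :\: [set s; t] /\ z \notin S.
  move=> zp; have /setDP[zV zS'] : z \in V :\: S' by apply: pV; rewrite -[_ :: _]/(s :: rcons (y :: p) t) mem_ends zp !orbT.
  have zst : z \notin [set s; t].
    have : uniq (s :: rcons (y :: p) t) by exact: up.
    rewrite uniq_ends => /and4P[_ sp' tp' _].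
    by rewrite !inE negb_or; apply/andP; split; [apply: contraNneq sp' | apply: contraNneq tp'] => <-.
  by split; [rewrite in_setD zst | move: zS'; rewrite in_setD zst].
have : pth (restr e (V :\: [set s; t])) [set y | e s y] [set y | e t y] (y :: p).
  rewrite /= !in_set sy esym lt !andbT; apply: restr_path => //.
    by case: (pW y (mem_head _ _)).
  by apply/allP=> z zp; case: (pW z) => //; rewrite in_cons zp orbT.
by move/sepS/hasP=> [z /pW[_ /negP]].
Qed.

(** The two paths from [s] to [t] form the cycle. Different vertices of [g] with a neighbour in [K]
    account for different edges, hence the lower bound on the feet of [K]. *)
Lemma rails_cycle s t g R K : path e s (rcons g t) -> uniq (s :: rcons g t) ->
  pth e [set y | e s y] [set y | e t y] R -> uniq R ->
  (forall z, z \in R -> z \notin s :: rcons g t) ->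
  (forall z, z \in K -> z \notin s :: rcons g t /\ z \notin R) ->
  (forall u v, u \in K -> e u v -> [\/ v \in K, v \in s :: rcons g t | v \in R]) ->
  let c := s :: rcons g t ++ rev R in
  [/\ is_cycle G c, forall z, z \in K -> z \notin c,
      forall u v, u \in K -> e u v -> v \in K \/ v \in c &
      #|[set y in g | [exists z in K, e y z]]| <= wt (feet G c) K].
Proof.
move=> pg ug pR uR Rg KgR clK c.
have cE z : (z \in c) = (z \in s :: rcons g t) || (z \in R).
  by rewrite /c -cat_cons mem_cat mem_rev.
split.
- case: R pR uR Rg KgR clK @c cE => // x p /and3P[xp]; rewrite !in_set => sx lx uR Rg KgR clK c cE.
  apply/and3P; split.
  + by rewrite /= size_cat size_rcons size_rev /=; clear; lia.
  + have rp : path e (last x p) (rev (belast x p)).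
      by rewrite rev_path (eq_path (e' := e)) // => u v; rewrite esym.
    rewrite -/e /c /= rcons_cat cat_path pg last_rcons lastI rev_rcons /= lx rcons_path rp /=.
    have -> : last (last x p) (rev (belast x p)) = x; last by rewrite esym.
    by case: (p) => //= a q; rewrite rev_cons last_rcons.
  + rewrite /c -cat_cons cat_uniq ug rev_uniq uR andbT; apply/hasPn=> z; rewrite mem_rev.
    exact: Rg.
- by move=> z /KgR[h1 h2]; rewrite cE negb_or h1.
- by move=> u v uK /(clK _ _ uK)[h | h | h]; [left | right; rewrite cE h | right; rewrite cE h orbT].
- set S := [set y in g | _]; have -> : #|S| = wt (fun=> 1) S by rewrite /wt sum1_card.
  apply: (@leq_trans (\sum_(x in K) wt (fun=> 1) [set z | (z \in c) && e x z])).
    apply: wt_cover => y; rewrite in_set => /andP[yg /existsP[z /andP[zK yz]]]; exists z => //.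
    by rewrite in_set cE mem_ends yg !orbT /= esym.
  by apply: leq_sum => x _; rewrite /wt sum1_card.
Qed.

Lemma rail_comp (R R' l : seq T) x : pth e V V (x :: R) ->
  {subset x :: R <= V} -> (forall z, z \in x :: R -> z \notin l /\ z \notin R') ->
  let K := ccomp e (V :\: ([set z in l] :|: [set z in R'])) x in
  [/\ cset e K, {subset x :: R <= K}, (forall z, z \in K -> [/\ z \in V, z \notin l & z \notin R']),
     (forall u v, u \in K -> e u v -> [\/ v \in K, v \in l | v \in R']) &
     forall u v, u \in K -> v \in V -> v \notin l -> v \notin R' -> e u v -> v \in K].
Proof.
move=> /and3P[xR _ _] RV Rl K.
have inW z : (z \in V :\: ([set z in l] :|: [set z in R'])) = [&& z \in V, z \notin l & z \notin R'].
  by rewrite !inE negb_or andbC.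
have xW : x \in V :\: ([set z in l] :|: [set z in R']).
  by rewrite inW RV ?mem_head //; have [-> ->] := Rl x (mem_head _ _).
have cl u v : u \in K -> v \in V -> v \notin l -> v \notin R' -> e u v -> v \in K.
  by move=> uK vV vl vR uv; apply: ccomp_closed uK _ uv; rewrite inW vV vl.
have KW z : z \in K -> [&& z \in V, z \notin l & z \notin R'].
  by move/(subsetP (ccomp_sub _ _ _)); rewrite inW.
split=> //.
- exact: ccomp_cset.
- move=> z zR; have xK : x \in K by apply: mem_ccomp.
  have sub : {subset x :: R <= V :\: ([set z in l] :|: [set z in R'])}.
    by move=> y yR; rewrite inW RV //; have [-> ->] := Rl y yR.
  rewrite in_set sub //=; case/splitPl: zR xR sub => p1 p2 <-; rewrite cat_path => /andP[xp1 _] sub.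
  apply: path_conn => // y yp; apply: sub; move: yp; rewrite !in_cons mem_cat.
  by case/orP=> ->; rewrite ?orbT.
- by move=> z /KW/and3P[].
- move=> u v uK uv; have [_ vV] := adj_V uv.
  case: (boolP (v \in l)) => vl; first by constructor 2.
  case: (boolP (v \in R')) => vR; first by constructor 3.
  by constructor 1; apply: cl uv.
Qed.

(** One of three disjoint paths is made non-separating, with the other two as anchors. All its inner
    vertices then have a neighbour in [K2] or [K3], the components around the other two paths; one
    of these sets sees at least half of them, and the remaining path closes up the cycle. *)
Lemma long_cycle s t D : s \in V -> t \in V -> 1 < D ->
  (forall P, is_xy_path G s t P -> D <= plen P) ->
  exists c K, [/\ is_cycle G c, cset e K /\ K \subset V, forall z, z \in K -> z \notin c,
     forall u v, u \in K -> e u v -> v \in K \/ v \in c & D.-1 <= 2 * wt (feet G c) K].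
Proof.
move=> sV tV D1 far.
have st : s != t.
  apply/eqP=> E; have := far (VPath s [::]); rewrite /is_xy_path /is_path /tgt /= sV E eqxx /plen /=.
  by move=> /(_ isT); move: D1; clear; lia.
have nst : ~~ e s t.
  apply/negP=> e_st; have := far (VPath s [:: t]).
  rewrite /is_xy_path /is_path /tgt /= sV -/e e_st !inE st !eqxx /plen /= => /(_ isT).
  by move: D1; clear; lia.
have [ps [szps alps pwps]] := three_paths sV tV st nst.
have mk R : pth (restr e (V :\: [set s; t])) [set y | e s y] [set y | e t y] R ->
    exists x R', [/\ path e x R', e s x, e t (last x R'), uniq (x :: R') &
      {subset x :: R' <= R} /\ (forall z, z \in x :: R' -> z \in V :\: [set s; t])].
  case: R => // x p /and3P[xp]; rewrite !in_set => sx.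
  case/shortenP: xp => R' xR uR sR lR; have [h1 /allP h2] := andP (path_restr xR).
  exists x, R'; split=> //; split.
    by move=> z; rewrite !in_cons => /predU1P[->|/sR ->]; rewrite ?eqxx ?orbT.
  move=> z; rewrite in_cons => /predU1P[-> | /h2 //]; have [_ xV] := adj_V sx.
  rewrite in_setD xV andbT !inE negb_or; apply/andP; split; first by rewrite eq_sym; exact: adj_ne sx.
  by apply: contraNneq nst => <-.
case: ps szps alps pwps => [|q1 [|q2 [|q3 [|]]]] //= _ /and4P[p1 p2 p3 _] /and3P[/and3P[d12 d13 _] /andP[d23 _] _].
have [x1 [R1 [e1 sx1 tx1 u1 [s1 w1]]]] := mk _ p1.
have [x2 [R2 [e2 sx2 tx2 u2 [s2 w2]]]] := mk _ p2.
have [x3 [R3 [e3 sx3 tx3 u3 [s3 w3]]]] := mk _ p3.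
have {}d12 := dsjS s1 s2 d12; have {}d13 := dsjS s1 s3 d13; have {}d23 := dsjS s2 s3 d23.
have wst (R : seq T) z : (forall z, z \in R -> z \in V :\: [set s; t]) -> z \in R ->
    [/\ z \in V, z != s & z != t].
  by move=> w /w; rewrite !inE negb_or => /andP[/andP[-> ->] ->].
pose A0 := [set z in x2 :: R2] :|: [set z in x3 :: R3].
have A0V : A0 \subset V.
  by apply/subsetP=> z; rewrite !in_setU !in_set => /orP[/(wst _ _ w2)[] | /(wst _ _ w3)[]].
have inA0 z : (z \in A0) = (z \in x2 :: R2) || (z \in x3 :: R3) by rewrite in_setU !in_set.
have sA0 : s \notin A0.
  by rewrite inA0; apply/negP=> /orP[/(wst _ _ w2)[_] | /(wst _ _ w3)[_]]; rewrite eqxx.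
have tA0 : t \notin A0.
  by rewrite inA0; apply/negP=> /orP[/(wst _ _ w2)[_ _] | /(wst _ _ w3)[_ _]]; rewrite eqxx.
have x2A : x2 \in A0 by rewrite inA0 mem_head.
(* The three vertices [s], [t], [x2] lie outside [X]. With at most two neighbours of [X], one of the
   three is not a neighbour and would be separated from [X]. *)
have C3 X : X != set0 -> X \subset V -> [disjoint X & s |: (t |: A0)] -> cset e X ->
    2 < #|nbrs e V X|.
  move=> /set0Pn[x xX] XV /pred0P dX _; rewrite ltnNge; apply/negP=> le2.
  have [y yo yn] : exists2 y, y \in [:: s; t; x2] & y \notin nbrs e V X.
    case: (boolP (has (predC [in nbrs e V X]) [:: s; t; x2])) => [/hasP[y] | /hasPn H]; first by exists y.
    suff: 3 <= #|nbrs e V X| by rewrite ltnNge le2.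
    apply: leq_trans (_ : #|[set z in [:: s; t; x2]]| <= _).
      have [_ xs xt] := wst _ x2 w2 (mem_head _ _).
      by rewrite cardsE (card_uniqP _) //= !inE negb_or st (eq_sym s) xs (eq_sym t) xt.
    by apply/subset_leq_card/subsetP=> z; rewrite in_set => /H; rewrite negbK.
  have yX : y \notin X.
    apply/negP=> yX; have := dX y; rewrite /= yX /= !in_setU1 in_setU.
    by move: yo; rewrite !inE => /or3P[] /eqP->; rewrite ?eqxx ?orbT.
  have yV : y \in V.
    move: yo; rewrite !inE => /or3P[] /eqP-> //; by case: (wst _ x2 w2 (mem_head _ _)).
  apply: (@no_cut T G con3 X (nbrs e V X) x y) => //.
  - exact: (subsetP XV).
  - by rewrite in_set xX andbF.
  - move=> u v uX uv; case: (boolP (v \in X)) => vX; [by left | right].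
    have [_ vV] := adj_V uv; rewrite in_set vV vX; apply/existsP; exists u; by rewrite uX.
have st0 : stpath e V A0 s t (s :: rcons (x1 :: R1) t).
  apply/and5P; split=> //.
  - by rewrite /= last_rcons.
  - by rewrite /= rcons_path e1 sx1 esym tx1.
  - apply/andP; split.
      rewrite cons_uniq rcons_uniq u1 andbT mem_rcons in_cons negb_or st /=.
      by apply/andP; split; apply/negP=> /(wst _ _ w1)[_]; rewrite ?eqxx.
    apply/allP=> z; rewrite mem_ends => /or3P[/eqP-> | /eqP-> | zR].
    + by rewrite in_setD sA0.
    + by rewrite in_setD tA0.
    + have [zV _ _] := wst _ _ w1 zR; rewrite in_setD zV andbT inA0; apply/negP=> /orP[z2 | z3].
        by have /pred0P/(_ z) := d12; rewrite /= zR z2.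
      by have /pred0P/(_ z) := d13; rewrite /= zR z3.
have [l [lP anc nbr]] := @nonsep T e esym V A0 s t A0V C3 _ st0.
case/and5P: lP => l0 /eqP hl /eqP ll sl /andP[ul /allP lU].
case: l l0 hl ll sl ul lU anc nbr => // x0 g _ /= -> {x0}.
case/lastP: g => [/= E | g t']; first by rewrite E eqxx in st.
rewrite last_rcons => E; subst t'; move=> sl ul lU anc nbr.
have ul' : uniq (s :: rcons g t) by exact: ul.
have szg : D.-1 <= size g.
  have := far (VPath s (rcons g t)); rewrite /plen /= size_rcons => h.
  have {}h : D <= (size g).+1.
    by apply: h; apply: xy_pathI => //; rewrite last_rcons.
  by move: h; clear; lia.
have lA0 z : z \in s :: rcons g t -> z \notin A0 by move/lU; rewrite in_setD => /andP[].
have R2l z : z \in x2 :: R2 -> z \notin s :: rcons g t /\ z \notin x3 :: R3.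
  move=> zR; split; first by apply/negP=> /lA0; rewrite inA0 zR.
  by apply/negP=> z3; have /pred0P/(_ z) := d23; rewrite /= zR z3.
have R3l z : z \in x3 :: R3 -> z \notin s :: rcons g t /\ z \notin x2 :: R2.
  move=> zR; split; first by apply/negP=> /lA0; rewrite inA0 zR orbT.
  by apply/negP=> z3; have /pred0P/(_ z) := d23; rewrite /= zR z3.
have V2 : {subset x2 :: R2 <= V} by move=> z /(wst _ _ w2)[].
have V3 : {subset x3 :: R3 <= V} by move=> z /(wst _ _ w3)[].
have pV (x : T) R : path e x R -> {subset x :: R <= V} -> pth e V V (x :: R).
  by move=> h1 h2; rewrite /= h1 !h2 ?mem_head ?mem_last.
have := rail_comp (pV _ _ e2 V2) V2 R2l; set K2 := ccomp _ _ _; case=> cK2 RK2 K2l K2c K2c'.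
have := rail_comp (pV _ _ e3 V3) V3 R3l; set K3 := ccomp _ _ _; case=> cK3 RK3 K3l K3c K3c'.
clearbody K2 K3.
(* Everything anchored is reached from one of the two paths off [l]. A walk that leaves [K2] does so
   by running into the third path, which lies in [K3], and conversely. *)
have cover y : y \in g -> (exists2 z, z \in K2 & e y z) \/ (exists2 z, z \in K3 & e y z).
  move=> yg; have ys : y != s.
    apply: contraTneq yg => ->; by case/andP: ul; rewrite mem_rcons in_cons negb_or => /andP[].
  have yt : y != t by apply: contraTneq yg => ->; case/andP: ul => _; rewrite rcons_uniq => /andP[].
  have yl : y \in s :: rcons g t by rewrite mem_ends yg !orbT.
  have [z zo yz] := nbr y yl ys yt.
  have := anc z zo; rewrite in_set => /andP[_ /existsP[a /andP[aA az]]].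
  suff: z \in K2 :|: K3 by case/setUP=> zK; [left | right]; exists z.
  have zV : z \in V by move: zo; rewrite in_set => /andP[].
  apply: (@connect_stable _ e _ [in K2 :|: K3] a z _ az).
    move=> u v uo; rewrite in_set => /andP[vV vl] uv; rewrite !in_setU.
    case/orP=> uK.
      case: (boolP (v \in x3 :: R3)) => [/RK3-> | v3]; first by rewrite orbT.
      by rewrite (K2c' u v).
    case: (boolP (v \in x2 :: R2)) => [/RK2-> // | v2].
    by rewrite (K3c' u v) ?orbT.
  by move: aA; rewrite inA0 in_setU => /orP[/RK2-> | /RK3->]; rewrite ?orbT.
have ug : uniq g by case/andP: ul => _; rewrite rcons_uniq => /andP[].
have szc : size g <= #|[set y in g | [exists z in K2, e y z]]| + #|[set y in g | [exists z in K3, e y z]]|.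
  have -> : size g = #|[set y in g]| by rewrite cardsE; symmetry; apply/card_uniqP.
  apply: leq_trans (leq_card_setU _ _); apply/subset_leq_card/subsetP=> y.
  rewrite in_setU !in_set => yg; rewrite yg.
  case: (cover y yg) => -[z zK yz]; apply/orP; [left | right]; apply/existsP; exists z; by rewrite zK.
have [c2a c2b c2c c2d] := rails_cycle sl ul' (R := x3 :: R3) (K := K2) ltac:(by rewrite /= e3 !in_set sx3 tx3) u3
  (fun z zR => (R3l z zR).1) (fun z zK => let: And3 _ a b := K2l z zK in conj a b) K2c.
have [c3a c3b c3c c3d] := rails_cycle sl ul' (R := x2 :: R2) (K := K3) ltac:(by rewrite /= e2 !in_set sx2 tx2) u2
  (fun z zR => (R2l z zR).1) (fun z zK => let: And3 _ a b := K3l z zK in conj a b) K3c.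
case: (leqP #|[set y in g | [exists z in K3, e y z]]| #|[set y in g | [exists z in K2, e y z]]|) => h.
  exists (s :: rcons g t ++ rev (x3 :: R3)), K2; split=> //.
    by split=> //; apply/subsetP=> z /K2l[].
  by move: szg szc c2d h; clear; lia.
exists (s :: rcons g t ++ rev (x2 :: R2)), K3; split=> //.
  by split=> //; apply/subsetP=> z /K3l[].
by move: szg szc c3d h; clear; lia.
Qed.

End Diameter.

(** * Combs *)

Section Tools.
Variables (T : finType) (G : graph T).
Hypotheses (cub : cubic G) (con3 : n_connected 3 G).
Let e := adj G.
Let esym : symmetric e := @adj_sym T G.
Implicit Types (A D L R X Y M : {set T}) (c P Q : seq T).

(** The outermost feet on [P] are joined behind [P] through their own sets and the connected set
    [M]. This sacrifices two items; the others keep their feet on the new cycle, with indices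
    shifted by a constant. *)
Lemma return_cycle P (I : finType) (J : {set I}) (a : I -> T) (E : I -> {set T}) M :
  sorted e P -> uniq P -> (forall j, j \in J -> a j \in P) -> {in J &, injective a} ->
  (forall j, j \in J -> [/\ cset e (E j), sees G (E j) (a j) & exists2 u, u \in E j & sees G M u]) ->
  cset e M -> (forall z, z \in M -> z \notin P) ->
  (forall j z, j \in J -> z \in E j -> z \notin P) -> 1 < #|J| ->
  exists c i0 i1, [/\ is_cycle G c, i0 \in J /\ i1 \in J,
    forall z, z \in c -> [\/ z \in P, z \in E i0, z \in E i1 | z \in M],
    forall j, j \in J -> index (a i0) P <= index (a j) P <= index (a i1) P &
    forall z, z \in P -> index (a i0) P <= index z P <= index (a i1) P ->
      z \in c /\ index z c = index z P - index (a i0) P].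
Proof.
move=> sP uP aP ainj EP cM MP EPd J1.
have [i0 i0J min0] := ex_min (fun j => index (a j) P) (ltnW J1).
have [i1 i1J max1] := ex_min (fun j => size P - index (a j) P) (ltnW J1).
have ltP j : j \in J -> index (a j) P < size P by move=> jJ; rewrite index_mem aP.
have [x0 _] : exists x : T, x \in P by exists (a i0); apply: aP.
have idx x y : x \in P -> y \in P -> index x P = index y P -> x = y.
  by move=> xP yP /(congr1 (nth x0 P)); rewrite !nth_index.
have {}max1 j : j \in J -> index (a j) P <= index (a i1) P.
  by move=> jJ; have := max1 j jJ; have := ltP j jJ; have := ltP i1 i1J; clear; lia.
have lt01 : index (a i0) P < index (a i1) P.
  have [j jJ ji0] : exists2 j, j \in J & j != i0.
    have : 0 < #|J :\ i0| by move: J1; rewrite (cardsD1 i0 J) i0J.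
    by rewrite card_gt0 => /set0Pn[j /setD1P[ne jJ]]; exists j.
  apply: leq_trans (max1 j jJ); rewrite ltn_neqAle min0 // andbT.
  apply: contra ji0 => /eqP E0; apply/eqP; apply: ainj => //.
  by symmetry; apply: idx E0; apply: aP.
have [cE0 s0 [u0 u0E m0]] := EP i0 i0J; have [cE1 s1 [u1 u1E m1]] := EP i1 i1J.
case/existsP: m0 => v0 /andP[v0M uv0]; case/existsP: m1 => v1 /andP[v1M uv1].
have {}uv0 : e u0 v0 by []; have {}uv1 : e u1 v1 by [].
have cY : cset e (E i0 :|: M :|: E i1).
  apply: (csetU esym _ cE1 (a := v1) (b := u1)); rewrite ?in_setU ?v1M ?orbT //.
    by apply: (csetU esym cE0 cM u0E v0M); rewrite uv0 orbT.
  by rewrite esym uv1 orbT.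
have YP z : z \in E i0 :|: M :|: E i1 -> z \notin P.
  by case/setUP=> [/setUP[] |]; [apply: EPd | apply: MP | apply: EPd].
have [||q [qY cyc]] := sub_cycle (x0 := x0) sP uP lt01 (ltP i1 i1J) cY YP.
- by rewrite nth_index ?aP //; apply: seesS s0; apply/subsetP=> z zE; rewrite !inE zE.
- by rewrite nth_index ?aP //; apply: seesS s1; apply/subsetP=> z zE; rewrite !inE zE !orbT.
set s := take _ _ in cyc; exists (s ++ q), i0, i1.
have sE : s = drop (index (a i0) P) (take (index (a i1) P).+1 P).
  by rewrite /s take_drop; congr drop; congr take; move: lt01; clear; lia.
have us : uniq s by apply/take_uniq/drop_uniq.
split=> //.
- move=> z; rewrite mem_cat => /orP[/mem_take/mem_drop | /qY]; first by constructor 1.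
  by case/setUP=> [/setUP[] |]; [constructor 2 | constructor 4 | constructor 3].
- by move=> j jJ; rewrite min0 ?max1.
- move=> z zP zidx.
  have zs : z \in s.
    have : z \in arc P (index (a i0) P) (index (a i1) P) by rewrite mem_arc // zP.
    by rewrite /arc in_set -sE.
  rewrite mem_cat zs index_cat zs; split=> //.
  have zP' : index z s < size s by rewrite index_mem.
  have zd : index z s < size (drop (index (a i0) P) P).
    by apply: leq_trans zP' _; rewrite /s size_take; case: ltnP => // /ltnW.
  have : nth x0 P (index (a i0) P + index z s) = z.
    rewrite -nth_drop -[RHS](nth_index x0 zs) /s nth_take //.
    by apply: leq_trans zP' _; rewrite /s size_take; case: ltnP.
  move/(congr1 (index^~ P)); rewrite index_uniq //; last by move: zd; rewrite size_drop ltn_subRL.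
  by move=> <-; rewrite addKn.
Qed.

Lemma ear_thru q L R u1 u2 : [disjoint L & R] -> q \notin L -> q \notin R ->
  cset e (q |: L) -> cset e (q |: R) -> u1 \in q |: L -> u2 \in q |: R ->
  thru e (q |: (L :|: R)) u1 u2 [:: q].
Proof.
move=> dLR qL qR cL cR u1L u2R.
have [p1 [h1 h2 h3 h4 h5]] := thru_cset cL u1L (setU11 q L).
have [p2 [k1 k2 k3 k4 k5]] := thru_cset cR (setU11 q R) u2R.
have p2R z : z \in p2 -> z \in R.
  move=> zp; have /setU1P[E | //] : z \in q |: R by apply: k4; rewrite in_cons zp orbT.
  by move: k3; rewrite cons_uniq -E zp.
exists (p1 ++ p2); split.
- by rewrite cat_path h1 h2.
- by rewrite last_cat h2.
- rewrite -cat_cons cat_uniq h3; apply/andP; split=> //; apply/andP; split; last by case/andP: k3.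
  apply/hasPn=> z /p2R zR; apply/negP=> /h4/setU1P[E | zL]; first by rewrite E (negbTE qR) in zR.
  by have /pred0P/(_ z) := dLR; rewrite /= zL zR.
- move=> z; rewrite -cat_cons mem_cat => /orP[/h4/setU1P[-> | zL] | /p2R zR];
    by rewrite !inE ?eqxx ?zL ?zR ?orbT.
- by move=> z; rewrite inE => /eqP->; rewrite -cat_cons mem_cat h5 // !inE eqxx orbT.
Qed.

Section Splice.
Variables (Q : seq T) (I : eqType) (D : I -> {set T}) (q u1 u2 : I -> T) (l r : I -> nat) (x0 : T).
Hypotheses (sQ : sorted e Q) (uQ : uniq Q).

(** Disjoint stretches of [Q] are replaced by detours through the sets [D j], so that a single path
    visits all the vertices [q j]. Consecutive stretches may share an end. *)
Lemma splice (s : seq I) m : m < size Q ->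
  (forall j, j \in s -> [/\ l j < r j, r j < size Q, thru e (D j) (u1 j) (u2 j) [:: q j],
     e (nth x0 Q (l j)) (u1 j) & e (u2 j) (nth x0 Q (r j))]) ->
  (forall j z, j \in s -> z \in D j -> z \notin Q) ->
  (forall i j z, i \in s -> j \in s -> z \in D i -> z \in D j -> i = j) -> uniq s ->
  (if s is j :: _ then m <= l j else true) -> sorted (fun i j => r i <= l j) s ->
  exists y, thru e (arc Q m (size Q) :|: [set z | has (fun j => z \in D j) s])
    (nth x0 Q m) y (map q s).
Proof.
elim: s m => [|j s IHs] m mQ ok DQ dis us ml so.
  exists (nth x0 Q (size Q).-1).
  have cA := cset_arc esym m (size Q) sQ.
  apply: (thru_sub (A := arc Q m (size Q)) (F := [:: nth x0 Q m; nth x0 Q (size Q).-1])) => //.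
    by apply: subsetUl.
  by apply: thru_cset cA _ _; apply: nth_arc; rewrite // ?leqnn //=; move: mQ; clear; lia.
have [lr rQ thj el er] := ok j (mem_head _ _).
have [|||||| y thy] := IHs (r j) rQ.
- by move=> i si; apply: ok; rewrite in_cons si orbT.
- by move=> i z si; apply: DQ; rewrite in_cons si orbT.
- by move=> i i' z si si'; apply: dis; rewrite in_cons ?si ?si' orbT.
- by case/andP: us.
- by case: (s) so => //= i s' /andP[].
- by apply: path_sorted so.
exists y; have lQ : l j < size Q := ltn_trans lr rQ.
have arcQ a b z : z \in arc Q a b -> z \in Q by apply: arc_sub.
have t1 : thru e (arc Q m (l j)) (nth x0 Q m) (nth x0 Q (l j)) [:: nth x0 Q m; nth x0 Q (l j)].
  by apply: thru_cset; [exact: cset_arc | apply: nth_arc | apply: nth_arc]; rewrite ?leqnn // ?ml.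
have t2 := thru_cat (B := D j) _ el t1 thj.
have {}t2 := t2 _.
have d1 : [disjoint arc Q m (l j) & D j].
  apply/pred0P=> z /=; apply/negP=> /andP[/arcQ zQ zD].
  by have := DQ j z (mem_head _ _) zD; rewrite zQ.
have {}t2 := t2 d1.
have d2 : [disjoint arc Q m (l j) :|: D j & arc Q (r j) (size Q) :|: [set z | has (fun i => z \in D i) s]].
  apply/pred0P=> z /=; apply/negP=> /andP[/setUP[za | zD] /setUP[zb | zh]].
  - move: za zb; rewrite !mem_arc // => /and3P[_ _ h1] /and3P[_ h2 _].
    by move: (leq_trans h2 h1); rewrite leqNgt lr.
  - move: zh; rewrite in_set => /hasP[i si zi].
    by have := DQ i z; rewrite in_cons si orbT (arcQ _ _ _ za) => /(_ isT zi).
  - by have := DQ j z (mem_head _ _) zD; rewrite (arcQ _ _ _ zb).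
  - move: zh; rewrite in_set => /hasP[i si zi].
    have E : j = i by apply: (dis j i z) => //; rewrite in_cons ?eqxx ?si ?orbT.
    by move: us; rewrite cons_uniq E si.
apply: thru_sub (thru_cat d2 er t2 thy).
  apply/subsetP=> z /setUP[/setUP[za | zD] | /setUP[zb | zh]]; apply/setUP.
  - left; move: za; rewrite !mem_arc // => /and3P[-> -> h2]; exact: leq_trans h2 (ltnW lQ).
  - by right; rewrite in_set /= zD.
  - left; move: zb; rewrite !mem_arc // => /and3P[-> h1 ->].
    by rewrite (leq_trans ml (leq_trans (ltnW lr) h1)).
  - by right; move: zh; rewrite !in_set /= => ->; rewrite orbT.
by move=> z; rewrite in_cons !mem_cat => /orP[/eqP-> | ->]; rewrite ?inE ?eqxx ?orbT.
Qed.

End Splice.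

Section Feet.
Variables (c : seq T).
Hypothesis cyc : is_cycle G c.

Lemma foot x : 0 < feet G c x -> exists2 z, z \in c & e x z.
Proof. by rewrite card_gt0 => /set0Pn[z]; rewrite in_set => /andP[zc xz]; exists z. Qed.

Lemma wt_foot X : 0 < wt (feet G c) X -> exists u z, [/\ u \in X, z \in c & e u z].
Proof.
rewrite lt0n sum_nat_eq0 negb_forall_in => /existsP[u /andP[uX]]; rewrite -lt0n.
by case/foot=> z zc uz; exists u, z.
Qed.

Lemma feet_card X (F : seq T) : uniq F -> (forall z, z \in F -> z \in c /\ exists2 u, u \in X & e u z) ->
  size F <= wt (feet G c) X.
Proof.
move=> uF ok; have -> : size F = wt (fun=> 1) [set z in F].
  by rewrite /wt sum1_card cardsE; symmetry; apply/card_uniqP.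
apply: (@leq_trans (\sum_(x in X) wt (fun=> 1) [set z | (z \in c) && e x z])).
  apply: wt_cover => y; rewrite in_set => /ok[yc [u uX uy]]; exists u => //.
  by rewrite in_set yc.
by apply: leq_sum => x _; rewrite /wt sum1_card.
Qed.

End Feet.
End Tools.

Section Comb.
Variables (T : finType) (G : graph T).
Hypotheses (cub : cubic G) (con3 : n_connected 3 G).
Let e := adj G.
Let V := vset G.
Let esym : symmetric e := @adj_sym T G.
Let eC x y : e x y -> e y x. Proof. by rewrite esym. Qed.
Implicit Types (A C D L R X Y M : {set T}) (P : seq T).
Variables (c : seq T) (K : {set T}) (Q : seq T).
Hypotheses (cyc : is_cycle G c) (Kc : forall z, z \in K -> z \notin c) (KV : K \subset V).
Hypotheses (sQ : sorted e Q) (uQ : uniq Q) (QK : {subset Q <= K}).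

(** A third vertex of the cycle adjacent to [D] would give weight 3, and [p] and [p'] are each
    adjacent to one vertex off the cycle only. *)
Lemma two_feet D q p q' p' : wt (feet G c) D <= 2 -> (forall z, z \in D -> z \notin c) ->
  q \in D -> q' \in D -> p \in c -> p' \in c -> p != p' -> e q p -> e q' p' ->
  forall u v, u \in D -> v \in c -> e u v -> u = q /\ v = p \/ u = q' /\ v = p'.
Proof.
move=> w2 Dc qD q'D pc p'c pp' qp qp' u v uD vc uv.
have vu : e v u by rewrite esym.
have pq : e p q by rewrite esym.
have p'q' : e p' q' by rewrite esym.
case: (altP (v =P p)) => [E | vp].
  by left; split=> //; subst v; exact: (cycle_foot cub cyc pc (Dc u uD) (Dc q qD) vu pq).
case: (altP (v =P p')) => [E | vp'].
  by right; split=> //; subst v; exact: (cycle_foot cub cyc p'c (Dc u uD) (Dc q' q'D) vu p'q').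
have := @feet_card T G c D [:: p; p'; v].
rewrite /= !inE negb_or pp' ![_ == v]eq_sym vp vp' => /(_ isT) H.
have : 3 <= wt (feet G c) D; last by rewrite leqNgt ltnS w2.
apply: H => z; rewrite !inE => /or3P[] /eqP->; split=> //; [by exists q | by exists q' | by exists u].
Qed.

(** An ear can be used in two ways: as a detour of [Q] through [q], or as a gadget with centre [q]
    whose arms end on different parts of [Q]. *)
Definition ear D q p L R u1 u2 z1 z2 := [/\ [/\ q \in D, p \in c & e q p],
  [/\ L \subset D, R \subset D, [disjoint L & R], q \notin L & q \notin R],
  [/\ cset e (q |: L), u1 \in q |: L, z1 \in Q & e u1 z1],
  [/\ cset e (q |: R), u2 \in q |: R, z2 \in Q & e u2 z2] & z1 != z2].

(** Apply [fan] at a vertex [q] with a foot, the labels being the neighbours on [Q]. Two labels make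
    an ear. If [x] is the only one, [D] has two feet and the edge to [x] as its exits. If a vertex
    [s] separates, the component of [q] has two feet and its edges to [s]; when there are two such
    edges, [s] is added and its third edge is the exit. *)
Lemma ear_or_blob x D : hung_ok G c K Q (x, D) ->
  (exists q p L R u1 u2 z1 z2, ear D q p L R u1 u2 z1 z2) \/
  (exists D' p p' o q q' q'', [/\ D' \subset D, p \in c, p' \in c & blob G D' p p' o q q' q'']).
Proof.
case=> /= xQ DK cD DQ [/andP[w0 w2] [d0 d0D [xd0 d0u]] out].
have Dc z : z \in D -> z \notin c by move/(subsetP DK)/Kc.
have [q [p [qD pc qp]]] := wt_foot w0.
have DV : D \subset V by apply: subset_trans DK KV.
have xc := Kc (QK xQ).
have xD : x \notin D by apply: contraL xQ; apply: DQ.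
have pD : p \notin D by apply: contraL pc; apply: Dc.
(* With a single foot [p], the set [C] would be cut off from the cycle by [p] and [s]. *)
have second C s : C \subset D -> q \in C -> s \notin C ->
    (forall u v, u \in C -> e u v -> [\/ v \in C, v = s | v \in c]) ->
    exists q' p', [/\ q' \in C, p' \in c, p' != p & e q' p'].
  move=> CD qC sC cl.
  case: (boolP [exists u in C, exists z, [&& z \in c, z != p & e u z]]) => [|none].
    by case/existsP=> u /andP[uC /existsP[z /and3P[]]]; exists u, z.
  exfalso; apply: (@no_cut_off _ _ con3 _ cyc C p s q) => //.
  - by apply: (subsetP DV); apply: (subsetP CD).
  - by move=> z /(subsetP CD)/Dc.
  - by apply: contra pD; apply: (subsetP CD).
  - move=> u v uC; rewrite -/(e u v) => uv; case: (cl u v uC uv) => [h | h | vc]; [by constructor 1 | by constructor 3 |].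
    constructor 2; apply/eqP/negPn/negP=> vp; move/existsPn/(_ u): none; rewrite uC => /existsPn/(_ v).
    by rewrite vc vp uv.
have feetD q' p' : q' \in D -> p' \in c -> p' != p -> e q' p' ->
    forall u v, u \in D -> v \in c -> e u v -> u = q /\ v = p \/ u = q' /\ v = p'.
  by move=> q'D p'c pp' qp'; apply: two_feet; rewrite // eq_sym.
case: (fan esym (fun u z => (z \in Q) && e u z) cD qD).
- case=> L [R [u1 [u2 [z1 [z2 [[s1 s2 d] [[c1 u1L /andP[z1Q l1]] [c2 u2R /andP[z2Q l2] z12]]]]]]]].
  have nq A : A \subset D :\ q -> q \notin A /\ A \subset D.
    move=> sA; split; last by apply: subset_trans sA (subsetDl _ _).
    by apply/negP=> /(subsetP sA); rewrite !inE eqxx.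
  have [qL LD] := nq L s1; have [qR RD] := nq R s2.
  by left; exists q, p, L, R, u1, u2, z1, z2.
- move=> same; right.
  have Qx u v : u \in D -> v \in Q -> e u v -> v = x.
    by move=> uD vQ uv; apply: (same u d0); rewrite ?vQ ?xQ ?uv //= esym.
  have cl u v : u \in D -> e u v -> [\/ v \in D, v = x | v \in c].
    move=> uD uv; case: (out u v uD uv) => h; [by constructor 1 | | by constructor 3].
    by constructor 2; apply: Qx uv.
  have [q' [p' [q'D p'c pp' qp']]] := second D x (subxx _) qD xD cl.
  exists D, p, p', x, q, q', d0; split=> //; split=> //.
  + by split=> //; apply: contraL p'c; apply: Dc.
  + split; first by rewrite eq_sym.
      by apply: contraNneq xc => <-.
    by apply: contraNneq xc => <-.
  + split=> //; first by rewrite adj_sym.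
    move=> u v uD vD uv; case: (cl u v uD uv) => [h | E | vc]; first by rewrite h in vD.
      by constructor 3; subst v; split=> //; apply: d0u => //; exact: eC.
    by case: (feetD q' p' q'D p'c pp' qp' u v uD vc uv) => h; [constructor 1 | constructor 2].
case=> s [C [[/setD1P[sq sD] qC sC cC] [clC noC]]]; right.
have CD : C \subset D by apply: subset_trans sC (subsetDl _ _).
have sNC : s \notin C by apply/negP=> /(subsetP sC); rewrite !inE eqxx.
have cl u v : u \in C -> e u v -> [\/ v \in C, v = s | v \in c].
  move=> uC uv; have uD := subsetP CD _ uC; case: (out u v uD uv) => [vD | vQ | vc].
  - by case: (clC u v uC vD uv) => h; [constructor 1 | constructor 2].
  - by have := noC u v uC; rewrite vQ uv.
  - by constructor 3.
have [q' [p' [q'C p'c pp' qp']]] := second C s CD qC sNC cl.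
have q'D := subsetP CD _ q'C; have ft := feetD q' p' q'D p'c pp' qp'.
have p'D : p' \notin D by apply: contraL p'c; apply: Dc.
have sc := Dc s sD; have cNC z : z \in c -> z \notin C by apply: contraL => /(subsetP CD)/Dc.
have [v vC vs] : exists2 v, v \in C & e v s.
  case: (boolP [exists v in C, e v s]) => [/existsP[v /andP[]] | none]; first by exists v.
  exfalso; apply: (@no_cut_off _ _ con3 _ cyc C p p' q) => //.
  - by apply: (subsetP DV).
  - by move=> z /(subsetP CD)/Dc.
  - exact: cNC.
  - exact: cNC.
  - move=> u v uC; rewrite -/(e u v) => uv; case: (cl u v uC uv) => [h | E | vc]; first by constructor 1.
      by move/existsPn/(_ u): none; rewrite uC -E uv.
    by case: (ft u v (subsetP CD _ uC) vc uv) => -[_ ->]; [constructor 2 | constructor 3].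
case: (boolP [exists v' in C, (v' != v) && e v' s]) => [/existsP[v' /and3P[v'C v'v v's]] | none]; last first.
  exists C, p, p', s, q, q', v; split=> //; split=> //.
  + by split=> //; apply: subset_trans CD DV.
  + by split=> //; apply: cNC.
  + split; first by rewrite eq_sym.
      by apply: contraNneq sc => <-.
    by apply: contraNneq sc => <-.
  + split=> // u w uC wC; rewrite -/(e u w) => uw; case: (cl u w uC uw) => [h | E | wc]; first by rewrite h in wC.
      constructor 3; subst w; split=> //; apply/eqP/negPn/negP=> ne.
      by move/existsPn/(_ u): none; rewrite uC ne uw.
    by case: (ft u w (subsetP CD _ uC) wc uw) => h; [constructor 1 | constructor 2].
have sV := subsetP DV _ sD; have [y [sy yv yv']] := third_nbr cub v v' sV.
rewrite eq_sym in yv; rewrite eq_sym in yv'; rewrite eq_sym in v'v.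
have sv : e s v by rewrite esym.
have sv' : e s v' by rewrite esym.
have all3 z : e s z -> [|| z == v, z == v' | z == y] by apply: (path3_nbrs cub sv sv' sy).
have qV := subsetP DV _ qD.
have yNC : y \notin C.
  apply/negP=> yC; apply: (@no_cut_off _ _ con3 _ cyc (s |: C) p p' q) => //.
  - by rewrite in_setU1 qC orbT.
  - by move=> z /setU1P[-> // | /(subsetP CD)/Dc].
  - by rewrite in_setU1 negb_or cNC // andbT; apply: contraNneq sc => <-.
  - by rewrite in_setU1 negb_or cNC // andbT; apply: contraNneq sc => <-.
  - move=> u w /setU1P[-> | uC] uw.
      by constructor 1; rewrite in_setU1; case/or3P: (all3 w uw) => /eqP->; rewrite ?vC ?v'C ?yC orbT.
    case: (cl u w uC uw) => [h | -> | wc]; [constructor 1 | constructor 1 |]; rewrite ?in_setU1 ?h ?eqxx ?orbT //.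
    by case: (ft u w (subsetP CD _ uC) wc uw) => -[_ ->]; [constructor 2 | constructor 3].
have yc : y \notin c.
  by apply/negP=> yc; case: (ft s y sD yc sy) => -[E _]; move: sNC; rewrite E ?qC ?q'C.
have ys : y != s by rewrite eq_sym; apply: adj_ne sy.
exists (s |: C), p, p', y, q, q', s; split=> //; first by rewrite subUset sub1set sD.
split=> //.
- split; first by exact: (csetU1 esym cC vC sv).
  by rewrite subUset sub1set sV; apply: subset_trans CD DV.
- by rewrite !in_setU1 qC q'C eqxx !orbT.
- rewrite !in_setU1 !negb_or (cNC p pc) (cNC p' p'c) yNC ys !andbT; split=> //; by apply: contraNneq sc => <-.
- split; first by rewrite eq_sym.
    by apply: contraNneq yc => <-.
  by apply: contraNneq yc => <-.
- split=> // u w /setU1P[-> | uC]; rewrite in_setU1 negb_or => /andP[ws wC] uw.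
    case/or3P: (all3 w uw) => /eqP E; subst w; [by rewrite vC in wC | by rewrite v'C in wC |].
    by constructor 3.
  case: (cl u w uC uw) => [h | E | wc]; [by rewrite h in wC | by rewrite E eqxx in ws |].
  by case: (ft u w (subsetP CD _ uC) wc uw) => h; [constructor 1 | constructor 2].
Qed.

Variables (k : nat).
Hypothesis k0 : 0 < k.

Lemma seq_vpath : 0 < size Q -> exists P : vpath T, is_path G P /\ pverts P = Q.
Proof.
case: (Q) sQ uQ QK => // x s sp us sub _; exists (VPath x s); split=> //.
by apply/and3P; split=> //; apply/(subsetP KV)/sub/mem_head.
Qed.

Lemma direct_good (dir : seq T) : uniq dir -> (forall x, x \in dir -> x \in Q /\ 0 < feet G c x) ->
  k <= size dir -> good k G.
Proof.
move=> ud ok kd; have [x0 x0d] : exists x, x \in dir.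
  by case: (dir) kd => [|x s _]; [rewrite leqNgt k0 | exists x; rewrite mem_head].
have Q0 : 0 < size Q by case: (ok x0 x0d); case: (Q).
have [P [pP PQ]] := seq_vpath Q0.
pose u (i : 'I_(size dir)) := nth x0 dir i.
have uin i : u i \in dir by apply: mem_nth.
have H i : exists v, v \in c /\ e (u i) v.
  by have [_ /foot[v vc uv]] := ok _ (uin i); exists v.
have [v vP] := fin_all_exists H.
apply: (@close_good T G k _ setT u u v P c pP cyc).
- by move=> z; rewrite PQ => /QK/Kc.
- by rewrite cardsT card_ord.
- by move=> i _; have [uQ' _] := ok _ (uin i); have [vc uv] := vP i; rewrite PQ; split=> //; left.
move=> i j _ _ ij; have uij : u i != u j by rewrite /u nth_uniq.
split=> //; apply: contraNneq uij => E; apply/eqP.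
have [vi ui] := vP i; have [vj uj] := vP j.
have Kd a : u a \notin c by apply/Kc/QK; case: (ok _ (uin a)).
have viu : e (v i) (u i) by rewrite esym.
have vju : e (v i) (u j) by rewrite E esym.
exact: (cycle_foot cub cyc vi (Kd i) (Kd j) viu vju).
Qed.

End Comb.

Lemma pigeonhole (I : finType) (J : {set I}) n (f : I -> 'I_n) m : 0 < m ->
  0 < n -> n * m <= #|J| -> exists i, m <= #|[set j in J | f j == i]|.
Proof.
move=> m0 n0 le; case: (boolP [exists i, m <= #|[set j in J | f j == i]|]) => [/existsP // | /existsPn no].
suff: #|J| <= n * m.-1 by move: le m0 n0; clear; nia.
rewrite -sum1_card (partition_big f xpredT) //= -[X in X * _]card_ord -sum_nat_const.
apply: leq_sum => i _; have := no i; rewrite -ltnNge => lt.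
rewrite -ltnS prednK //; apply: leq_ltn_trans lt.
by rewrite -sum1_card; apply/eq_leq/eq_bigl => j; rewrite inE.
Qed.

(** * Combs with many hung sets *)

Section Hung.
Variables (T : finType) (G : graph T).
Hypotheses (cub : cubic G) (con3 : n_connected 3 G).
Let e := adj G.
Let V := vset G.
Let esym : symmetric e := @adj_sym T G.
Let eC x y : e x y -> e y x. Proof. by rewrite esym. Qed.
Implicit Types (A C L R X Y M : {set T}) (P : seq T).
Variables (c : seq T) (K : {set T}) (Q : seq T).
Hypotheses (cyc : is_cycle G c) (Kc : forall z, z \in K -> z \notin c) (KV : K \subset V).
Hypotheses (sQ : sorted e Q) (uQ : uniq Q) (QK : {subset Q <= K}).
Variables (k : nat) (k0 : 0 < k).
Variables (I : finType) (x : I -> T) (D : I -> {set T}).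
Hypothesis hung : forall i, hung_ok G c K Q (x i, D i).
Hypothesis disD : forall i j z, z \in D i -> z \in D j -> i = j.

Let Dc i z : z \in D i -> z \notin c.
Proof. by case: (hung i) => _ s _ _ _ /(subsetP s)/Kc. Qed.
Let DQ i z : z \in D i -> z \notin Q.
Proof. by case: (hung i) => _ _ _ h _ /h. Qed.
Let Qc z : z \in Q -> z \notin c. Proof. by move/QK/Kc. Qed.

Let foot_inj i j u v p : u \in D i -> v \in D j -> p \in c -> e u p -> e v p -> i = j.
Proof.
move=> uD vD pc /eC pu /eC pv; have E := cycle_foot cub cyc pc (Dc uD) (Dc vD) pu pv.
by apply: (disD uD); rewrite E.
Qed.

Lemma take_drop_disj (s : seq T) n z : uniq s -> z \in take n s -> z \in drop n s -> False.
Proof.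
by rewrite -{1}(cat_take_drop n s) cat_uniq => /and3P[_ /hasPn h _] zt /h; rewrite /= zt.
Qed.

(** Each ear spans an interval of [Q]. If [k] of them are disjoint, [splice] makes a path through
    their vertices [q j], which is [k]-close to the cycle. If many share a point, [Q] is cut there
    and its two parts serve as rails. *)
Lemma ears_good (J : {set I}) :
  (forall j, j \in J -> exists q p L R u1 u2 z1 z2, ear G c Q (D j) q p L R u1 u2 z1 z2) ->
  k * (4 * 12 ^ k) <= #|J| -> good k G.
Proof.
move=> ears le.
have H j : exists q p L R u1 u2 z1 z2, j \in J ->
    ear G c Q (D j) q p L R u1 u2 z1 z2 /\ index z1 Q < index z2 Q.
  case: (boolP (j \in J)) => jJ; last by exists (x j), (x j), set0, set0, (x j), (x j), (x j), (x j).
  have [q [p [L [R [u1 [u2 [z1 [z2 ea]]]]]]]] := ears j jJ.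
  case: (ltngtP (index z1 Q) (index z2 Q)) => h.
  - by exists q, p, L, R, u1, u2, z1, z2.
  - exists q, p, R, L, u2, u1, z2, z1 => _; split=> //.
    by case: ea => h1 [h2 h3 h4 h5 h6] h7 h8 h9; split=> //; [split=> //; rewrite disjoint_sym | rewrite eq_sym].
  - case: ea => _ _ [_ _ z1Q _] [_ _ z2Q _] /eqP[].
    by rewrite -(nth_index z1 z1Q) h nth_index.
have [q {}H] := fin_all_exists H; have [p {}H] := fin_all_exists H.
have [L {}H] := fin_all_exists H; have [R {}H] := fin_all_exists H.
have [u1 {}H] := fin_all_exists H; have [u2 {}H] := fin_all_exists H.
have [z1 {}H] := fin_all_exists H; have [z2 {}H] := fin_all_exists H.
have [j0 j0J] : exists j, j \in J.
  apply/set0Pn; rewrite -card_gt0; apply: leq_trans le; by rewrite !muln_gt0 k0 expn_gt0.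
have pinj i j : i \in J -> j \in J -> p i = p j -> i = j.
  move=> iJ jJ E; have [[[qi pi qpi] _ _ _ _] _] := H i iJ; have [[[qj pj qpj] _ _ _ _] _] := H j jJ.
  by apply: (foot_inj qi qj pi qpi); rewrite E.
pose l j := index (z1 j) Q; pose r j := index (z2 j) Q.
have lr j : j \in J -> l j < r j by move=> jJ; case: (H j jJ).
case: (helly lr le) => [[J' [sJ kJ' sep]] | [t0 ht]].
- have linj : {in J' &, injective l}.
    move=> i j iJ jJ E; apply/eqP/negPn/negP=> ij.
    have li := lr i (subsetP sJ _ iJ); have lj := lr j (subsetP sJ _ jJ).
    by case: (sep i j iJ jJ ij); move: li lj; rewrite E; clear; lia.
  have [s [szs sJ' so]] := ex_chain linj kJ'.
  have us : uniq s by apply: sorted_uniq so => [i j j' | i]; [apply: ltn_trans | apply: ltnn].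
  have sJJ i : i \in s -> i \in J by move/sJ'; apply: (subsetP sJ).
  have so' : sorted (fun i j => r i <= l j) s.
    apply: (@sub_in_sorted _ [in s] (fun i j => l i < l j)) so; last by apply/allP.
    move=> i j si sj lij; have ij : i != j by apply: contraTneq lij => ->; rewrite ltnn.
    have := lr j (sJJ j sj); case: (sep i j (sJ' _ si) (sJ' _ sj) ij) => // h.
    by move: lij h; clear; lia.
  have Q0 : 0 < size Q by have [[_ _ [_ _ zQ _] _ _] _] := H j0 j0J; case: (Q) zQ.
  have [||||||y [pp [h1 h2 h3 h4 h5]]] := @splice T G Q I D q u1 u2 l r (z1 j0) sQ uQ s 0 Q0.
  + move=> j sj; have [[_ [s1 s2 d qL qR] [cL u1L z1Q e1] [cR u2R z2Q e2] _] lt] := H j (sJJ j sj).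
    split=> //; first by rewrite index_mem.
    * apply: (thru_sub _ _ (ear_thru d qL qR cL cR u1L u2R)) => //.
      have [[qD _ _] _ _ _ _] := (H j (sJJ j sj)).1.
      by rewrite !subUset sub1set qD s1.
    * by rewrite nth_index //; apply: eC.
    * by rewrite nth_index.
  + by move=> j z _; apply: DQ.
  + by move=> i j z _ _; apply: disD.
  + exact: us.
  + by case: (s).
  + exact: so'.
  have inP z : z \in nth (z1 j0) Q 0 :: pp -> z \notin c.
    by move/h4/setUP=> [/arc_sub/Qc // |]; rewrite in_set => /hasP[i _ /Dc].
  pose P := VPath (nth (z1 j0) Q 0) pp.
  have pP : is_path G P.
    by apply/and3P; split=> //; apply/(subsetP KV)/QK/mem_nth.
  apply: (@close_good T G k I [set j in s] q q p P c pP cyc) => //.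
  + by rewrite cardsE (card_uniqP us) szs.
  + move=> j; rewrite in_set => sj; have [[[qD pc qp] _ _ _ _] _] := H j (sJJ j sj).
    by split=> //; [apply: h5; apply: map_f | left].
  + move=> i j; rewrite !in_set => si sj ij.
    have [[[qi pi qpi] _ _ _ _] _] := H i (sJJ i si).
    have [[[qj pj qpj] _ _ _ _] _] := H j (sJJ j sj).
    have nq : q i != q j by apply: contraNneq ij => E; apply/eqP/(disD qi); rewrite E.
    by split=> //; apply: contraNneq ij => E; apply/eqP/pinj; rewrite ?sJJ.
set J' := [set j in J | _] in ht.
have J'P j : j \in J' -> j \in J /\ l j <= t0 < r j by rewrite in_set => /andP[].
have subQ n z : z \in [set z in take n Q] \/ z \in [set z in drop n Q] -> z \in Q.
  by rewrite !in_set => -[/mem_take | /mem_drop].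
apply: (@two_rails T G cub k c I J' p q D L R (x j0) k0 cyc _ _ _ _ _
  [set z in take t0.+1 Q] [set z in drop t0.+1 Q]).
- by move=> j /J'P[jJ _]; case: (H j jJ) => -[[]].
- by move=> i j /J'P[iJ _] /J'P[jJ _]; apply: pinj.
- by move=> j z _; apply: Dc.
- by move=> i j z _ _; apply: disD.
- by move=> j /J'P[jJ _]; have [[[qD _ qp] [s1 s2 d _ _] _ _ _] _] := H j jJ.
- by apply: (cset_seq esym); exact: take_sorted.
- by apply: (cset_seq esym); exact: drop_sorted.
- apply/pred0P=> z /=; rewrite !in_set; apply/negP=> /andP[]; exact: take_drop_disj.
- by move=> z zt; apply/Qc/(subQ t0.+1); left.
- by move=> z zt; apply/Qc/(subQ t0.+1); right.
- move=> j z _ zD; have zQ := DQ zD; apply: contra zQ => /setUP h; exact: subQ h.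
- move=> j /J'P[jJ /andP[lt tr]].
  have [[_ [_ _ _ qL qR] [cL u1L z1Q e1] [cR u2R z2Q e2] _] _] := H j jJ.
  split; split=> //; [exists (u1 j) => // | exists (u2 j) => //].
    by apply: seesI e1; rewrite in_set in_take.
  by apply: seesI e2; rewrite in_set; apply: drop_index.
- by apply: leq_trans ht _.
Qed.

Lemma blob_swap A p p' o q q' q'' : blob G A p p' o q q' q'' -> blob G A p' p o q' q q''.
Proof.
case=> h1 [qA q'A q''A] [pA p'A oA] [n1 n2 n3] [qp q'p' q''o out]; split=> //; split=> //.
  by rewrite eq_sym.
move=> u v uA vA uv; case: (out u v uA vA uv) => h;
  [by constructor 2 | by constructor 1 | by constructor 3].
Qed.

(* Once the feet of the blobs are separated by a point of the cycle, one side of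
   the cycle closes up through two of the blobs and [Q]. *)
Lemma split_blobs_good (J : {set I}) (P P' : seq T) :
  sorted e P -> uniq P -> sorted e P' -> {subset P <= c} -> {subset P' <= c} -> uniq P' ->
  (forall z, z \in P -> z \in P' -> False) ->
  (forall j, j \in J -> exists A p p' o q q' q'', [/\ A \subset D j, p \in P, p' \in P' &
     blob G A p p' o q q' q'']) ->
  3 * (4 * 12 ^ k + 2) <= #|J| -> good k G.
Proof.
move=> sP uP sP' Pc P'c uP' PP' bl le.
have [j0 j0J] : exists j, j \in J.
  by apply/set0Pn; rewrite -card_gt0; apply: leq_trans le; rewrite muln_gt0 addn2.
have Q0 : forall j, x j \in Q by move=> j; case: (hung j).
(* The value of [f] records the kind of the blob: 0 for a single vertex, 1 for a theta-graph, 2 for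
   a wiggly core. [leg2] and [leg3] are used merely as the ordinals 1 and 2. *)
have H j : exists (A : {set T}) p p' q q' (f : 'I_3), j \in J -> [/\ A \subset D j /\ cset e A,
    p \in P, p' \in P' & [/\ q \in A, q' \in A, e q p & e q' p']] /\
    [\/ f = 0 :> nat /\ q = q', f = 1 :> nat /\ bead G true A q q' | f = 2 :> nat /\ bead G false A q q'].
  case: (boolP (j \in J)) => jJ; last by exists set0, (x j), (x j), (x j), (x j), ord0.
  have [A [p [p' [o [q [q' [q'' [sA pP p'P' bA]]]]]]]] := bl j jJ.
  have [[cA _] [qA q'A _] _ _ [qp q'p' _ _]] := bA.
  case: (ltnP 1 #|A|) => A1; last first.
    exists A, p, p', q, q', ord0 => _; split=> //; constructor 1; split=> //.
    by move/card_le1P: A1 => /(_ q qA q'); rewrite q'A inE => E; apply/eqP; rewrite eq_sym -E.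
  have [b bb] := blob_bead cub con3 A1 bA.
  exists A, p, p', q, q', (if b then leg2 else leg3) => _; split=> //.
  by case: b bb => bb; [constructor 2 | constructor 3].
have [A {}H] := fin_all_exists H; have [p {}H] := fin_all_exists H.
have [p' {}H] := fin_all_exists H; have [q {}H] := fin_all_exists H.
have [q' {}H] := fin_all_exists H; have [f {}H] := fin_all_exists H.
(* The pigeonhole principle over the three kinds accounts for the factor 3, and the summand 2 pays
   for the two blobs that close up the new cycle. *)
have m0 : 0 < 4 * 12 ^ k + 2 by rewrite addn2.
have [i hi] := pigeonhole f m0 isT le; set J1 := [set j in J | _] in hi.
have J1J j : j \in J1 -> j \in J /\ f j = i by rewrite in_set => /andP[-> /eqP].
have data j : j \in J1 -> [/\ A j \subset D j, cset e (A j), p j \in P, p' j \in P' &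
    [/\ q j \in A j, q' j \in A j, e (q j) (p j) & e (q' j) (p' j)]].
  by move=> /J1J[jJ _]; have [[[h1 h2] h3 h4 h5] _] := H j jJ.
have AD j z : j \in J1 -> z \in A j -> z \in D j.
  by move=> jJ; case: (data j jJ) => s _ _ _ _; apply: (subsetP s).
have pinj : {in J1 &, injective p}.
  move=> a b aJ bJ E; have [_ _ pa _ [qa _ ea _]] := data a aJ; have [_ _ _ _ [qb _ eb _]] := data b bJ.
  by apply: (foot_inj (AD _ _ aJ qa) (AD _ _ bJ qb) (Pc _ pa) ea); rewrite E.
have p'inj : {in J1 &, injective p'}.
  move=> a b aJ bJ E; have [_ _ _ pa [_ qa _ ea]] := data a aJ; have [_ _ _ _ [_ qb _ eb]] := data b bJ.
  by apply: (foot_inj (AD _ _ aJ qa) (AD _ _ bJ qb) (P'c _ pa) ea); rewrite E.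
have DP j z : z \in D j -> z \notin P by move/Dc; apply: contra; apply: Pc.
have DP' j z : z \in D j -> z \notin P' by move/Dc; apply: contra; apply: P'c.
have J12 : 1 < #|J1| by apply: leq_trans hi; rewrite addn2.
have cQ : cset e [set z in Q] by exact: (cset_seq esym).
have [||||c' [i0 [i1 [cyc' [i0J i1J] inc' rng cc']]]] := @return_cycle T G P I J1 p D [set z in Q] sP uP _ pinj _ cQ _ _ J12.
- by move=> j jJ; case: (data j jJ).
- move=> j jJ; have [_ _ _ _ [qA _ qp _]] := data j jJ.
  have [/= xQ _ cD _ [_ [d0 d0D [xd _]] _]] := hung j.
  split=> //; first by apply: (seesI (s := q j)); [apply: AD qA | apply: eC].
  by exists d0 => //; apply: (seesI (s := x j)); [rewrite in_set | apply: eC].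
- by move=> z; rewrite in_set => /Qc; apply: contra; apply: Pc.
- by move=> j z _; apply: DP.
set J2 := J1 :\: [set i0; i1].
have J2J j : j \in J2 -> [/\ j \in J1, j != i0 & j != i1].
  by rewrite in_setD !inE negb_or => /andP[/andP[-> ->] ->].
have J2c : 4 * 12 ^ k <= #|J2|.
  have := cardsID [set i0; i1] J1; have := subset_leq_card (subsetIr J1 [set i0; i1]).
  have : #|[set i0; i1]| <= 2 by rewrite cards2; case: eqP.
  by rewrite -/J2; move: hi; clear; lia.
have pc' j : j \in J1 -> p j \in c'.
  by move=> jJ; have [_ _ pP _ _] := data j jJ; have [] := cc' (p j) pP (rng j jJ).
have Dc' j z : j \in J2 -> z \in D j -> z \notin c'.
  move=> /J2J[jJ n0 n1] zD; apply/negP=> /inc'[zP | z0 | z1 | zQ].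
  - by have := DP j z zD; rewrite zP.
  - by rewrite (disD zD z0) eqxx in n0.
  - by rewrite (disD zD z1) eqxx in n1.
  - by move: zQ; rewrite in_set (negbTE (DQ zD)).
have P'c' z : z \in P' -> z \notin c'.
  move=> zP'; apply/negP=> /inc'[zP | /DP'| /DP' | zQ]; rewrite ?zP' //.
    exact: PP' zP zP'.
  by move: zQ; rewrite in_set => /Qc; rewrite P'c.
have bead_case b : (forall j, j \in J1 -> bead G b (A j) (q j) (q' j)) -> good k G.
  move=> bb; apply: (@bead_rail T G cub b k c' I J2 p q q' A [set z in P'] k0 cyc') => //.
  - by move=> j /J2J[jJ _ _]; apply: pc'.
  - by move=> a1 a2 /J2J[h1 _ _] /J2J[h2 _ _]; apply: pinj.
  - by move=> j z jJ zA; apply: Dc' (jJ) _; apply: AD zA; case: (J2J j jJ).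
  - move=> a1 a2 z /J2J[h1 _ _] /J2J[h2 _ _] z1 z2; apply: (@disD a1 a2 z); exact: AD.
  - exact: (cset_seq esym).
  - by move=> z; rewrite in_set; apply: P'c'.
  - move=> j z /J2J[jJ _ _] zA; rewrite in_set; apply: DP'; exact: AD zA.
  - move=> j /J2J[jJ _ _]; have [_ cA _ pP' [_ _ qp qp']] := data j jJ.
    split=> //; [exact: bb | exact: eC |].
    by apply: (seesI (s := p' j)); rewrite ?in_set.
have fi j : j \in J1 -> [\/ i = 0 :> nat /\ q j = q' j, i = 1 :> nat /\ bead G true (A j) (q j) (q' j)
    | i = 2 :> nat /\ bead G false (A j) (q j) (q' j)].
  by move=> /J1J[jJ <-]; case: (H j jJ).
case: (nat_of_ord i) fi => [|[|[|n]]] fi.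
(* Blobs that are single vertices are the middle vertices of paths of length 2 from the path [P'] to
   the new cycle. *)
- have qq' j : j \in J1 -> q j = q' j by move/fi=> [[_ ->] | [] | []].
  have [P0 [pP0 PE]] : exists P0 : vpath T, is_path G P0 /\ pverts P0 = P'.
    have [_ _ _ p'P _] := data i0 i0J; case: (P') sP' uP' P'c p'P => // y s sy us sub _.
    by exists (VPath y s); split=> //; apply/and3P; split=> //; apply: (cycle_V cyc); apply/sub/mem_head.
  apply: (@close_good T G k I J2 p' q p P0 c' pP0 cyc').
  + by move=> z; rewrite PE; apply: P'c'.
  + by apply: leq_trans J2c; apply: leq_trans (ltnW (ltn_expl k (isT : 1 < 12))) _; apply: leq_pmull.
  + move=> j jJ2; have [jJ _ _] := J2J j jJ2; have [_ _ pP p'P [qA _ qp q'p']] := data j jJ.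
    have qD := AD j _ jJ qA; rewrite PE; split=> //; first exact: pc'.
    right; split; [exact: DP' qD | exact: Dc' qD | rewrite -/e; apply: eC; by rewrite qq'].
  + move=> a1 a2 /J2J[h1 _ _] /J2J[h2 _ _] ne.
    have [_ _ _ _ [q1 _ _ _]] := data a1 h1; have [_ _ _ _ [q2 _ _ _]] := data a2 h2.
    split; apply: contraNneq ne => E; apply/eqP; [exact: p'inj | exact: pinj |].
    by apply: (@disD a1 a2 (q a1)); [exact: AD | rewrite E; exact: AD].
- by apply: (bead_case true) => j /fi[[] | [_ ?] | []].
- by apply: (bead_case false) => j /fi[[] | [] | [_ ?]].
- by case: (fi i0 i0J) => -[].
Qed.

(** The two feet of a blob span an interval of the cycle. If many intervals are disjoint, [rail]
    applies with [Q] as the connected set and the second foot as the end of one arm. If many share a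
    point, the cycle is cut there. *)
Lemma blobs_good (J : {set I}) :
  (forall j, j \in J -> exists A p p' o q q' q'',
     [/\ A \subset D j, p \in c, p' \in c & blob G A p p' o q q' q'']) ->
  8 * 12 ^ k * (3 * (4 * 12 ^ k + 2)) <= #|J| -> good k G.
Proof.
move=> bl le; case/and3P: (cyc) => c2 cc uc.
have sc : sorted e c by case: (c) cc => //= y s; rewrite rcons_path => /andP[].
have [j0 j0J] : exists j, j \in J.
  by apply/set0Pn; rewrite -card_gt0; apply: leq_trans le; rewrite !muln_gt0 expn_gt0 addn2.
have H j : exists A p p' o q q' q'', j \in J ->
    [/\ A \subset D j, p \in c, p' \in c & blob G A p p' o q q' q''].
  case: (boolP (j \in J)) => jJ; last by exists set0, (x j), (x j), (x j), (x j), (x j), (x j).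
  by have [A [p [p' [o [q [q' [q'' h]]]]]]] := bl j jJ; exists A, p, p', o, q, q', q''.
have [A {}H] := fin_all_exists H; have [p {}H] := fin_all_exists H.
have [p' {}H] := fin_all_exists H; have [o {}H] := fin_all_exists H.
have [q {}H] := fin_all_exists H; have [q' {}H] := fin_all_exists H.
have [q'' {}H] := fin_all_exists H.
have idx y z : y \in c -> z \in c -> index y c = index z c -> y = z.
  by move=> yc zc /(congr1 (nth y c)); rewrite !nth_index.
have data j : j \in J -> [/\ p j \in c, p' j \in c, p j != p' j &
    [/\ q j \in D j, q' j \in D j, e (q j) (p j) & e (q' j) (p' j)]].
  move=> jJ; have [sA pc pc' [_ [qA q'A _] _ [pp' _ _] [qp q'p' _ _]]] := H j jJ.
  by split=> //; split=> //; apply: (subsetP sA).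
pose l j := minn (index (p j) c) (index (p' j) c).
pose r j := maxn (index (p j) c) (index (p' j) c).
have lr j : j \in J -> l j < r j.
  move=> jJ; have [pc pc' pp' _] := data j jJ.
  have : index (p j) c != index (p' j) c by apply: contra pp' => /eqP/idx->.
  by rewrite /l /r; clear; lia.
case: (helly lr le) => [[J' [sJ leJ' sep]] | [t0 ht]].
- have JJ j : j \in J' -> j \in J by apply: (subsetP sJ).
  have cQ : cset e [set z in Q] by exact: (cset_seq esym).
  have arms j : exists L R, j \in J' -> [/\ L \subset D j, R \subset D j, [disjoint L & R],
      arm G (q j) L (e^~ (p' j)) & arm G (q j) R (sees G [set z in Q])].
    case: (boolP (j \in J')) => jJ'; last by exists set0, set0.
    have jJ := JJ j jJ'; have [pc pc' pp' [qD q'D qp qp']] := data j jJ.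
    have [/= xQ _ cD _ [/andP[_ w2] [d0 d0D [xd _]] out]] := hung j.
    have [||| L [R h]] := @two_arms T G con3 c cyc (D j) (q j) (p j) (e^~ (p' j)) (sees G [set z in Q]) cD qD (@Dc j) pc qp.
    + move=> u v uD uv; case: (out u v uD uv) => [h | h | h]; [by constructor 1 | |].
        by constructor 4; apply: seesI uv; rewrite in_set.
      case: (two_feet cub cyc w2 (@Dc j) qD q'D pc pc' pp' qp qp' uD h uv) => -[E1 E2].
        by constructor 2.
      by constructor 3; rewrite E1.
    + by exists (q' j).
    + by exists d0 => //; apply: (seesI (s := x j)); [rewrite in_set | apply: eC].
    by exists L, R.
  have [L {}arms] := fin_all_exists arms; have [R {}arms] := fin_all_exists arms.
  have pinj i j : i \in J' -> j \in J' -> p i = p j -> i = j.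
    move=> /JJ iJ /JJ jJ E; have [pc _ _ [qD _ qp _]] := data i iJ; have [_ _ _ [qD2 _ qp2 _]] := data j jJ.
    by apply: (foot_inj qD qD2 pc qp); rewrite E.
  apply: (@rail T G cub k c I J' p q p' D L R [set z in Q] k0 cyc) => //.
  + by move=> j /JJ/data[].
  + by move=> j z _; apply: Dc.
  + by move=> i j z _ _; apply: disD.
  + move=> j jJ'; have [_ _ _ [qD _ qp _]] := data j (JJ j jJ').
    by have [h1 h2 h3 _ _] := arms j jJ'.
  + by move=> z; rewrite in_set; apply: Qc.
  + by move=> j z _ /DQ; rewrite in_set.
  + move=> j jJ'; have [_ p'c _ _] := data j (JJ j jJ').
    by have [_ _ _ h4 h5] := arms j jJ'.
  + move=> i j iJ jJ E; have [pc _ pp' [qD _ qp _]] := data i (JJ i iJ).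
    have [_ _ _ [_ q'D _ qp']] := data j (JJ j jJ).
    have ij : i = j by apply: (foot_inj qD q'D pc qp); rewrite E.
    by subst j; rewrite E eqxx in pp'.
set J' := [set j in J | _] in ht.
have J'P j : j \in J' -> j \in J /\ l j <= t0 < r j by rewrite in_set => /andP[].
have inT y : y \in c -> (y \in take t0.+1 c) = (index y c <= t0) by move=> yc; rewrite in_take.
have inD y : y \in c -> t0 < index y c -> y \in drop t0.+1 c by apply: drop_index.
have tdP z : z \in take t0.+1 c -> z \in drop t0.+1 c -> False by apply: take_drop_disj.
have tc : {subset take t0.+1 c <= c} by move=> z /mem_take.
have dc : {subset drop t0.+1 c <= c} by move=> z /mem_drop.
have st := take_sorted t0.+1 sc; have sd := drop_sorted t0.+1 sc.
have ut := take_uniq t0.+1 uc; have ud := drop_uniq t0.+1 uc.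
apply: (@split_blobs_good J' (take t0.+1 c) (drop t0.+1 c)) => //.
move=> j /J'P[jJ lr0].
have [sA pc p'c bA] := H j jJ; move: lr0; rewrite /l /r.
case: (leqP (index (p j) c) t0) => h lr0.
  exists (A j), (p j), (p' j), (o j), (q j), (q' j), (q'' j); split=> //; first by rewrite inT.
  by apply: inD => //; move: lr0 h; clear; lia.
exists (A j), (p' j), (p j), (o j), (q' j), (q j), (q'' j); split=> //.
- by rewrite inT //; move: lr0 h; clear; lia.
- exact: inD.
- exact: blob_swap.
Qed.

End Hung.

Section Comb.
Variables (T : finType) (G : graph T).
Hypotheses (cub : cubic G) (con3 : n_connected 3 G).
Variables (c : seq T) (K : {set T}) (k : nat).
Hypotheses (cyc : is_cycle G c) (Kc : forall z, z \in K -> z \notin c) (KV : K \subset vset G).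
Hypothesis k0 : 0 < k.

(** With [k] direct items, [Q] itself is [k]-close to the cycle. Otherwise the hung sets are so many
    that the ears or the blobs reach their threshold; the bound is the sum of the three. *)
Lemma comb_good n : comb G c K n ->
  k + k * (4 * 12 ^ k) + 8 * 12 ^ k * (3 * (4 * 12 ^ k + 2)) <= n -> good k G.
Proof.
case=> Q [dir [hung [[sQ uQ QK ud [okd okh pwh]] <-]]] le.
case: (leqP k (size dir)) => [kd | kd]; first exact: (direct_good cub cyc Kc KV sQ uQ QK k0 ud okd kd).
have [x0 _] : exists x : T, x \in c by case/and3P: (cyc); case: (c) => // x s; exists x; rewrite mem_head.
pose h (i : 'I_(size hung)) := nth (x0, set0) hung i.
have hh i : h i \in hung by apply: mem_nth.
have okh' i : hung_ok G c K Q ((h i).1, (h i).2) by rewrite -surjective_pairing; apply: okh.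
have dis i j z : z \in (h i).2 -> z \in (h j).2 -> i = j.
  move=> zi zj; apply: val_inj => /=; have key a b : a < b -> b < size hung ->
      z \in (nth (x0, set0) hung a).2 -> z \in (nth (x0, set0) hung b).2 -> False.
    move=> ab bs za zb; have := (pairwiseP (x0, set0) pwh) a b (ltn_trans ab bs) bs ab.
    by move/pred0P/(_ z); rewrite /= za zb.
  by case: (ltngtP i j) => // ij; [case: (key _ _ ij (ltn_ord j)) | case: (key _ _ ij (ltn_ord i))].
have H i : exists b : bool, if b
    then exists q p (L R : {set T}) u1 u2 z1 z2, ear G c Q (h i).2 q p L R u1 u2 z1 z2
    else exists (A : {set T}) p p' o q q' q'', [/\ A \subset (h i).2, p \in c, p' \in c & blob G A p p' o q q' q''].
  by case: (ear_or_blob cub con3 cyc Kc KV QK (okh' i)) => H; [exists true | exists false].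
have [f fP] := fin_all_exists H.
have sz : #|[set i | f i]| + #|~: [set i | f i]| = size hung by rewrite cardsC card_ord.
case: (leqP (k * (4 * 12 ^ k)) #|[set i | f i]|) => hl.
  apply: (ears_good cub cyc Kc KV sQ uQ QK k0 okh' dis (J := [set i | f i])) hl.
  by move=> j; rewrite inE => fj; have := fP j; rewrite fj.
apply: (blobs_good cub con3 cyc Kc sQ QK k0 okh' dis (J := ~: [set i | f i])).
  by move=> j; rewrite !inE => /negbTE fj; have := fP j; rewrite fj.
by move: le kd sz hl; clear; lia.
Qed.

End Comb.

(** * Families of pieces *)

Section Family.
Variables (T : finType) (G : graph T).
Hypotheses (cub : cubic G) (con3 : n_connected 3 G).
Let e := adj G.
Let esym : symmetric e := @adj_sym T G.
Let eC x y : e x y -> e y x. Proof. by rewrite esym. Qed.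
Implicit Types (A B C D L R Y M : {set T}) (P : seq T).
Variables (c : seq T) (K M0 : {set T}) (k : nat).
Hypotheses (cyc : is_cycle G c) (Kc : forall z, z \in K -> z \notin c) (k0 : 0 < k).
Variables (I : finType) (X O : I -> {set T}) (x : I -> T).
Let E i := X i :|: O i.
Hypothesis EK : forall i, E i \subset K.
Hypothesis Edis : forall i j z, z \in E i -> z \in E j -> i = j.
Hypotheses (M0K : M0 \subset K) (cM0 : cset e M0) (M0E : forall i z, z \in E i -> z \notin M0).
Hypothesis okX : forall i, [/\ cset e (X i), cset e (O i), [disjoint X i & O i], x i \in O i &
  [/\ wt (feet G c) (X i) = 2, 0 < wt (feet G c) (O i), exists2 u, u \in X i & e u (x i),
  exists2 v, v \in M0 & e (x i) v &
  forall u v, u \in X i -> e u v -> [\/ v \in X i, v = x i, v \in M0 | v \in c]]].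

Let XE i z : z \in X i -> z \in E i. Proof. by rewrite in_setU => ->. Qed.
Let OE i z : z \in O i -> z \in E i. Proof. by rewrite in_setU => ->; rewrite orbT. Qed.
Let Ec i z : z \in E i -> z \notin c. Proof. by move/(subsetP (EK i))/Kc. Qed.
Let M0c z : z \in M0 -> z \notin c. Proof. by move/(subsetP M0K)/Kc. Qed.

Let foot_inj i j u v p : u \in E i -> v \in E j -> p \in c -> e u p -> e v p -> u = v /\ i = j.
Proof.
move=> uD vD pc /eC pu /eC pv; have Euv := cycle_foot cub cyc pc (Ec uD) (Ec vD) pu pv.
by split=> //; apply: (Edis uD); rewrite Euv.
Qed.

(* The two feet of the core [X i], in either order, and a foot of [O i]. *)
Definition footed i qa a qb b v g := [/\ [/\ qa \in X i, a \in c & e qa a],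
  [/\ qb \in X i, b \in c & e qb b], a != b & [/\ v \in O i, g \in c & e v g]].

(** The two feet of [X i] end at different vertices of the cycle, since a vertex of the cycle has
    only one neighbour off it. *)
Lemma footedP i : exists qa a qb b v g, footed i qa a qb b v g.
Proof.
case: (okX i) => cX cO dXO xO [w2 w0 _ _ _].
have [v [g [vO gc vg]]] := wt_foot w0.
have w2' : 0 < wt (feet G c) (X i) by rewrite w2.
have [qa [a [qaX ac qaa]]] := wt_foot w2'.
case: (boolP [exists u in X i, exists b, [&& b \in c, b != a & e u b]]) => [|none].
  case/existsP=> qb /andP[qbX /existsP[b /and3P[bc ba qbb]]].
  by exists qa, a, qb, b, v, g; split=> //; rewrite eq_sym.
have only u b : u \in X i -> b \in c -> e u b -> b = a.
  move=> uX bc ub; apply/eqP/negPn/negP=> ba; move/existsPn/(_ u): none.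
  by rewrite uX => /existsPn/(_ b)/negP; apply; apply/and3P.
have : wt (feet G c) (X i) <= 1; last by rewrite w2.
rewrite (wtD1 _ qaX); have -> : wt (feet G c) (X i :\ qa) = 0.
  apply/eqP; rewrite -leqn0 leqNgt; apply/negP=> /wt_foot[u [z [/setD1P[uq uX] zc uz]]].
  have za := only u z uX zc uz; subst z.
  by have [Eu _] := foot_inj (XE uX) (XE qaX) zc uz qaa; rewrite Eu eqxx in uq.
rewrite addn0 -(cards1 a); apply/subset_leq_card/subsetP=> z; rewrite in_set in_set1 => /andP[zc qz].
by rewrite (only qa z qaX zc qz).
Qed.

Lemma footed_out i qa a qb b v g : footed i qa a qb b v g ->
  forall u z, u \in X i -> e u z -> [\/ z \in X i, z = a, z = b /\ e u b | sees G (x i |: M0) u].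
Proof.
case=> [[qaX ac qaa] [qbX bc qbb] ab _] u z uX uz; case: (okX i) => _ _ _ _ [w2 _ _ _ out].
case: (out u z uX uz) => [h | h | h | h]; [by constructor 1 | | |].
- by constructor 4; apply: seesI uz; rewrite h setU11.
- by constructor 4; apply: seesI uz; rewrite in_setU1 h orbT.
have Xc y : y \in X i -> y \notin c by move/XE/Ec.
case: (two_feet cub cyc (eq_leq w2) Xc qaX qbX ac bc ab qaa qbb uX h uz) => -[E1 E2]; first by constructor 2.
by constructor 3; split=> //; rewrite E1.
Qed.

(** The sets [O i] link the cores [X i] to [M0]; taken together with [M0] they form one rail, at the
    price of giving up the third feet. *)
Definition hub (J : {set I}) := M0 :|: [set z | [exists i in J, z \in O i]].

Lemma hub_cset J : cset e (hub J).
Proof.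
case: (set_0Vmem J) => [-> | [j0 j0J]].
  have -> : hub set0 = M0; last exact: cM0.
  apply/setP=> z; rewrite in_setU in_set; case: existsP; rewrite ?orbF // => -[i].
  by rewrite inE.
have [_ _ _ _ [_ _ _ [m mM _] _]] := okX j0.
apply: (@cset_center _ e esym _ m) => y /setUP[yM | ].
  by apply: connect_restrS (csetP _ _ cM0 m y mM yM); apply: subsetUl.
rewrite in_set => /existsP[i /andP[iJ yO]]; case: (okX i) => _ cO _ xO [_ _ _ [v vM xv] _].
have sO : O i \subset hub J.
  by apply/subsetP=> z zO; rewrite /hub in_setU in_set; apply/orP; right; apply/existsP; exists i; rewrite iJ.
apply: (@connect_trans _ _ v).
  by apply: connect_restrS (csetP _ _ cM0 m v mM vM); apply: subsetUl.
apply: (@connect_trans _ _ (x i)); last exact: connect_restrS (csetP _ _ cO (x i) y xO yO).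
by apply: connect1; rewrite restrE (eC xv) (subsetP sO _ xO) /hub in_setU vM.
Qed.

Lemma hub_in J z : z \in hub J -> z \in M0 \/ exists2 i, i \in J & z \in O i.
Proof. by rewrite /hub => /setUP[|]; [left | rewrite in_set => /existsP[i /andP[]]; right; exists i]. Qed.

Lemma hubK J z : z \in hub J -> z \in K.
Proof.
by case/hub_in=> [/(subsetP M0K) // | [i _ /OE]]; apply: (subsetP (EK i)).
Qed.

Lemma hub_core J i z : z \in X i -> z \notin hub J.
Proof.
move=> zX; apply/negP=> /hub_in[zM | [j _ zO]]; first by have := M0E (XE zX); rewrite zM.
have ij := Edis (XE zX) (OE zO); subst j.
by case: (okX i) => _ _ /pred0P/(_ z) /=; rewrite zX zO.
Qed.

Lemma core_arms i qa a qb b v g : footed i qa a qb b v g ->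
  exists L R : {set T}, [/\ L \subset X i, R \subset X i, [disjoint L & R],
    arm G qa L (e^~ b) & arm G qa R (sees G (x i |: M0))].
Proof.
move=> ft; case: (ft) => [[qaX ac qaa] [qbX bc qbb] ab _]; case: (okX i) => cX _ _ _ [_ _ [u uX ux] _ _].
apply: (@two_arms T G con3 c cyc (X i) qa a) => //.
- by move=> z /XE/Ec.
- move=> y z yX yz; case: (footed_out ft yX yz) => [h | h | [_ h] | h];
    [by constructor 1 | by constructor 2 | by constructor 3 | by constructor 4].
- by exists qb.
- by exists u => //; apply: seesI ux; rewrite setU11.
Qed.

(** One arm leaves the core through [x i] and runs on through [O i] to the third foot [g]. The other
    avoids [x i], so it ends next to [b] or to [M0]; which of the two is recorded by [o]. *)
Lemma side_arms i qa a qb b v g : footed i qa a qb b v g ->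
  exists (L R : {set T}) (o : bool), [/\ L \subset E i, R \subset E i, [disjoint L & R],
    arm G qa L (e^~ g) & arm G qa R (if o then e^~ b else sees G M0)].
Proof.
move=> ft; case: (ft) => [[qaX ac qaa] [qbX bc qbb] ab [vO gc vg]].
case: (okX i) => cX cO dXO xO [_ _ [u uX ux] _ out].
have [||| L [R [sL sR dLR [qL cL [z zL zx]] armR]]] := @two_arms T G con3 c cyc (X i) qa a (e^~ (x i))
    (fun y => e y b || sees G M0 y) cX qaX (fun z zX => Ec (XE zX)) ac qaa.
- move=> y z yX yz; case: (out y z yX yz) => [h | h | h | h]; first by constructor 1.
  + by constructor 3; rewrite -h.
  + by constructor 4; apply/orP; right; apply: seesI yz.
  + case: (footed_out ft yX yz) => [h1 | h1 | [_ h1] | h1]; [by constructor 1 | by constructor 2 | |].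
      by constructor 4; rewrite h1.
    case/existsP: h1 => m /andP[/setU1P[-> yx | mM ym]]; first by constructor 3.
    by constructor 4; apply/orP; right; apply: seesI ym.
- by exists u.
- by exists qb => //; apply/orP; left.
have qO : qa \notin O i.
  by apply/negP=> qO; have /pred0P/(_ qa) := dXO; rewrite /= qaX qO.
have armL : arm G qa (L :|: O i) (e^~ g).
  split; first by rewrite in_setU negb_or qL.
    by rewrite setUA; apply: (csetU esym cL cO zL xO); rewrite (zx : e z (x i)) orbT.
  by exists v; rewrite // !in_setU vO !orbT.
case: armR => qR cR [y yR yA].
have dLOR : [disjoint L :|: O i & R].
  apply/pred0P=> w /=; apply/negP=> /andP[/setUP[wL | wO] wR].
    by have /pred0P/(_ w) := dLR; rewrite /= wL wR.
  by have /pred0P/(_ w) := dXO; rewrite /= wO (subsetP sR).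
exists (L :|: O i), R, (e y b); split=> //.
- by rewrite setSU.
- exact: subset_trans sR (subsetUl _ _).
- split=> //; exists y => //; by move: yA => /=; case: ifP.
Qed.

Section Sides.
Variables (P1 P2 : seq T).
Hypotheses (sP1 : sorted e P1) (uP1 : uniq P1) (sP2 : sorted e P2) (P1c : {subset P1 <= c})
  (P2c : {subset P2 <= c}) (P12 : forall z, z \in P1 -> z \in P2 -> False).
Variables (J : {set I}) (qa a qb b v g : I -> T).
Hypothesis ft : forall j, j \in J -> footed j (qa j) (a j) (qb j) (b j) (v j) (g j).
Hypotheses (aP : forall j, j \in J -> a j \in P1) (bP : forall j, j \in J -> b j \in P2).

Lemma side_inj : {in J &, injective a}.
Proof.
move=> i j iJ jJ Eij; have [[qi ci ei] _ _ _] := ft iJ; have [[qj cj ej] _ _ _] := ft jJ.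
by have [] := foot_inj (XE qi) (XE qj) ci ei; rewrite // Eij.
Qed.

Lemma side_ag i j : i \in J -> j \in J -> a i <> g j.
Proof.
move=> iJ jJ Eij; have [[qi ci ei] _ _ _] := ft iJ; have [_ _ _ [vj gj vg]] := ft jJ.
have [] := foot_inj (XE qi) (OE vj) ci ei; first by rewrite Eij.
move=> Ev ij; subst j; case: (okX i) => _ _ /pred0P/(_ (qa i)) /=; by rewrite qi Ev vj.
Qed.

Let E_P i z : z \in E i -> z \notin P1. Proof. by move/Ec; apply: contra; apply: P1c. Qed.

Lemma card_setD2 (A : {set I}) i j : #|A| <= #|A :\: [set i; j]| + 2.
Proof.
have := cardsID [set i; j] A; have := subset_leq_card (subsetIr A [set i; j]).
have : #|[set i; j]| <= 2 by rewrite cards2; case: eqP.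
by clear; lia.
Qed.

(* [P1] is closed up to a cycle through two of the sets [E j] and the arc [P3]. *)
Lemma opposite_good (P3 : seq T) : sorted e P3 -> {subset P3 <= c} ->
  (forall z, z \in P3 -> z \in P1 \/ z \in P2 -> False) ->
  (forall j, j \in J -> g j \in P3) -> 4 * 12 ^ k + 2 <= #|J| -> good k G.
Proof.
move=> sP3 P3c P3d gP le; have J1 : 1 < #|J| by apply: leq_trans le; rewrite addn2.
have cP3 : cset e [set z in P3] by apply: (cset_seq esym).
have [|||c' [i0 [i1 [cyc' [i0J i1J] inc' rng cc']]]] :=
  @return_cycle T G P1 I J a E [set z in P3] sP1 uP1 aP side_inj _ cP3 _ _ J1.
- move=> j jJ; have [[qX ac qaa] _ _ [vO _ vg]] := ft jJ; case: (okX j) => cX cO _ xO [_ _ [u uX ux] _ _].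
  split; first by apply: (csetU esym cX cO uX xO); rewrite (ux : e u (x j)) orbT.
    by apply: seesI (eC qaa); apply: XE.
  by exists (v j); [apply: OE | apply: seesI vg; rewrite in_set gP].
- by move=> z; rewrite in_set => z3; apply/negP=> z1; apply: (P3d z z3); left.
- by move=> j z _; apply: E_P.
set J2 := J :\: [set i0; i1].
have J2J j : j \in J2 -> [/\ j \in J, j != i0 & j != i1].
  by rewrite in_setD !inE negb_or => /andP[/andP[-> ->] ->].
have H j : exists (L R : {set T}), j \in J -> [/\ L \subset X j, R \subset X j, [disjoint L & R],
    arm G (qa j) L (e^~ (b j)) & arm G (qa j) R (sees G (x j |: M0))].
  case: (boolP (j \in J)) => jJ; last by exists set0, set0.
  by have [L [R h]] := core_arms (ft jJ); exists L, R.
have [L {}H] := fin_all_exists H; have [R {}H] := fin_all_exists H.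
have ndis j i z : j != i -> z \in E j -> z \in E i -> False.
  by move=> ji z1 z2; rewrite (Edis z1 z2) eqxx in ji.
(* On the new cycle the feet [a j] survive, while [P2], reached through [b j], is the first rail and
   the hub of the remaining items the second. *)
apply: (@two_rails T G cub k c' I J2 a qa X L R (x i0) k0 cyc' _ _ _ _ _ [set z in P2] (hub J2)).
- by move=> j /J2J[jJ _ _]; case: (cc' (a j) (aP jJ) (rng j jJ)).
- by move=> i j /J2J[iJ _ _] /J2J[jJ _ _]; apply: side_inj.
- move=> j z /J2J[jJ n0 n1] /XE zE; apply/negP=> /inc'[z1 | z0 | z1 | z3].
  + by have := E_P zE; rewrite z1.
  + exact: ndis n0 zE z0.
  + exact: ndis n1 zE z1.
  + by move: z3; rewrite in_set => /P3c; rewrite (negbTE (Ec zE)).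
- by move=> i j z _ _ /XE zi /XE zj; apply: Edis zi zj.
- move=> j /J2J[jJ _ _]; have [[qX _ qaa] _ _ _] := ft jJ; by have [h1 h2 h3 _ _] := H j jJ.
- exact: (cset_seq esym).
- exact: hub_cset.
- apply/pred0P=> z /=; rewrite in_set; apply/negP=> /andP[/P2c zc /hubK/Kc]; by rewrite zc.
- move=> z; rewrite in_set => z2; apply/negP=> /inc'[z1 | z0 | z1 | z3].
  + exact: P12 z1 z2.
  + by have := Ec z0; rewrite P2c.
  + by have := Ec z1; rewrite P2c.
  + by move: z3; rewrite in_set => z3; apply: (P3d z z3); right.
- move=> z zh; have zc := Kc (hubK zh); apply/negP=> /inc'[z1 | z0 | z1 | z3].
  + by rewrite (P1c z1) in zc.
  + case/hub_in: zh => [zM | [i /J2J[_ n0 _] zO]]; first by have := M0E z0; rewrite zM.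
    exact: ndis n0 (OE zO) z0.
  + case/hub_in: zh => [zM | [i /J2J[_ _ n1] zO]]; first by have := M0E z1; rewrite zM.
    exact: ndis n1 (OE zO) z1.
  + by move: z3; rewrite in_set => /P3c; rewrite (negbTE zc).
- move=> j z _ zX; rewrite in_setU negb_or (hub_core _ zX) andbT in_set.
  by apply: contra (Ec (XE zX)); apply: P2c.
- move=> j jJ2; have [jJ _ _] := J2J j jJ2; have [_ _ _ h4 h5] := H j jJ; split.
    by apply: armS h4 => z zb; apply: seesI zb; rewrite in_set bP.
  apply: armS h5 => z; apply: seesS; rewrite subUset subsetUl andbT sub1set in_setU in_set.
  by apply/orP; right; apply/existsP; exists j; rewrite jJ2; case: (okX j).
- by have := card_setD2 J i0 i1; rewrite -/J2; move: le; clear; lia.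
Qed.

End Sides.

Lemma mem_half (s : seq T) n z : z \in s -> (z \in take n s) = (index z s < n) /\
  (z \in drop n s) || (index z s < n).
Proof.
move=> zs; split; first exact: in_take.
by move: (zs); rewrite -{1}(cat_take_drop n s) mem_cat in_take // orbC.
Qed.

(** The feet [a] and [g] lie on [P1], and [b] lies on [P2]. If many intervals between [a] and [g]
    share a point, [P1] is cut there and [opposite_good] applies. If many are disjoint, [rail]
    applies with [g] as the second foot: on [c] with rail [M0] if the other arms end at [M0], and
    otherwise on [P1], closed up through [M0], with rail [P2]. *)
Lemma side_good (P1 P2 : seq T) off : sorted e P1 -> uniq P1 -> sorted e P2 ->
  {subset P1 <= c} -> {subset P2 <= c} -> (forall z, z \in P1 -> z \in P2 -> False) ->
  (forall z, z \in P1 -> index z c = index z P1 + off) ->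
  forall (J : {set I}) (qa a qb b v g : I -> T),
  (forall j, j \in J -> footed j (qa j) (a j) (qb j) (b j) (v j) (g j)) ->
  (forall j, j \in J -> a j \in P1) -> (forall j, j \in J -> b j \in P2) ->
  (forall j, j \in J -> g j \in P1) ->
  2 * (8 * 12 ^ k + 2) * (2 * (4 * 12 ^ k + 2)) <= #|J| -> good k G.
Proof.
move=> sP1 uP1 sP2 P1c P2c P12 ioff J qa a qb b v g ft aP bP gP le.
pose ia j := index (a j) P1; pose ig j := index (g j) P1.
have idx y z : y \in P1 -> z \in P1 -> index y P1 = index z P1 -> y = z.
  by move=> yP zP E0; rewrite -(nth_index y yP) E0 nth_index.
have iag i j : i \in J -> j \in J -> ia i != ig j.
  move=> iJ jJ; apply/eqP=> E0; apply: (side_ag ft iJ jJ); apply: idx E0; [exact: aP | exact: gP].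
have ainj := side_inj ft.
have [|[J3 [J3J le3 sep]] | [t tle]] := @helly I J (fun j => minn (ia j) (ig j))
    (fun j => maxn (ia j) (ig j)) _ _ _ le.
- by move=> j jJ; have := iag j j jJ jJ; clear; lia.
- have H j : exists (L R : {set T}) (o : bool), j \in J -> [/\ L \subset E j, R \subset E j, [disjoint L & R],
      arm G (qa j) L (e^~ (g j)) & arm G (qa j) R (if o then e^~ (b j) else sees G M0)].
    case: (boolP (j \in J)) => jJ; last by exists set0, set0, true.
    by have [L [R [o h]]] := side_arms (ft j jJ); exists L, R, o.
  have [L {}H] := fin_all_exists H; have [R {}H] := fin_all_exists H; have [o {}H] := fin_all_exists H.
  have [oo le4] := half_card o le3.
  set J4 := [set j in J3 | _] in le4.
  have J4J j : j \in J4 -> [/\ j \in J3, j \in J & o j = oo].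
    by rewrite in_set => /andP[j3 /eqP]; split=> //; apply: (subsetP J3J).
  have {}H j : j \in J4 -> [/\ qa j \in E j, e (qa j) (a j), [/\ L j \subset E j, R j \subset E j & [disjoint L j & R j]],
      arm G (qa j) (L j) (e^~ (g j)) & arm G (qa j) (R j) (if oo then e^~ (b j) else sees G M0)].
    move=> /J4J[_ jJ <-]; have [[qX _ qaa] _ _ _] := ft j jJ; have [h1 h2 h3 h4 h5] := H j jJ.
    by split=> //; apply: XE.
  clearbody J4; case: oo J4J H => J4J H; last first.
    apply: (@rail T G cub k c I J4 a qa g E L R M0 k0 cyc _ _ _ _ _ cM0 M0c).
    + by move=> j /J4J[_ jJ _]; apply/P1c/aP.
    + by move=> i j /J4J[_ iJ _] /J4J[_ jJ _]; apply: ainj.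
    + by move=> j z _; apply: Ec.
    + by move=> i j z _ _; apply: Edis.
    + by move=> j /H[h1 h2 [h3 h4 h5] _ _].
    + by move=> j z _; apply: M0E.
    + by move=> j j4; have [_ jJ _] := J4J j j4; have [_ _ _ h1 h2] := H j j4; split=> //; apply/P1c/gP.
    + by move=> i j /J4J[_ iJ _] /J4J[_ jJ _]; apply: (side_ag ft).
    + move=> i j /J4J[i3 iJ _] /J4J[j3 jJ _] ij; have := sep i j i3 j3 ij.
      by rewrite !ioff ?aP ?gP // -/(ia i) -/(ia j) -/(ig i) -/(ig j); clear; lia.
    + by move: le4; clear; lia.
  have aP4 j : j \in J4 -> a j \in P1 by case/J4J=> _ /aP.
  have J41 : 1 < #|J4| by move: le4; clear; lia.
  have [||||c' [i0 [i1 [cyc' [i0J i1J] inc' rng cc']]]] :=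
    @return_cycle T G P1 I J4 a E M0 sP1 uP1 aP4 _ _ cM0 _ _ J41.
  + by move=> i j /J4J[_ iJ _] /J4J[_ jJ _]; apply: ainj.
  + move=> j /J4J[_ jJ _]; have [[qX ac qaa] _ _ _] := ft j jJ.
    case: (okX j) => cX cO _ xO [_ _ [u uX ux] [y yM xy] _]; split.
    * by apply: (csetU esym cX cO uX xO); rewrite (ux : e u (x j)) orbT.
    * by apply: seesI (eC qaa); apply: XE.
    * by exists (x j); [apply: OE | apply: seesI xy].
  + by move=> z /M0c; apply: contra; apply: P1c.
  + by move=> j z _ /Ec; apply: contra; apply: P1c.
  set J5 := J4 :\: [set i0; i1].
  have J54 j : j \in J5 -> [/\ j \in J4, j != i0 & j != i1].
    by rewrite in_setD !inE negb_or => /andP[/andP[-> ->] ->].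
  have ndis j i z : j != i -> z \in E j -> z \in E i -> False.
    by move=> ji z1 z2; rewrite (Edis z1 z2) eqxx in ji.
  (* The interval of [j] is disjoint from those of the outermost items [i0] and [i1], so its end
     [g j] lies between them as [a j] does, and survives on the new cycle. *)
  have grng j : j \in J5 -> ia i0 <= ig j <= ia i1.
    move=> /J54[j4 n0 n1]; have [j3 jJ _] := J4J j j4; have := rng j j4; rewrite -/(ia i0) -/(ia j) -/(ia i1).
    have [i03 i0J' _] := J4J i0 i0J; have [i13 i1J' _] := J4J i1 i1J.
    have m0 : ia j != ia i0 by apply: contra n0 => /eqP E0; apply/eqP/(ainj j i0) => //; apply: idx E0; apply: aP.
    have m1 : ia j != ia i1 by apply: contra n1 => /eqP E0; apply/eqP/(ainj j i1) => //; apply: idx E0; apply: aP.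
    by move: m0 m1 (sep j i0 j3 i03 n0) (sep j i1 j3 i13 n1); clear; lia.
  apply: (@rail T G cub k c' I J5 a qa g E L R [set z in P2] k0 cyc').
  + by move=> j /J54[j4 _ _]; have [_ jJ _] := J4J j j4; case: (cc' (a j) (aP j jJ) (rng j j4)).
  + by move=> i j /J54[/J4J[_ iJ _] _ _] /J54[/J4J[_ jJ _] _ _]; apply: ainj.
  + move=> j z /J54[jJ n0 n1] zE; apply/negP=> /inc'[z1 | z0 | z1 | z3].
    * by have := Ec zE; rewrite P1c.
    * exact: ndis n0 zE z0.
    * exact: ndis n1 zE z1.
    * by have := M0E zE; rewrite z3.
  + by move=> i j z _ _; apply: Edis.
  + by move=> j /J54[/H[h1 h2 [h3 h4 h5] _ _] _ _].
  + exact: (cset_seq esym).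
  + move=> z; rewrite in_set => z2; apply/negP=> /inc'[z1 | z0 | z1 | z3].
    * exact: P12 z1 z2.
    * by have := Ec z0; rewrite P2c.
    * by have := Ec z1; rewrite P2c.
    * by have := M0c z3; rewrite P2c.
  + by move=> j z _ /Ec zc; rewrite in_set; apply: contra zc; apply: P2c.
  + move=> j j5; have [j4 n0 n1] := J54 j j5; have [_ jJ _] := J4J j j4; have [_ _ _ h1 h2] := H j j4; split=> //.
      by case: (cc' (g j) (gP j jJ) (grng j j5)).
    by apply: armS h2 => z zb; apply: seesI zb; rewrite in_set bP.
  + by move=> i j /J54[/J4J[_ iJ _] _ _] /J54[/J4J[_ jJ _] _ _]; apply: (side_ag ft).
  + move=> i j i5 j5 ij; have [i4 _ _] := J54 i i5; have [j4 _ _] := J54 j j5.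
    have [i3 iJ _] := J4J i i4; have [j3 jJ _] := J4J j j4; have := sep i j i3 j3 ij.
    have [_ ->] := cc' (a i) (aP i iJ) (rng i i4); have [_ ->] := cc' (a j) (aP j jJ) (rng j j4).
    have [_ ->] := cc' (g i) (gP i iJ) (grng i i5); have [_ ->] := cc' (g j) (gP j jJ) (grng j j5).
    by rewrite -/(ia i) -/(ia j) -/(ig i) -/(ig j); clear; lia.
  + by have := card_setD2 J4 i0 i1; rewrite -/J5; move: le4; clear; lia.
have [o leo] := half_card (fun j => ia j <= t) tle.
set J4 := [set j in _ | _] in leo.
have J4J j : j \in J4 -> [/\ j \in J, minn (ia j) (ig j) <= t < maxn (ia j) (ig j) & (ia j <= t) = o].
  by rewrite 2!in_set => /andP[/andP[h1 h2] /eqP].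
have ft4 j : j \in J4 -> footed j (qa j) (a j) (qb j) (b j) (v j) (g j) by case/J4J=> /ft.
have tP : {subset take t.+1 P1 <= P1} by move=> z /mem_take.
have dP : {subset drop t.+1 P1 <= P1} by move=> z /mem_drop.
have bP4 j : j \in J4 -> b j \in P2 by case/J4J=> /bP.
have side j z : j \in J -> z \in P1 -> if index z P1 <= t then z \in take t.+1 P1 else z \in drop t.+1 P1.
  move=> jJ zP; have [h1 h2] := mem_half t.+1 zP; rewrite h1 ltnS; move: h2; rewrite ltnS.
  by case: ifP => // _; rewrite orbF.
have td z : z \in take t.+1 P1 -> z \in drop t.+1 P1 -> False by apply: take_drop_disj.
clearbody J4; case: o J4J => J4J.
- apply: (@opposite_good (take t.+1 P1) P2 _ _ sP2 _ P2c _ J4 qa a qb b v g ft4 _ bP4 (drop t.+1 P1)).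
  + exact: take_sorted.
  + exact: take_uniq.
  + by move=> z /tP/P1c.
  + by move=> z /tP; apply: P12.
  + by move=> j /J4J[jJ _ h]; have := side j (a j) jJ (aP j jJ); rewrite -/(ia j) h.
  + exact: drop_sorted.
  + by move=> z /dP/P1c.
  + by move=> z zd [zt | z2]; [apply: td zt zd | apply: (P12 z) (dP z zd) z2].
  + move=> j /J4J[jJ h1 h]; have := side j (g j) jJ (gP j jJ); rewrite -/(ig j).
    by case: ifP => // h2; move: h1 h h2; clear; lia.
  + by apply: leq_trans leo; rewrite leqnn.
- apply: (@opposite_good (drop t.+1 P1) P2 _ _ sP2 _ P2c _ J4 qa a qb b v g ft4 _ bP4 (take t.+1 P1)).
  + exact: drop_sorted.
  + exact: drop_uniq.
  + by move=> z /dP/P1c.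
  + by move=> z /dP; apply: P12.
  + by move=> j /J4J[jJ _ h]; have := side j (a j) jJ (aP j jJ); rewrite -/(ia j) h.
  + exact: take_sorted.
  + by move=> z /tP/P1c.
  + by move=> z zt [zd | z2]; [apply: td zt zd | apply: (P12 z) (tP z zt) z2].
  + move=> j /J4J[jJ h1 h]; have := side j (g j) jJ (gP j jJ); rewrite -/(ig j).
    by case: ifP => // h2; move: h1 h h2; clear; lia.
  + by apply: leq_trans leo; rewrite leqnn.
Qed.

Lemma footed_sym i qa a qb b v g : footed i qa a qb b v g -> footed i qb b qa a v g.
Proof. by case=> h1 h2 ab h3; split; rewrite // eq_sym. Qed.

(** The two feet of a core span an interval of the cycle. Many disjoint intervals are handled by
    [rail] with the hub of all pieces. If many share a point, the cycle is cut there, and half of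
    the third feet lie on the same side. *)
Lemma family_good :
  8 * 12 ^ k * (2 * (2 * (8 * 12 ^ k + 2) * (2 * (4 * 12 ^ k + 2)))) <= #|I| -> good k G.
Proof.
rewrite -cardsT => le; set J : {set I} := setT in le.
have [qa ft] := fin_all_exists footedP; have [a {}ft] := fin_all_exists ft.
have [qb {}ft] := fin_all_exists ft; have [b {}ft] := fin_all_exists ft.
have [v {}ft] := fin_all_exists ft; have [g {}ft] := fin_all_exists ft.
have ac j : a j \in c by have [[_ h _] _ _ _] := ft j.
have bc j : b j \in c by have [_ [_ h _] _ _] := ft j.
have gc j : g j \in c by have [_ _ _ [_ h _]] := ft j.
have ab i j : a i <> b j.
  move=> E0; have [[q1 _ e1] _ ne _] := ft i; have [_ [q2 c2 e2] _ _] := ft j.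
  have [|_ ij] := foot_inj (XE q1) (XE q2) c2 _ e2; first by rewrite -E0.
  by subst j; rewrite E0 eqxx in ne.
have [x0 uc sc] : exists2 x : T, x \in c & uniq c /\ sorted e c.
  case/and3P: cyc; case: (c) => [//|z s] _ /= pz uz; exists z; first exact: mem_head.
  by split=> //; move: pz; rewrite rcons_path => /andP[].
case: sc => {}uc sc.
pose ia j := index (a j) c; pose ib j := index (b j) c; pose ig j := index (g j) c.
have iab j : ia j != ib j.
  by apply/eqP=> E0; apply: (ab j j); rewrite -(nth_index x0 (ac j)) -/(ia j) E0 nth_index.
have [|[J3 [_ le3 sep]] | [t tle]] := @helly I J (fun j => minn (ia j) (ib j))
    (fun j => maxn (ia j) (ib j)) _ _ _ le.
- by move=> j _; have := iab j; clear; lia.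
- have H j : exists (L R : {set T}), [/\ L \subset X j, R \subset X j, [disjoint L & R],
      arm G (qa j) L (e^~ (b j)) & arm G (qa j) R (sees G (x j |: M0))] by apply: core_arms (ft j).
  have [L {}H] := fin_all_exists H; have [R {}H] := fin_all_exists H.
  apply: (@rail T G cub k c I J3 a qa b X L R (hub setT) k0 cyc _ _ _ _ _ (hub_cset setT)).
  + by move=> j _; apply: ac.
  + exact: side_inj (fun j _ => ft j).
  + by move=> j z _ /XE/Ec.
  + by move=> i j z _ _ /XE zi /XE; apply: Edis zi.
  + by move=> j _; have [h1 h2 h3 _ _] := H j; have [[qX _ qaa] _ _ _] := ft j.
  + by move=> z /hubK/Kc.
  + by move=> j z _; apply: hub_core.
  + move=> j _; have [_ _ _ h4 h5] := H j; split=> //.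
    apply: armS h5 => z; apply: seesS; rewrite subUset subsetUl andbT sub1set /hub in_setU in_set.
    by apply/orP; right; apply/existsP; exists j; rewrite in_setT; case: (okX j).
  + by move=> i j _ _; apply: ab.
  + by move=> i j i3 j3 ij; have := sep i j i3 j3 ij; rewrite /ia /ib; clear; lia.
  + exact: le3.
have [o leo] := half_card (fun j => ig j <= t) tle.
set J4 := [set j in _ | _] in leo.
have J4J j : j \in J4 -> (ib j <= t) = ~~ (ia j <= t) /\ (ig j <= t) = o.
  by rewrite 2!in_set => /andP[/andP[_ h1] /eqP h2]; split=> //; move: h1; clear; lia.
(* The two feet of the core are renamed so that the first is on the same side of the cut as the
   third foot [g j]. *)
pose si j := (ia j <= t) == (ig j <= t).
pose al j := if si j then a j else b j; pose be j := if si j then b j else a j.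
pose qal j := if si j then qa j else qb j; pose qbe j := if si j then qb j else qa j.
have ft4 j : j \in J4 -> footed j (qal j) (al j) (qbe j) (be j) (v j) (g j).
  by move=> _; rewrite /qal /al /qbe /be; case: (si j) => //; apply: footed_sym.
have alc j : al j \in c by rewrite /al; case: ifP.
have bec j : be j \in c by rewrite /be; case: ifP.
have alt j : j \in J4 -> (index (al j) c <= t) = o.
  case/J4J; rewrite /al /si -/(ia j); case: eqP => [E1 | E1]; first by rewrite -/(ia j) E1.
  by rewrite -/(ib j) => -> h; rewrite -h; move/eqP: E1; case: (ia j <= t); case: (ig j <= t).
have bet j : j \in J4 -> (index (be j) c <= t) = ~~ o.
  case/J4J; rewrite /be /si -/(ia j); case: eqP => [E1 | E1 _]; first by rewrite -/(ib j) -E1 => -> ->.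
  by rewrite -/(ia j) => h; rewrite -h; move/eqP: E1; case: (ia j <= t); case: (ig j <= t).
have gt j : j \in J4 -> (index (g j) c <= t) = o by case/J4J.
have tc : {subset take t.+1 c <= c} by move=> z /mem_take.
have dc : {subset drop t.+1 c <= c} by move=> z /mem_drop.
have it z : z \in c -> index z c <= t -> z \in take t.+1 c by move=> zc h; rewrite in_take.
have out z : z \in c -> (index z c <= t) = false -> z \in drop t.+1 c.
  by move=> zc h; have [_] := mem_half t.+1 zc; rewrite ltnS h orbF.
have td z : z \in take t.+1 c -> z \in drop t.+1 c -> False by apply: take_drop_disj.
clearbody J4; case: o alt bet gt {J4J} => alt bet gt.
- apply: (@side_good (take t.+1 c) (drop t.+1 c) 0 _ _ _ tc dc td _ J4 qal al qbe be v g ft4) => //.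
  + exact: take_sorted.
  + exact: take_uniq.
  + exact: drop_sorted.
  + by move=> z zt; rewrite -{1}(cat_take_drop t.+1 c) index_cat zt addn0.
  + by move=> j /alt/(it _ (alc j)).
  + by move=> j /bet/(out _ (bec j)).
  + by move=> j /gt/(it _ (gc j)).
- apply: (@side_good (drop t.+1 c) (take t.+1 c) (size (take t.+1 c)) _ _ _ dc tc _ _ J4 qal al qbe be v g ft4) => //.
  + exact: drop_sorted.
  + exact: drop_uniq.
  + exact: take_sorted.
  + by move=> z zd zt; apply: td zt zd.
  + move=> z zd; have zt : (z \in take t.+1 c) = false by apply/negP=> zt; apply: td zt zd.
    by rewrite -{1}(cat_take_drop t.+1 c) index_cat zt addnC.
  + by move=> j /alt/(out _ (alc j)).
  + by move=> j /bet/(it _ (bec j)).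
  + by move=> j /gt/(out _ (gc j)).
Qed.

End Family.

(** * Conclusion *)

Section Main.
Variables (T : finType) (G : graph T).
Hypotheses (cub : cubic G) (con3 : n_connected 3 G).
Let e := adj G.
Let V := vset G.
Let esym : symmetric e := @adj_sym T G.
Let eC x y : e x y -> e y x. Proof. by rewrite esym. Qed.

(** A cycle and a vertex off it suffice: two neighbours of [x] are joined in [G] without [x] and its
    third neighbour [d], which makes a cycle through [x] that avoids [d]. *)
Lemma zero_good : good 0 G.
Proof.
have [x xV] : exists x, x \in V.
  by case: con3 => V3 _; apply/set0Pn; rewrite -card_gt0; apply: ltn_trans V3.
have [a [xa _ _]] := third_nbr cub x x xV; have [b [xb ba _]] := third_nbr cub a a xV.
have [d [xd da db]] := third_nbr cub a b xV.
have S2 : #|[set x; d]| <= 2 by rewrite cards2; case: eqP.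
have inS z : e x z -> z != d -> z \in V :\: [set x; d].
  move=> xz zd; have [_ zV] := adj_V xz; rewrite in_setD in_set2 negb_or zd zV !andbT.
  by rewrite eq_sym (adj_ne xz).
have [] := cset_path (con3_cset con3 S2) (inS a xa _) (inS b xb _); rewrite 1?eq_sym //.
move=> p [pa la up pS].
have cyc : is_cycle G (x :: a :: p).
  apply/and3P; split; first by case: p la {pa up pS} => //= E; rewrite E eqxx in ba.
    by rewrite /= rcons_path la (xa : adj G x a) (pa : path (adj G) a p) (eC xb : adj G b x).
  rewrite cons_uniq up andbT; apply/negP=> /pS; by rewrite !inE eqxx.
apply: (@close_good T G 0 T set0 id id id (VPath d [::]) _ _ cyc).
- by have [_ dV] := adj_V xd; apply/and3P.
- move=> z; rewrite inE => /eqP->; rewrite in_cons negb_or eq_sym (adj_ne xd) /=.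
  by apply/negP=> /pS; rewrite !inE eqxx orbT.
- by rewrite cards0.
- by move=> j; rewrite inE.
- by move=> i j; rewrite inE.
Qed.

(** A single foot joins a one-vertex path to the cycle. The case [k = 1] is separate because
    [12 ^ (5 * k) <= 2 ^ (9 * k ^ 2)] fails there. *)
Lemma one_good c (K : {set T}) : is_cycle G c -> (forall z, z \in K -> z \notin c) -> K \subset V ->
  0 < wt (feet G c) K -> good 1 G.
Proof.
move=> cyc Kc KV /wt_foot[u [v [uK vc uv]]].
apply: (@close_good T G 1 unit setT (fun=> u) (fun=> u) (fun=> v) (VPath u [::]) c _ cyc).
- by apply/and3P; split=> //; apply: (subsetP KV).
- by move=> z; rewrite inE => /eqP->; apply: Kc.
- by rewrite cardsT card_unit.
- by move=> j _; split=> //; [apply: mem_head | left].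
- by move=> [] [] _ _; rewrite eqxx.
Qed.

Lemma large_good c (K : {set T}) k n m : is_cycle G c -> cset e K -> (forall z, z \in K -> z \notin c) ->
  K \subset V -> (forall u v, u \in K -> e u v -> v \in K \/ v \in c) -> 0 < k -> 0 < n ->
  k + k * (4 * 12 ^ k) + 8 * 12 ^ k * (3 * (4 * 12 ^ k + 2)) <= n ->
  8 * 12 ^ k * (2 * (2 * (8 * 12 ^ k + 2) * (2 * (4 * 12 ^ k + 2)))) <= m ->
  3 * ((4 + 2 * n) * m + 2) + 3 < wt (feet G c) K -> good k G.
Proof.
move=> cyc cK Kc KV clK k0 n0 len lem ltK.
have [x0 [_ [x0K _ _]]] := wt_foot (leq_ltn_trans (leq0n _) ltK).
have fx0 : feet G c x0 <= 3.
  apply: leq_trans (cubic_deg3 cub x0); apply/subset_leq_card/subsetP=> z.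
  by rewrite !in_set => /andP[].
(* The search starts with the one-vertex path [x0]. This vertex has at most 3 feet and [K :\ x0] at
   most 3 components, whence the bound [3 * (.. + 2) + 3]; a heavy component has enough feet both to
   start the search and to force [m] pieces. *)
have [||y yn] := @big_comp T e esym (feet G c) K x0 3 ((4 + 2 * n) * m + 2) cK x0K.
- by apply: nb_card0; apply: cubic_deg3 cub.
- by have := wtD1 (feet G c) x0K; move: ltK fx0; clear; lia.
set X := ccomp e (K :\ x0) y => wX.
have yD : y \in K :\ x0 by move: yn; rewrite in_set => /andP[].
have x0y : e x0 y by move: yn; rewrite in_set => /andP[].
have sX : X \subset K :\ x0 by apply: ccomp_sub.
have yX : y \in X by apply: mem_ccomp yD.
have cX : cset e X by apply: ccomp_cset yD.
have x0X : x0 \notin X by apply/negP=> /(subsetP sX); rewrite !inE eqxx.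
have cKX : cset e (K :\: X) by apply: cset_diff_comp.
have st : state G c K n [::] x0 X y [::] [::].
  split=> //.
  - by split=> //; move=> z; rewrite inE => /eqP->.
  - by split=> //; apply: subset_trans sX (subsetDl _ _).
  - by move=> z zX; rewrite inE; apply: contraNneq x0X => <-.
  - move=> u v uX uv; have /setD1P[_ uK] := subsetP sX _ uX.
    case: (clK u v uK uv) => [vK | vc]; last by constructor 3.
    case: (altP (v =P x0)) => [-> | vx]; first by constructor 2; rewrite mem_head.
    by constructor 1; apply: ccomp_closed uX _ uv; rewrite in_setD1 vx.
  - by split=> //; move: wX; clear; lia.
case: (search cub Kc KV st) => [H | [F [F0 leF [subF okF pwF] cF]]].
  exact: (comb_good cub con3 cyc Kc KV k0 H len).
have f0 : piece T := (set0, x0, set0).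
pose f (i : 'I_(size F)) := nth f0 F i.
have fF i : f i \in F by apply: mem_nth.
have leM : m <= size F.
  rewrite leqNgt; apply/negP=> lt; have := leq_mul (leqnn (4 + 2 * n)) (ltnW lt).
  by move: wX leF; rewrite /= subn0 mulnC; clear; lia.
have sC : cov F \subset X by apply: (@cov_sub T G c); split; [exact: subF | exact: okF | exact: pwF].
have EC i z : z \in (f i).1.1 :|: (f i).2 -> z \in cov F.
  by move=> zf; rewrite in_set; apply/hasP; exists (f i).
have M0E0 : K :\: cov F = (K :\: X) :|: (x0 |: X :\: cov F).
  apply/setP=> z; rewrite !in_setU in_set1 !in_setD; case: (altP (z =P x0)) => [-> | _] /=.
    by rewrite x0K !orbT andbT; apply: contra x0X; apply: (subsetP sC).
  case: (boolP (z \in X)) => [zX | zX] /=; first by have /setD1P[_ ->] := subsetP sX _ zX; rewrite andbT.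
  by rewrite andbF orbF; have -> : z \notin cov F by apply: contra zX; apply: (subsetP sC).
(* The common set of the family is what the pieces leave of [K]; it is connected, because the search
   keeps [x0] together with the rest of [X] connected. *)
apply: (@family_good T G cub con3 c K (K :\: cov F) k cyc Kc k0 'I_(size F)
  (fun i => (f i).1.1) (fun i => (f i).2) (fun i => (f i).1.2)).
- by move=> i; apply: subset_trans (subF _ (fF i)) (subset_trans sX (subsetDl _ _)).
- move=> i j z zi zj; apply: val_inj => /=.
  have key a b : a < b -> b < size F -> z \in (nth f0 F a).1.1 :|: (nth f0 F a).2 ->
      z \in (nth f0 F b).1.1 :|: (nth f0 F b).2 -> False.
    move=> ab bs za zb; have := (pairwiseP f0 pwF) a b (ltn_trans ab bs) bs ab.
    by move/pred0P/(_ z); rewrite /= za zb.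
  by case: (ltngtP i j) => // ij; [case: (key _ _ ij (ltn_ord j)) | case: (key _ _ ij (ltn_ord i))].
- exact: subsetDl.
- rewrite M0E0; apply: (csetU esym cKX cF (a := x0) (b := x0)); rewrite ?eqxx ?setU11 //.
  by rewrite in_setD x0X.
- by move=> i z /EC zC; rewrite in_setD zC.
- move=> i; apply: (piece_okS _ (okF _ (fF i))) => z; rewrite M0E0 => h; apply/setUP; right.
  by case/setUP: h => [|h]; [rewrite in_set mem_seq1 => /eqP->; apply: setU11 | apply/setU1P; right].
- by rewrite card_ord; apply: leq_trans lem leM.
Qed.

End Main.

(** Here [n] is quadratic and [m] cubic in [t], so [(4 + 2 * n) * m] is at most [10 ^ 8 * t ^ 5],
    and the outer factor 6 and the small summands fit into another factor 10. *)
Lemma diameter_bound k t n m : 1 < k -> t = 12 ^ k ->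
  n = k + k * (4 * t) + 8 * t * (3 * (4 * t + 2)) ->
  m = 8 * t * (2 * (2 * (8 * t + 2) * (2 * (4 * t + 2)))) ->
  2 * (3 * ((4 + 2 * n) * m + 2) + 3) < (10 ^ 9 * k ^ 13 * 2 ^ (9 * k ^ 2)).-1.
Proof.
move=> k1 Et En Em.
have kt : k <= t by rewrite Et; apply: leq_trans (ltnW (ltn_expl k (isT : 1 < 12))) _.
have t1 : 100 <= t.
  by apply: leq_trans (_ : 12 ^ 2 <= t); rewrite // Et leq_exp2l.
have nb : 4 + 2 * n <= 300 * t ^ 2 by rewrite En -mulnn; move: kt t1; clear; nia.
have mb : m <= 3000 * t ^ 3 by rewrite Em !expnS expn0; move: t1; clear; nia.
(* By [12 ^ 5 <= 2 ^ 18], and [18 * k <= 9 * k ^ 2] because [k] is at least 2. *)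
have t5 : t ^ 5 <= 2 ^ (9 * k ^ 2).
  rewrite Et -expnM mulnC expnM; apply: leq_trans (_ : (2 ^ 18) ^ k <= _).
    by rewrite leq_exp2r ?(ltnW k1) // expnM; apply: leq_trans (_ : (2 ^ 4) ^ 5 <= _).
  by rewrite -expnM leq_exp2l // -mulnn; nia.
(* Factored so that no power of ten larger than [10 ^ 4] has to be evaluated as a unary number. *)
have -> : 10 ^ 9 = 10 * (10 ^ 4 * 10 ^ 4) by rewrite -expnD -expnS.
have k13 : 0 < k ^ 13 by rewrite expn_gt0 ltnW.
have a4 : 3000 <= 10 ^ 4 by [].
have b4 : 300 <= 10 ^ 4 by [].
have M1 : (4 + 2 * n) * m <= 10 ^ 4 * 10 ^ 4 * t ^ 5.
  apply: leq_trans (leq_mul nb mb) _; rewrite mulnACA -expnD.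
  by apply: leq_mul => //; apply: leq_mul.
have M2 : 10 * (10 ^ 4 * 10 ^ 4) * t ^ 5 <= 10 * (10 ^ 4 * 10 ^ 4) * k ^ 13 * 2 ^ (9 * k ^ 2).
  by apply: leq_mul => //; apply: leq_pmulr.
have t5' : 100 <= 10 ^ 4 * 10 ^ 4 * t ^ 5.
  have t4 : 0 < t ^ 4 by rewrite expn_gt0; apply/orP; left; apply: leq_trans (t1).
  apply: leq_trans t1 _; rewrite (expnS t 4) mulnCA; apply: leq_pmulr.
  have p4 : 0 < 10 ^ 4 by rewrite expn_gt0.
  by rewrite muln_gt0 t4 andbT muln_gt0 p4.
move: M1 M2 t5'; move: (10 ^ 4 * 10 ^ 4) => h; move: ((4 + 2 * n) * m) => w; rewrite -!mulnA.
move: (2 ^ _) (k ^ 13) => p q; move: (t ^ 5) => r; clear; nia.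
Qed.

Theorem theorem5p15 (T : finType) (G : graph T) (k : nat) :
  cubic G -> n_connected 3 G ->
  10 ^ 9 * k ^ 13 * 2 ^ (9 * k ^ 2) <= diameter G ->
  good k G.
Proof.
move=> cub con3; case: k => [|k]; first by move=> _; apply: zero_good.
set D := 10 ^ 9 * _ * _ => leD.
have D1 : 1 < D.
  by rewrite /D -mulnA; apply: leq_trans (leq_pmulr _ _); rewrite ?muln_gt0 ?expn_gt0 // -{1}(expn1 2); apply: leq_trans (_ : 10 ^ 1 <= _); rewrite ?leq_exp2l.
have [s [t [sV tV leD']]] := diameter_dist (ltnW D1) leD.
have [c [K [cyc [cK KV] Kc clK leK]]] := long_cycle con3 sV tV D1
  (fun P pP => leq_trans leD' (dist_path pP)).
case: (posnP k) => [-> | k0].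
  by apply: (one_good cyc Kc KV); move: D1 leK; clear; lia.
apply: (large_good cub con3 cyc cK Kc KV clK _ _ (leqnn _) (leqnn _)) => //.
have := diameter_bound (k0 : 1 < k.+1) erefl erefl erefl; rewrite -/D => h.
by have := leq_trans h leK; rewrite ltn_mul2l.
Qed.
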